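(* Let $G$ be a connected complex reductive group, $K$ a maximal compact subgroup of $G$, $T_{\mathbb{R}}$ a (real) maximal torus of $K$, and $T\subseteq G$ the complexification of $T_{\mathbb{R}}$ (a complex maximal torus of $G$). Let $W$ be a representation of $G$ and $w\in W$. Let $W = \bigoplus_{j\in J} W_j$ be a decomposition into subrepresentations. Take a $(K,T)$-compatible form on each $W_j$, and let $\langle -,-\rangle$ denote their direct sum form on $W$, with norm $\|\cdot\|$. Write $w = \sum_{j\in J} w_j$ with $w_j\in W_j$, and let $w_j = \sum_{\lambda\in \mathrm{Supp}(w_j)} w_{j,\lambda}$ be the weight decomposition of each $w_j$. Suppose 1. $\mathrm{Supp}(w_j)$ is uncramped for all $j\in J$; 2. $\sum_{j\in J}\sum_{\lambda\in \mathrm{Supp}(w_j)} \|w_{j,\lambda}\|^2\,\lambda = 0$ (in $\mathfrak{t}^*$). Then the orbit $G\cdot w$ is closed.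
   Context: Representations are rational and finite-dimensional. $\mathfrak{g}$ and $\mathfrak{t}$ are the Lie algebras of $G$ and $T$; characters of $T$ (weights) are regarded as elements of $\mathfrak{t}^*$ by differentiation. For a representation $U$ of $G$ and weight $\lambda$, $U_\lambda = \{u\in U\mid t\cdot u = \lambda(t)u\ \forall t\in T\}$, and $U=\bigoplus_\lambda U_\lambda$. For $u\in U$, the unique expression $u = \sum_\lambda u_\lambda$ with $u_\lambda\in U_\lambda$ is its weight decomposition, and $\mathrm{Supp}(u) = \{\lambda\mid u_\lambda\neq 0\}$. The root system $\Phi\subset\mathfrak{t}^*$ is the set of nonzero weights of $T$ on $\mathfrak{g}$ under the adjoint action. Two weights $\lambda,\mu$ are root adjacent if $\lambda-\mu\in\Phi$. A set of weights is uncramped if no pair of weights in it is root adjacent. A $(K,T)$-compatible form on a representation $U$ of $G$ is a positive definite $K$-invariant hermitian form on $U$ for which the weight spaces $U_\lambda$ are pairwise orthogonal. The direct sum form of forms $\langle-,-\rangle_j$ on $W_j$ is $\langle \sum_j a_j,\sum_j b_j\rangle = \sum_j\langle a_j,b_j\rangle_j$. *)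

(* Defs.v *)
From HB Require Import structures.
From mathcomp Require Import all_boot all_order all_algebra.
From mathcomp Require Import sesquilinear complex.
From mathcomp Require Import all_classical all_reals all_analysis.
(* Not imported: its notations clash with those of mathcomp-analysis. *)
From mathcomp Require mpoly.

Set Implicit Arguments.
Unset Strict Implicit.
Unset Printing Implicit Defensive.

Import Order.TTheory GRing.Theory Num.Theory.
Import numFieldNormedType.Exports.

Local Open Scope classical_set_scope.
Local Open Scope ring_scope.

Definition Cx (R : realType) : numClosedFieldType := R[i].

Section ZariskiTopology.
Context {C : numClosedFieldType} {V : vectType C}.

Definition polynomial_function (f : V -> C) : Prop :=
  exists p : mpoly.mpoly (\dim {:V}) C,
    forall v, f v = mpoly.meval (fun i => coord (vbasis {:V}) i v) p.

Definition zariski_closed (Z : set V) : Prop :=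
  exists2 F : set (V -> C), F `<=` polynomial_function &
    Z = [set v | forall f, F f -> f v = 0].

Definition zariski_connected (S : set V) : Prop :=
  forall A B : set V, zariski_closed A -> zariski_closed B ->
    S `<=` A `|` B -> S `&` A `&` B = set0 -> S `<=` A \/ S `<=` B.

End ZariskiTopology.

Section MatrixGroups.
Context {C : numClosedFieldType} {n : nat}.
Implicit Types (G H K N S T : set 'M[C]_n) (X : 'M[C]_n).

Definition GL : set 'M[C]_n := [set g | g \in unitmx].

Definition subgroup H : Prop :=
  [/\ H `<=` GL, H 1%:M, (forall g h, H g -> H h -> H (g *m h))
    & (forall g, H g -> H (invmx g))].

Definition normal_in N G : Prop :=
  N `<=` G /\ (forall g h, G g -> N h -> N (g *m h *m invmx g)).

Definition algebraic_group G : Prop :=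
  subgroup G /\ exists2 Z : set 'M[C]_n, zariski_closed Z & G = GL `&` Z.

Definition unipotent (u : 'M[C]_n) : Prop :=
  exists k : nat, (u - 1%:M) ^+ k = 0.

(* The unipotent radical is the largest connected normal unipotent closed
   subgroup, so it is trivial iff every such subgroup is. *)
Definition reductive G : Prop :=
  algebraic_group G /\
  forall N, algebraic_group N -> zariski_connected N -> normal_in N G ->
    N `<=` unipotent -> N = [set 1%:M].

Definition compact_subgroup K G : Prop :=
  [/\ subgroup K, K `<=` G & compact K].

Definition maximal_compact_subgroup K G : Prop :=
  compact_subgroup K G /\
  forall K', compact_subgroup K' G -> K `<=` K' -> K' = K.

(* Compact subgroups of GL_n(C) are Lie groups, and a (real) torus is a
   compact connected abelian Lie group. *)
Definition torus_in S K : Prop :=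
  [/\ compact_subgroup S K, connected S
    & (forall s t, S s -> S t -> s *m t = t *m s)].

Definition maximal_torus S K : Prop :=
  torus_in S K /\ forall S', torus_in S' K -> S `<=` S' -> S' = S.

Definition expm X : 'M[C]_n :=
  limn (series (fun k : nat => (k`!%:R)^-1 *: X ^+ k)).

Definition lie_algebra G : set 'M[C]_n :=
  [set X | forall s : C, G (expm (s *: X))].

Definition real_lie_algebra K : set 'M[C]_n :=
  [set X | forall s : C, s \is Num.real -> K (expm (s *: X))].

(* For a torus S with Lie algebra s, the connected complex group with Lie
   algebra s + i s; it is abelian, so it is the image of exp. *)
Definition torus_complexification S : set 'M[C]_n :=
  [set expm (X + 'i *: Y) | X in real_lie_algebra S & Y in real_lie_algebra S].

Definition regular_on G (f : 'M[C]_n -> C) : Prop :=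
  exists (p : 'M[C]_n -> C) (k : nat), polynomial_function p /\
    forall g, G g -> f g = p g / \det g ^+ k.

(* Characters of T are extended by 0 outside T, so that they are equal as
   functions iff they are equal on T. *)
Definition weight T (lam : 'M[C]_n -> C) : Prop :=
  [/\ regular_on T lam, lam 1%:M = 1,
      (forall s t, T s -> T t -> lam (s *m t) = lam s * lam t)
    & (forall g, ~ T g -> lam g = 0)].

(* The element of the dual of lie_algebra T defined by a character: only its
   values on lie_algebra T are meaningful. *)
Definition differential (lam : 'M[C]_n -> C) X : C :=
  derive1 (fun s : C => lam (expm (s *: X)) : C^o) 0.

Definition root G T (alpha : 'M[C]_n -> C) : Prop :=
  [/\ weight T alpha,
      (exists2 X, lie_algebra T X & differential alpha X != 0)
    & (exists X, [/\ lie_algebra G X, X != 0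
        & forall t, T t -> t *m X *m invmx t = alpha t *: X])].

Definition root_adjacent G T (lam mu : 'M[C]_n -> C) : Prop :=
  exists2 alpha, root G T alpha &
    forall X, lie_algebra T X ->
      differential lam X - differential mu X = differential alpha X.

Definition uncramped G T (A : set ('M[C]_n -> C)) : Prop :=
  forall lam mu, A lam -> A mu -> ~ root_adjacent G T lam mu.

End MatrixGroups.

Section Representations.
Context {C : numClosedFieldType} {n : nat}.
Implicit Types (G K T : set 'M[C]_n) (V : vectType C).

Definition representation G V (rho : 'M[C]_n -> 'End(V)) : Prop :=
  [/\ rho 1%:M = \1%VF,
      (forall g h, G g -> G h -> rho (g *m h) = (rho g \o rho h)%VF)
    & (forall (phi : 'Hom(V, C^o)) (v : V),
         regular_on G (fun g => phi (rho g v)))].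

Definition invariant_subspace G V (rho : 'M[C]_n -> 'End(V))
    (U : {vspace V}) : Prop :=
  forall g, G g -> (rho g @: U <= U)%VS.

Definition subrep V (rho : 'M[C]_n -> 'End(V)) (U : {vspace V})
    (g : 'M[C]_n) : 'End(subvs_of U) :=
  linfun (fun u : subvs_of U => vsproj U (rho g (vsval u))).

Definition weight_space T V (rho : 'M[C]_n -> 'End(V))
    (lam : 'M[C]_n -> C) : set V :=
  [set v | forall t, T t -> rho t v = lam t *: v].

(* A family of vectors indexed by characters; in a weight decomposition of v,
   supp c is the set of weights occurring in v. *)
Definition supp V (c : ('M[C]_n -> C) -> V) : set ('M[C]_n -> C) :=
  [set lam | c lam != 0].

Definition weight_decomposition T V (rho : 'M[C]_n -> 'End(V)) (v : V)
    (c : ('M[C]_n -> C) -> V) : Prop :=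
  [/\ supp c `<=` weight T,
      (forall lam, supp c lam -> weight_space T rho lam (c lam)),
      finite_set (supp c)
    & v = \sum_(lam \in supp c) c lam].

Definition compatible_form K T V (rho : 'M[C]_n -> 'End(V))
    (h : {dot V for Num.conj}) : Prop :=
  (forall k u v, K k -> h (rho k u) (rho k v) = h u v) /\
  (forall lam mu u v, weight T lam -> weight T mu -> lam <> mu ->
     weight_space T rho lam u -> weight_space T rho mu v -> h u v = 0).

Section DirectSum.
Context {V : vectType C} {J : finType} (W : J -> {vspace V}).

Definition component (j : J) (v : V) : V := sumv_pi (\sum_i W i)%VS j v.

Definition direct_sum_form (h : forall j, {dot subvs_of (W j) for Num.conj})
    (a b : V) : C :=
  \sum_j h j (vsproj (W j) (component j a)) (vsproj (W j) (component j b)).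

End DirectSum.
End Representations.

(* Main.v *)
(** This is the Kempf-Ness argument. Since the supports are uncramped, root vectors map each
    [w_(j,l)] to a vector orthogonal to [w_j], and the balance condition takes care of the Lie
    algebra of [T]; hence [<X w, w> = 0] for all [X] in [g = Lie G], i.e. [w] is critical for
    the norm on its orbit.

    Let [Z] be the Zariski closure of [G w], where [w] is critical. A [K]-invariant polynomial
    is invariant under [exp (k + i k)], hence under [G], hence constant on [Z]. If [|v| <= |w|]
    and [v] is not in [K w], a [K]-invariant polynomial separates [v] from [w]: pair with the
    vector of minimal norm in the closed convex hull of the orbit of the [N]-th symmetric power
    of [(w, 1)], with [N] large. So all critical vectors of [Z] lie in [K w]. For [x] in [Z],
    vectors of [G x] approaching the minimal norm tend to a critical vector, which may be taken
    to be [w]. The rank of [X |-> X x] is constant on [Z], so that near [w] minimising the norm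
    on a slice [exp (q)], with [q] a complement of the stabiliser of [w] in [i k], gives a
    critical vector of [G x]; therefore [x] is in [G w].

    This requires [g = k + i k] with [K] unitary. An invariant form makes [K] unitary. The
    idempotent projecting onto [s = [g, g]] is moved by the centraliser of [K] to one of minimal
    norm in the closure of its orbit, for which [s] is self-adjoint, and that limit lies in the
    orbit because a Casimir operator (nondegenerate, as the unipotent radical is trivial) kills
    the first cohomology. Maximality of [K] then gives [K = G /\ U(n)]. *)
Require Import Defs.
From HB Require Import structures.
From mathcomp Require Import all_boot all_order all_algebra.
From mathcomp Require Import sesquilinear complex spectral ring lra zify.
From mathcomp Require Import all_classical all_reals all_analysis.
(* Not imported with its notations, which clash with those of mathcomp-analysis. *)
From mathcomp Require mpoly.

Set Implicit Arguments.
Unset Strict Implicit.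
Unset Printing Implicit Defensive.

Import Order.TTheory GRing.Theory Num.Theory.
Import numFieldNormedType.Exports.
Import -(notations) mpoly.

Local Open Scope classical_set_scope.
Local Open Scope ring_scope.
Local Open Scope sesquilinear_scope.

(** Averaging over [K] is replaced by minimisation: a strictly convex function yields the invariant
    form, the point of least norm of a convex hull yields invariant polynomials, and a [K]-invariant
    functional is determined by its values on the commutant of [K]. Lie algebras and Zariski-closed
    sets are linked by the independence of exponential polynomials: an equation that holds along
    [exp (s X)] still holds when the [exp (s a)], [a] in the spectrum, are replaced by any character
    of the additive group. So algebraic Lie algebras contain the conjugate parts of their elements,
    and this makes trace forms nondegenerate. [G] is connected in the Zariski sense, and is not a
    priori generated by exponentials. Regular functions invariant under [exp g] take countably many
    values; uncountability of the scalars makes such a function algebraic over them, hence constant.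
    Separating [v] from [K w] is a race in the degree [N]: after normalisation the hull stays away
    from 0 by an inverse dimension, polynomial in [N], because the phases of [<k w, w>] are of third
    order near [w]; the correlation with [v] decays exponentially. *)

Local Notation polyf := polynomial_function.
Local Notation real_lie := real_lie_algebra.

(* [R[i]] is only accessed through this interface, so that its construction is never
   unfolded by unification. *)
Record realform (R : realType) := Realform {
  cC :> numClosedFieldType;
  io : {rmorphism R -> cC};
  ro : cC -> R;
  ioK : cancel io ro;
  roK : forall z : cC, z \is Num.real -> io (ro z) = z;
  io_le : {mono io : x y / x <= y} }.
Arguments io {R r}.
Arguments ro {R r}.

(** * Modulus on the complex field, Frobenius norm and hermitian product of matrices *)

Section Norms.
Context {R : realType} {S : realform R}.
Local Notation C := (cC S).
Local Notation io := (@io R S).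

Section ComplexModulus.
Implicit Types (x y : R) (z w : C).

Definition nc z : R := ro `|z|.
Definition re z : R := ro ('Re z).
Definition im z : R := ro ('Im z).

Lemma io_leE : {mono io : x y / x <= y}.
Proof. exact: io_le. Qed.
Lemma io_inj : injective io.
Proof. exact: can_inj (@ioK R S). Qed.
Lemma io_lt : {mono io : x y / x < y}.
Proof. by move=> x y; rewrite !lt_def io_leE (inj_eq io_inj). Qed.
Lemma io_real x : io x \is Num.real.
Proof.
case: (lerP 0 x) => h; first by rewrite ger0_real // -(rmorph0 io) io_leE.
by rewrite ler0_real // -(rmorph0 io) io_leE ltW.
Qed.
Lemma io_ge0 x : (0 <= io x) = (0 <= x).
Proof. by rewrite -(rmorph0 io) io_leE. Qed.
Lemma io_gt0 x : (0 < io x) = (0 < x).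
Proof. by rewrite -(rmorph0 io) io_lt. Qed.
Lemma ioJ x : (io x)^* = io x.
Proof. exact/CrealP/io_real. Qed.
Lemma normr_io x : `|io x| = io `|x|.
Proof.
have [h|h] := leP 0 x; first by rewrite !ger0_norm ?io_ge0.
rewrite [in RHS]ltr0_norm // rmorphN /= ltr0_norm //.
by rewrite -(rmorph0 io) io_lt.
Qed.

Lemma ncE z : io (nc z) = `|z|.
Proof. by rewrite roK // ger0_real. Qed.
Lemma nc_ge0 z : 0 <= nc z.
Proof. by rewrite -io_ge0 ncE. Qed.
Lemma ncM z w : nc (z * w) = nc z * nc w.
Proof. by apply: io_inj; rewrite rmorphM /= !ncE normrM. Qed.
Lemma ncD z w : nc (z + w) <= nc z + nc w.
Proof. by rewrite -io_leE rmorphD /= !ncE ler_normD. Qed.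
Lemma ncN z : nc (- z) = nc z.
Proof. by rewrite /nc normrN. Qed.
Lemma ncBC z w : nc (z - w) = nc (w - z).
Proof. by rewrite -ncN opprB. Qed.
Lemma ncJ z : nc z^* = nc z.
Proof. by apply: io_inj; rewrite !ncE norm_conjC. Qed.
Lemma nc_io x : nc (io x) = `|x|.
Proof. by apply: io_inj; rewrite ncE normr_io. Qed.
Lemma nc_nat k : nc k%:R = k%:R.
Proof. by rewrite -(rmorph_nat io) nc_io ger0_norm. Qed.
Lemma nc0 : nc 0 = 0.
Proof. by rewrite -(rmorph0 io) nc_io normr0. Qed.
Lemma nc1 : nc 1 = 1.
Proof. by rewrite -(rmorph1 io) nc_io normr1. Qed.
Lemma nc_eq0 z : (nc z == 0) = (z == 0).
Proof. by rewrite -(inj_eq io_inj) ncE rmorph0 normr_eq0. Qed.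
Lemma nc_gt0 z : (0 < nc z) = (z != 0).
Proof. by rewrite lt_def nc_ge0 nc_eq0 andbT. Qed.
Lemma ncX z k : nc (z ^+ k) = nc z ^+ k.
Proof. by elim: k => [|k IH]; rewrite ?expr0 ?nc1 // !exprS ncM IH. Qed.
Lemma ncV z : nc z^-1 = (nc z)^-1.
Proof. by apply: io_inj; rewrite ncE normfV fmorphV ncE. Qed.
Lemma nc_sum (I : Type) (r : seq I) (P : pred I) (F : I -> C) :
  nc (\sum_(i <- r | P i) F i) <= \sum_(i <- r | P i) nc (F i).
Proof.
elim/big_ind2: _ => [|a b c d h1 h2|i _]; rewrite ?nc0 //.
exact: le_trans (ncD _ _) (lerD h1 h2).
Qed.
Lemma mulJ_nc z : z * z^* = io (nc z ^+ 2).
Proof. by rewrite rmorphXn /= ncE normCK. Qed.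

Lemma reE z : io (re z) = 'Re z.
Proof. by rewrite roK // Creal_Re. Qed.
Lemma imE z : io (im z) = 'Im z.
Proof. by rewrite roK // Creal_Im. Qed.
Lemma reD z w : re (z + w) = re z + re w.
Proof. by apply: io_inj; rewrite rmorphD /= !reE raddfD. Qed.
Lemma imD z w : im (z + w) = im z + im w.
Proof. by apply: io_inj; rewrite rmorphD /= !imE raddfD. Qed.
Lemma reN z : re (- z) = - re z.
Proof. by apply: io_inj; rewrite rmorphN /= !reE raddfN. Qed.
Lemma imN z : im (- z) = - im z.
Proof. by apply: io_inj; rewrite rmorphN /= !imE raddfN. Qed.
Lemma reB z w : re (z - w) = re z - re w.
Proof. by rewrite reD reN. Qed.
Lemma imB z w : im (z - w) = im z - im w.
Proof. by rewrite imD imN. Qed.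
Lemma re_io x : re (io x) = x.
Proof. by apply: io_inj; rewrite reE (Creal_ReP _ _) // io_real. Qed.
Lemma im_io x : im (io x) = 0.
Proof. by apply: io_inj; rewrite imE rmorph0 (Creal_ImP _ _) // io_real. Qed.
Lemma re0 : re 0 = 0. Proof. by rewrite -(rmorph0 io) re_io. Qed.
Lemma re1 : re 1 = 1. Proof. by rewrite -(rmorph1 io) re_io. Qed.
Lemma reim z : z = io (re z) + 'i * io (im z).
Proof. by rewrite reE imE -Crect. Qed.
Lemma reJ z : re z^* = re z.
Proof. by apply: io_inj; rewrite !reE Re_conj. Qed.
Lemma imJ z : im z^* = - im z.
Proof. by apply: io_inj; rewrite rmorphN /= !imE Im_conj. Qed.
Lemma reM z w : re (z * w) = re z * re w - im z * im w.
Proof. by apply: io_inj; rewrite rmorphB !rmorphM /= !reE !imE ReM. Qed.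
Lemma imM z w : im (z * w) = re z * im w + re w * im z.
Proof. by apply: io_inj; rewrite rmorphD !rmorphM /= !reE !imE ImM. Qed.
Lemma reMio x z : re (io x * z) = x * re z.
Proof. by rewrite reM re_io im_io mul0r subr0. Qed.
Lemma re_i : re 'i = 0.
Proof. by apply: io_inj; rewrite reE rmorph0 Re_i. Qed.
Lemma im_i : im 'i = 1.
Proof. by apply: io_inj; rewrite imE rmorph1 Im_i. Qed.
Lemma nc2E z : nc z ^+ 2 = re z ^+ 2 + im z ^+ 2.
Proof.
apply: io_inj; rewrite -mulJ_nc rmorphD !rmorphXn /= reE imE -normC2_Re_Im.
by rewrite normCK.
Qed.
Lemma nc_i : nc 'i = 1.
Proof. by apply: io_inj; rewrite ncE normCi rmorph1. Qed.
Lemma ler_re_nc z : `|re z| <= nc z.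
Proof.
rewrite -(@ler_pXn2r _ 2%N) ?nnegrE ?nc_ge0 //.
by rewrite real_normK ?num_real // nc2E lerDl sqr_ge0.
Qed.
Lemma ler_im_nc z : `|im z| <= nc z.
Proof.
rewrite -(@ler_pXn2r _ 2%N) ?nnegrE ?nc_ge0 //.
by rewrite real_normK ?num_real // nc2E lerDr sqr_ge0.
Qed.
Lemma re_le_nc z : re z <= nc z.
Proof. exact: le_trans (ler_norm _) (ler_re_nc z). Qed.
Lemma nc_le_reim z : nc z <= `|re z| + `|im z|.
Proof.
rewrite {1}[z]reim; apply: le_trans (ncD _ _) _.
by rewrite ncM nc_i mul1r !nc_io.
Qed.
Lemma re_sum (I : Type) (r : seq I) (P : pred I) (F : I -> C) :
  re (\sum_(i <- r | P i) F i) = \sum_(i <- r | P i) re (F i).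
Proof. by apply: (big_morph re reD re0). Qed.
Lemma lerB_nc z w : nc z - nc w <= nc (z - w).
Proof. by have := ncD (z - w) w; rewrite subrK; lra. Qed.
End ComplexModulus.

Definition fn {m n} (A : 'M[C]_(m, n)) : R := \sum_i \sum_j nc (A i j) ^+ 2.
Definition nm {m n} (A : 'M[C]_(m, n)) : R := Num.sqrt (fn A).
Definition ip {m n} (A B : 'M[C]_(m, n)) : C := \sum_i \sum_j A i j * (B i j)^*.

Lemma fn_ge0 m n (A : 'M[C]_(m, n)) : 0 <= fn A.
Proof. by apply: sumr_ge0 => i _; apply: sumr_ge0 => j _; rewrite sqr_ge0. Qed.
Lemma nm_ge0 m n (A : 'M[C]_(m, n)) : 0 <= nm A.
Proof. exact: sqrtr_ge0. Qed.
Lemma nm2 m n (A : 'M[C]_(m, n)) : nm A ^+ 2 = fn A.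
Proof. by rewrite sqr_sqrtr // fn_ge0. Qed.
Lemma ip_fn m n (A : 'M[C]_(m, n)) : ip A A = io (fn A).
Proof.
rewrite /ip /fn rmorph_sum; apply: eq_bigr => i _.
by rewrite rmorph_sum; apply: eq_bigr => j _; rewrite mulJ_nc.
Qed.
Lemma ipE m n (A B : 'M[C]_(m, n)) : ip A B = \tr (A *m B^t*).
Proof.
rewrite /mxtrace; apply: eq_bigr => i _; rewrite mxE; apply: eq_bigr => j _.
by rewrite !mxE.
Qed.
Lemma ipDl m n (A B D : 'M[C]_(m, n)) : ip (A + B) D = ip A D + ip B D.
Proof. by rewrite !ipE mulmxDl raddfD. Qed.
Lemma ipZl m n a (A D : 'M[C]_(m, n)) : ip (a *: A) D = a * ip A D.
Proof. by rewrite !ipE -scalemxAl linearZ. Qed.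
Lemma ipJ m n (A B : 'M[C]_(m, n)) : (ip A B)^* = ip B A.
Proof.
rewrite /ip rmorph_sum; apply: eq_bigr => i _; rewrite rmorph_sum.
by apply: eq_bigr => j _; rewrite rmorphM /= conjCK mulrC.
Qed.
Lemma ipDr m n (A B D : 'M[C]_(m, n)) : ip D (A + B) = ip D A + ip D B.
Proof. by rewrite -ipJ ipDl rmorphD /= !ipJ. Qed.
Lemma ipZr m n a (A D : 'M[C]_(m, n)) : ip D (a *: A) = a^* * ip D A.
Proof. by rewrite -ipJ ipZl rmorphM /= !ipJ. Qed.
Lemma ipNl m n (A D : 'M[C]_(m, n)) : ip (- A) D = - ip A D.
Proof. by rewrite -scaleN1r ipZl mulN1r. Qed.
Lemma ipNr m n (A D : 'M[C]_(m, n)) : ip D (- A) = - ip D A.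
Proof. by rewrite -ipJ ipNl rmorphN /= ipJ. Qed.
Lemma ipBl m n (A B D : 'M[C]_(m, n)) : ip (A - B) D = ip A D - ip B D.
Proof. by rewrite ipDl ipNl. Qed.
Lemma ipBr m n (A B D : 'M[C]_(m, n)) : ip D (A - B) = ip D A - ip D B.
Proof. by rewrite ipDr ipNr. Qed.
Lemma ip0l m n (D : 'M[C]_(m, n)) : ip 0 D = 0.
Proof. by rewrite -(scale0r 0) ipZl mul0r. Qed.
Lemma ip0r m n (D : 'M[C]_(m, n)) : ip D 0 = 0.
Proof. by rewrite -ipJ ip0l rmorph0. Qed.
Lemma ip_suml m n (I : Type) (r : seq I) (P : pred I) (F : I -> 'M[C]_(m, n)) D :
  ip (\sum_(i <- r | P i) F i) D = \sum_(i <- r | P i) ip (F i) D.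
Proof. exact: (big_morph (ip^~ D) (fun A B => ipDl A B D) (ip0l D)). Qed.
Lemma ip_sumr m n (I : Type) (r : seq I) (P : pred I) (F : I -> 'M[C]_(m, n)) D :
  ip D (\sum_(i <- r | P i) F i) = \sum_(i <- r | P i) ip D (F i).
Proof. exact: (big_morph (ip D) (fun A B => ipDr A B D) (ip0r D)). Qed.
Lemma fn_eq0 m n (A : 'M[C]_(m, n)) : (fn A == 0) = (A == 0).
Proof.
apply/eqP/eqP => [h|->]; last first.
  by rewrite /fn big1 // => i _; rewrite big1 // => j _; rewrite mxE nc0 expr0n.
apply/matrixP => i j; rewrite mxE; apply/eqP; rewrite -nc_eq0 -sqrf_eq0; apply/eqP.
move/psumr_eq0P: h => h.
have /psumr_eq0P := h (fun i _ => sumr_ge0 _ (fun j _ => sqr_ge0 _)) i isT.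
by apply=> // k _; rewrite sqr_ge0.
Qed.
Lemma nm_eq0 m n (A : 'M[C]_(m, n)) : (nm A == 0) = (A == 0).
Proof. by rewrite -sqrf_eq0 nm2 fn_eq0. Qed.
Lemma nm_gt0 m n (A : 'M[C]_(m, n)) : (0 < nm A) = (A != 0).
Proof. by rewrite lt_def nm_ge0 nm_eq0 andbT. Qed.
Lemma nm0 m n : nm (0 : 'M[C]_(m, n)) = 0.
Proof. by apply/eqP; rewrite nm_eq0. Qed.
Lemma nmZ m n a (A : 'M[C]_(m, n)) : nm (a *: A) = nc a * nm A.
Proof.
have h : fn (a *: A) = nc a ^+ 2 * fn A.
  apply: (@io_inj); rewrite -ip_fn ipZl ipZr ip_fn mulrA mulJ_nc rmorphM //.
by rewrite /nm h sqrtrM ?sqr_ge0 // sqrtr_sqr ger0_norm ?nc_ge0.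
Qed.
Lemma nmN m n (A : 'M[C]_(m, n)) : nm (- A) = nm A.
Proof. by rewrite -scaleN1r nmZ ncN nc1 mul1r. Qed.
Lemma nmBC m n (A B : 'M[C]_(m, n)) : nm (A - B) = nm (B - A).
Proof. by rewrite -nmN opprB. Qed.
Lemma CSip m n (A B : 'M[C]_(m, n)) : nc (ip A B) <= nm A * nm B.
Proof.
have [->|B0] := eqVneq B 0; first by rewrite ip0r nc0 nm0 mulr0.
set c := ip A B; set b := fn B.
have b0 : 0 < b by rewrite lt_def fn_ge0 fn_eq0 B0.
have : 0 <= fn (io b *: A - c *: B) by exact: fn_ge0.
have -> : fn (io b *: A - c *: B) = b * (b * fn A - nc c ^+ 2).
  apply: (@io_inj); rewrite -ip_fn !(ipBl, ipBr, ipZl, ipZr) !ip_fn -[ip B A]ipJ -/c -/b.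
  rewrite !(rmorphM io b) rmorphB (rmorphM io b) /= ioJ -mulJ_nc; ring.
rewrite pmulr_rge0 // subr_ge0 /b -!nm2 -exprMn mulrC ler_pXn2r ?nnegrE //.
- exact: nc_ge0.
- by rewrite mulr_ge0 ?nm_ge0.
Qed.
Lemma nmD m n (A B : 'M[C]_(m, n)) : nm (A + B) <= nm A + nm B.
Proof.
rewrite -(@ler_pXn2r _ 2%N) ?nnegrE ?nm_ge0 ?addr_ge0 ?nm_ge0 // nm2.
have -> : fn (A + B) = fn A + fn B + 2 * re (ip A B).
  rewrite -[LHS](@re_io) -ip_fn !(ipDl, ipDr) !reD !ip_fn !re_io -(ipJ A B) reJ; ring.
have := le_trans (re_le_nc _) (CSip A B); rewrite sqrrD !nm2; lra.
Qed.
Lemma nmB m n (A B : 'M[C]_(m, n)) : nm A - nm B <= nm (A - B).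
Proof. by have := nmD (A - B) B; rewrite subrK; lra. Qed.
Lemma nm_triB m n (A B D : 'M[C]_(m, n)) : nm (A - D) <= nm (A - B) + nm (B - D).
Proof. by have := nmD (A - B) (B - D); rewrite addrA subrK. Qed.
Lemma nm_sum m n (I : Type) (r : seq I) (P : pred I) (F : I -> 'M[C]_(m, n)) :
  nm (\sum_(i <- r | P i) F i) <= \sum_(i <- r | P i) nm (F i).
Proof.
elim/big_ind2: _ => [|a b c d h1 h2|i _]; rewrite ?nm0 //.
exact: le_trans (nmD _ _) (lerD h1 h2).
Qed.
Lemma nc_le_nm m n (A : 'M[C]_(m, n)) i j : nc (A i j) <= nm A.
Proof.
rewrite -(@ler_pXn2r _ 2%N) ?nnegrE ?nm_ge0 ?nc_ge0 // nm2 /fn (bigD1 i) //=.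
rewrite (bigD1 j) //= -addrA lerDl addr_ge0 //; apply: sumr_ge0 => k _.
  exact: sqr_ge0.
by apply: sumr_ge0 => l _; exact: sqr_ge0.
Qed.
Lemma nm_le_sum m n (A : 'M[C]_(m, n)) : nm A <= \sum_i \sum_j nc (A i j).
Proof.
rewrite {1}(matrix_sum_delta A); apply: le_trans (nm_sum _ _ _) _.
apply: ler_sum => i _; apply: le_trans (nm_sum _ _ _) _; apply: ler_sum => j _.
rewrite nmZ ler_piMr ?nc_ge0 //.
rewrite -(@ler_pXn2r _ 2%N) ?nnegrE ?nm_ge0 // nm2 /fn (bigD1 i) //= (bigD1 j) //=.
rewrite mxE !eqxx nc1 expr1n !big1 ?addr0 // => [k ki|k kj].
  by rewrite big1 // => l _; rewrite mxE (negPf ki) nc0 expr0n.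
by rewrite mxE (negPf kj) andbF nc0 expr0n.
Qed.
Lemma fn_row_sum m n (A : 'M[C]_(m, n)) : fn A = \sum_i fn (row i A).
Proof.
apply: eq_bigr => i _; rewrite /fn big_ord1; apply: eq_bigr => j _.
by rewrite mxE.
Qed.
Lemma fn_tr m n (A : 'M[C]_(m, n)) : fn A^T = fn A.
Proof.
rewrite /fn exchange_big; apply: eq_bigr => i _; apply: eq_bigr => j _.
by rewrite mxE.
Qed.
Lemma fn_adj m n (A : 'M[C]_(m, n)) : fn (A^t*) = fn A.
Proof.
rewrite -(fn_tr A); apply: eq_bigr => i _; apply: eq_bigr => j _.
by rewrite !mxE ncJ.
Qed.
Lemma nm_adj m n (A : 'M[C]_(m, n)) : nm (A^t*) = nm A.
Proof. by rewrite /nm fn_adj. Qed.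
Lemma nmM m n p (A : 'M[C]_(m, n)) (B : 'M[C]_(n, p)) : nm (A *m B) <= nm A * nm B.
Proof.
rewrite -(@ler_pXn2r _ 2%N) ?nnegrE ?mulr_ge0 ?nm_ge0 // exprMn !nm2.
rewrite (fn_row_sum A) -(fn_tr B) (fn_row_sum B^T) big_distrl /=.
apply: ler_sum => i _; rewrite big_distrr /=; apply: ler_sum => j _.
have := CSip (row i A) (map_mx Num.conj (row j B^T)).
have -> : ip (row i A) (map_mx Num.conj (row j B^T)) = (A *m B) i j.
  rewrite /ip big_ord1 mxE; apply: eq_bigr => k _; by rewrite !mxE conjCK.
have -> : nm (map_mx Num.conj (row j B^T)) = nm (row j B^T).
  rewrite /nm /fn; congr Num.sqrt; apply: eq_bigr => k _; apply: eq_bigr => l _.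
  by rewrite !mxE ncJ.
move=> h; rewrite -!nm2 -exprMn ler_pXn2r ?nnegrE ?mulr_ge0 ?nm_ge0 ?nc_ge0 //.
Qed.
End Norms.

Section Adjoint.
Context {C : numClosedFieldType}.

Lemma adjM m n p (A : 'M[C]_(m, n)) (B : 'M[C]_(n, p)) :
  (A *m B)^t* = B^t* *m A^t*.
Proof. by rewrite trmx_mul map_mxM. Qed.
Lemma adjD m n (A B : 'M[C]_(m, n)) : (A + B)^t* = A^t* + B^t*.
Proof. by rewrite linearD map_mxD. Qed.
Lemma adjN m n (A : 'M[C]_(m, n)) : (- A)^t* = - A^t*.
Proof. by rewrite linearN map_mxN. Qed.
Lemma adjB m n (A B : 'M[C]_(m, n)) : (A - B)^t* = A^t* - B^t*.
Proof. by rewrite adjD adjN. Qed.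
Lemma adjZ m n a (A : 'M[C]_(m, n)) : (a *: A)^t* = a^* *: A^t*.
Proof. by rewrite linearZ map_mxZ. Qed.
Lemma adj1 n : (1%:M : 'M[C]_n)^t* = 1%:M.
Proof. by rewrite trmx1 map_mx1. Qed.
Lemma adj0 m n : (0 : 'M[C]_(m, n))^t* = 0.
Proof. by rewrite trmx0 map_mx0. Qed.
Lemma adj_diag n (d : 'rV[C]_n) : (diag_mx d)^t* = diag_mx (map_mx Num.conj d).
Proof. by rewrite tr_diag_mx map_diag_mx. Qed.
Lemma adj_sum m n (I : Type) (r : seq I) (P : pred I) (F : I -> 'M[C]_(m, n)) :
  (\sum_(i <- r | P i) F i)^t* = \sum_(i <- r | P i) (F i)^t*.
Proof. exact: (big_morph (fun A : 'M[C]_(m, n) => A^t*) (@adjD m n) (adj0 m n)). Qed.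
Lemma unitmx_adj n (A : 'M[C]_n) : (A^t* \in unitmx) = (A \in unitmx).
Proof. by rewrite map_unitmx unitmx_tr. Qed.
Lemma adjV n (A : 'M[C]_n) : (invmx A)^t* = invmx (A^t*).
Proof. by rewrite trmx_inv map_invmx. Qed.
Lemma adj_tr n (A : 'M[C]_n) : \tr (A^t*) = (\tr A)^*.
Proof. by rewrite -map_trmx mxtrace_tr trace_map_mx. Qed.
End Adjoint.

(** One-sided on purpose: only upper bounds are asked for, so that estimates are chains of
    inequalities and [cvg0_cst] turns a limit into [c <= 0]. For norms it is convergence to 0. *)
Definition cvg0 {R : realType} (a : nat -> R) : Prop :=
  forall e, 0 < e -> \forall k \near \oo, a k < e.

(** Not monotone: [k <= phi k] already carries every eventual property from a sequence to its
    reindexing, and such maps compose. *)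
Definition subseq_ix (phi : nat -> nat) : Prop := forall k, (k <= phi k)%N.

(** * Null sequences, limits of matrices, Bolzano-Weierstrass *)

Section NullSequences.
Context {R : realType}.
Implicit Types (a b : nat -> R).

Lemma cvg0_le a b : (\forall k \near \oo, a k <= b k) -> cvg0 b -> cvg0 a.
Proof.
move=> ab b0 e e0; have := b0 _ e0; apply: filterS2 ab => k.
exact: le_lt_trans.
Qed.
Lemma cvg0_leA a b : (forall k, a k <= b k) -> cvg0 b -> cvg0 a.
Proof. by move=> ab; apply: cvg0_le; apply: nearW. Qed.
Lemma cvg0D a b : cvg0 a -> cvg0 b -> cvg0 (fun k => a k + b k).
Proof.
move=> a0 b0 e e0; have e2 : 0 < e / 2 by lra.
by apply: filterS2 (a0 _ e2) (b0 _ e2) => k; lra.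
Qed.
Lemma cvg0Z c a : 0 <= c -> cvg0 a -> cvg0 (fun k => c * a k).
Proof.
move=> c0 a0 e e0; have c1 : 0 < c + 1 by lra.
have e2 : 0 < e / (c + 1) by rewrite divr_gt0.
apply: filterS (a0 _ e2) => k; rewrite ltr_pdivlMr // => h.
have [ak|ak] := leP 0 (a k); first nra.
by apply: le_lt_trans e0; rewrite mulr_ge0_le0 // ltW.
Qed.
Lemma cvg0_cst0 : cvg0 (fun _ => 0 : R).
Proof. by move=> e e0; apply: nearW. Qed.
Lemma cvg0_subseq phi a : subseq_ix phi -> cvg0 a -> cvg0 (a \o phi).
Proof.
move=> hphi a0 e /a0 [N _ hN]; exists N => // k Nk.
by apply: hN; apply: leq_trans Nk (hphi k).
Qed.
Lemma cvg0_sum (I : Type) (r : seq I) (F : I -> nat -> R) :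
  (forall i, cvg0 (F i)) -> cvg0 (fun k => \sum_(i <- r) F i k).
Proof.
move=> h; elim: r => [|i r IH].
  by apply: cvg0_leA cvg0_cst0 => k; rewrite big_nil.
by apply: cvg0_leA (cvg0D (h i) IH) => k; rewrite big_cons.
Qed.
Lemma cvg0_inv : cvg0 (fun k => k.+1%:R^-1 : R).
Proof.
move=> e e0; have := near_infty_natSinv_lt (PosNum e0).
by apply: filterS => k.
Qed.
Lemma near_ex (P : nat -> Prop) : (\forall k \near \oo, P k) -> exists k, P k.
Proof. by case=> N _ h; exists N; apply: h => /=. Qed.
Lemma cvg0_cst (c : R) : cvg0 (fun=> c) -> c <= 0.
Proof.
move=> h; rewrite leNgt; apply/negP => /h /near_ex [k].
by rewrite ltxx.
Qed.
Lemma near_subseq phi (P : nat -> Prop) : subseq_ix phi ->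
  (\forall k \near \oo, P k) -> \forall k \near \oo, P (phi k).
Proof.
move=> hphi [N _ hN]; exists N => // k Nk.
by apply: hN; apply: leq_trans Nk (hphi k).
Qed.

Lemma bw_real (u : nat -> R) B : (forall k, `|u k| <= B) ->
  exists2 phi, subseq_ix phi & exists l, cvg0 (fun k => `|u (phi k) - l|).
Proof.
move=> uB; have cK := @segment_compact R (- B) B.
have FK : (u @ \oo) `[(- B), B]%classic.
  by exists 0%N => // k _; rewrite /= in_itv /= -ler_norml.
have [l [_ cl]] := cK (u @ \oo) _ FK.
have ex k : exists j, (k <= j)%N /\ `|u j - l| < k.+1%:R^-1.
  have [||x [[j /= kj <-] xl]] := cl (u @` [set j | (k <= j)%N]) (ball l k.+1%:R^-1).
  - by exists k => // j kj; exists j.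
  - by apply: nbhsx_ballx; rewrite invr_gt0 ltr0Sn.
  - by exists j; split=> //; rewrite distrC; exact: xl.
have [phi hphi] := choice ex; exists phi; first by move=> k; case: (hphi k).
exists l; apply: cvg0_leA cvg0_inv => k; exact/ltW/(hphi k).2.
Qed.

Lemma bw_real_seq (I : eqType) (s : seq I) (u : nat -> I -> R) B :
  (forall k i, `|u k i| <= B) ->
  exists2 phi, subseq_ix phi &
    exists l : I -> R, forall i, i \in s -> cvg0 (fun k => `|u (phi k) i - l i|).
Proof.
move=> uB; elim: s => [|i s [phi hphi [l hl]]].
  by exists id => //; exists (fun=> 0).
have [psi hpsi [li hli]] := bw_real (fun k => uB (phi k) i).
exists (phi \o psi); first by move=> k; apply: leq_trans (hpsi k) (hphi _).
exists (fun j => if j == i then li else l j) => j.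
rewrite inE; case: eqVneq => [-> _|_ /= js] //.
exact: (cvg0_subseq hpsi (hl j js)).
Qed.
End NullSequences.

Section ComplexLimits.
Context {R : realType} {S : realform R}.
Local Notation C := (cC S).
Local Notation io := (@io R S).

Definition cvs (u : nat -> C) (l : C) : Prop := cvg0 (fun k => nc (u k - l)).
Definition cvm {m n} (A : nat -> 'M[C]_(m, n)) (L : 'M[C]_(m, n)) : Prop :=
  cvg0 (fun k => nm (A k - L)).

Implicit Types (u v : nat -> C) (l a b : C).

Lemma cvs_cst a : cvs (fun=> a) a.
Proof. by apply: cvg0_leA cvg0_cst0 => k; rewrite subrr nc0. Qed.
Lemma cvs_ext u v l : u =1 v -> cvs u l -> cvs v l.
Proof. by move=> /funext ->. Qed.
Lemma cvs_near u v l : (\forall k \near \oo, u k = v k) -> cvs u l -> cvs v l.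
Proof. by move=> uv; apply: cvg0_le; apply: filterS uv => k ->. Qed.
Lemma cvsD u v a b : cvs u a -> cvs v b -> cvs (fun k => u k + v k) (a + b).
Proof.
move=> ua vb; apply: cvg0_leA (cvg0D ua vb) => k.
by rewrite opprD addrACA ncD.
Qed.
Lemma cvsJ u a : cvs u a -> cvs (fun k => (u k)^*) a^*.
Proof. by apply: cvg0_leA => k; rewrite -rmorphB ncJ. Qed.
Lemma cvs_bd u a : cvs u a -> \forall k \near \oo, nc (u k) <= nc a + 1.
Proof.
move=> /(_ 1 ltr01); apply: filterS => k /=; have := lerB_nc (u k) a; lra.
Qed.
Lemma cvsM u v a b : cvs u a -> cvs v b -> cvs (fun k => u k * v k) (a * b).
Proof.
move=> ua vb.
have h1 : 0 <= nc a + 1 by rewrite addr_ge0 ?nc_ge0.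
apply: cvg0_le (cvg0D (cvg0Z h1 vb) (cvg0Z (nc_ge0 b) ua)).
apply: filterS (cvs_bd ua) => k h.
have -> : u k * v k - a * b = u k * (v k - b) + b * (u k - a) by ring.
by apply: le_trans (ncD _ _) _; rewrite !ncM lerD2r ler_wpM2r // nc_ge0.
Qed.
Lemma cvs_sum (I : Type) (r : seq I) (P : pred I) (F : I -> nat -> C) L :
  (forall i, cvs (F i) (L i)) ->
  cvs (fun k => \sum_(i <- r | P i) F i k) (\sum_(i <- r | P i) L i).
Proof.
move=> h; elim: r => [|i r IH].
  by apply: cvs_ext (cvs_cst _) => k; rewrite !big_nil.
rewrite big_cons; case: ifP => Pi.
  by apply: cvs_ext (cvsD (h i) IH) => k; rewrite big_cons Pi.
by apply: cvs_ext IH => k; rewrite big_cons Pi.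
Qed.
Lemma cvs_prod (I : Type) (r : seq I) (P : pred I) (F : I -> nat -> C) L :
  (forall i, cvs (F i) (L i)) ->
  cvs (fun k => \prod_(i <- r | P i) F i k) (\prod_(i <- r | P i) L i).
Proof.
move=> h; elim: r => [|i r IH].
  by apply: cvs_ext (cvs_cst _) => k; rewrite !big_nil.
rewrite big_cons; case: ifP => Pi.
  by apply: cvs_ext (cvsM (h i) IH) => k; rewrite big_cons Pi.
by apply: cvs_ext IH => k; rewrite big_cons Pi.
Qed.
Lemma cvs_uniq u a b : cvs u a -> cvs u b -> a = b.
Proof.
move=> ua ub; apply/eqP; rewrite -subr_eq0 -nc_eq0 eq_le nc_ge0 andbT.
apply: cvg0_cst; apply: cvg0_leA (cvg0D ua ub) => k.
have := ncD (a - u k) (u k - b); rewrite addrA subrK ncBC; lra.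
Qed.
Lemma cvs_re u a : cvs u a -> cvg0 (fun k => `|re (u k) - re a|).
Proof. by apply: cvg0_leA => k; rewrite -reB ler_re_nc. Qed.
Lemma cvs_le_re u a B : cvs u a -> (\forall k \near \oo, re (u k) <= B) -> re a <= B.
Proof.
move=> ua h; rewrite -subr_le0; apply: cvg0_cst.
apply: cvg0_le (cvs_re ua); apply: filterS h => k.
by have := ler_norm (re a - re (u k)); rewrite distrC; lra.
Qed.
Lemma cvs_ge_re u a B : cvs u a -> (\forall k \near \oo, B <= re (u k)) -> B <= re a.
Proof.
move=> ua h; rewrite -subr_le0; apply: cvg0_cst.
apply: cvg0_le (cvs_re ua); apply: filterS h => k.
by have := ler_norm (re (u k) - re a); lra.
Qed.
Lemma cvs_neq0 u a : cvs u a -> a != 0 ->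
  \forall k \near \oo, nc a / 2 <= nc (u k).
Proof.
move=> ua a0; have h : 0 < nc a / 2 by have := nc_gt0 a; rewrite a0; lra.
apply: filterS (ua _ h) => k /=; have := lerB_nc a (u k); rewrite ncBC; lra.
Qed.
Lemma cvsV u a : cvs u a -> a != 0 -> cvs (fun k => (u k)^-1) a^-1.
Proof.
move=> ua a0; have ha : 0 < nc a by rewrite nc_gt0.
have hc : 0 <= 2 / (nc a * nc a) by rewrite divr_ge0 // mulr_ge0 // ltW.
apply: cvg0_le (cvg0Z hc ua); apply: filterS (cvs_neq0 ua a0) => k h.
have huk : 0 < nc (u k) by lra.
have uk0 : u k != 0 by rewrite -nc_gt0.
have -> : (u k)^-1 - a^-1 = - ((u k - a) * (u k * a)^-1) by field; rewrite uk0 a0.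
rewrite ncN !(ncM, ncV) mulrC ler_wpM2r ?nc_ge0 //.
rewrite -[leLHS]mul1r ler_pdivrMr ?mulr_gt0 //.
rewrite mulrAC ler_pdivlMr ?mulr_gt0 // mul1r; nra.
Qed.

Section Matrices.
Variables (m n : nat).
Implicit Types (A B : nat -> 'M[C]_(m, n)).

Lemma cvm_cst (L : 'M[C]_(m, n)) : cvm (fun=> L) L.
Proof. by apply: cvg0_leA cvg0_cst0 => k; rewrite subrr nm0. Qed.
Lemma cvm_subseq phi A L : subseq_ix phi -> cvm A L -> cvm (A \o phi) L.
Proof. exact: cvg0_subseq. Qed.
Lemma cvm_ext A B L : A =1 B -> cvm A L -> cvm B L.
Proof. by move=> /funext ->. Qed.
Lemma cvm_near A B L : (\forall k \near \oo, A k = B k) -> cvm A L -> cvm B L.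
Proof. by move=> uv; apply: cvg0_le; apply: filterS uv => k ->. Qed.
Lemma cvmD A B L M : cvm A L -> cvm B M -> cvm (fun k => A k + B k) (L + M).
Proof.
move=> ua vb; apply: cvg0_leA (cvg0D ua vb) => k.
by rewrite opprD addrACA nmD.
Qed.
Lemma cvmN A L : cvm A L -> cvm (fun k => - A k) (- L).
Proof. by apply: cvg0_leA => k; rewrite -opprD nmN. Qed.
Lemma cvmB A B L M : cvm A L -> cvm B M -> cvm (fun k => A k - B k) (L - M).
Proof. by move=> ua /cvmN; apply: cvmD. Qed.
Lemma cvm_bd A L : cvm A L -> \forall k \near \oo, nm (A k) <= nm L + 1.
Proof.
move=> /(_ 1 ltr01); apply: filterS => k /=; have := nmB (A k) L; lra.
Qed.
Lemma cvmZ u A a L : cvs u a -> cvm A L -> cvm (fun k => u k *: A k) (a *: L).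
Proof.
move=> ua vb.
have h1 : 0 <= nc a + 1 by rewrite addr_ge0 ?nc_ge0.
apply: cvg0_le (cvg0D (cvg0Z h1 vb) (cvg0Z (nm_ge0 L) ua)).
apply: filterS (cvs_bd ua) => k h.
have -> : u k *: A k - a *: L = u k *: (A k - L) + (u k - a) *: L.
  by rewrite scalerBr scalerBl addrA subrK.
by apply: le_trans (nmD _ _) _; rewrite !nmZ [nm L * _]mulrC lerD2r ler_wpM2r // nm_ge0.
Qed.
Lemma cvm_uniq A L M : cvm A L -> cvm A M -> L = M.
Proof.
move=> ua ub; apply/eqP; rewrite -subr_eq0 -nm_eq0 eq_le nm_ge0 andbT.
apply: cvg0_cst; apply: cvg0_leA (cvg0D ua ub) => k.
by have := nm_triB L (A k) M; rewrite (nmBC L (A k)).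
Qed.
Lemma cvm_entry A L i j : cvm A L -> cvs (fun k => A k i j) (L i j).
Proof. by apply: cvg0_leA => k; have := nc_le_nm (A k - L) i j; rewrite !mxE. Qed.
Lemma cvm_entries A (L : 'M[C]_(m, n)) : (forall i j, cvs (fun k => A k i j) (L i j)) -> cvm A L.
Proof.
move=> h; apply: cvg0_leA (_ : cvg0 (fun k => \sum_i \sum_j nc (A k i j - L i j))).
  move=> k; apply: le_trans (nm_le_sum _) _; apply: ler_sum => i _.
  by apply: ler_sum => j _; rewrite !mxE.
by apply: cvg0_sum => i; apply: cvg0_sum => j; exact: h.
Qed.
Lemma cvm_sum (I : Type) (r : seq I) (P : pred I) (F : I -> nat -> 'M[C]_(m, n)) L :
  (forall i, cvm (F i) (L i)) ->
  cvm (fun k => \sum_(i <- r | P i) F i k) (\sum_(i <- r | P i) L i).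
Proof.
move=> h; elim: r => [|i r IH].
  by apply: cvm_ext (cvm_cst _) => k; rewrite !big_nil.
rewrite big_cons; case: ifP => Pi.
  by apply: cvm_ext (cvmD (h i) IH) => k; rewrite big_cons Pi.
by apply: cvm_ext IH => k; rewrite big_cons Pi.
Qed.
Lemma cvm_nm A L : cvm A L -> cvg0 (fun k => `|nm (A k) - nm L|).
Proof.
apply: cvg0_leA => k; rewrite ler_norml; have := nmB (A k) L.
by have := nmB L (A k); rewrite (nmBC L (A k)); lra.
Qed.
Lemma cvm_le_nm A L (b : R) : cvm A L -> (\forall k \near \oo, nm (A k) <= b) -> nm L <= b.
Proof.
move=> /cvm_nm ua h; rewrite -subr_le0; apply: cvg0_cst.
apply: cvg0_le ua; apply: filterS h => k.
by have := ler_norm (nm L - nm (A k)); rewrite distrC; lra.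
Qed.
Lemma cvm_ge_nm A L (b : R) : cvm A L -> (\forall k \near \oo, b <= nm (A k)) -> b <= nm L.
Proof.
move=> /cvm_nm ua h; rewrite -subr_le0; apply: cvg0_cst.
apply: cvg0_le ua; apply: filterS h => k.
by have := ler_norm (nm (A k) - nm L); lra.
Qed.
Lemma bw_mx A (b : R) : (forall k, nm (A k) <= b) ->
  exists2 phi, subseq_ix phi & exists L, cvm (A \o phi) L.
Proof.
move=> AB; pose u k (i : 'I_m * 'I_n * bool) : R :=
  if i.2 then re (A k i.1.1 i.1.2) else im (A k i.1.1 i.1.2).
have uB k i : `|u k i| <= b.
  apply: le_trans (AB k); apply: le_trans (nc_le_nm _ i.1.1 i.1.2).
  by rewrite /u; case: i.2; rewrite (ler_re_nc, ler_im_nc).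
have [phi hphi [l hl]] := bw_real_seq (enum {: 'I_m * 'I_n * bool}) uB.
exists phi => //.
exists (\matrix_(i, j) (io (l (i, j, true)) + 'i * io (l (i, j, false)))).
apply: cvm_entries => i j; rewrite mxE.
have h (t : bool) : cvg0 (fun k => `|u (phi k) (i, j, t) - l (i, j, t)|).
  by apply: hl; rewrite mem_enum.
apply: cvg0_leA (cvg0D (h true) (h false)) => k.
apply: le_trans (nc_le_reim _) _; rewrite /u /= reB imB reD imD.
rewrite !re_io !im_io reM imM !re_io !im_io re_i im_i.
by rewrite !(mul0r, mulr0, mulr1, mul1r, subr0, add0r, addr0).
Qed.
End Matrices.

Lemma cvmM m n p (A : nat -> 'M[C]_(m, n)) (B : nat -> 'M[C]_(n, p)) L M :
  cvm A L -> cvm B M -> cvm (fun k => A k *m B k) (L *m M).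
Proof.
move=> ua vb.
have h1 : 0 <= nm L + 1 by rewrite addr_ge0 ?nm_ge0.
apply: cvg0_le (cvg0D (cvg0Z h1 vb) (cvg0Z (nm_ge0 M) ua)).
apply: filterS (cvm_bd ua) => k h.
have -> : A k *m B k - L *m M = A k *m (B k - M) + (A k - L) *m M.
  by rewrite mulmxBr mulmxBl addrA subrK.
apply: le_trans (nmD _ _) _; apply: lerD.
  by apply: le_trans (nmM _ _) _; rewrite ler_wpM2r // nm_ge0.
by rewrite mulrC; exact: nmM.
Qed.
Lemma cvm_adj m n (A : nat -> 'M[C]_(m, n)) L :
  cvm A L -> cvm (fun k => (A k)^t*) (L^t*).
Proof. by apply: cvg0_leA => k; rewrite -adjB nm_adj. Qed.
Lemma cvs_trace n (A : nat -> 'M[C]_n) L : cvm A L -> cvs (fun k => \tr (A k)) (\tr L).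
Proof. by move=> h; apply: cvs_sum => i; apply: cvm_entry. Qed.
Lemma cvs_det n (A : nat -> 'M[C]_n) L : cvm A L -> cvs (fun k => \det (A k)) (\det L).
Proof.
move=> h; apply: cvs_sum => s; apply: cvsM; first exact: cvs_cst.
by apply: cvs_prod => i; apply: cvm_entry.
Qed.
Lemma cvs_ip m n (A B : nat -> 'M[C]_(m, n)) L M :
  cvm A L -> cvm B M -> cvs (fun k => ip (A k) (B k)) (ip L M).
Proof.
move=> h1 h2; apply: cvs_sum => i; apply: cvs_sum => j.
by apply: cvsM; [|apply: cvsJ]; apply: cvm_entry.
Qed.
Lemma cvm_unit n (A : nat -> 'M[C]_n) L : cvm A L -> L \in unitmx ->
  \forall k \near \oo, A k \in unitmx.
Proof.
rewrite unitmxE unitfE => /cvs_det h L0; apply: filterS (cvs_neq0 h L0) => k.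
rewrite unitmxE unitfE -nc_gt0; have := nc_gt0 (\det L); rewrite L0; lra.
Qed.
Lemma cvm_inv n (A : nat -> 'M[C]_n) L : cvm A L -> L \in unitmx ->
  cvm (fun k => invmx (A k)) (invmx L).
Proof.
move=> h Lu; have := cvm_unit h Lu => Au.
apply: (@cvm_near _ _ (fun k => (\det (A k))^-1 *: \adj (A k))).
  by apply: filterS Au => k; rewrite /invmx => ->.
rewrite /invmx Lu; apply: cvmZ.
  by apply: cvsV; [exact: cvs_det | move: Lu; rewrite unitmxE unitfE].
apply: cvm_entries => i j; rewrite mxE.
apply: (@cvs_ext (fun k => cofactor (A k) j i)); first by move=> k; rewrite mxE.
apply: cvsM; first exact: cvs_cst.
apply: cvs_det; apply: cvm_entries => a b; rewrite !mxE.
by apply: cvs_ext (cvm_entry _ _ h) => k; rewrite !mxE.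
Qed.
End ComplexLimits.

(** * Compactness of sets of matrices; the matrix exponential and its estimates *)

Section Exponential.
Context {R : realType} {S : realform R}.
Local Notation C := (cC S).
Local Notation io := (@io R S).

Lemma nbhs_nm m n (L : 'M[C]_(m, n)) e : 0 < e -> nbhs L [set X | nm (X - L) < e].
Proof.
move=> e0; have d0 : 0 < e / ((m * n)%:R + 1) by rewrite divr_gt0 // ltr_wpDl.
apply/nbhs_ballP; exists (io (e / ((m * n)%:R + 1))); first by rewrite /= io_gt0.
move=> X /= h; apply: le_lt_trans (nm_le_sum _) _.
apply: (@le_lt_trans _ _ (\sum_(i < m) \sum_(j < n) (e / ((m * n)%:R + 1)))).
  apply: ler_sum => i _; apply: ler_sum => j _; rewrite !mxE.
  by rewrite ncBC -(io_leE (S := S)) ncE; apply: ltW; have [_ hij] := h; exact: hij.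
rewrite !sumr_const !card_ord -mulrnA (mulnC n m) -[ltLHS]mulr_natl mulrA.
rewrite ltr_pdivrMr ?ltr_wpDl // mulrC ltr_pM2l //; lra.
Qed.

Lemma nbhs_nmP m n (L : 'M[C]_(m, n)) (U : set 'M[C]_(m, n)) : nbhs L U ->
  exists2 e : R, 0 < e & forall X, nm (X - L) < e -> U X.
Proof.
move=> /nbhs_ballP [eps /= eps0 hU].
have er : io (ro eps) = eps by rewrite roK // gtr0_real.
exists (ro eps); first by rewrite -(io_gt0 (S := S)) er.
move=> X h; apply: hU; split => // i j; rewrite /ball /= -er -ncE io_lt ncBC.
by apply: le_lt_trans h; have := nc_le_nm (X - L) i j; rewrite !mxE.
Qed.

Lemma cvmP m n (A : nat -> 'M[C]_(m, n)) L : cvm A L -> A @ \oo --> L.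
Proof.
move=> h U /nbhs_nmP [e e0 hU]; apply: filterS (h e e0) => k; exact: hU.
Qed.

Lemma compact_seq m n (K : set 'M[C]_(m, n)) (A : nat -> 'M[C]_(m, n)) :
  compact K -> (forall k, K (A k)) ->
  exists2 L, K L & forall e N, 0 < e -> exists2 k, (N <= k)%N & nm (A k - L) < e.
Proof.
move=> cK KA; have FK : (A @ \oo) K by exists 0%N => // k _; apply: KA.
have [L [KL cl]] := cK (A @ \oo) _ FK; exists L => // e N e0.
have [|X [[k /= Nk <-] h]] := cl (A @` [set k | (N <= k)%N]) _ _ (nbhs_nm L e0).
  by exists N => // k Nk; exists k.
by exists k.
Qed.

Lemma compact_bounded m n (K : set 'M[C]_(m, n)) : compact K ->
  exists B : R, forall X, K X -> nm X <= B.
Proof.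
move=> cK; apply: contrapT => h.
have h1 (k : nat) : exists X, K X /\ k%:R < nm X.
  apply: contrapT => h1; apply: h; exists k%:R => X KX.
  by rewrite leNgt; apply/negP => h2; apply: h1; exists X.
have [A hA] := choice h1.
have [L KL hL] := compact_seq cK (fun k => (hA k).1).
have [N hN] : exists N : nat, nm L + 1 < N%:R.
  by exists (Num.bound (nm L + 1)); apply: archi_boundP; rewrite addr_ge0 ?nm_ge0.
have [k Nk] := hL 1 N ltr01; have := nmB (A k) L; have := (hA k).2.
have : N%:R <= k%:R :> R by rewrite ler_nat.
lra.
Qed.

Lemma compact_cvm m n (K : set 'M[C]_(m, n)) A L : compact K ->
  (forall k, K (A k)) -> cvm A L -> K L.
Proof.
move=> cK KA AL; have [M KM hM] := compact_seq cK KA.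
suff -> : L = M by [].
apply/eqP; rewrite -subr_eq0 -nm_eq0 eq_le nm_ge0 andbT leNgt; apply/negP => d.
have d2 : 0 < nm (L - M) / 2 by lra.
have [N _ hN] := AL _ d2; have [k Nk hk] := hM _ N d2.
have := hN k Nk; have := nm_triB L (A k) M; rewrite /= (nmBC L (A k)); lra.
Qed.

(** [f] and [g] identify complex matrices with real vectors through the real and imaginary parts of
    the entries; the set is then the continuous image of a closed bounded set of real vectors. *)
Lemma bounded_compact m n (K : set 'M[C]_(m, n)) (B : R) :
  (forall X, K X -> nm X <= B) ->
  (forall A L, (forall k, K (A k)) -> cvm A L -> K L) -> compact K.
Proof.
move=> KB Kcl.
pose T := ('I_m * 'I_n * bool)%type; pose N := #|{: T}|.
pose f (v : 'rV[R]_N) : 'M[C]_(m, n) := \matrix_(i, j)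
  (io (v 0 (enum_rank (i, j, true))) + 'i * io (v 0 (enum_rank (i, j, false)))).
pose g (X : 'M[C]_(m, n)) : 'rV[R]_N := \row_k
  let t : T := enum_val k in if t.2 then re (X t.1.1 t.1.2) else im (X t.1.1 t.1.2).
have gK X : f (g X) = X.
  apply/matrixP => i j; rewrite !mxE !enum_rankK /=; exact/esym/reim.
have fB (v w : 'rV[R]_N) (e : R) : (forall k, `|v 0 k - w 0 k| <= e) -> 0 <= e ->
    nm (f v - f w) <= (m * n)%:R * (2 * e).
  move=> h e0; apply: le_trans (nm_le_sum _) _.
  apply: (@le_trans _ _ (\sum_(i < m) \sum_(j < n) 2 * e)); last first.
    by rewrite !sumr_const !card_ord -mulrnA (mulnC n m) !mulr_natl.
  apply: ler_sum => i _; apply: ler_sum => j _; rewrite !mxE.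
  rewrite opprD addrACA -mulrBr -!rmorphB; apply: le_trans (ncD _ _) _.
  by rewrite ncM nc_i mul1r !nc_io; have := h (enum_rank (i, j, true));
     have := h (enum_rank (i, j, false)); lra.
have fcont : continuous f.
  move=> v U /nbhs_nmP [e e0 hU].
  have d0 : 0 < e / ((m * n)%:R * 2 + 1) by rewrite divr_gt0 // ltr_wpDl.
  apply/nbhs_ballP; exists (e / ((m * n)%:R * 2 + 1)) => // w [_ hw]; apply: hU.
  apply: le_lt_trans (fB _ _ (e / ((m * n)%:R * 2 + 1)) _ (ltW d0)) _.
    by move=> k; have := hw 0 k; rewrite /ball /= distrC => /ltW.
  move: d0; set K1 := (m * n)%:R; set d := e / _ => d0.
  have K0 : 0 <= K1 by rewrite /K1.
  have hd : d * (K1 * 2 + 1) = e by rewrite divfK // gt_eqF // ltr_wpDl // mulr_ge0.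
  by lra.
have -> : K = f @` (f @^-1` K).
  rewrite eqEsubset; split => [X KX|_ [v Kv <-] //]; exists (g X) => //=.
    by rewrite gK.
apply: continuous_compact; first exact: continuous_subspaceT.
apply: bounded_closed_compact.
  exists B; split; first exact: num_real.
  move=> M BM v /= Kv; have B0 : 0 <= B := le_trans (nm_ge0 _) (KB _ Kv).
  have hv k : `|v 0 k| <= B.
    apply: le_trans (KB _ Kv).
    have [[[i j] b] ->] : exists t : T, k = enum_rank t.
      by exists (enum_val k); rewrite enum_valK.
    apply: le_trans (nc_le_nm _ i j); rewrite mxE.
    case: b; [apply: le_trans (ler_re_nc _) | apply: le_trans (ler_im_nc _)];
      rewrite ?reD ?imD ?reM ?imM ?re_io ?im_io ?re_i ?im_i;
      by rewrite !(mul0r, mulr0, mulr1, mul1r, subr0, add0r, addr0).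
  have M0 : 0 <= M by lra.
  rewrite /Num.norm /= mx_normrE; apply: bigmax_le => // ij _.
  by rewrite ord1; apply: le_trans (hv ij.2) _; lra.
move=> v cv /=.
have ex k : exists w, K (f w) /\ forall j, `|v 0 j - w 0 j| <= k.+1%:R^-1.
  have k0 : 0 < k.+1%:R^-1 :> R by rewrite invr_gt0.
  have [w [Kw [_ hw]]] := cv _ (nbhsx_ballx v k.+1%:R^-1 k0).
  exists w; split=> // j; apply: ltW; exact: hw.
have [w hw] := choice ex.
apply: (Kcl (f \o w)) => [k|]; first by case: (hw k).
have c0 : 0 <= (m * n)%:R * 2 :> R by rewrite mulr_ge0.
apply: cvg0_leA (cvg0Z c0 cvg0_inv) => k /=.
rewrite -mulrA; apply: fB; last by rewrite invr_ge0.
by move=> j; rewrite distrC; apply: (hw k).2.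
Qed.

Lemma exchange_triangle (V : nmodType) (F : nat -> nat -> V) N :
  \sum_(k < N) \sum_(i < k.+1) F (k - i)%N i =
  \sum_(i < N) \sum_(j < N | (i + j < N)%N) F j i.
Proof.
transitivity (\sum_(0 <= i < N) \sum_(0 <= j < N | (i + j < N)%N) F j i); last first.
  by rewrite big_mkord; apply: eq_bigr => i _; rewrite big_mkord.
transitivity (\sum_(0 <= k < N) \sum_(0 <= i < N | (i < k.+1)%N) F (k - i)%N i).
  rewrite big_mkord; apply: eq_bigr => k _.
  by rewrite -(big_mkord xpredT (fun i => F (k - i)%N i)) (big_nat_widen 0 k.+1 N) /=.
rewrite (exchange_big_dep_nat xpredT) //=.
apply: eq_big_nat => i /andP [_ iN].
transitivity (\sum_(i <= k < N) F (k - i)%N i).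
  rewrite [RHS]big_nat_cond [LHS]big_nat_cond (big_cat_nat _ (n := i)) //=; last exact: ltnW.
  rewrite big_nat_cond big1 ?add0r => [|k]; last by lia.
  by rewrite big_nat_cond; apply: eq_bigl => k; lia.
rewrite -{1}(add0n i) big_addn big_nat_cond [RHS]big_nat_cond.
rewrite (big_nat_widen _ _ N) ?leq_subr //.
apply: eq_big => [k|k _]; last by rewrite addnK.
lia.
Qed.

Definition epart n (X : 'M[C]_n) (N : nat) : 'M[C]_n :=
  \sum_(k < N) (k`!%:R)^-1 *: X ^+ k.

Definition rpart (x : R) (N : nat) : R := \sum_(k < N) x ^+ k / k`!%:R.

Lemma epart0 n (X : 'M[C]_n) : epart X 0 = 0.
Proof. by rewrite /epart big_ord0. Qed.
Lemma rpart0 x : rpart x 0 = 0.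
Proof. by rewrite /rpart big_ord0. Qed.

Lemma rpart_cvg x : cvg0 (fun N => `|rpart x N - expR x|).
Proof.
have /cvgrPdist_lt h := is_cvg_series_exp_coeff x.
move=> e e0; have := h e e0; apply: filterS => N.
rewrite /series /= distrC /rpart big_mkord; congr (`| _ - _ | < _).
Qed.

Lemma rpart_le x M N : 0 <= x -> (M <= N)%N -> rpart x M <= rpart x N.
Proof.
move=> x0 MN; rewrite /rpart -!(big_mkord xpredT (fun k => x ^+ k / k`!%:R)).
rewrite [leRHS](big_cat_nat (n := M)) //= lerDl; apply: sumr_ge0 => i _.
by rewrite divr_ge0 ?exprn_ge0.
Qed.

Lemma rpart_le_exp x N : 0 <= x -> rpart x N <= expR x.
Proof.
move=> x0; rewrite -subr_le0; apply: cvg0_cst.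
apply: cvg0_le (rpart_cvg x); exists N => // M NM /=.
have := rpart_le x0 NM; have := ler_norm (rpart x M - expR x); lra.
Qed.

(** The Frobenius norm of the identity is not 1, so bounds for [X ^+ 0] carry it as a factor; the
    summand 1 makes the constant at least 1 in every size. *)
Definition cn (n : nat) : R := 1 + nm (1%:M : 'M[C]_n).
Lemma cn_ge1 n : 1 <= cn n.
Proof. by rewrite lerDl nm_ge0. Qed.
Lemma cn_ge0 n : 0 <= cn n.
Proof. exact: le_trans ler01 (cn_ge1 n). Qed.

Lemma nmX n (X : 'M[C]_n) k : nm (X ^+ k) <= cn n * nm X ^+ k.
Proof.
elim: k => [|k IH]; first by rewrite !expr0 mulr1 /cn lerDr.
rewrite !exprS; apply: le_trans (nmM _ _) _; rewrite mulrCA.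
by rewrite ler_wpM2l ?nm_ge0.
Qed.

Lemma epart_diff n (X : 'M[C]_n) M N : (M <= N)%N ->
  nm (epart X N - epart X M) <= cn n * (rpart (nm X) N - rpart (nm X) M).
Proof.
move=> MN; rewrite /epart /rpart.
rewrite -!(big_mkord xpredT (fun k => (k`!%:R)^-1 *: X ^+ k)).
rewrite -!(big_mkord xpredT (fun k => nm X ^+ k / k`!%:R)).
rewrite (big_cat_nat (n := M)) //= [X in _ * (X - _)](big_cat_nat (n := M)) //=.
rewrite ![_ + \sum_(M <= i < N) _]addrC !addrK mulr_sumr.
apply: le_trans (nm_sum _ _ _) _; apply: ler_sum => k _.
rewrite nmZ ncV mulrC mulrA.
have -> : nc (k`!%:R : C) = k`!%:R.
  by rewrite -(rmorph_nat io) nc_io ger0_norm.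
by rewrite ler_wpM2r ?invr_ge0 ?nmX.
Qed.

(** Boundedness gives a convergent subsequence of partial sums; the real tail then bounds the
    distance from each partial sum to a later one of that subsequence. *)
Lemma epart_cvg n (X : 'M[C]_n) : exists L, cvm (epart X) L.
Proof.
have b k : nm (epart X k) <= cn n * expR (nm X).
  have := epart_diff X (leq0n k); rewrite epart0 rpart0 !subr0.
  move=> h; apply: le_trans h _; rewrite ler_wpM2l ?cn_ge0 //.
  by apply: rpart_le_exp; exact: nm_ge0.
have [phi hphi [L hL]] := bw_mx b; exists L.
have h : cvg0 (fun k => cn n * `|rpart (nm X) k - expR (nm X)|).
  by apply: cvg0Z (rpart_cvg _); exact: cn_ge0.
apply: cvg0_leA (cvg0D h hL) => k /=.
apply: le_trans (nm_triB _ (epart X (phi k)) _) _; rewrite lerD2r nmBC.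
apply: le_trans (epart_diff _ (hphi k)) _; rewrite ler_wpM2l ?cn_ge0 //.
have := rpart_le_exp (phi k) (nm_ge0 X).
have := ler_norm (expR (nm X) - rpart (nm X) k); rewrite distrC; lra.
Qed.

Lemma expm_cvm n (X : 'M[C]_n) : cvm (epart X) (expm X).
Proof.
have [L hL] := epart_cvg X; suff -> : expm X = L by [].
rewrite /expm; apply: cvg_lim; first exact: norm_hausdorff.
have -> : series (fun k : nat => (k`!%:R)^-1 *: X ^+ k) = epart X.
  by apply/funext => N; rewrite /series /= big_mkord.
exact: cvmP.
Qed.

(** The real series are compared termwise through [k! <= (N + k)!]; this gives up a factor [1 / N!]
    but leaves one form of bound for all [N]. *)
Lemma expm_tail n (X : 'M[C]_n) N :
  nm (expm X - epart X N) <= cn n * (nm X ^+ N * expR (nm X)).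
Proof.
apply: (@cvm_le_nm _ _ _ _ (fun M => epart X M - epart X N)).
  by apply: cvmB (expm_cvm X) (cvm_cst _).
exists N => // M /= NM; apply: le_trans (epart_diff _ NM) _.
rewrite ler_wpM2l ?cn_ge0 // /rpart -!(big_mkord xpredT (fun k => nm X ^+ k / k`!%:R)).
rewrite [\sum_(0 <= i < M) _](big_cat_nat (n := N)) //= addrAC subrr add0r -{1}(add0n N) big_addn.
apply: (@le_trans _ _ (nm X ^+ N * rpart (nm X) (M - N))); last first.
  by rewrite ler_wpM2l ?exprn_ge0 ?nm_ge0 // rpart_le_exp ?nm_ge0.
rewrite /rpart big_mkord mulr_sumr; apply: ler_sum => k _.
rewrite exprD mulrA [nm X ^+ N * _]mulrC ler_wpM2l //.
  by rewrite mulr_ge0 ?exprn_ge0 ?nm_ge0.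
rewrite lef_pV2 ?posrE ?ltr0n ?fact_gt0 // ler_nat.
elim: N {NM k} (k : nat) => [|N IH] j; first by rewrite addn0.
by rewrite addnS factS; apply: leq_trans (IH j) (leq_pmull _ _).
Qed.

Lemma expm_bound n (X : 'M[C]_n) : nm (expm X) <= cn n * expR (nm X).
Proof.
have := expm_tail X 0; rewrite /epart big_ord0 subr0 expr0 mul1r; exact.
Qed.
Lemma expm_tail1 n (X : 'M[C]_n) : nm (expm X - 1%:M) <= cn n * (nm X * expR (nm X)).
Proof.
have := expm_tail X 1; rewrite /epart big_ord1 expr0 fact0 invr1 scale1r expr1; exact.
Qed.
Lemma expm_tail2 n (X : 'M[C]_n) :
  nm (expm X - 1%:M - X) <= cn n * (nm X ^+ 2 * expR (nm X)).
Proof.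
have := expm_tail X 2; rewrite /epart big_ord_recr big_ord1 /= expr0 fact0 invr1.
rewrite scale1r expr1 scale1r opprD addrA; exact.
Qed.
Lemma expm_tail3 n (X : 'M[C]_n) :
  nm (expm X - 1%:M - X - 2^-1 *: (X *m X)) <= cn n * (nm X ^+ 3 * expR (nm X)).
Proof.
have := expm_tail X 3; rewrite /epart !big_ord_recr big_ord0 /= add0r expr0 fact0 invr1.
rewrite scale1r expr1 scale1r expr2 !opprD !addrA; exact.
Qed.

Lemma expm0 n : expm (0 : 'M[C]_n) = 1%:M.
Proof.
have := expm_tail1 (0 : 'M[C]_n); rewrite nm0 mul0r mulr0 => h.
by apply/eqP; rewrite -subr_eq0 -nm_eq0 eq_le nm_ge0 h.
Qed.

Lemma expmD n (X Y : 'M[C]_n) : X *m Y = Y *m X ->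
  expm (X + Y) = expm X *m expm Y.
Proof.
move=> XY.
(* Product minus partial sum is the part of the square outside the triangle [i + j < N]; termwise it
   is dominated by the same part for the real numbers [nm X] and [nm Y], where the exponential law
   is known. *)
have hN N : nm (epart X N *m epart Y N - epart (X + Y) N) <=
    cn n * cn n * (rpart (nm X) N * rpart (nm Y) N - rpart (nm X + nm Y) N).
  pose F j i : 'M[C]_n := ((j`!%:R)^-1 *: X ^+ j) *m ((i`!%:R)^-1 *: Y ^+ i).
  pose f j i : R := nm X ^+ j / j`!%:R * (nm Y ^+ i / i`!%:R).
  have fact0 k : k`!%:R != 0 :> C by rewrite pnatr_eq0 -lt0n fact_gt0.
  have rfact0 k : k`!%:R != 0 :> R by rewrite pnatr_eq0 -lt0n fact_gt0.
  have e1 : epart (X + Y) N = \sum_(i < N) \sum_(j < N | (i + j < N)%N) F j i.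
    rewrite -exchange_triangle; apply: eq_bigr => k _.
    rewrite exprDn_comm // scaler_sumr; apply: eq_bigr => i _.
    rewrite /F -scalemxAl -scalemxAr !scalerA -[_ *+ 'C(k, i)]scaler_nat !scalerA; congr (_ *: _).
    have ik : (i <= k)%N by rewrite -ltnS.
    rewrite -(bin_fact ik) !natrM; field.
    by rewrite !fact0 pnatr_eq0 -lt0n bin_gt0.
  have e2 : rpart (nm X + nm Y) N = \sum_(i < N) \sum_(j < N | (i + j < N)%N) f j i.
    rewrite -exchange_triangle; apply: eq_bigr => k _.
    rewrite exprDn mulr_suml; apply: eq_bigr => i _.
    have ik : (i <= k)%N by rewrite -ltnS.
    rewrite /f -mulr_natl -(bin_fact ik) !natrM; field.
    by rewrite !rfact0 pnatr_eq0 -lt0n bin_gt0.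
  have e3 : epart X N *m epart Y N = \sum_(i < N) \sum_(j < N) F j i.
    rewrite /epart mulmx_sumr; apply: eq_bigr => i _.
    by rewrite mulmx_suml.
  have e4 : rpart (nm X) N * rpart (nm Y) N = \sum_(i < N) \sum_(j < N) f j i.
    rewrite /rpart mulr_sumr; apply: eq_bigr => i _.
    by rewrite mulr_suml.
  have split (V : zmodType) (Fc : nat -> nat -> V) :
     \sum_(i < N) \sum_(j < N) Fc j i - \sum_(i < N) \sum_(j < N | (i + j < N)%N) Fc j i
     = \sum_(i < N) \sum_(j < N | ~~ (i + j < N)%N) Fc j i.
    rewrite -sumrB; apply: eq_bigr => i _.
    by rewrite (bigID (fun j : 'I_N => (i + j < N)%N)) /= addrAC subrr add0r.
  rewrite e1 e2 e3 e4 !split mulr_sumr; apply: le_trans (nm_sum _ _ _) _.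
  apply: ler_sum => i _; rewrite mulr_sumr; apply: le_trans (nm_sum _ _ _) _.
  apply: ler_sum => j _; apply: le_trans (nmM _ _) _.
  have nf (k : nat) : nc ((k`!%:R)^-1 : C) = (k`!%:R)^-1.
    by rewrite ncV -(rmorph_nat io) nc_io ger0_norm.
  rewrite !nmZ !nf /f mulrACA -[leRHS]mulrACA.
  rewrite mulrACA [X in _ <= X]mulrACA.
  have b1 := nmX X j; have b2 := nmX Y i.
  have i1 : 0 <= (j`!%:R)^-1 :> R by rewrite invr_ge0.
  have i2 : 0 <= (i`!%:R)^-1 :> R by rewrite invr_ge0.
  have := ler_pM (nm_ge0 _) (nm_ge0 _) b1 b2.
  move=> /(ler_wpM2l (mulr_ge0 i1 i2)); congr (_ <= _); ring.
apply: (@cvm_uniq _ _ _ _ (epart (X + Y))); first exact: expm_cvm.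
have h1 := cvmM (expm_cvm X) (expm_cvm Y).
have h2 : cvg0 (fun N => nm (epart X N *m epart Y N - epart (X + Y) N)).
  pose x := nm X; pose y := nm Y.
  have hc : 0 <= cn n * cn n by rewrite mulr_ge0 ?cn_ge0.
  have g1 := cvg0Z (expR_ge0 y) (rpart_cvg x).
  have g2 := cvg0Z (expR_ge0 x) (rpart_cvg y).
  apply: cvg0_leA (cvg0Z hc (cvg0D g1 (cvg0D g2 (rpart_cvg (x + y))))) => N.
  apply: le_trans (hN N) _; rewrite ler_wpM2l // -/x -/y.
  have p1 := rpart_le_exp N (nm_ge0 X); have p2 := rpart_le_exp N (nm_ge0 Y).
  have q1 : 0 <= rpart x N by apply: sumr_ge0 => k _; rewrite divr_ge0 ?exprn_ge0 ?nm_ge0.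
  have q2 : 0 <= rpart y N by apply: sumr_ge0 => k _; rewrite divr_ge0 ?exprn_ge0 ?nm_ge0.
  have := ler_norm (expR (x + y) - rpart (x + y) N); rewrite distrC expRD.
  have := ler_norm (expR x - rpart x N); rewrite distrC.
  have := ler_norm (expR y - rpart y N); rewrite distrC.
  have e1 := expR_ge0 x; have e2 := expR_ge0 y.
  have pp := ler_pM q1 q2 p1 p2.
  have m1 := mulr_ge0 e2 (normr_ge0 (rpart x N - expR x)).
  have m2 := mulr_ge0 e1 (normr_ge0 (rpart y N - expR y)).
  by rewrite -/x -/y in pp; lra.
apply: cvg0_leA (cvg0D h1 h2) => N.
have := nm_triB (epart (X + Y) N) (epart X N *m epart Y N) (expm X *m expm Y).
rewrite (nmBC (epart (X + Y) N) (epart X N *m epart Y N)); lra.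
Qed.

Lemma expmV n (X : 'M[C]_n) : expm X *m expm (- X) = 1%:M.
Proof. by rewrite -expmD ?subrr ?expm0 // mulmxN mulNmx. Qed.
Lemma expmVl n (X : 'M[C]_n) : expm (- X) *m expm X = 1%:M.
Proof. by have := expmV (- X); rewrite opprK. Qed.
Lemma expm_unit n (X : 'M[C]_n) : expm X \in unitmx.
Proof. by have [] := mulmx1_unit (expmV X). Qed.
Lemma invmx_expm n (X : 'M[C]_n) : invmx (expm X) = expm (- X).
Proof.
by rewrite -[RHS](mulKmx (expm_unit X)) expmV mulmx1.
Qed.
Lemma expm_adds n (X : 'M[C]_n) (s t : C) :
  expm ((s + t) *: X) = expm (s *: X) *m expm (t *: X).
Proof. by rewrite scalerDl expmD // -!scalemxAl -!scalemxAr !scalerA mulrC. Qed.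
Lemma expm_mulrn n (X : 'M[C]_n) k : expm (k%:R *: X) = expm X ^+ k.
Proof.
elim: k => [|k IH]; first by rewrite scale0r expm0 expr0.
by rewrite exprSr -IH -[in LHS]addn1 natrD expm_adds scale1r.
Qed.
Lemma expm_conj n (P X : 'M[C]_n) : P \in unitmx ->
  expm (P *m X *m invmx P) = P *m expm X *m invmx P.
Proof.
move=> Pu; apply: (@cvm_uniq _ _ _ _ (epart (P *m X *m invmx P))).
  exact: expm_cvm.
apply: cvm_ext (cvmM (cvmM (cvm_cst P) (expm_cvm X)) (cvm_cst (invmx P))) => N.
rewrite /epart mulmx_sumr mulmx_suml; apply: eq_bigr => k _.
rewrite -scalemxAr -scalemxAl; congr (_ *: _); elim: (k : nat) => [|j IH].
  by rewrite !expr0 mulmx1 mulmxV.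
by rewrite !exprS -!mulmxE -IH !mulmxA mulmxKV.
Qed.
Lemma expm_adj n (X : 'M[C]_n) : expm (X^t*) = (expm X)^t*.
Proof.
apply: (@cvm_uniq _ _ _ _ (epart (X^t*))); first exact: expm_cvm.
apply: cvm_ext (cvm_adj (expm_cvm X)) => N.
rewrite /epart adj_sum; apply: eq_bigr => k _.
rewrite adjZ fmorphV rmorph_nat; congr (_ *: _); elim: (k : nat) => [|j IH].
  by rewrite !expr0 adj1.
by rewrite exprSr exprS adjM IH.
Qed.

Section ScalarExponential.
Implicit Types (z w : C).

(** The complex exponential, taken as the exponential of a matrix of size 1 so that its functional
    equation and estimates are those of [expm]. *)
Definition expc z : C := (expm (z%:M : 'M[C]_1)) 0 0.

Lemma expc_cvs z : cvs (fun N => \sum_(k < N) (k`!%:R)^-1 * z ^+ k) (expc z).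
Proof.
apply: cvs_ext (cvm_entry 0 0 (expm_cvm (z%:M : 'M[C]_1))) => N.
rewrite /epart summxE; apply: eq_bigr => k _.
by rewrite mxE -rmorphXn /= mxE eqxx.
Qed.
Lemma expmE1 (A : 'M[C]_1) : expm A = (expc (A 0 0))%:M.
Proof. by rewrite {1}(mx11_scalar A) [LHS]mx11_scalar. Qed.
Lemma nm1E (A : 'M[C]_1) : nm A = nc (A 0 0).
Proof. by rewrite /nm /fn !big_ord1 sqrtr_sqr ger0_norm // nc_ge0. Qed.
Lemma expc0 : expc 0 = 1.
Proof. by rewrite /expc raddf0 expm0 mxE. Qed.
Lemma expcD z w : expc (z + w) = expc z * expc w.
Proof.
rewrite /expc raddfD /= expmD; first by rewrite mxE big_ord1.
by rewrite -!scalar_mxM mulrC.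
Qed.
Lemma expcV z : expc z * expc (- z) = 1.
Proof. by rewrite -expcD subrr expc0. Qed.
Lemma expc_neq0 z : expc z != 0.
Proof.
by apply/eqP => h; have := expcV z; rewrite h mul0r => /eqP; rewrite eq_sym oner_eq0.
Qed.
Lemma expcN z : expc (- z) = (expc z)^-1.
Proof. by apply: (mulfI (expc_neq0 z)); rewrite expcV mulfV // expc_neq0. Qed.
Lemma expcMn z k : expc (k%:R * z) = expc z ^+ k.
Proof.
elim: k => [|k IH]; first by rewrite mul0r expc0 expr0.
by rewrite exprSr -IH -addn1 natrD mulrDl mul1r expcD.
Qed.
Lemma expcJ z : (expc z)^* = expc z^*.
Proof.
have -> : expc z^* = (expm ((z%:M : 'M[C]_1)^t*)) 0 0.
  by congr (expm _ _ _); apply/matrixP => i j; rewrite !ord1 !mxE eqxx.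
by rewrite expm_adj !mxE.
Qed.
Lemma expc_io x : expc (io x) = io (expR x).
Proof.
apply: (cvs_uniq (expc_cvs _)).
apply: (@cvs_ext _ _ (fun N => io (rpart x N))).
  move=> N; rewrite /rpart rmorph_sum; apply: eq_bigr => k _.
  by rewrite rmorphM fmorphV rmorphXn rmorph_nat mulrC.
by apply: cvg0_leA (rpart_cvg x) => N; rewrite -rmorphB nc_io.
Qed.
Lemma nc_expc z : nc (expc z) = expR (re z).
Proof.
have h : nc (expc z) ^+ 2 = expR (re z) ^+ 2.
  apply: (@io_inj R S); rewrite -mulJ_nc expcJ -expcD.
  have -> : z + z^* = io (re z + re z).
    rewrite [in LHS](reim z) rmorphD rmorphM /= !ioJ conjCi rmorphD; ring.
  by rewrite expc_io expRD.
by apply/eqP; rewrite -(@eqrXn2 _ 2%N) ?nc_ge0 ?expR_ge0 // h.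
Qed.
Lemma expc_tail2 z : nc (expc z - 1 - z) <= cn 1 * (nc z ^+ 2 * expR (nc z)).
Proof.
have := expm_tail2 (z%:M : 'M[C]_1); rewrite !nm1E !mxE eqxx; exact.
Qed.

(* The remainder bound makes [c] the derivative of [t |-> expc (t * c)] at [0]. *)
Lemma expc_ne1 (c : C) : c != 0 ->
  exists2 d : R, 0 < d & forall t, 0 < t -> t <= d -> expc (io t * c) != 1.
Proof.
move=> c0; have nc0 : 0 < nc c by rewrite nc_gt0.
pose M := cn 1 * (nc c ^+ 2 * expR (nc c)).
have M0 : 0 <= M by rewrite mulr_ge0 ?cn_ge0 // mulr_ge0 ?sqr_ge0 ?expR_ge0.
exists (Num.min 1 (nc c / (M + 1) / 2)); first by rewrite lt_min ltr01 !divr_gt0 // ltr_wpDl.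
move=> t t0; rewrite le_min => /andP [t1 t2]; apply/eqP => h.
have := expc_tail2 (io t * c); rewrite h subrr sub0r ncN ncM nc_io gtr0_norm //.
apply/negP; rewrite -ltNge.
apply: (@le_lt_trans _ _ (t ^+ 2 * M)).
  rewrite /M exprMn [leRHS]mulrCA ler_wpM2l ?cn_ge0 // -mulrA ler_wpM2l ?sqr_ge0 //.
  by rewrite ler_wpM2l ?sqr_ge0 // ler_expR ler_piMl // ltW.
rewrite expr2 -mulrA ltr_pM2l //.
have M1 : 0 < M + 1 by lra.
have : t * (M + 1) <= nc c / 2 by rewrite -ler_pdivlMr // mulrAC.
by lra.
Qed.
End ScalarExponential.

Lemma diag_mxX n (d : 'rV[C]_n) k : diag_mx d ^+ k = diag_mx (map_mx (fun z => z ^+ k) d).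
Proof.
elim: k => [|k IH].
  rewrite expr0; have -> : map_mx (fun z : C => z ^+ 0) d = const_mx 1.
    by apply/rowP => j; rewrite !mxE expr0.
  by rewrite diag_const_mx.
rewrite exprS IH -mulmxE mulmx_diag; congr diag_mx; apply/rowP => j.
by rewrite !mxE exprS.
Qed.
Lemma expm_diag n (d : 'rV[C]_n) : expm (diag_mx d) = diag_mx (map_mx expc d).
Proof.
apply: (cvm_uniq (expm_cvm _)); apply: cvm_entries => i j.
rewrite !mxE; apply: (@cvs_ext _ _ (fun N =>
  (\sum_(k < N) (k`!%:R)^-1 * d 0 i ^+ k) * (i == j)%:R)).
  move=> N; rewrite /epart summxE mulr_suml; apply: eq_bigr => k _.
  by rewrite diag_mxX !mxE; case: eqVneq => [->|]; rewrite ?mulr1 ?mulr0 ?mulr0n ?mulr1n ?mulr0.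
rewrite -[X in cvs _ X]mulr_natr; apply: cvsM (cvs_cst _); exact: expc_cvs.
Qed.
Lemma expm_scalar n (z : C) : expm (z%:M : 'M[C]_n) = (expc z)%:M.
Proof.
by rewrite -diag_const_mx expm_diag -diag_const_mx; congr diag_mx; apply/rowP => j; rewrite !mxE.
Qed.
Lemma expm_nilp n (X : 'M[C]_n) k : X ^+ k = 0 -> expm X = epart X k.
Proof.
move=> Xk; apply: (cvm_uniq (expm_cvm _)).
apply: cvm_near (cvm_cst (epart X k)); exists k => // N /= kN.
rewrite /epart -!(big_mkord xpredT (fun k => (k`!%:R)^-1 *: X ^+ k)).
rewrite [RHS](big_cat_nat (n := k)) //= [X in _ = _ + X]big1_seq ?addr0 // => i /=.
by rewrite mem_index_iota => /andP [ki _]; rewrite -(subnK ki) exprD Xk mulr0 scaler0.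
Qed.

Lemma nmX_diff n (A B : 'M[C]_n) (rho : R) k : nm A <= rho -> nm B <= rho ->
  nm (A ^+ k.+1 - B ^+ k.+1) <= cn n * (k.+1%:R * rho ^+ k) * nm (A - B).
Proof.
move=> Ar Br; have r0 : 0 <= rho := le_trans (nm_ge0 _) Ar.
elim: k => [|k IH].
  rewrite !expr1 expr0 mulr1 mulr1; apply: ler_peMl; rewrite ?nm_ge0 ?cn_ge1 //.
rewrite exprS [B ^+ _]exprS.
have -> : A * A ^+ k.+1 - B * B ^+ k.+1 =
    A *m (A ^+ k.+1 - B ^+ k.+1) + (A - B) *m B ^+ k.+1.
  by rewrite mulmxBr mulmxBl addrA subrK.
apply: le_trans (nmD _ _) _.
have h1 : nm (A *m (A ^+ k.+1 - B ^+ k.+1)) <=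
    rho * (cn n * (k.+1%:R * rho ^+ k) * nm (A - B)).
  by apply: le_trans (nmM _ _) _; apply: ler_pM; rewrite ?nm_ge0.
have h2 : nm ((A - B) *m B ^+ k.+1) <= nm (A - B) * (cn n * rho ^+ k.+1).
  apply: le_trans (nmM _ _) _; rewrite ler_wpM2l ?nm_ge0 //.
  apply: le_trans (nmX _ _) _; rewrite ler_wpM2l ?cn_ge0 //.
  by rewrite lerXn2r // nnegrE ?nm_ge0.
apply: le_trans (lerD h1 h2) _; rewrite le_eqVlt; apply/orP; left; apply/eqP.
rewrite exprS -[k.+2]addn1 natrD; ring.
Qed.

(** In the difference of the two series the constant terms cancel and the linear ones give [A - B],
    so [expm - id] has a Lipschitz constant of order [rho] near 0. *)
Lemma expm_lip n (A B : 'M[C]_n) (rho : R) : nm A <= rho -> nm B <= rho ->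
  nm (expm A - expm B - (A - B)) <= cn n * (rho * expR rho) * nm (A - B).
Proof.
move=> Ar Br; have r0 : 0 <= rho := le_trans (nm_ge0 _) Ar.
apply: (@cvm_le_nm _ _ _ _ (fun N => epart A N - epart B N - (A - B))).
  exact: cvmB (cvmB (expm_cvm A) (expm_cvm B)) (cvm_cst _).
exists 2%N => // -[|[|N]] //= _.
have -> : epart A N.+2 - epart B N.+2 - (A - B) =
    \sum_(j < N) (j.+2`!%:R)^-1 *: (A ^+ j.+2 - B ^+ j.+2).
  rewrite /epart !big_ord_recl /= !expr0 !fact0 !invr1 !scale1r !expr1.
  have ab (a b c x y : 'M[C]_n) : (a + (b + x)) - (a + (c + y)) - (b - c) = x - y.
    rewrite [- (a + (c + y))]opprD [a + _ + _]addrACA subrr add0r.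
    by rewrite [- (c + y)]opprD [b + _ + _]addrACA [LHS]addrAC subrr add0r.
  rewrite ab -sumrB.
  by apply: eq_bigr => j _; rewrite scalerBr.
apply: le_trans (nm_sum _ _ _) _.
apply: (@le_trans _ _ (\sum_(j < N) cn n * (rho * (rho ^+ j / j`!%:R)) * nm (A - B))).
  apply: ler_sum => j _; rewrite nmZ ncV nc_nat.
  rewrite mulrC ler_pdivrMr ?ltr0n ?fact_gt0 //.
  apply: le_trans (nmX_diff j.+1 Ar Br) _.
  have f1 : 1 <= j.+1%:R :> R by rewrite ler1n.
  rewrite 2!factS !natrM -!mulrA ler_wpM2l ?cn_ge0 //.
  have jf : j`!%:R != 0 :> R by rewrite pnatr_eq0 -lt0n fact_gt0.
  have -> : rho * (rho ^+ j * (j`!%:R^-1 * (nm (A - B) * (j.+2%:R * (j.+1%:R * j`!%:R))))) =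
    j.+1%:R * (j.+2%:R * (rho ^+ j.+1 * nm (A - B))) by rewrite exprS; field.
  by rewrite ler_peMl // !mulr_ge0 ?exprn_ge0 ?nm_ge0.
rewrite -mulr_suml -mulr_sumr ler_wpM2r ?nm_ge0 // ler_wpM2l ?cn_ge0 //.
by rewrite -mulr_sumr ler_wpM2l //; exact: rpart_le_exp.
Qed.

Lemma expm_dist n (A B : 'M[C]_n) (rho : R) : nm A <= rho -> nm B <= rho ->
  nm (expm A - expm B) <= (1 + cn n * (rho * expR rho)) * nm (A - B).
Proof.
move=> Ar Br; have := nmB (expm A - expm B) (A - B).
by have := expm_lip Ar Br; lra.
Qed.

Lemma cvm_expm n (A : nat -> 'M[C]_n) L : cvm A L -> cvm (fun k => expm (A k)) (expm L).
Proof.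
move=> h; have c0 : 0 <= 1 + cn n * ((nm L + 1) * expR (nm L + 1)).
  by rewrite addr_ge0 // mulr_ge0 ?cn_ge0 // mulr_ge0 ?expR_ge0 // addr_ge0 ?nm_ge0.
apply: cvg0_le (cvg0Z c0 h); apply: filterS (cvm_bd h) => k hk.
by apply: expm_dist => //; rewrite lerDl.
Qed.

(** Telescoping: each extra factor [g] or [h] multiplies norms by at most [1 + a <= expR a], so [m]
    factors cost [expR (m a)], which stays bounded as long as [m a] does. *)
Lemma nm_powdiff n (g h : 'M[C]_n) (a : R) m : nm (g - 1%:M) <= a -> nm (h - 1%:M) <= a ->
  nm (h ^+ m - g ^+ m) <= m%:R * expR (m%:R * a) * nm (h - g).
Proof.
move=> ga ha; have a0 : 0 <= a := le_trans (nm_ge0 _) ga.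
have mulg (Z : 'M[C]_n) j : nm (Z *m g ^+ j) <= nm Z * expR (j%:R * a).
  elim: j => [|j IH]; first by rewrite expr0 mulmx1 mul0r expR0 mulr1.
  have -> : Z *m g ^+ j.+1 = Z *m g ^+ j *m (g - 1%:M) + Z *m g ^+ j.
    by rewrite exprSr -mulmxE mulmxA mulmxBr mulmx1 subrK.
  apply: le_trans (nmD _ _) _.
  have h1 := le_trans (nmM (Z *m g ^+ j) (g - 1%:M)) (ler_wpM2l (nm_ge0 _) ga).
  have h2 : nm (Z *m g ^+ j) * (1 + a) <= nm Z * expR (j%:R * a) * expR a.
    by apply: ler_pM; rewrite ?nm_ge0 ?expR_ge1Dx ?addr_ge0.
  have e : j.+1%:R * a = j%:R * a + a by rewrite -addn1 natrD mulrDl mul1r.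
  rewrite e expRD; lra.
elim: m => [|m IH]; first by rewrite !expr0 subrr nm0 mul0r mul0r.
rewrite exprS [g ^+ _]exprS.
have -> : h * h ^+ m - g * g ^+ m =
  (h ^+ m - g ^+ m) + (h - 1%:M) *m (h ^+ m - g ^+ m) + (h - g) *m g ^+ m.
  rewrite (mulmxBl h 1%:M) mul1mx [X in _ = X + _]addrCA subrr addr0.
  by rewrite mulmxBr mulmxBl addrA subrK.
apply: le_trans (nmD _ _) _; apply: le_trans (lerD (nmD _ _) (mulg _ _)) _.
have h1 := le_trans (nmM (h - 1%:M) (h ^+ m - g ^+ m)) (ler_wpM2r (nm_ge0 _) ha).
have E1 := expR_ge1Dx a; have E0 := expR_ge0 (m%:R * a).
have h2 : (1 + a) * nm (h ^+ m - g ^+ m) <= expR a * (m%:R * expR (m%:R * a) * nm (h - g)).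
  by apply: ler_pM; rewrite ?nm_ge0 ?addr_ge0.
have e : m.+1%:R * a = m%:R * a + a by rewrite -addn1 natrD mulrDl mul1r.
have e' : m.+1%:R = m%:R + 1 :> R by rewrite -addn1 natrD.
have h3 : nm (h - g) * expR (m%:R * a) <= nm (h - g) * expR (m%:R * a) * expR a.
  by rewrite ler_peMr ?mulr_ge0 ?nm_ge0 // -expR0 ler_expR.
rewrite e e' expRD; lra.
Qed.

(** Since [1 + A] and [expm A] differ by a multiple of [|A| ^ 2], their [m]-th powers differ by a
    bounded multiple of [m |A| ^ 2], and [m |A|] is bounded. One-parameter groups and the product
    formula for sums both come from this. *)
Lemma expm_pow_lim n (A : nat -> 'M[C]_n) (m : nat -> nat) Z : cvm A 0 ->
  cvm (fun k => (m k)%:R *: A k) Z ->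
  cvm (fun k => (1%:M + A k) ^+ m k) (expm Z).
Proof.
move=> A0 mA; pose a k := nm (A k); pose c := cn n * expR 1.
have c0 : 0 <= c by rewrite mulr_ge0 ?cn_ge0 ?expR_ge0.
have c1 : 1 <= c.
  have e1 : 1 <= expR 1 :> R by rewrite -expR0 ler_expR.
  have := cn_ge1 n; rewrite /c; nra.
pose B := nm Z + 1.
have lim2 := cvm_expm mA.
have a0 : cvg0 a by apply: cvg0_leA A0 => k; rewrite subr0.
pose K := B * expR (c * B) * c.
have K0 : 0 <= K by rewrite !mulr_ge0 ?expR_ge0 // addr_ge0 ?nm_ge0.
have h : cvg0 (fun k => nm ((1%:M + A k) ^+ m k - expm ((m k)%:R *: A k))).
  apply: cvg0_le (cvg0Z K0 a0).
  apply: filterS2 (a0 1 ltr01) (cvm_bd mA) => k ak; rewrite nmZ nc_nat => mk.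
  have ak0 : 0 <= a k := nm_ge0 _.
  have ea : expR (a k) <= expR 1 by rewrite ler_expR ltW.
  have g1 : nm (expm (A k) - 1%:M) <= c * a k.
    apply: le_trans (expm_tail1 _) _; rewrite /c -mulrA ler_wpM2l ?cn_ge0 //.
    by rewrite mulrC ler_wpM2r.
  have g2 : nm (1%:M + A k - 1%:M) <= c * a k by rewrite addrAC subrr add0r ler_peMl.
  rewrite expm_mulrn; apply: le_trans (nm_powdiff _ g1 g2) _.
  have g3 : nm (1%:M + A k - expm (A k)) <= c * (a k * a k).
    rewrite nmBC opprD addrA; apply: le_trans (expm_tail2 _) _.
    rewrite /c -mulrA ler_wpM2l ?cn_ge0 // -expr2 mulrC ler_wpM2r ?sqr_ge0 //.
  have mB : (m k)%:R * a k <= B by [].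
  have mpos : 0 <= (m k)%:R :> R by [].
  have e2 : expR ((m k)%:R * (c * a k)) <= expR (c * B).
    by rewrite ler_expR mulrCA ler_wpM2l.
  apply: (@le_trans _ _ ((m k)%:R * expR (c * B) * (c * (a k * a k)))).
    apply: ler_pM; rewrite ?mulr_ge0 ?expR_ge0 ?nm_ge0 // ler_wpM2l //.
  have -> : (m k)%:R * expR (c * B) * (c * (a k * a k)) =
    ((m k)%:R * a k) * (expR (c * B) * c * a k) by ring.
  have -> : K * a k = B * (expR (c * B) * c * a k) by rewrite /K; ring.
  rewrite ler_wpM2r //; apply: mulr_ge0 => //; apply: mulr_ge0 => //; exact: expR_ge0.
apply: cvg0_leA (cvg0D h lim2) => k; exact: nm_triB.
Qed.
End Exponential.

(** * Polynomial functions and exponential polynomials *)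

Section PolynomialFunctions.
Context {C : numClosedFieldType} {V : vectType C}.
Implicit Types (f g : V -> C).

Lemma polyf_cst (c : C) : polyf (fun _ : V => c).
Proof. by exists (mpoly.mpolyC _ c) => v; rewrite mpoly.mevalC. Qed.
Lemma polyfD f g : polyf f -> polyf g ->
  polyf (fun v => f v + g v).
Proof.
move=> [p hp] [q hq]; exists (p + q) => v.
by rewrite mpoly.mevalD hp hq.
Qed.
Lemma polyfM f g : polyf f -> polyf g ->
  polyf (fun v => f v * g v).
Proof.
move=> [p hp] [q hq]; exists (p * q) => v.
by rewrite mpoly.mevalM hp hq.
Qed.
Lemma polyf_ext f g : f =1 g -> polyf f -> polyf g.
Proof. by move=> /funext ->. Qed.
Lemma polyf_sum (I : Type) (r : seq I) (P : pred I) (F : I -> V -> C) :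
  (forall i, polyf (F i)) ->
  polyf (fun v => \sum_(i <- r | P i) F i v).
Proof.
move=> h; elim: r => [|i r IH].
  by apply: polyf_ext (polyf_cst 0) => v; rewrite big_nil.
case Pi : (P i).
  by apply: polyf_ext (polyfD (h i) IH) => v; rewrite big_cons Pi.
by apply: polyf_ext IH => v; rewrite big_cons Pi.
Qed.
Lemma polyf_prod (I : Type) (r : seq I) (P : pred I) (F : I -> V -> C) :
  (forall i, polyf (F i)) ->
  polyf (fun v => \prod_(i <- r | P i) F i v).
Proof.
move=> h; elim: r => [|i r IH].
  by apply: polyf_ext (polyf_cst 1) => v; rewrite big_nil.
case Pi : (P i).
  by apply: polyf_ext (polyfM (h i) IH) => v; rewrite big_cons Pi.
by apply: polyf_ext IH => v; rewrite big_cons Pi.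
Qed.
Lemma polyf_coord i : polyf (coord (vbasis {:V}) i : V -> C).
Proof. by exists (mpoly.mpolyX _ (mpoly.mnm1 i)) => v; rewrite mpoly.mevalXU. Qed.
Lemma polyf_lin (f : {linear V -> C^o}) : polyf (f : V -> C).
Proof.
apply: (@polyf_ext (fun v => \sum_i coord (vbasis {:V}) i v * f (vbasis {:V})`_i)).
  move=> v; rewrite {2}(coord_vbasis (memvf v)) linear_sum.
  by apply: eq_bigr => i _; rewrite linearZ.
by apply: polyf_sum => i; apply: polyfM (polyf_coord i) (polyf_cst _).
Qed.
Lemma polyfX f k : polyf f -> polyf (fun v => f v ^+ k).
Proof.
move=> h; elim: k => [|k IH].
  by apply: polyf_ext (polyf_cst 1) => v; rewrite expr0.
by apply: polyf_ext (polyfM h IH) => v; rewrite exprS.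
Qed.
Lemma polyfN f : polyf f -> polyf (fun v => - f v).
Proof. by move=> h; apply: polyf_ext (polyfM (polyf_cst (-1)) h) => v; rewrite mulN1r. Qed.
Lemma polyfB f g : polyf f -> polyf g ->
  polyf (fun v => f v - g v).
Proof. by move=> h1 h2; apply: polyfD h1 (polyfN h2). Qed.

Lemma polyf_ind (Q : (V -> C) -> Prop) :
  (forall c, Q (fun _ => c)) ->
  (forall f g, Q f -> Q g -> Q (fun v => f v + g v)) ->
  (forall f g, Q f -> Q g -> Q (fun v => f v * g v)) ->
  (forall i, Q (coord (vbasis {:V}) i : V -> C)) ->
  forall f, polyf f -> Q f.
Proof.
move=> Qc Qa Qm Qx f [p hp].
have -> : f = fun v => mpoly.meval (fun i => coord (vbasis {:V}) i v) p by apply/funext.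
elim/mpoly.mpolyind: p {f hp} => [|c m p _ _ IH].
  by have := Qc 0; congr Q; apply/funext => v; rewrite mpoly.meval0.
have Xm : Q (fun v => \prod_i coord (vbasis {:V}) i v ^+ m i).
  elim: (index_enum _) => [|i r IHr].
    by have := Qc 1; congr Q; apply/funext => v; rewrite big_nil.
  suff Xi : Q (fun v => coord (vbasis {:V}) i v ^+ m i).
    by have := Qm _ _ Xi IHr; congr Q; apply/funext => v; rewrite big_cons.
  elim: (m i) => [|k IHk].
    by have := Qc 1; congr Q; apply/funext => v; rewrite expr0.
  by have := Qm _ _ (Qx i) IHk; congr Q; apply/funext => v; rewrite exprS.
have := Qa _ _ (Qm _ _ (Qc c) Xm) IH; congr Q; apply/funext => v.
by rewrite mpoly.mevalD mpoly.mevalZ mpoly.mevalX.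
Qed.
End PolynomialFunctions.

Section PolynomialsOnMatrices.
Context {C : numClosedFieldType}.

Lemma polyf_entry m n i j : polyf (fun X : 'M[C]_(m, n) => X i j).
Proof.
have lin : linear (fun X : 'M[C]_(m, n) => X i j : C^o) by move=> a A B; rewrite !mxE.
pose l := GRing.isLinear.Build C 'M[C]_(m, n) C^o _ (fun X : 'M[C]_(m, n) => X i j : C^o) lin.
pose L : {linear 'M[C]_(m, n) -> C^o} := HB.pack (fun X : 'M[C]_(m, n) => X i j : C^o) l.
exact: (polyf_lin L).
Qed.
Lemma lin_entries m n (f : {linear 'M[C]_(m, n) -> C^o}) X :
  f X = \sum_i \sum_j X i j * f (delta_mx i j) :> C.
Proof.
rewrite {1}(matrix_sum_delta X) linear_sum; apply: eq_bigr => i _.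
by rewrite linear_sum; apply: eq_bigr => j _; rewrite linearZ.
Qed.
Lemma polyf_indmx m n (Q : ('M[C]_(m, n) -> C) -> Prop) :
  (forall c, Q (fun _ => c)) ->
  (forall f g, Q f -> Q g -> Q (fun v => f v + g v)) ->
  (forall f g, Q f -> Q g -> Q (fun v => f v * g v)) ->
  (forall i j, Q (fun X => X i j)) ->
  forall f, polyf f -> Q f.
Proof.
move=> Qc Qa Qm Qx; apply: polyf_ind => // k.
have -> : (coord (vbasis {:'M[C]_(m, n)}) k : 'M[C]_(m, n) -> C) =
  fun X => \sum_i \sum_j X i j * coord (vbasis {:'M[C]_(m, n)}) k (delta_mx i j).
  by apply/funext => X; exact: (lin_entries (coord (vbasis {:'M[C]_(m, n)}) k)).
have Qs (I : Type) (r : seq I) F : (forall i, Q (F i)) -> Q (fun X => \sum_(i <- r) F i X).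
  move=> h; elim: r => [|i r IH].
    by have := Qc 0; congr Q; apply/funext => X; rewrite big_nil.
  by have := Qa _ _ (h i) IH; congr Q; apply/funext => X; rewrite big_cons.
by apply: (Qs) => i; apply: (Qs) => j; apply: Qm.
Qed.
Lemma polyf_compmx (V : vectType C) m n (f : 'M[C]_(m, n) -> C) (u : V -> 'M[C]_(m, n)) :
  polyf f -> (forall i j, polyf (fun v => u v i j)) ->
  polyf (fun v => f (u v)).
Proof.
move=> hf hu; move: hf; apply: (polyf_indmx (Q := fun f => polyf (f \o u))) => //.
- by move=> c; exact: polyf_cst.
- by move=> f1 g1 h1 h2; exact: polyfD h1 h2.
- by move=> f1 g1 h1 h2; exact: polyfM h1 h2.
Qed.
Lemma polyf_det (V : vectType C) n (u : V -> 'M[C]_n) :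
  (forall i j, polyf (fun v => u v i j)) ->
  polyf (fun v => \det (u v)).
Proof.
move=> hu; apply: polyf_sum => s; apply: polyfM; first exact: polyf_cst.
by apply: polyf_prod => i.
Qed.
Lemma polyf_mulmx (V : vectType C) m n p (u : V -> 'M[C]_(m, n)) (w : V -> 'M[C]_(n, p)) :
  (forall i j, polyf (fun v => u v i j)) ->
  (forall i j, polyf (fun v => w v i j)) ->
  forall i j, polyf (fun v => (u v *m w v) i j).
Proof.
move=> hu hw i j; apply: (@polyf_ext _ _ (fun v => \sum_k u v i k * w v k j)).
  by move=> v; rewrite mxE.
by apply: polyf_sum => k; exact: polyfM.
Qed.
End PolynomialsOnMatrices.

Section ExponentialPolynomials.
Context {R : realType} {S : realform R}.
Local Notation C := (cC S).
Local Notation io := (@io R S).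

Lemma size_shift_diff (p : {poly C}) (t : C) : p != 0 ->
  (size (p \Po ('X + t%:P) - p)%R < size p)%N.
Proof.
move=> p0; have sp : size (p \Po ('X + t%:P)) = size p by rewrite size_comp_poly2 ?size_XaddC.
have lp : lead_coef (p \Po ('X + t%:P)) = lead_coef p.
  by rewrite lead_coef_comp ?size_XaddC // lead_coefXaddC expr1n mulr1.
have szp : (0 < size p)%N by rewrite size_poly_gt0.
rewrite -(prednK szp) ltnS; apply/leq_sizeP => j; rewrite leq_eqVlt coefB => /orP [/eqP <-|].
  by rewrite -{1}sp -!lead_coefE lp subrr.
by rewrite prednK // => h; rewrite !nth_default ?sp ?subrr.
Qed.

(** Shifting [m] and subtracting [y.1] times the relation keeps the bases, lowers the degree of the
    polynomial of [y] and raises no other, so induction on the total size applies. When all the new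
    polynomials vanish, the leading coefficient, multiplied by [x.1 - y.1], kills the polynomial of
    every [x] other than [y]; that of [y] then has too many zeros. *)
Lemma exp_poly_indep (t : C) N (r : seq (C * {poly C})) : t != 0 ->
  (\sum_(x <- r) size x.2 <= N)%N ->
  uniq [seq x.1 | x <- r] -> (forall x, x \in r -> x.1 != 0) ->
  (forall m, \sum_(x <- r) x.2.[m%:R * t] * x.1 ^+ m = 0) ->
  forall x, x \in r -> x.2 = 0.
Proof.
move=> t0; elim: N r => [|N IH] r sN ur z0 hr.
  move=> x xr; apply/eqP; rewrite -size_poly_eq0 -leqn0.
  by apply: leq_trans sN; rewrite (big_rem x) //= leq_addr.
case: (pselect (exists2 y, y \in r & y.2 != 0)) => [[y yr y0]|h]; last first.
  by move=> x xr; apply/eqP/negP => /negP x0; apply: h; exists x.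
pose op (x : C * {poly C}) :=
  (x.1, x.1 *: (x.2 \Po ('X + t%:P)) - y.1 *: x.2) : C * {poly C}.
have sz x : x \in r -> (size (op x).2 <= size x.2)%N.
  move=> _; rewrite /op /=; apply: leq_trans (size_polyD _ _) _; rewrite geq_max size_polyN.
  rewrite !(leq_trans (size_scale_leq _ _)) //.
  by rewrite size_comp_poly2 ?size_XaddC.
have szy : (size (op y).2 < size y.2)%N.
  rewrite /op /= -scalerBr; apply: leq_ltn_trans (size_scale_leq _ _) _.
  exact: size_shift_diff.
have oph x m : (op x).2.[m%:R * t] * (op x).1 ^+ m =
   x.2.[m.+1%:R * t] * x.1 ^+ m.+1 - y.1 * (x.2.[m%:R * t] * x.1 ^+ m).
  rewrite /op /= hornerD hornerN !hornerZ horner_comp hornerD hornerX hornerC.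
  have -> : m.+1%:R * t = m%:R * t + t by rewrite -natr1 mulrDl mul1r.
  by rewrite exprS; ring.
have opz : forall x, x \in map op r -> x.2 = 0.
  apply: IH; last 1 first.
  - move=> m; rewrite big_map.
    under eq_bigr => x _ do rewrite oph.
    by rewrite sumrB -mulr_sumr !hr mulr0 subrr.
  - rewrite big_map -ltnS; apply: leq_trans sN.
    rewrite (big_rem y) // [X in (_ <= X)%N](big_rem y) //= -addSn leq_add //.
    rewrite big_seq [X in (_ <= X)%N]big_seq; apply: leq_sum => x /mem_rem; exact: sz.
  - by rewrite -map_comp (@eq_map _ _ _ fst).
  - by move=> _ /mapP [x xr ->] /=; exact: (z0 x xr).
have oz x : x \in r -> x != y -> x.2 = 0.
  move=> xr xy; have := opz _ (map_f op xr); rewrite /op /= => /subr0_eq h.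
  have xy1 : x.1 != y.1.
    apply: contra xy => /eqP e; apply/eqP.
    have ix := nth_index (0, 0) xr; have iy := nth_index (0, 0) yr.
    rewrite -ix -iy; congr nth; apply/eqP.
    have sx : (index x r < size [seq z.1 | z <- r])%N by rewrite size_map index_mem.
    have sy : (index y r < size [seq z.1 | z <- r])%N by rewrite size_map index_mem.
    rewrite -(nth_uniq 0 sx sy ur) !(nth_map (0, 0)) ?index_mem //.
    by rewrite ix iy e.
  apply/eqP/negP => /negP x0; move/(congr1 lead_coef): h.
  rewrite !lead_coefZ lead_coef_comp ?size_XaddC // lead_coefXaddC expr1n mulr1.
  move/(mulIf _); rewrite lead_coef_eq0 => /(_ x0) e.
  by rewrite e eqxx in xy1.
have y00 : y.2 = 0.
  apply: (@roots_geq_poly_eq0 _ _ [seq k%:R * t | k <- iota 0 (size y.2)]).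
  - apply/allP => _ /mapP [k _ ->]; rewrite /root.
    have := hr k; rewrite (big_rem y) //= big_seq big1 ?addr0 => [|x xr].
      by move/eqP; rewrite mulf_eq0 expf_eq0 (negPf (z0 _ yr)) andbF orbF.
    have ur' : uniq r by exact: map_uniq ur.
    by rewrite oz ?horner0 ?mul0r ?(mem_rem xr) //; move: xr; rewrite mem_rem_uniq // => /andP [].
  - rewrite map_inj_uniq ?iota_uniq // => a b /(mulIf t0) /eqP.
    by rewrite eqr_nat => /eqP.
  - by rewrite size_map size_iota.
by rewrite y00 eqxx in y0.
Qed.

Lemma sum_allpairs (I J K : Type) (f : I -> J -> K) (G : K -> C) (r : seq I) (r' : seq J) :
  \sum_(z <- [seq f x y | x <- r, y <- r']) G z = \sum_(x <- r) \sum_(y <- r') G (f x y).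
Proof.
by elim: r => [|x r IH]; rewrite ?big_nil //= big_cat big_map IH big_cons.
Qed.

Definition expo_hom (E : C -> C) : Prop := E 0 = 1 /\ forall a b, E (a + b) = E a * E b.

Definition ep_eval (l : seq (C * {poly C})) (E : C -> C) (s : C) : C :=
  \sum_(x <- l) x.2.[s] * E x.1.

(* [F E s] stands for an exponential polynomial in [s] in which each [exp (a s)] is
   replaced by [E a]; all exponents [a] satisfy [A]. *)
Definition is_ep (A : C -> Prop) (F : (C -> C) -> C -> C) : Prop :=
  exists2 l, (forall x, x \in l -> A x.1) &
    forall E s, expo_hom E -> F E s = ep_eval l E s.

Variable A : C -> Prop.
Hypotheses (A0 : A 0) (AD : forall a b, A a -> A b -> A (a + b)).

Lemma is_ep_poly (p : {poly C}) a : A a -> is_ep A (fun E s => p.[s] * E a).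
Proof.
move=> Aa; exists [:: (a, p)] => [x|E s _]; first by rewrite inE => /eqP ->.
by rewrite /ep_eval big_seq1.
Qed.
Lemma is_ep_cst c : is_ep A (fun _ _ => c).
Proof.
have [l hl h] := is_ep_poly c%:P A0; exists l => // E s hE.
by rewrite -h // hornerC hE.1 mulr1.
Qed.
Lemma is_epD F G : is_ep A F -> is_ep A G -> is_ep A (fun E s => F E s + G E s).
Proof.
move=> [l hl h] [l' hl' h']; exists (l ++ l') => [x|E s hE].
  by rewrite mem_cat => /orP [/hl|/hl'].
by rewrite h // h' // /ep_eval big_cat.
Qed.
Lemma is_epM F G : is_ep A F -> is_ep A G -> is_ep A (fun E s => F E s * G E s).
Proof.
move=> [l hl h] [l' hl' h'].
exists [seq (x.1 + y.1, x.2 * y.2) | x <- l, y <- l'] => [z|E s hE].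
  by case/allpairsP => [[x y] [/= xl yl' ->]] /=; apply: AD; [exact: hl | exact: hl'].
rewrite h // h' // /ep_eval sum_allpairs mulr_suml; apply: eq_bigr => x _.
rewrite mulr_sumr; apply: eq_bigr => y _ /=.
by rewrite hE.2 hornerM; ring.
Qed.
Lemma is_ep_ext F G : (forall E s, expo_hom E -> F E s = G E s) -> is_ep A F -> is_ep A G.
Proof. by move=> FG [l hl h]; exists l => // E s hE; rewrite -FG // h. Qed.
Lemma is_ep_sumseq (I : eqType) (r : seq I) F : (forall i, i \in r -> is_ep A (F i)) ->
  is_ep A (fun E s => \sum_(i <- r) F i E s).
Proof.
elim: r => [|i r IH] h.
  by apply: is_ep_ext (is_ep_cst 0) => E s _; rewrite big_nil.
have hi := h i (mem_head _ _).
have hr : forall j, j \in r -> is_ep A (F j) by move=> j jr; apply: h; rewrite inE jr orbT.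
by apply: is_ep_ext (is_epD hi (IH hr)) => E s _; rewrite big_cons.
Qed.

Lemma ep_eval_group l E s : let u := undup [seq x.1 | x <- l] in
  ep_eval l E s = \sum_(a <- u) (\sum_(x <- l | x.1 == a) x.2).[s] * E a.
Proof.
move=> u; rewrite /ep_eval.
transitivity (\sum_(x <- l) \sum_(a <- u | a == x.1) x.2.[s] * E a).
  rewrite big_seq [RHS]big_seq; apply: eq_bigr => x xl.
  have xu : x.1 \in u by rewrite mem_undup map_f.
  rewrite big_mkcond (bigD1_seq x.1) ?undup_uniq //= eqxx big1 ?addr0 // => a /negPf.
  by move=> ->.
rewrite (exchange_big_dep xpredT) //=; apply: eq_bigr => a _.
rewrite horner_sum mulr_suml; apply: eq_bigl => x.
by rewrite eq_sym.
Qed.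

(** The hypothesis supplies [t] for which the exponents of [F] have distinct [exp (t a)]; the
    relations at the multiples [m t] then kill every coefficient, hence [F] for every character [E]
    and every [s]. *)
Lemma ep_vanish F : is_ep A F ->
  (forall l : seq C, (forall a, a \in l -> A a) -> exists t : C,
    [/\ t != 0, {in l &, injective (fun a => expc (t * a))} &
     forall m, F (fun a => expc (m%:R * t * a)) (m%:R * t) = 0]) ->
  forall E s, expo_hom E -> F E s = 0.
Proof.
move=> [l lA hl] h E s hE.
pose u := undup [seq x.1 | x <- l]; pose Q a := \sum_(x <- l | x.1 == a) x.2.
have uA a : a \in u -> A a by rewrite mem_undup => /mapP [x xl ->]; exact: lA.
have [t [t0 inj hF]] := h u uA.
have hQ x : x \in [seq (expc (t * a), Q a) | a <- u] -> x.2 = 0.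
  apply: (exp_poly_indep t0 (leqnn _)).
  - by rewrite -map_comp map_inj_in_uniq ?undup_uniq.
  - by move=> _ /mapP [a _ ->]; exact: expc_neq0.
  move=> m; rewrite big_map -[RHS](hF m) hl; last first.
    by split=> [|a b]; rewrite ?mulr0 ?expc0 // mulrDr expcD.
  rewrite ep_eval_group; apply: eq_bigr => a _ /=.
  by rewrite -expcMn mulrA.
rewrite hl // ep_eval_group big_seq big1 // => a au.
have /= q0 := hQ (expc (t * a), Q a) (map_f (fun a => (expc (t * a), Q a)) au).
by rewrite -/(Q a) q0 horner0 mul0r.
Qed.
End ExponentialPolynomials.

Section SmallStep.
Context {R : realType} {S : realform R}.
Local Notation C := (cC S).
Local Notation io := (@io R S).

Lemma expc_inj_small (l : seq C) : exists2 d : R, 0 < d &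
  forall t, 0 < t -> t <= d -> {in l &, injective (fun a => expc (io t * a))}.
Proof.
have [d d0 hd] : exists2 d : R, 0 < d & forall t, 0 < t -> t <= d ->
    forall c, c \in [seq a - b | a <- l, b <- l] -> c != 0 -> expc (io t * c) != 1.
  elim: [seq a - b | a <- l, b <- l] => [|c r [d d0 hd]]; first by exists 1.
  have [->|c0] := eqVneq c 0.
    exists d => // t t0 td e; rewrite inE => /orP [/eqP ->|]; last exact: hd.
    by rewrite eqxx.
  have [d' d'0 hd'] := expc_ne1 c0; exists (Num.min d d'); first by rewrite lt_min d0.
  move=> t t0; rewrite le_min => /andP [t1 t2] e; rewrite inE => /orP [/eqP ->|] e0.
    exact: hd'.
  exact: hd.
exists d => // t t0 td a b al bl e; apply/eqP; rewrite -subr_eq0; apply/negP => /negP ab.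
have abl : a - b \in [seq a - b | a <- l, b <- l] by apply/allpairsP; exists (a, b).
have := hd t t0 td _ abl ab; rewrite mulrBr expcD expcN e divff ?expc_neq0 //.
by rewrite eqxx.
Qed.
End SmallStep.

(** By Bezout, one polynomial can be prescribed to order [N] at finitely many points: on a spectrum
    this gives the spectral projections, and with [N = 1] it is interpolation. *)
Lemma crt_poly (C : fieldType) (s : seq C) N (c : C -> C) : uniq s ->
  exists h : {poly C}, forall a, a \in s -> ('X - a%:P) ^+ N %| h - (c a)%:P.
Proof.
elim: s => [|b s IH] /=; first by exists 0.
move=> /andP [bs /IH [h hh]].
pose M : {poly C} := \prod_(a <- s) ('X - a%:P) ^+ N.
have cop : coprimep M (('X - b%:P) ^+ N).
  rewrite coprimep_expr // coprimep_XsubC rootE horner_prod prodf_seq_neq0.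
  apply/allP => a sa; rewrite /= !hornerE expf_eq0 subr_eq0.
  by apply/negP => /andP [_ /eqP e]; rewrite e sa in bs.
have [[u v] /= uv] := Bezout_eq1_coprimepP _ _ cop.
exists (h + ((c b)%:P - h) * (u * M)) => a; rewrite inE => /orP [/eqP ->|sa].
  have -> : h + ((c b)%:P - h) * (u * M) - (c b)%:P =
    (h - (c b)%:P) * v * ('X - b%:P) ^+ N.
    have -> : u * M = 1 - v * ('X - b%:P) ^+ N by rewrite -uv addrK.
    by ring.
  exact: dvdp_mull.
have -> : h + ((c b)%:P - h) * (u * M) - (c a)%:P =
  (h - (c a)%:P) + ((c b)%:P - h) * u * M by ring.
rewrite dvdp_add ?hh // dvdp_mull // /M (big_rem a) //=.
exact: dvdp_mulr.
Qed.

Lemma prod_XsubC_dvd (C : fieldType) (s : seq C) N (q : {poly C}) : uniq s ->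
  (forall a, a \in s -> ('X - a%:P) ^+ N %| q) -> \prod_(a <- s) ('X - a%:P) ^+ N %| q.
Proof.
elim: s => [|b s IH] /=; first by rewrite big_nil dvd1p.
move=> /andP [bs us] h; rewrite big_cons Gauss_dvdp ?h ?mem_head //=.
  by apply: IH => // a sa; apply: h; rewrite inE sa orbT.
rewrite coprimep_sym coprimep_expr // coprimep_XsubC rootE horner_prod prodf_seq_neq0.
apply/allP => a sa; rewrite /= !hornerE expf_eq0 subr_eq0.
by apply/negP => /andP [_ /eqP e]; rewrite e sa in bs.
Qed.

Lemma tr_nilp (C : numClosedFieldType) n (A : 'M[C]_n) k : A ^+ k = 0 -> \tr A = 0.
Proof.
case: n A => [|n] A Ak; first by rewrite /mxtrace big_ord0.
have [rs hrs] := closed_field_poly_normal (char_poly A).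
rewrite (monicP (char_poly_monic A)) scale1r in hrs.
have r0 : forall a, a \in rs -> a = 0.
  move=> a ars; have : root (char_poly A) a.
    by rewrite hrs root_prod_XsubC.
  rewrite -eigenvalue_root_char => /eigenvalueP [v vA v0].
  have vk j : v *m A ^+ j = a ^+ j *: v.
    elim: j => [|j IH]; first by rewrite !expr0 mulmx1 scale1r.
    by rewrite exprSr -mulmxE mulmxA IH -scalemxAl vA scalerA exprSr.
  move: (vk k); rewrite Ak mulmx0 => /esym/eqP; rewrite scaler_eq0 (negPf v0) orbF.
  by rewrite expf_eq0 => /andP [_ /eqP].
have e : char_poly A = 'X ^+ size rs.
  rewrite hrs; elim: (rs) r0 => [|a r IH] r0; first by rewrite big_nil expr0.
  rewrite big_cons IH => [|b br]; last by apply: r0; rewrite inE br orbT.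
  by rewrite (r0 a) ?mem_head // subr0 exprS.
have : size (char_poly A) = (size rs).+1 by rewrite e size_polyXn.
rewrite size_char_poly => -[sn].
apply/eqP; rewrite -oppr_eq0 -char_poly_trace // e -sn coefXn.
by rewrite eqn_leq ltnn andbF.
Qed.

Lemma tr_idem (C : fieldType) n (A : 'M[C]_n) : A *m A = A -> \tr A = (\rank A)%:R.
Proof.
move=> AA; rewrite -{1}(mulmx_base A) mxtrace_mulC.
suff -> : row_base A *m col_base A = 1%:M by rewrite mxtrace1.
have h1 : row_free (row_base A) by exact: row_base_free.
have h2 : row_full (col_base A) by exact: col_base_full.
apply: (row_free_inj h1); apply: (row_full_inj h2).
by rewrite mul1mx -mulmxA mulmx_base mulmxA mulmx_base AA.
Qed.

(** * Spectral projections and the additive Jordan decomposition *)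

Section SpectralProjections.
Context {C : numClosedFieldType} {n : nat}.
Implicit Types (X Y : 'M[C]_n.+1).

Definition spec X : seq C := undup (sval (closed_field_poly_normal (char_poly X))).
(** The projection onto the generalised eigenspace of [a], as a polynomial in [X] that agrees with 1
    at [a] and with 0 at the other eigenvalues to order [n.+1]; the size bounds every multiplicity,
    so none is recorded. *)
Definition spr X a : 'M[C]_n.+1 := horner_mx X
  (sval (cid (crt_poly (C := C) n.+1 (fun b => (b == a)%:R) (undup_uniq (sval (closed_field_poly_normal (char_poly X))))))).

Lemma spec_uniq X : uniq (spec X).
Proof. exact: undup_uniq. Qed.
Lemma spec_prod X : char_poly X %| \prod_(a <- spec X) ('X - a%:P) ^+ n.+1.
Proof.
have := svalP (closed_field_poly_normal (char_poly X)); rewrite /spec.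
set rs := sval _; rewrite (monicP (char_poly_monic X)) scale1r => h.
have sz : (size rs <= n.+1)%N.
  by have := size_char_poly X; rewrite h size_prod_XsubC => -[->].
rewrite h -prodr_undup_exp_count; elim: (undup rs) => [|a r IH]; first by rewrite !big_nil.
rewrite !big_cons dvdp_mul // dvdp_exp2l //.
exact: leq_trans (count_size _ _) sz.
Qed.
Lemma horner_spec0 X q : (forall a, a \in spec X -> ('X - a%:P) ^+ n.+1 %| q) ->
  horner_mx X q = 0.
Proof.
move=> h; have := dvdp_trans (spec_prod X) (prod_XsubC_dvd (spec_uniq X) h).
case/dvdpP => p ->; rewrite rmorphM /=.
by rewrite (Cayley_Hamilton X) mulr0.
Qed.
Definition sprp X a : {poly C} :=
  sval (cid (crt_poly (C := C) n.+1 (fun b => (b == a)%:R) (undup_uniq (sval (closed_field_poly_normal (char_poly X)))))).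
Lemma sprpP X a b : b \in spec X -> ('X - b%:P) ^+ n.+1 %| sprp X a - ((b == a)%:R)%:P.
Proof. by rewrite /sprp; case: cid => /= h; apply. Qed.
Lemma sprE X a : spr X a = horner_mx X (sprp X a). Proof. by []. Qed.

Lemma spr_comm X Y a : X *m Y = Y *m X -> spr X a *m Y = Y *m spr X a.
Proof. by move=> h; apply/comm_mx_sym/comm_mx_horner/comm_mx_sym. Qed.
Lemma spr_sum X : \sum_(a <- spec X) spr X a = 1%:M.
Proof.
apply/eqP; rewrite -subr_eq0; apply/eqP.
under eq_bigr => a _ do rewrite sprE.
have e : horner_mx X 1 = 1%:M := rmorph1 _.
rewrite -e -rmorph_sum -rmorphB /=; apply: horner_spec0 => b bs.
rewrite (bigD1_seq b) ?spec_uniq //= addrAC.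
have := sprpP b bs; rewrite eqxx polyC1 => h1.
rewrite dvdp_add //.
rewrite big_seq_cond; elim/big_rec: _ => [|a p /andP [_ ab] hp]; first exact: dvdp0.
by rewrite dvdp_add //; have := sprpP a bs; rewrite eq_sym (negPf ab) subr0.
Qed.
Lemma spr_orth X a b : a \in spec X -> a != b -> spr X a *m spr X b = 0.
Proof.
move=> aS ab; rewrite !sprE mulmxE -rmorphM /=; apply: horner_spec0 => c cs.
have [ca|ca] := eqVneq c a.
  by have := sprpP b cs; rewrite ca (negPf ab) subr0 => h; exact: dvdp_mull.
by have := sprpP a cs; rewrite (negPf ca) subr0 => h; exact: dvdp_mulr.
Qed.
Lemma spr_idem X a : a \in spec X -> spr X a *m spr X a = spr X a.
Proof.
move=> aS; rewrite -[RHS]mulmx1 -(spr_sum X) mulmx_sumr (bigD1_seq a) ?spec_uniq //=.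
by rewrite big1 ?addr0 // => b ba; rewrite spr_orth // eq_sym.
Qed.
Lemma spr_nil X a : a \in spec X -> (X - a%:M) ^+ n.+1 *m spr X a = 0.
Proof.
move=> aS; have -> : X - a%:M = horner_mx X ('X - a%:P).
  by rewrite rmorphB /= horner_mx_X horner_mx_C.
rewrite sprE mulmxE -rmorphXn -rmorphM /=; apply: horner_spec0 => c cs.
have [->|ca] := eqVneq c a; first exact: dvdp_mulr.
by have := sprpP a cs; rewrite (negPf ca) subr0 => h; exact: dvdp_mull.
Qed.
Lemma spr_commX X a : X *m spr X a = spr X a *m X.
Proof. by rewrite spr_comm. Qed.

(* The value at [X] of an arbitrary function [c] on the spectrum; nilpotent parts are
   dropped, so [gfun X id] is the semisimple part of [X]. *)
Definition gfun X (c : C -> C) : 'M[C]_n.+1 := \sum_(a <- spec X) c a *: spr X a.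

Lemma gfun_comm X Y c : X *m Y = Y *m X -> gfun X c *m Y = Y *m gfun X c.
Proof.
move=> h; rewrite /gfun mulmx_suml mulmx_sumr; apply: eq_bigr => a _.
by rewrite -scalemxAl -scalemxAr spr_comm.
Qed.
Lemma gfunM X c d : gfun X c *m gfun X d = gfun X (fun a => c a * d a).
Proof.
rewrite /gfun mulmx_suml big_seq [RHS]big_seq; apply: eq_bigr => a aS.
rewrite mulmx_sumr (bigD1_seq a) ?spec_uniq //= big1 ?addr0 => [|b ba].
  by rewrite -scalemxAl -scalemxAr spr_idem // scalerA.
by rewrite -scalemxAl -scalemxAr spr_orth ?scaler0 // eq_sym.
Qed.
Lemma gfunD X c d : gfun X c + gfun X d = gfun X (fun a => c a + d a).
Proof. by rewrite /gfun -big_split; apply: eq_bigr => a _; rewrite scalerDl. Qed.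
Lemma gfunZ X z c : z *: gfun X c = gfun X (fun a => z * c a).
Proof. by rewrite /gfun scaler_sumr; apply: eq_bigr => a _; rewrite scalerA. Qed.
Lemma gfun_spr X c a : a \in spec X -> gfun X c *m spr X a = c a *: spr X a.
Proof.
move=> aS; rewrite /gfun mulmx_suml (bigD1_seq a) ?spec_uniq //= big1_seq ?addr0.
  by rewrite -scalemxAl spr_idem.
by move=> b /andP [ba bS]; rewrite -scalemxAl spr_orth // scaler0.
Qed.
Lemma nilp_part X : (X - gfun X id) ^+ n.+1 = 0.
Proof.
rewrite -[LHS]mulmx1 -(spr_sum X) mulmx_sumr big1_seq // => a /andP [_ aS].
suff h k : (X - gfun X id) ^+ k *m spr X a = (X - a%:M) ^+ k *m spr X a.
  by rewrite h spr_nil.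
elim: k => [|k IH]; first by rewrite !expr0.
have e : (X - gfun X id) *m spr X a = spr X a *m (X - a%:M).
  by rewrite mulmxBl gfun_spr // mulmxBr -spr_commX mul_mx_scalar.
have e2 : (X - a%:M) *m spr X a = spr X a *m (X - a%:M).
  by rewrite mulmxBl mulmxBr spr_commX mul_scalar_mx mul_mx_scalar.
by rewrite !exprSr -!mulmxE -!mulmxA e e2 !mulmxA IH.
Qed.
(** The nilpotent part commutes with [gfun X c] and so contributes no trace. With [c] the
    conjugation the sum is that of [|a| ^ 2] with multiplicities: the source of positivity for the
    trace form. *)
Lemma tr_gfun X c : \tr (X *m gfun X c) = \sum_(a <- spec X) c a * a * (\rank (spr X a))%:R.
Proof.
have -> : X *m gfun X c = (X - gfun X id) *m gfun X c + gfun X (fun a => c a * a).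
  have -> : gfun X (fun a => c a * a) = gfun X id *m gfun X c.
    by rewrite gfunM; congr gfun; apply/funext => a; rewrite mulrC.
  by rewrite mulmxBl subrK.
have nil : ((X - gfun X id) *m gfun X c) ^+ n.+1 = 0.
  have cc : (X - gfun X id) *m gfun X c = gfun X c *m (X - gfun X id).
    by rewrite mulmxBl mulmxBr -gfun_comm // !gfunM; congr (_ - gfun _ _); apply/funext => a; rewrite mulrC.
  by rewrite mulmxE exprMn_comm ?nilp_part ?mul0r //; exact: cc.
rewrite raddfD /= (tr_nilp nil) add0r /gfun raddf_sum big_seq [RHS]big_seq.
by apply: eq_bigr => a aS; rewrite /= mxtraceZ tr_idem ?spr_idem.
Qed.
Lemma gfun0_nilp X : gfun X id = 0 -> X ^+ n.+1 = 0.
Proof. by move=> h; rewrite -[X]subr0 -h nilp_part. Qed.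
End SpectralProjections.

(** * Lie algebras of closed and of algebraic groups *)

Section LieAlgebras.
Context {R : realType} {S : realform R}.
Local Notation C := (cC S).
Local Notation io := (@io R S).

Section AlgebraicHull.

Lemma expm_nilpM n m (X : 'M[C]_n) (B : 'M[C]_(n, m)) k : X ^+ k *m B = 0 ->
  expm X *m B = epart X k *m B.
Proof.
move=> Xk; apply: (cvm_uniq (cvmM (expm_cvm _) (cvm_cst B))).
apply: cvm_near (cvm_cst (epart X k *m B)); exists k => // N /= kN.
rewrite /epart -!(big_mkord xpredT (fun k => (k`!%:R)^-1 *: X ^+ k)).
rewrite [X in _ = X *m _](big_cat_nat (n := k)) //= mulmxDl.
rewrite [X in _ = _ + X]mulmx_suml [X in _ = _ + X]big1_seq ?addr0 // => i /=.
rewrite mem_index_iota => /andP [ki _]; rewrite -(subnK ki) exprD -scalemxAl -mulmxE.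
by rewrite -mulmxA Xk mulmx0 scaler0.
Qed.

Section OneMatrix.
Variables (n : nat) (X : 'M[C]_n.+1).

(** [exp (s X)] with every [exp (s a)] replaced by [E a]. Decoupling [E] from [s] separates the
    semisimple from the unipotent part: at [s = 0] only [gfun X E] is left. *)
Definition espec (E : C -> C) (s : C) : 'M[C]_n.+1 :=
  \sum_(a <- spec X) E a *: (epart (s *: (X - a%:M)) n.+1 *m spr X a).

Lemma expm_spec s : expm (s *: X) = espec (fun a => expc (s * a)) s.
Proof.
rewrite -[LHS]mulmx1 -(spr_sum X) mulmx_sumr /espec big_seq [RHS]big_seq.
apply: eq_bigr => a aS.
have -> : s *: X = (s * a)%:M + s *: (X - a%:M).
  by rewrite scalerBr scale_scalar_mx addrC subrK.
rewrite expmD; last by rewrite mul_scalar_mx mul_mx_scalar.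
rewrite expm_scalar mul_scalar_mx -scalemxAl; congr (_ *: _).
apply: expm_nilpM; rewrite exprZn -scalemxAl spr_nil // scaler0 //.
Qed.
Lemma espec0 E : espec E 0 = gfun X E.
Proof.
apply: eq_bigr => a _; congr (_ *: _); rewrite /epart big_ord_recl /= expr0.
rewrite fact0 invr1 scale1r big1 ?addr0 ?mul1mx // => i _.
by rewrite scale0r expr0n /= scaler0.
Qed.
Lemma gfun_expc (c : C -> C) : expm (gfun X c) = gfun X (fun a => expc (c a)).
Proof.
rewrite -[LHS]mulmx1 -(spr_sum X) mulmx_sumr /gfun big_seq [RHS]big_seq.
apply: eq_bigr => a aS; rewrite -/(gfun X c).
have -> : gfun X c = (c a)%:M + (gfun X c - (c a)%:M) by rewrite addrC subrK.
rewrite expmD; last by rewrite mul_scalar_mx mul_mx_scalar.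
rewrite expm_scalar mul_scalar_mx -scalemxAl; congr (_ *: _).
rewrite (@expm_nilpM _ _ _ _ 1) ?epart1 ?expr1.
  by rewrite /epart big_ord1 expr0 fact0 invr1 scale1r mul1mx.
by rewrite mulmxBl gfun_spr // mul_scalar_mx subrr.
Qed.

Variable A : C -> Prop.
Hypotheses (A0 : A 0) (AD : forall a b, A a -> A b -> A (a + b)).
Hypothesis AX : forall a, a \in spec X -> A a.

Lemma is_ep_espec i j : is_ep A (fun E s => espec E s i j).
Proof.
apply: (@is_ep_ext _ _ A (fun E s => \sum_(a <- spec X)
   (\sum_(k < n.+1) ((k`!%:R)^-1 * ((X - a%:M) ^+ k *m spr X a) i j) *: 'X^k : {poly C}).[s] * E a)).
  move=> E s _; rewrite /espec summxE; apply: eq_bigr => a _; rewrite mxE mulrC; congr (_ * _).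
  rewrite /epart mulmx_suml summxE horner_sum; apply: eq_bigr => k _.
  by rewrite hornerZ hornerXn exprZn -!scalemxAl !mxE; ring.
by apply: is_ep_sumseq => // a aS; apply: is_ep_poly; exact: AX.
Qed.

Lemma is_ep_polyf f : polyf f -> is_ep A (fun E s => f (espec E s)).
Proof.
apply: (polyf_indmx (Q := fun f => is_ep A (fun E s => f (espec E s)))).
- by move=> c; exact: is_ep_cst.
- by move=> f1 f2; exact: is_epD.
- by move=> f1 f2; exact: is_epM.
- exact: is_ep_espec.
Qed.

Lemma espec_vanish f : polyf f ->
  (forall l : seq C, (forall a, a \in l -> A a) -> exists t : C,
    [/\ t != 0, {in l &, injective (fun a => expc (t * a))} &
     forall m : nat, f (expm ((m%:R * t) *: X)) = 0]) ->
  forall E s, expo_hom E -> f (espec E s) = 0.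
Proof.
move=> pf h; apply: (ep_vanish (is_ep_polyf pf)) => // l lA.
have [t [t0 inj ht]] := h l lA; exists t; split=> // m.
by rewrite -expm_spec.
Qed.
End OneMatrix.

Lemma expo_expc (t : C) : expo_hom (fun a => expc (t * a)).
Proof. by split=> [|a b]; rewrite ?mulr0 ?expc0 // mulrDr expcD. Qed.

(** The multiples of one small real step already carry the independence of exponential polynomials,
    so a real half-line of parameters decides for all complex ones. *)
Lemma polyf_real_complex n (X : 'M[C]_n) f : polyf f ->
  (forall t : R, 0 <= t -> f (expm (io t *: X)) = 0) -> forall s, f (expm (s *: X)) = 0.
Proof.
case: n X f => [|n] X f pf h s.
  by rewrite -(h 0) //; congr f; apply/matrixP => -[].
rewrite expm_spec; apply: (espec_vanish (A := fun=> True)) pf _ _ _ (expo_expc s) => // l _.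
have [d d0 hd] := expc_inj_small l; exists (io d); split.
- by rewrite fmorph_eq0 gt_eqF.
- exact: hd.
- by move=> m; rewrite -(rmorph_nat io) -rmorphM /= h // mulr_ge0 // ltW.
Qed.
End AlgebraicHull.

Lemma lie_real_complex n (G : set 'M[C]_n) X : algebraic_group G ->
  (forall t : R, 0 <= t -> G (expm (io t *: X))) -> lie_algebra G X.
Proof.
move=> [_ [Z [F Fp ->] ->]] h s; split; first exact: expm_unit.
move=> f Ff; apply: polyf_real_complex; first exact: Fp.
by move=> t t0; have [_] := h t t0; apply.
Qed.

(** An algebraic Lie algebra contains the replicas of its elements: [a |-> exp (s phi a)] is
    multiplicative since [phi] is additive, so the equations of [G] hold at [exp (s gfun X phi)]. It
    is applied to the conjugation, to real and imaginary parts and to the identity. *)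
Lemma lie_gfun n (G : set 'M[C]_n.+1) X (phi : C -> C) : algebraic_group G ->
  lie_algebra G X -> (forall a b, phi (a + b) = phi a + phi b) ->
  lie_algebra G (gfun X phi).
Proof.
move=> [_ [Z [F Fp ->] ->]] h phiD s; split; first exact: expm_unit.
have phi0 : phi 0 = 0 by apply: (addrI (phi 0)); rewrite -phiD !addr0.
move=> f Ff; rewrite gfunZ gfun_expc -espec0.
apply: (espec_vanish (A := fun=> True)) (Fp f Ff) _ _ _ _ => // [l _|].
  have [d d0 hd] := expc_inj_small l; exists (io d); split.
  - by rewrite fmorph_eq0 gt_eqF.
  - exact: hd.
  - by move=> m; have [_] := h (m%:R * io d); apply.
by split=> [|a b]; rewrite ?phi0 ?mulr0 ?expc0 // phiD mulrDr expcD.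
Qed.

Lemma notnear_subseq (P : nat -> Prop) : ~ (\forall k \near \oo, P k) ->
  exists2 phi, subseq_ix phi & forall k, ~ P (phi k).
Proof.
move=> h; have ex N : exists k, (N <= k)%N /\ ~ P k.
  apply: contrapT => h1; apply: h; exists N => // k Nk.
  by apply: contrapT => h2; apply: h1; exists k.
have [phi hphi] := choice ex; exists phi => k; by case: (hphi k).
Qed.

(** The common engine of the minimisations: a minimising sequence is bounded, a subsequence has a
    limit in [P], and [f] passes to that limit. *)
Lemma min_attained m n (P : set 'M[C]_(m, n)) (f : 'M[C]_(m, n) -> R) (B : R) :
  P !=set0 -> (forall X, P X -> nm X <= B) ->
  (forall A L, (forall k, P (A k)) -> cvm A L -> P L) ->
  (forall A L, (forall k, P (A k)) -> cvm A L -> cvg0 (fun k => `|f (A k) - f L|)) ->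
  (forall X, 0 <= f X) ->
  exists2 X, P X & forall Y, P Y -> f X <= f Y.
Proof.
move=> [X0 PX0] PB Pcl fc f0.
pose I := inf [set f X | X in P].
have hI : has_inf [set f X | X in P].
  by split; [exists (f X0); exists X0 | exists 0 => _ [X _ <-]].
have ex (k : nat) : exists X, P X /\ f X < I + k.+1%:R^-1.
  have k0 : 0 < k.+1%:R^-1 :> R by rewrite invr_gt0.
  by have [_ [X PX <-] h] := inf_adherent k0 hI; exists X.
have [A hA] := choice ex.
have [phi hphi [L hL]] := bw_mx (fun k => PB _ (hA k).1).
have PL : P L by apply: Pcl hL => k; exact: (hA _).1.
exists L => // Y PY; apply: (@le_trans _ _ I); last by apply: ge_inf; [case: hI | exists Y].
rewrite -subr_le0; apply: cvg0_cst.
apply: cvg0_leA (cvg0D (fc _ _ (fun k => (hA (phi k)).1) hL) (cvg0_subseq hphi cvg0_inv)) => k /=.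
have h1 : f (A (phi k)) <= I + (phi k).+1%:R^-1 by exact: ltW (hA _).2.
have h2 := ler_norm (f L - f (A (phi k))); rewrite distrC in h2.
rewrite lerBlDr; apply: le_trans (_ : f (A (phi k)) + `|f (A (phi k)) - f L| <= _).
  by rewrite -lerBlDl.
by rewrite addrC -addrA [_ + I]addrC lerD2l.
Qed.

Lemma cvm_linear m n p q (f : {linear 'M[C]_(m, n) -> 'M[C]_(p, q)}) A L :
  cvm A L -> cvm (fun k => f (A k)) (f L).
Proof.
move=> h; have e X : f X = \sum_i \sum_j X i j *: f (delta_mx i j).
  rewrite {1}(matrix_sum_delta X) linear_sum; apply: eq_bigr => i _.
  by rewrite linear_sum; apply: eq_bigr => j _; rewrite linearZ.
rewrite e; apply: cvm_ext (_ : cvm (fun k => \sum_i \sum_j A k i j *: f (delta_mx i j)) _).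
  by move=> k; rewrite [RHS]e.
by apply: cvm_sum => i; apply: cvm_sum => j; apply: cvmZ (cvm_entry _ _ h) (cvm_cst _).
Qed.

Lemma vspace_cvm m n (U : {vspace 'M[C]_(m, n)}) A L :
  (forall k, A k \in U) -> cvm A L -> L \in U.
Proof.
move=> AU h; have hf := cvm_linear (projv U) h.
have -> : L = projv U L; last exact: memv_proj.
apply: (cvm_uniq h); apply: cvm_ext hf => k; exact: projv_id.
Qed.

Lemma polyf_cvs m n (f : 'M[C]_(m, n) -> C) A L : polyf f ->
  cvm A L -> cvs (fun k => f (A k)) (f L).
Proof.
move=> pf h; move: f pf; apply: polyf_indmx => [c|f g|f g|i j].
- exact: cvs_cst.
- exact: cvsD.
- exact: cvsM.
- exact: cvm_entry.
Qed.

Lemma vspace_of_set (K : fieldType) (V : vectType K) (P : set V) : P 0 ->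
  (forall x y, P x -> P y -> P (x + y)) -> (forall a x, P x -> P (a *: x)) ->
  exists U : {vspace V}, forall x, P x <-> x \in U.
Proof.
move=> P0 PD PZ.
pose Q (k : nat) := exists U : {vspace V}, \dim U = k /\ forall x, x \in U -> P x.
have Q0 : exists k, `[< Q k >].
  exists 0%N; apply/asboolP; exists 0%VS; rewrite dimv0; split=> // x.
  by rewrite memv0 => /eqP ->.
have Qb k : `[< Q k >] -> (k <= \dim {:V})%N.
  by move=> /asboolP [U [<- _]]; apply: dimvS; exact: subvf.
case: (ex_maxnP Q0 Qb) => k /asboolP [U [dU UP]] kmax; exists U => x; split; last exact: UP.
move=> Px; have : `[< Q (\dim (U + <[x]>)) >].
  apply/asboolP; exists (U + <[x]>)%VS; split=> // y.
  by case/memv_addP => u uU [_ /vlineP [a ->] ->]; apply: PD; [exact: UP | exact: PZ].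
move=> /kmax; rewrite -dU => h.
have /eqP -> : U == (U + <[x]>)%VS by rewrite eqEdim addvSl.
by rewrite memvE addvSr.
Qed.

Section ClosedGroups.
Variable n : nat.
Implicit Types (G : set 'M[C]_n) (X Y : 'M[C]_n).

(** Closed relative to the invertible matrices: this covers algebraic groups, whose limits may be
    singular, as well as compact ones. *)
Definition closed_group G : Prop := subgroup G /\
  forall A L, (forall k, G (A k)) -> cvm A L -> L \in unitmx -> G L.

Lemma algebraic_closed G : algebraic_group G -> closed_group G.
Proof.
move=> [sG [Z [F Fp ZF] GZ]]; split => // A L GA AL Lu.
rewrite GZ; split=> //; rewrite ZF => f Ff.
apply: (cvs_uniq (polyf_cvs (Fp f Ff) AL)).
apply: cvs_ext (cvs_cst 0) => k; have := GA k.
by rewrite GZ ZF => -[_ ->].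
Qed.
Lemma compact_closed_group G : subgroup G -> compact G -> closed_group G.
Proof. by move=> sG cG; split=> // A L GA AL _; exact: compact_cvm GA AL. Qed.

Lemma real_lieP G X :
  real_lie G X <-> forall t : R, G (expm (io t *: X)).
Proof.
by split=> h => [t|s sr]; [apply: h; exact: io_real | rewrite -(roK sr)].
Qed.

Lemma group_expX G g k : subgroup G -> G g -> G (g ^+ k).
Proof.
move=> [_ G1 GM _] Gg; elim: k => [|k IH]; first by rewrite expr0.
by rewrite exprS; exact: GM.
Qed.

(** With [m] the integral part of [t c], the power [h ^ m] lies in [G] and tends to [exp (t Y)]: the
    directions in which [G] approaches 1 are tangent to it. *)
Lemma lie_direction G (h : nat -> 'M[C]_n) (c : nat -> R) Y : closed_group G ->
  (forall k, G (h k)) -> cvm h 1%:M -> (forall k, 0 <= c k) ->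
  cvm (fun k => io (c k) *: (h k - 1%:M)) Y -> real_lie G Y.
Proof.
move=> [sG clG] Gh h1 c0 hY; apply/real_lieP => t.
wlog t0 : t / 0 <= t => [hw|].
  have [t0|t0] := leP 0 t; first exact: hw.
  have [_ _ _ GV] := sG; rewrite -[t]opprK rmorphN scaleNr -invmx_expm; apply: GV.
  by apply: hw; rewrite oppr_ge0 ltW.
pose m k := Num.truncn (t * c k).
have hm k : (m k)%:R <= t * c k < (m k)%:R + 1.
  by have := truncn_itv (mulr_ge0 t0 (c0 k)); rewrite -natr1.
have A0 : cvm (fun k => h k - 1%:M) 0.
  by rewrite -(subrr 1%:M); exact: cvmB h1 (cvm_cst _).
have mA : cvm (fun k => (m k)%:R *: (h k - 1%:M)) (io t *: Y).
  have d0 : cvm (fun k => io ((m k)%:R - t * c k) *: (h k - 1%:M)) 0.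
    apply: cvg0_leA A0 => k; rewrite !subr0 nmZ nc_io ler_piMl ?nm_ge0 //.
    by rewrite ler_norml; have := hm k; lra.
  have := cvmD d0 (cvmZ (cvs_cst (io t)) hY); rewrite add0r.
  apply: cvm_ext => k; rewrite scalerA -scalerDl; congr (_ *: _).
  by rewrite rmorphB rmorphM /= rmorph_nat; ring.
apply: clG (expm_pow_lim A0 mA) (expm_unit _) => k.
by rewrite addrC subrK; apply: group_expX.
Qed.

Lemma expm_quot (A : nat -> 'M[C]_n) (e : nat -> R) L : cvm A L ->
  cvg0 e -> (forall k, 0 < e k) ->
  cvm (fun k => io ((e k)^-1) *: (expm (io (e k) *: A k) - 1%:M)) L.
Proof.
move=> AL e0 ep; pose B := nm L + 1.
have B0 : 0 <= B by rewrite addr_ge0 ?nm_ge0.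
have c0 : 0 <= cn (S := S) n * (B ^+ 2 * expR B) by rewrite mulr_ge0 ?cn_ge0 // mulr_ge0 ?sqr_ge0 ?expR_ge0.
apply: cvg0_le (cvg0D (cvg0Z c0 e0) AL).
apply: filterS2 (cvm_bd AL) (e0 1 ltr01) => k hk ek1.
have -> : io ((e k)^-1) *: (expm (io (e k) *: A k) - 1%:M) - L =
  io ((e k)^-1) *: (expm (io (e k) *: A k) - 1%:M - io (e k) *: A k) + (A k - L).
  have e1 : io ((e k)^-1) * io (e k) = 1 by rewrite -rmorphM mulVf ?gt_eqF // rmorph1.
  by rewrite [in RHS]scalerBr [_ *: (_ *: A k)]scalerA e1 scale1r addrA subrK.
apply: le_trans (nmD _ _) _; rewrite lerD2r nmZ nc_io gtr0_norm ?invr_gt0 //.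
rewrite ler_pdivrMl //; apply: le_trans (expm_tail2 _) _.
have -> : e k * (cn (S := S) n * (B ^+ 2 * expR B) * e k) =
  cn (S := S) n * (e k ^+ 2 * (B ^+ 2 * expR B)) by ring.
have Ak2 : nm (A k) ^+ 2 <= B ^+ 2 by rewrite lerXn2r ?nnegrE ?nm_ge0.
have E : expR (e k * nm (A k)) <= expR B.
  rewrite ler_expR; apply: le_trans hk; rewrite ler_piMl ?nm_ge0 //; exact: ltW.
rewrite ler_wpM2l ?cn_ge0 // nmZ nc_io gtr0_norm // exprMn -mulrA ler_wpM2l ?sqr_ge0 //.
by apply: ler_pM => //; rewrite ?sqr_ge0 ?expR_ge0.
Qed.

Lemma real_lie_cvm G (A : nat -> 'M[C]_n) L : closed_group G ->
  (forall k, real_lie G (A k)) -> cvm A L -> real_lie G L.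
Proof.
move=> [_ clG] GA AL; apply/real_lieP => t.
apply: clG (cvm_expm (cvmZ (cvs_cst (io t)) AL)) (expm_unit _) => k.
by apply: GA; exact: io_real.
Qed.
Lemma real_lie0 G : subgroup G -> real_lie G 0.
Proof. by move=> [_ G1 _ _] s _; rewrite scaler0 expm0. Qed.
Lemma real_lieZ G X t : real_lie G X -> real_lie G (io t *: X).
Proof. by move=> /real_lieP h; apply/real_lieP => u; rewrite scalerA -rmorphM. Qed.
Lemma real_lieN G X : real_lie G X -> real_lie G (- X).
Proof. by move=> /(real_lieZ (-1)); rewrite rmorphN1 scaleN1r. Qed.
Lemma real_lieD G X Y : closed_group G ->
  real_lie G X -> real_lie G Y -> real_lie G (X + Y).
Proof.
move=> cG GX GY; have [[_ _ GM _] _] := cG.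
pose e (k : nat) : R := k.+1%:R^-1.
have ep k : 0 < e k by rewrite invr_gt0.
have eX := expm_quot (cvm_cst X) cvg0_inv ep.
have eY := expm_quot (cvm_cst Y) cvg0_inv ep.
have lim (Z : 'M[C]_n) : cvm (fun k => expm (io (e k) *: Z)) 1%:M.
  rewrite -expm0 -(scale0r Z); apply: cvm_expm; apply: cvmZ (cvm_cst Z).
  by apply: cvg0_leA cvg0_inv => k; rewrite subr0 nc_io gtr0_norm.
apply: (@lie_direction G (fun k => expm (io (e k) *: X) *m expm (io (e k) *: Y))
  (fun k => (e k)^-1)) => //.
- by move=> k; apply: GM; [apply: GX | apply: GY]; exact: io_real.
- by rewrite -(mulmx1 1%:M); exact: cvmM (lim X) (lim Y).
- by move=> k; rewrite invr_ge0 ltW.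
have := cvmD (cvmM eX (lim Y)) eY; rewrite mulmx1; apply: cvm_ext => k.
by rewrite -scalemxAl -scalerDr mulmxBl mul1mx addrA subrK.
Qed.
Lemma real_lie_conj G X g : subgroup G -> G g ->
  real_lie G X -> real_lie G (g *m X *m invmx g).
Proof.
move=> [GU _ GM GV] Gg GX s sr.
rewrite scalemxAl scalemxAr expm_conj; last exact: GU.
by apply: (GM); [apply: (GM) => //; exact: GX | exact: GV].
Qed.

Lemma bracket_limit X Y (e : nat -> R) : cvg0 e -> (forall k, 0 < e k) ->
  cvm (fun k => io ((e k)^-1) *:
    (expm (io (e k) *: X) *m Y *m invmx (expm (io (e k) *: X)) - Y)) (X *m Y - Y *m X).
Proof.
move=> e0 ep.
have eX := expm_quot (cvm_cst X) e0 ep.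
have lim : cvm (fun k => expm (io (e k) *: X)) 1%:M.
  rewrite -expm0 -(scale0r X); apply: cvm_expm; apply: cvmZ (cvm_cst X).
  by apply: cvg0_leA e0 => k; rewrite subr0 nc_io gtr0_norm.
have limV := cvm_inv lim (unitmx1 _ _).
have := cvmM (cvmB (cvmM eX (cvm_cst Y)) (cvmM (cvm_cst Y) eX)) limV.
rewrite invmx1 mulmx1; apply: cvm_ext => k.
rewrite -scalemxAl -scalemxAr -scalerBr -scalemxAl; congr (_ *: _).
rewrite [(_ - 1%:M) *m Y]mulmxBl mul1mx mulmxBr mulmx1 opprB addrA subrK mulmxBl.
by rewrite mulmxK ?expm_unit.
Qed.

Lemma real_lie_bracket G X Y : closed_group G ->
  real_lie G X -> real_lie G Y -> real_lie G (X *m Y - Y *m X).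
Proof.
move=> cG GX GY; have [sG _] := cG.
have ep (k : nat) : 0 < k.+1%:R^-1 :> R by rewrite invr_gt0.
apply: (real_lie_cvm cG) (bracket_limit X Y cvg0_inv ep) => k.
apply: real_lieZ; apply: real_lieD => //; last exact: real_lieN.
by apply: real_lie_conj => //; apply: GX; exact: io_real.
Qed.

(** Chosen so that [expm - id] is a contraction with constant 1/2 on the ball of this radius; hence
    the factor 2 in [expm_inj_small]. *)
Definition small_rad : R := (2 * (cn (S := S) n * expR 1))^-1.
Lemma small_rad_gt0 : 0 < small_rad.
Proof. by rewrite invr_gt0 mulr_gt0 // mulr_gt0 ?expR_gt0 // (lt_le_trans ltr01) ?cn_ge1. Qed.
Lemma small_rad_le1 : small_rad <= 1.
Proof.
have e1 : 1 <= expR 1 :> R by rewrite -expR0 ler_expR.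
rewrite invf_le1; first by have := cn_ge1 (S := S) n; nra.
by rewrite mulr_gt0 // mulr_gt0 ?expR_gt0 // (lt_le_trans ltr01) ?cn_ge1.
Qed.
Lemma small_radE r : r <= small_rad -> cn (S := S) n * (r * expR r) <= 2^-1.
Proof.
move=> hr; have [r0|r0] := leP r 0.
  apply: (@le_trans _ _ 0); last by rewrite invr_ge0.
  by rewrite mulr_ge0_le0 ?cn_ge0 // mulr_le0_ge0 ?expR_ge0.
have E : expR r <= expR 1 by rewrite ler_expR (le_trans hr) ?small_rad_le1.
have c0 : 0 < cn (S := S) n * expR 1 by rewrite mulr_gt0 ?expR_gt0 // (lt_le_trans ltr01) ?cn_ge1.
apply: (@le_trans _ _ (r * (cn (S := S) n * expR 1))).
  by rewrite mulrCA ler_wpM2l ?(ltW r0) // ler_wpM2l ?cn_ge0.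
by move: hr; rewrite /small_rad invfM -ler_pdivlMr.
Qed.
Lemma expm_inj_small X : nm X <= small_rad -> nm X <= 2 * nm (expm X - 1%:M).
Proof.
move=> hX; have := expm_lip hX (_ : nm (0 : 'M[C]_n) <= small_rad).
rewrite nm0 expm0 !subr0 => /(_ (ltW small_rad_gt0)) h.
have := le_trans h (ler_wpM2r (nm_ge0 X) (small_radE (lexx _))).
have := nmB X (expm X - 1%:M); rewrite (nmBC X); lra.
Qed.

(* Nearest point argument: [X_k] minimises [|exp(-X) h_k - 1|] over small [X] in the Lie
   algebra; a limit direction of the remainders would lie in the Lie algebra and could be
   used to decrease the minimum. *)
Lemma closed_subgroup_exp G (h : nat -> 'M[C]_n) : closed_group G ->
  (forall k, G (h k)) -> cvm h 1%:M ->
  exists X : nat -> 'M[C]_n, [/\ forall k, real_lie G (X k), cvm X 0 &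
    \forall k \near \oo, h k = expm (X k)].
Proof.
move=> cG Gh h1; have [sG clG] := cG; have [GU G1 GM GV] := sG.
pose d := small_rad; have d0 := small_rad_gt0.
pose P : set 'M[C]_n := [set X | real_lie G X /\ nm X <= d].
have P0 : P 0 by split; [exact: real_lie0 | rewrite nm0 ltW].
have Pcl A L : (forall k, P (A k)) -> cvm A L -> P L.
  move=> PA AL; split; first by apply: real_lie_cvm AL => // k; case: (PA k).
  by apply: cvm_le_nm AL _; apply: nearW => k; case: (PA k).
have ex k : exists X, P X /\ forall Y, P Y ->
    nm (expm (- X) *m h k - 1%:M) <= nm (expm (- Y) *m h k - 1%:M).
  have [||||| X PX hX] := @min_attained n n P (fun X => nm (expm (- X) *m h k - 1%:M)) d.
  - by exists 0.
  - by move=> X [].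
  - exact: Pcl.
  - move=> A L _ AL; apply: cvm_nm; apply: cvmB (cvm_cst _).
    by apply: cvmM (cvm_cst _); apply: cvm_expm; exact: cvmN.
  - by move=> X; exact: nm_ge0.
  by exists X.
have [X hX] := choice ex; exists X.
pose y k := expm (- X k) *m h k.
have Gy k : G (y k).
  apply: GM => //; have [[lX _] _] := hX k; have := lX (-1) _.
  by rewrite scaleN1r; apply; rewrite realN real1.
have y1 : cvm y 1%:M.
  apply: cvg0_leA h1 => k; have [_ /(_ 0 P0)] := hX k.
  by rewrite oppr0 expm0 mul1mx.
have X0 : cvm X 0.
  have c0 : 0 <= 2 * (cn (S := S) n * expR d) by rewrite mulr_ge0 // mulr_ge0 ?cn_ge0 ?expR_ge0.
  have c2 : 0 <= 2 :> R by [].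
  apply: cvg0_leA (cvg0D (cvg0Z c0 y1) (cvg0Z c2 h1)) => k; rewrite subr0.
  have [[_ Xd] _] := hX k; apply: le_trans (expm_inj_small Xd) _.
  rewrite -mulrA -mulrDr ler_wpM2l //.
  have -> : expm (X k) - 1%:M = - (expm (X k) *m (y k - 1%:M)) + (h k - 1%:M).
    by rewrite /y mulmxBr mulmx1 mulmxA expmV mul1mx opprB addrA subrK.
  apply: le_trans (nmD _ _) _; rewrite nmN lerD2r.
  apply: le_trans (nmM _ _) _; rewrite ler_wpM2r ?nm_ge0 //.
  apply: le_trans (expm_bound _) _; rewrite ler_wpM2l ?cn_ge0 //.
  by rewrite ler_expR.
split=> // [k|]; first by have [[]] := hX k.
suff h2 : \forall k \near \oo, y k = 1%:M.
  apply: filterS h2 => k yk; rewrite -[h k]mul1mx -(expmV (X k)) -mulmxA.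
  by rewrite -/(y k) yk mulmx1.
apply: contrapT => /notnear_subseq [phi hphi yphi].
pose e k := nm (y (phi k) - 1%:M).
have ep k : 0 < e k by rewrite nm_gt0 subr_eq0; apply/eqP/yphi.
have vb k : nm (io ((e k)^-1) *: (y (phi k) - 1%:M)) <= 1.
  by rewrite nmZ nc_io gtr0_norm ?invr_gt0 // mulVf ?gt_eqF.
have [psi hpsi [Y hY]] := bw_mx vb.
pose th k := phi (psi k).
have hth : subseq_ix th by move=> k; apply: leq_trans (hpsi k) (hphi _).
have e0 : cvg0 (e \o psi) by have := cvm_subseq hth y1; apply.
have lY : real_lie G Y.
  apply: (lie_direction cG (h := y \o th) (c := fun k => (e (psi k))^-1) _ _ _ hY).
  - by move=> k; exact: Gy.
  - exact: (cvm_subseq hth y1).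
  - by move=> k; rewrite invr_ge0 ltW.
have nY : nm Y <= 1 by apply: cvm_le_nm hY _; apply: nearW => k; exact: vb.
pose rho k := nm (X (th k)) + e (psi k).
have rho0 : cvg0 rho.
  apply: cvg0D e0; have := cvm_subseq hth X0; apply: cvg0_leA => k /=.
  by rewrite subr0.
(* Relative error of replacing [X] by [X + e Y]: nonlinearity of the exponential, deviation of the
   rescaled remainder from [Y], and [h - 1]. Once it is below 1 the new remainder is shorter than
   [e], against minimality. *)
pose er k := cn (S := S) n * (rho k * expR (rho k)) * (nm (1%:M : 'M[C]_n) + 1)
  + nm (io ((e (psi k))^-1) *: (y (th k) - 1%:M) - Y) + nm (h (th k) - 1%:M).
have hth1 := cvm_subseq hth h1.
have er0 : cvg0 er.
  apply: cvg0D hth1; apply: cvg0D hY.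
  have c0 : 0 <= cn (S := S) n * expR 1 * (nm (1%:M : 'M[C]_n) + 1).
    by rewrite !mulr_ge0 ?cn_ge0 ?expR_ge0 // addr_ge0 ?nm_ge0.
  apply: cvg0_le (cvg0Z c0 rho0); apply: filterS (rho0 1 ltr01) => k r1.
  have r0 : 0 <= rho k by rewrite addr_ge0 ?nm_ge0 // ltW.
  rewrite [leRHS]mulrAC ler_wpM2r ?addr_ge0 ?nm_ge0 // -mulrA ler_wpM2l ?cn_ge0 //.
  by rewrite mulrC ler_wpM2r // ler_expR ltW.
have [k [[rk erk] hk]] := near_ex (filterI (filterI (rho0 _ d0) (er0 1 ltr01)) (cvm_bd hth1)).
have [[lX Xd] /(_ (X (th k) + io (e (psi k)) *: Y))] := hX (th k).
have nY' : nm (io (e (psi k)) *: Y) <= e (psi k).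
  by rewrite nmZ nc_io gtr0_norm // ler_piMr // ltW.
have PY : P (X (th k) + io (e (psi k)) *: Y).
  split; first by apply: real_lieD => //; exact: real_lieZ.
  apply: le_trans (nmD _ _) _; apply: le_trans (ltW rk); rewrite /rho.
  by rewrite lerD2l.
move=> /(_ PY); apply/negP; rewrite -ltNge.
rewrite -/(y (th k)) -[ltRHS]/(e (psi k)).
set ee := e (psi k); have eep : 0 < ee := ep _.
have -> : expm (- (X (th k) + io ee *: Y)) *m h (th k) - 1%:M =
  (expm (- (X (th k) + io ee *: Y)) - expm (- X (th k)) - (- (X (th k) + io ee *: Y) - - X (th k)))
   *m h (th k) + io ee *: (io (ee^-1) *: (y (th k) - 1%:M) - Y)
   - io ee *: (Y *m (h (th k) - 1%:M)).
  have tele (a b c u z : 'M[C]_n) : a - b + c + (b - u - z) - (c - z) = a - u.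
    by apply/matrixP => i j; rewrite !mxE; ring.
  have -> : - (X (th k) + io ee *: Y) - - X (th k) = - (io ee *: Y).
    by rewrite opprD addrAC subrr add0r.
  have e1 : io ee * io (ee^-1) = 1 by rewrite -rmorphM divff ?gt_eqF // rmorph1.
  rewrite opprK scalerBr scalerA e1 scale1r mulmxDl mulmxBl -/(y (th k)).
  rewrite scalemxAl mulmxBr mulmx1; exact/esym/tele.
have n1 : nm (- (X (th k) + io ee *: Y)) <= rho k.
  by rewrite nmN; apply: le_trans (nmD _ _) _; rewrite lerD2l.
have n2 : nm (- X (th k)) <= rho k by rewrite nmN lerDl ltW.
have L1 := expm_lip n1 n2.
have L2 : nm (- (X (th k) + io ee *: Y) - - X (th k)) <= ee.
  by rewrite opprD addrAC opprK addNr add0r nmN.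
have r0 : 0 <= rho k * expR (rho k) by rewrite mulr_ge0 ?expR_ge0 // addr_ge0 ?nm_ge0 // ltW.
have L3 := le_trans L1 (ler_wpM2l (mulr_ge0 (cn_ge0 (S := S) n) r0) L2).
have L4 := ler_pM (nm_ge0 _) (nm_ge0 (h (th k))) L3 hk.
have L5 := le_trans (nmM _ _) L4.
have L6 : nm (io ee *: (Y *m (h (th k) - 1%:M))) <= ee * nm (h (th k) - 1%:M).
  rewrite nmZ nc_io gtr0_norm // ler_pM2l //; apply: le_trans (nmM _ _) _.
  by rewrite ler_piMl ?nm_ge0.
apply: le_lt_trans (nmD _ _) _; rewrite nmN.
apply: le_lt_trans (lerD (nmD _ _) L6) _.
rewrite [nm (io ee *: _)]nmZ nc_io gtr0_norm //.
have := ltr_pM2l eep (er k) 1; rewrite mulr1 => hh.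
have : ee * er k < ee by rewrite hh.
rewrite /er -/ee; move: L5; lra.
Qed.

Lemma closed_subgroup_nbhd G : closed_group G ->
  exists2 e : R, 0 < e & forall g, G g -> nm (g - 1%:M) < e ->
    exists2 X, real_lie G X & g = expm X.
Proof.
move=> cG; apply: contrapT => h.
have ex (k : nat) : exists g, [/\ G g, nm (g - 1%:M) < k.+1%:R^-1 &
    ~ exists2 X, real_lie G X & g = expm X].
  apply: contrapT => h1; apply: h; exists k.+1%:R^-1; first by rewrite invr_gt0.
  by move=> g Gg hg; apply: contrapT => h2; apply: h1; exists g.
have [g hg] := choice ex.
have g1 : cvm g 1%:M by apply: cvg0_leA cvg0_inv => k; have [_ /ltW] := hg k.
have [X [lX _ /near_ex [k hk]]] := closed_subgroup_exp cG (fun k => let: And3 a _ _ := hg k in a) g1.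
by have [_ _] := hg k; apply; exists (X k).
Qed.
End ClosedGroups.
End LieAlgebras.

Lemma poly_nat_eq0 (C : numClosedFieldType) (p : {poly C}) :
  (forall m : nat, p.[m%:R] = 0) -> p = 0.
Proof.
move=> h; apply: (@roots_geq_poly_eq0 _ _ [seq k%:R | k <- iota 0 (size p)]).
- by apply/allP => _ /mapP [k _ ->]; rewrite /root h.
- by rewrite map_inj_uniq ?iota_uniq // => a b /eqP; rewrite eqr_nat => /eqP.
- by rewrite size_map size_iota.
Qed.

Lemma mx_exprZ (C : numClosedFieldType) n (X : 'M[C]_n) c k : (c *: X) ^+ k = c ^+ k *: X ^+ k.
Proof.
elim: k => [|k IH]; first by rewrite !expr0 scale1r.
by rewrite !exprS IH -!mulmxE -scalemxAr -scalemxAl scalerA mulrC.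
Qed.

(** * Engel's theorem *)

Section Engel.
Context {C : numClosedFieldType} {n : nat}.
Implicit Types (U H : {vspace 'M[C]_n}) (x y : 'M[C]_n) (v : 'cV[C]_n).

(** Filtration of the column space by the vectors that every product of [a] elements of [U]
    annihilates; Engel's theorem says that it exhausts the space. *)
Fixpoint killed U (a : nat) v : Prop :=
  if a is a'.+1 then forall x, x \in U -> killed U a' (x *m v) else v = 0.

Definition bracket_closed U := forall x y, x \in U -> y \in U -> x *m y - y *m x \in U.

Lemma killedD U a v w : killed U a v -> killed U a w -> killed U a (v + w).
Proof.
elim: a v w => [|a IH] v w /=; first by move=> -> ->; rewrite addr0.
by move=> hv hw x xU; rewrite mulmxDr; apply: IH; [exact: hv | exact: hw].
Qed.
Lemma killedZ U a c v : killed U a v -> killed U a (c *: v).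
Proof.
elim: a v => [|a IH] v /=; first by move=> ->; rewrite scaler0.
by move=> hv x xU; rewrite -scalemxAr; apply: IH; exact: hv.
Qed.
Lemma killed0 U a : killed U a 0.
Proof. by elim: a => [|a IH] //= x xU; rewrite mulmx0. Qed.
Lemma killedB U a v w : killed U a v -> killed U a w -> killed U a (v - w).
Proof. by move=> hv hw; rewrite -scaleN1r; apply: killedD hv (killedZ _ hw). Qed.
Lemma killed_sum U a (I : Type) (r : seq I) (F : I -> 'cV[C]_n) :
  (forall i, killed U a (F i)) -> killed U a (\sum_(i <- r) F i).
Proof.
move=> h; elim: r => [|i r IH]; first by rewrite big_nil; exact: killed0.
by rewrite big_cons; exact: killedD.
Qed.
Lemma killedS U a v : killed U a v -> killed U a.+1 v.
Proof.
elim: a v => [|a IH] v; first by move=> /= -> x _; rewrite mulmx0.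
by move=> hv x xU; apply: IH; exact: hv.
Qed.
Lemma killed_le U a b v : (a <= b)%N -> killed U a v -> killed U b v.
Proof. by move=> /subnK <-; elim: (b - a)%N => [|k IH] // /IH /killedS. Qed.

(** Among the subalgebras of [U] whose filtration exhausts the space take [H] of largest dimension.
    If it is proper, some [y] in [U] outside [H] normalises it, and [H + <[y]>] still has an
    exhausting filtration. *)
Lemma engel U : bracket_closed U ->
  (forall x, x \in U -> exists k, x ^+ k = 0) -> exists k, forall v, killed U k v.
Proof.
move=> brU nilU.
pose Q (d : nat) := exists H, [/\ \dim H = d, (H <= U)%VS, bracket_closed H &
  exists k, forall v, killed H k v].
have Q0 : exists d, `[< Q d >].
  exists 0%N; apply/asboolP; exists 0%VS; split; rewrite ?dimv0 ?sub0v //.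
    by move=> x y; rewrite !memv0 => /eqP -> /eqP ->; rewrite mul0mx subrr.
  by exists 1%N => v x; rewrite memv0 => /eqP ->; rewrite mul0mx.
have Qb d : `[< Q d >] -> (d <= \dim U)%N by move=> /asboolP [H [<- HU _ _]]; exact: dimvS.
case: (ex_maxnP Q0 Qb) => d /asboolP [H [dH HU brH [k hk]]] dmax.
have [UH|UH] := boolP (U <= H)%VS.
  by exists k; have -> : U = H by apply/eqP; rewrite eqEsubv UH HU.
have /subvPn [y0 y0U y0H] := UH.
have [y [yU yH hy]] : exists y, [/\ y \in U, y \notin H &
    forall x, x \in H -> x *m y - y *m x \in H].
  apply: contrapT => noy.
  (* [Sh i y]: multiplication by [y] raises the level by at most [k - i]. If nothing outside [H]
     normalised [H], one could always bracket with [H] and stay outside it, gaining one step each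
     time; after [k + k] steps [y] would be 0. *)
  pose Sh i y := forall a v, killed H a v -> killed H (a + k - i) (y *m v).
  have step i : exists y, [/\ y \in U, y \notin H & Sh i y].
    elim: i => [|i [y [yU yH hy]]].
      exists y0; split=> // a v _; rewrite subn0.
      by apply: killed_le (leq_addl _ _) (hk _).
    have : ~ forall x, x \in H -> x *m y - y *m x \in H.
      by move=> h; apply: noy; exists y.
    move/existsNP => [x /not_implyP [xH xyH]]; exists (x *m y - y *m x); split.
    - by apply: brU => //; exact: (subvP HU).
    - exact/negP.
    move=> a v va; rewrite mulmxBl; apply: killedB.
      have := hy a v va; rewrite -mulmxA subnS; case: (a + k - i)%N => [|b] //=.
        by move=> ->; rewrite mulmx0.
      by move=> h; exact: h.
    rewrite -mulmxA; case: a va => [|a] va; first by rewrite va !mulmx0; exact: killed0.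
    by have := hy a (x *m v) (va x xH); apply: killed_le; lia.
  have [y [_ yH hy]] := step (k + k)%N; move/negP: yH; apply.
  have -> : y = 0; last exact: mem0v.
  apply/matrixP => i j; have := hy k (delta_mx j 0) (hk _).
  rewrite subnn /= => /matrixP /(_ i 0); rewrite -colE !mxE => ->.
  by [].
have [p hp] := nilU y yU.
pose H' := (H + <[y]>)%VS.
have H'P x : x \in H' -> exists h c, h \in H /\ x = h + c *: y.
  by case/memv_addP => h hH [_ /vlineP [c ->] ->]; exists h, c.
have : `[< Q (\dim H') >].
  apply/asboolP; exists H'; split=> //.
  - by rewrite subv_add HU -memvE.
  - move=> x1 x2 /H'P [h1 [c1 [h1H ->]]] /H'P [h2 [c2 [h2H ->]]].
    rewrite memvE; apply: (subv_trans _ (addvSl H _)); rewrite -memvE.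
    have -> : (h1 + c1 *: y) *m (h2 + c2 *: y) - (h2 + c2 *: y) *m (h1 + c1 *: y) =
      (h1 *m h2 - h2 *m h1) + c2 *: (h1 *m y - y *m h1) - c1 *: (h2 *m y - y *m h2).
      rewrite !(mulmxDl, mulmxDr) -!(scalemxAl, scalemxAr).
      move: (h1 *m h2) (h2 *m h1) (h1 *m y) (y *m h1) (h2 *m y) (y *m h2) (y *m y).
      by move=> m1 m2 m3 m4 m5 m6 m7; apply/matrixP => i j; rewrite !mxE; ring.
    apply: rpredB; [apply: rpredD|]; [exact: brH | |]; by apply: rpredZ; exact: hy.
  have pres a v : killed H a v -> killed H a (y *m v).
    elim: a v => [|a IH] v; first by move=> /= ->; rewrite mulmx0.
    move=> hv x xH; have -> : x *m (y *m v) = y *m (x *m v) + (x *m y - y *m x) *m v.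
      by rewrite mulmxBl !mulmxA addrC subrK.
    apply: killedD; first by apply: IH; exact: hv.
    by apply: hv; exact: hy.
  (* One level for [H] becomes [p] levels for [H + <[y]>], because [y ^ p = 0] and [y] preserves the
     filtration of [H]. *)
  have main a v : killed H a v -> killed H' (p * a) v.
    elim: a v => [|a IH] v; first by move=> /= ->; exact: killed0.
    have Qj j w : killed H a.+1 w -> killed H a (y ^+ j *m w) -> killed H' (p * a + j) w.
      elim: j w => [|j IHj] w w1 w2; first by rewrite addn0; apply: IH; rewrite expr0 mul1mx in w2.
      rewrite addnS => x /H'P [h [c [hH ->]]]; rewrite mulmxDl -scalemxAl.
      apply: killedD.
        by apply: killed_le (leq_addr _ _) _; apply: IH; exact: w1.
      apply: killedZ; apply: IHj; first exact: pres.
      by rewrite mulmxA mulmxE -exprSr.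
    by move=> hv; rewrite mulnS addnC; apply: Qj => //; rewrite hp mul0mx; exact: killed0.
  by exists (p * k)%N => v; apply: main.
move=> /dmax; rewrite -dH leqNgt => /negP; case.
rewrite ltn_neqAle dimvS ?addvSl // andbT; apply/negP => e.
have /eqP HH' : H == H' by rewrite eqEdim addvSl -(eqP e) leqnn.
by move/negP: yH; apply; rewrite HH' memvE addvSr.
Qed.

Lemma killedP U a v : killed U a v <-> forall s : seq 'M[C]_n, size s = a ->
  (forall x, x \in s -> x \in U) -> foldl (fun w x => x *m w) v s = 0.
Proof.
elim: a v => [|a IH] v /=.
  by split=> [-> [] //|/(_ [::]) /= h]; apply: h.
split=> [h [|x s] //= [sa] sU|h x xU].
  have /IH := h x (sU x (mem_head _ _)); apply; first by case: sa.
  by move=> y ys; apply: sU; rewrite inE ys orbT.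
apply/IH => s sa sU; apply: (h (x :: s)) => /=; first by rewrite sa.
by move=> y; rewrite inE => /orP [/eqP -> //|]; exact: sU.
Qed.
End Engel.

(** * The unipotent radical; differentials of regular functions and representations *)

Section Differentials.
Context {R : realType} {S : realform R}.
Local Notation C := (cC S).
Local Notation io := (@io R S).

Section UnipotentRadical.
Variables (n : nat) (G : set 'M[C]_n) (U : {vspace 'M[C]_n}).
Hypothesis (redG : reductive G).
Hypothesis (UG : forall g x, G g -> x \in U -> g *m x *m invmx g \in U).
Hypothesis (Ulie : forall x, x \in U -> lie_algebra G x).
Hypotheses (brU : bracket_closed U) (nilU : forall x, x \in U -> exists k, x ^+ k = 0).

Lemma geom_inv (g : 'M[C]_n) k : (1%:M - g) ^+ k = 0 ->
  g *m (\sum_(i < k) (1%:M - g) ^+ i) = 1%:M.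
Proof.
move=> gk.
suff h j : g *m (\sum_(i < j) (1%:M - g) ^+ i) = 1%:M - (1%:M - g) ^+ j by rewrite h gk subr0.
elim: j => [|j IH]; first by rewrite big_ord0 mulmx0 expr0 subrr.
rewrite big_ord_recr /= mulmxDr IH exprS -mulmxE mulmxBl mul1mx.
by rewrite opprB addrA addrAC.
Qed.

(** The elements of [G] acting as the identity on the graded pieces of the filtration of [U]: a
    normal unipotent subgroup containing [exp U], to which reductivity can be applied. *)
Let N : set 'M[C]_n := [set g | G g /\
  forall a v, killed U a.+1 v -> killed U a ((g - 1%:M) *m v)].

Lemma lowerP g : (forall a v, killed U a.+1 v -> killed U a ((g - 1%:M) *m v)) ->
  forall a v, killed U a v -> killed U a (g *m v).
Proof.
move=> h [|a] v hv; first by rewrite hv mulmx0.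
by rewrite -[g](subrK 1%:M) mulmxDl mul1mx; apply: killedD => //; apply: killedS; exact: h.
Qed.

Lemma lower_nil g k : (forall v, killed U k v) ->
  (forall a v, killed U a.+1 v -> killed U a ((g - 1%:M) *m v)) -> (g - 1%:M) ^+ k = 0.
Proof.
move=> hk h; suff hj j a v : killed U (a + j) v -> killed U a ((g - 1%:M) ^+ j *m v).
  apply/matrixP => i j; have := hj k 0%N (delta_mx j 0) (hk _).
  by rewrite /= => /matrixP /(_ i 0); rewrite -colE !mxE => ->.
elim: j v => [|j IH] v; first by rewrite addn0 expr0 mul1mx.
by rewrite addnS exprSr -mulmxE -mulmxA => /h; exact: IH.
Qed.

Lemma lower_inv g : (forall a v, killed U a.+1 v -> killed U a ((g - 1%:M) *m v)) ->
  g \in unitmx /\ forall a v, killed U a.+1 v -> killed U a ((invmx g - 1%:M) *m v).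
Proof.
move=> h; have [k hk] := engel brU nilU.
have nil := lower_nil hk h.
have nil' : (1%:M - g) ^+ k = 0 by rewrite -opprB exprNn nil mulr0.
have gi := geom_inv nil'; have [gu _] := mulmx1_unit gi; split=> // a v hv.
have -> : invmx g - 1%:M = - (g - 1%:M) *m invmx g.
  by rewrite mulNmx mulmxBl mulmxV // mul1mx opprB.
rewrite -mulmxA mulNmx -scaleN1r; apply: killedZ; apply: (h).
have -> : invmx g = \sum_(i < k) (1%:M - g) ^+ i by rewrite -[RHS](mulKmx gu) gi mulmx1.
rewrite mulmx_suml; apply: killed_sum => i; elim: (i : nat) => [|j IH].
  by rewrite expr0 mul1mx.
rewrite exprS -mulmxE -mulmxA mulmxBl mul1mx; apply: killedB => //.
exact: (lowerP h IH).
Qed.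

Lemma N_algebraic : algebraic_group N.
Proof.
have [[sG [Z [F Fp ZF] GZ]] _] := redG; have [GU G1 GM GV] := sG; split.
  split.
  - by move=> g [/GU].
  - by split=> // a v _; rewrite subrr mul0mx; exact: killed0.
  - move=> g h [Gg hg] [Gh hh]; split=> [|a v hv]; first exact: GM.
    have -> : g *m h - 1%:M = (g - 1%:M) *m h + (h - 1%:M).
      by rewrite mulmxBl mul1mx addrA subrK.
    rewrite mulmxDl -mulmxA; apply: killedD; last exact: hh.
    by apply: hg; exact: lowerP.
  - by move=> g [Gg hg]; split; [exact: GV | exact: (lower_inv hg).2].
(* Lowering the filtration is a family of polynomial equations in [g]: one for each vector, word in
   [U] and coordinate. *)
pose F' := F `|` [set f | exists a v s i, [/\ killed U a.+1 v, size s = a,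
  (forall x, x \in s -> x \in U) &
  f = fun g : 'M[C]_n => (foldl (fun w x => x *m w) ((g - 1%:M) *m v) s) i (0 : 'I_1)]].
exists [set g | forall f, F' f -> f g = 0].
  exists F' => // f [/Fp //|[a [v [s [i [_ _ _ ->]]]]]].
  have : forall i : 'I_n, polyf (fun g : 'M[C]_n => ((g - 1%:M) *m v) i (0 : 'I_1)).
    move=> j; apply: (polyf_mulmx (p := 1)) => [k l|k l]; last exact: polyf_cst.
    apply: (@polyf_ext _ _ (fun g : 'M[C]_n => g k l - (1%:M : 'M[C]_n) k l)).
      by move=> g; rewrite !mxE.
    exact: polyfB (polyf_entry _ _) (polyf_cst _).
  elim/last_ind: s i => [|s x IH] i h; first exact: h.
  apply: (@polyf_ext _ _ (fun g : 'M[C]_n =>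
    (x *m foldl (fun w x => x *m w) ((g - 1%:M) *m v) s) i 0)).
    by move=> g; rewrite foldl_rcons.
  apply: (polyf_mulmx (p := 1)) => [k l|k l]; first exact: polyf_cst.
  rewrite ord1; exact: IH.
rewrite eqEsubset; split=> g.
  move=> [Gg hg]; split; first exact: GU.
  move=> f [Ff|[a [v [s [i [hv sa sU ->]]]]]].
    by move: Gg; rewrite GZ ZF => -[_]; apply.
  by have /killedP := hg a v hv => /(_ s sa sU) ->; rewrite mxE.
move=> [gu hg]; split.
  by rewrite GZ ZF; split=> // f Ff; apply: hg; left.
move=> a v hv; apply/killedP => s sa sU; apply/matrixP => i j; rewrite ord1 [RHS]mxE.
by apply: (hg (fun g : 'M[C]_n => (foldl (fun w x => x *m w) ((g - 1%:M) *m v) s) i (0 : 'I_1))); right; exists a, v, s, i.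
Qed.

(** The binomial coefficient as a polynomial in its upper argument, which makes the powers [u ^ m]
    of a unipotent matrix polynomial in [m]. *)
Definition bin_poly (j : nat) : {poly C} := (j`!%:R)^-1 *: \prod_(i < j) ('X - i%:R%:P).
Lemma bin_polyE j m : (bin_poly j).[m%:R] = 'C(m, j)%:R.
Proof.
rewrite hornerZ horner_prod.
have fj : j`!%:R != 0 :> C by rewrite pnatr_eq0 -lt0n fact_gt0.
apply: (mulfI fj); rewrite mulrA mulfV // mul1r -natrM mulnC bin_ffact.
elim: j {fj} => [|j IH]; first by rewrite big_ord0 ffactn0.
rewrite big_ord_recr /= IH ffactnSr natrM !hornerE.
have [jm|mj] := leqP j m; first by rewrite natrB.
by rewrite ffact_small // !mul0r.
Qed.

Lemma unip_curve (u : 'M[C]_n) k : (u - 1%:M) ^+ k = 0 ->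
  exists p : 'I_n -> 'I_n -> {poly C}, forall m : nat,
    \matrix_(i, j) (p i j).[m%:R] = u ^+ m.
Proof.
move=> uk; exists (fun i j => \sum_(l < k) ((u - 1%:M) ^+ l) i j *: bin_poly l) => m.
have -> : u ^+ m = \sum_(l < k) (u - 1%:M) ^+ l *+ 'C(m, l).
  rewrite -{1}[u](subrK 1%:M) exprDn_comm; last by rewrite /GRing.comm mulr1 mul1r.
  transitivity (\sum_(l < m.+1) (u - 1%:M) ^+ l *+ 'C(m, l)).
    rewrite (reindex_inj rev_ord_inj) /=; apply: eq_bigr => l _.
    have lm : (l <= m)%N by rewrite -ltnS.
    by rewrite subSS subKn // bin_sub // expr1n mulr1.
  rewrite -!(big_mkord xpredT (fun l => (u - 1%:M) ^+ l *+ 'C(m, l))).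
  have [km|mk] := leqP k m.+1.
    rewrite (big_cat_nat (n := k)) //= [X in _ + X]big1_seq ?addr0 // => i /=.
    rewrite mem_index_iota => /andP [ki _].
    by rewrite -(subnK ki) exprD uk mulr0 mul0rn.
  rewrite [RHS](big_cat_nat (n := m.+1)) //=; last exact: ltnW.
  rewrite [X in _ = _ + X]big1_seq ?addr0 // => i /=.
  by rewrite mem_index_iota => /andP [mi _]; rewrite bin_small // mulr0n.
apply/matrixP => i j; rewrite mxE summxE horner_sum; apply: eq_bigr => l _.
by rewrite hornerZ bin_polyE mulmxnE mulr_natr.
Qed.

Lemma polyf_curve (p : 'I_n -> 'I_n -> {poly C}) f : polyf f ->
  exists q : {poly C}, forall s, q.[s] = f (\matrix_(i, j) (p i j).[s]).
Proof.
move: f; apply: polyf_indmx.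
- by move=> c; exists c%:P => s; rewrite hornerC.
- by move=> f g [q hq] [q' hq']; exists (q + q') => s; rewrite hornerD hq hq'.
- by move=> f g [q hq] [q' hq']; exists (q * q') => s; rewrite hornerM hq hq'.
- by move=> i j; exists (p i j) => s; rewrite mxE.
Qed.

(** Interpolating the powers of [u] gives a polynomial curve from 1 to [u], inside [N] because it is
    so at all naturals. Along it the product of an equation of [A] and an equation of [B] is the
    zero polynomial, so one factor is; hence [u] lies in the same closed set as 1. *)
Lemma N_connected : zariski_connected N.
Proof.
have [sN [Z [F Fp ZF] NZ]] := N_algebraic.
have [k hk] := engel brU nilU.
have curve u : N u -> exists p : 'I_n -> 'I_n -> {poly C},
    [/\ \matrix_(i, j) (p i j).[0] = 1%:M, \matrix_(i, j) (p i j).[1] = u &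
     forall s, N (\matrix_(i, j) (p i j).[s])].
  move=> Nu; have [Gu hu] := Nu; have [p hp] := unip_curve (lower_nil hk hu).
  exists p; split; [by rewrite (hp 0%N) | by rewrite (hp 1%N) expr1 |].
  have Zs s f : F f -> f (\matrix_(i, j) (p i j).[s]) = 0.
    move=> Ff; have [q hq] := polyf_curve p (Fp f Ff).
    rewrite -hq (@poly_nat_eq0 _ q) ?horner0 // => m; rewrite hq hp.
    by have := group_expX m sN Nu; rewrite {1}NZ ZF => -[_]; apply.
  move=> s; have low a v : killed U a.+1 v -> killed U a ((\matrix_(i, j) (p i j).[s] - 1%:M) *m v).
    move=> hv; apply/killedP => t ta tU; apply/matrixP => i j; rewrite ord1 [RHS]mxE.
    pose f (g : 'M[C]_n) := (foldl (fun w x => x *m w) ((g - 1%:M) *m v) t) i (0 : 'I_1).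
    have pf : polyf f.
      rewrite /f; elim/last_ind: t {ta tU f} i => [|t x IH] i.
        apply: (polyf_mulmx (p := 1)) => [b l|b l]; last exact: polyf_cst.
        apply: (@polyf_ext _ _ (fun g : 'M[C]_n => g b l - (1%:M : 'M[C]_n) b l)).
          by move=> g; rewrite !mxE.
        exact: polyfB (polyf_entry _ _) (polyf_cst _).
      apply: (@polyf_ext _ _ (fun g : 'M[C]_n =>
        (x *m foldl (fun w x => x *m w) ((g - 1%:M) *m v) t) i 0)).
        by move=> g; rewrite foldl_rcons.
      apply: (polyf_mulmx (p := 1)) => [b l|b l]; first exact: polyf_cst.
      rewrite ord1; exact: IH.
    have [q hq] := polyf_curve p pf; rewrite -/(f _) -hq (@poly_nat_eq0 _ q) ?horner0 // => m.
    rewrite hq hp /f; have [_ hm] := group_expX m sN Nu.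
    by have /killedP := hm a v hv => /(_ t ta tU) ->; rewrite mxE.
  rewrite NZ; split; last by rewrite ZF => f; exact: Zs.
  by case: (lower_inv low).
move=> A B.
wlog A1 : A B / A 1%:M => [hw cA cB NAB AB0|].
  have [_ N1 _ _] := sN; have [A1|B1] := NAB _ N1; first exact: (hw A B).
  have [||h|h] := hw B A B1 cB cA; rewrite 1?setUC 1?setIAC //; by [right | left].
move=> [FA FAp AF] [FB FBp BF] NAB AB0; left => u Nu.
have [p [p0 p1 ps]] := curve u Nu.
rewrite AF => f Ff; apply: contrapT => fu.
have B1 : B 1%:M.
  rewrite BF => g Fg; have [qf hqf] := polyf_curve p (FAp f Ff).
  have [qg hqg] := polyf_curve p (FBp g Fg).
  have q0 : qf * qg = 0.
    apply: poly_nat_eq0 => m; rewrite hornerM hqf hqg.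
    have [] := NAB _ (ps m%:R); first by rewrite AF => /(_ f Ff) ->; rewrite mul0r.
    by rewrite BF => /(_ g Fg) ->; rewrite mulr0.
  move/eqP: q0; rewrite mulf_eq0 => /orP [/eqP qf0|/eqP qg0].
    by case: fu; rewrite -p1 -hqf qf0 horner0.
  by rewrite -p0 -hqg qg0 horner0.
have [_ N1 _ _] := sN.
have : (N `&` A `&` B) 1%:M by [].
by rewrite AB0.
Qed.

(** [N] is trivial by reductivity and contains every [exp (s x)], while the exponential is injective
    near 0. *)
Lemma nil_ideal0 x : x \in U -> x = 0.
Proof.
move=> xU; have [[sG _] hred] := redG; have [GU G1 GM GV] := sG.
have stab g a v : G g -> killed U a v -> killed U a (g *m v).
  move=> Gg; elim: a v => [|a IH] v; first by move=> /= ->; rewrite mulmx0.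
  move=> hv y yU; have -> : y *m (g *m v) = g *m (invmx g *m y *m g *m v).
    by rewrite !mulmxA mulmxV ?mul1mx // GU.
  by apply: IH; apply: hv; have := UG (GV _ Gg) yU; rewrite invmxK.
have N1 : N = [set 1%:M].
  apply: hred; [exact: N_algebraic | exact: N_connected | split |].
  - by move=> g [].
  - move=> g u Gg [Gu hu]; split=> [|a v hv]; first by apply: (GM) => //; [exact: GM | exact: GV].
    have -> : (g *m u *m invmx g - 1%:M) *m v = g *m ((u - 1%:M) *m (invmx g *m v)).
      by rewrite -[1%:M in LHS](mulmxV (GU _ Gg)) -mulmxBl !mulmxA mulmxBr mulmx1.
    by apply: (stab) => //; apply: (hu); apply: (stab) => //; exact: GV.
  - move=> u [_ hu]; have [k hk] := engel brU nilU.
    by exists k; exact: lower_nil hk hu.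
have exN s : N (expm (s *: x)).
  split=> [|a v hv]; first exact: Ulie.
  have [k xk] := nilU xU.
  have [k' ->] : exists k', expm (s *: x) = epart (s *: x) k'.+1.
    exists k; apply: expm_nilp; rewrite mx_exprZ (exprS x) xk mulr0 scaler0 //.
  rewrite /epart big_ord_recl /= expr0 fact0 invr1 scale1r addrAC subrr add0r.
  rewrite mulmx_suml; apply: killed_sum => i; rewrite -scalemxAl; apply: killedZ.
  rewrite mx_exprZ -scalemxAl; apply: killedZ; rewrite /bump /= add1n.
  elim: (i : nat) => [|j IH]; first by rewrite expr1; exact: hv.
  rewrite exprS -mulmxE -mulmxA.
  have : killed U a (x ^+ j.+1 *m v) by [].
  case: a hv {IH} => [|a] hv h; first by rewrite h mulmx0.
  by apply: killedS; exact: h.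
have [->//|x0] := eqVneq x 0.
pose t := small_rad (S := S) n / nm x.
have nx : 0 < nm x by rewrite nm_gt0.
have t0 : 0 < t by rewrite divr_gt0 ?small_rad_gt0.
have h := exN (io t); rewrite N1 in h.
have := @expm_inj_small _ _ _ (io t *: x).
rewrite h subrr nm0 mulr0 nmZ nc_io gtr0_norm // /t divfK ?gt_eqF // => /(_ (lexx _)).
by move=> h1; have := small_rad_gt0 (S := S) n; rewrite ltNge h1.
Qed.
End UnipotentRadical.

Section DifferentialAtOne.
Variable n : nat.
Implicit Types (f g : 'M[C]_n -> C) (D X Y Z : 'M[C]_n).

Definition dl D Z : C := \sum_i \sum_j Z i j * D i j.

(** Differentiability at 1 is tested along every sequence [1 + A k] with a rescaled limit, not along
    lines only, so that it applies directly to exponentials; [D] is the gradient, paired by [dl]. *)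
Definition diff1 f D : Prop := forall (A : nat -> 'M[C]_n) (e : nat -> R) Z,
  cvg0 e -> (forall k, 0 < e k) -> cvm (fun k => io ((e k)^-1) *: A k) Z ->
  cvs (fun k => io ((e k)^-1) * (f (1%:M + A k) - f 1%:M)) (dl D Z).

Lemma cvs_io (e : nat -> R) l : cvg0 (fun k => `|e k - l|) -> cvs (fun k => io (e k)) (io l).
Proof. by apply: cvg0_leA => k; rewrite -rmorphB nc_io. Qed.

Lemma cvs_io0 (e : nat -> R) : cvg0 e -> (forall k, 0 < e k) -> cvs (fun k => io (e k)) 0.
Proof.
move=> e0 ep; rewrite -[X in cvs _ X](rmorph0 io); apply: cvs_io.
by apply: cvg0_leA e0 => k; rewrite subr0 gtr0_norm.
Qed.

Lemma diff1_cvs f D (A : nat -> 'M[C]_n) (e : nat -> R) Z : diff1 f D ->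
  cvg0 e -> (forall k, 0 < e k) -> cvm (fun k => io ((e k)^-1) *: A k) Z ->
  cvs (fun k => f (1%:M + A k)) (f 1%:M).
Proof.
move=> fD e0 ep h; have h1 := cvsM (cvs_io0 e0 ep) (fD _ _ _ e0 ep h).
have h2 := cvsD (cvs_cst (f 1%:M)) h1; rewrite mul0r addr0 in h2.
apply: cvs_ext h2 => k; rewrite mulrA -rmorphM mulfV ?gt_eqF // (rmorph1 io) mul1r.
by rewrite addrC subrK.
Qed.

Lemma dlD D1 D2 Z : dl (D1 + D2) Z = dl D1 Z + dl D2 Z.
Proof.
rewrite -big_split; apply: eq_bigr => i _; rewrite -big_split; apply: eq_bigr => j _.
by rewrite mxE mulrDr.
Qed.
Lemma dlZ a D Z : dl (a *: D) Z = a * dl D Z.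
Proof.
rewrite mulr_sumr; apply: eq_bigr => i _; rewrite mulr_sumr; apply: eq_bigr => j _.
by rewrite mxE mulrCA.
Qed.
Lemma dl_linear D a X Y : dl D (a *: X + Y) = a * dl D X + dl D Y.
Proof.
rewrite mulr_sumr -big_split; apply: eq_bigr => i _ /=.
rewrite mulr_sumr -big_split; apply: eq_bigr => j _ /=.
by rewrite !mxE mulrDl mulrA.
Qed.

Lemma diff1_cst c : diff1 (fun=> c) 0.
Proof.
move=> A e Z _ _ _; have -> : dl 0 Z = 0.
  by rewrite /dl big1 // => i _; rewrite big1 // => j _; rewrite mxE mulr0.
by apply: cvs_ext (cvs_cst 0) => k; rewrite subrr mulr0.
Qed.
Lemma diff1_add f g D1 D2 : diff1 f D1 -> diff1 g D2 -> diff1 (fun X => f X + g X) (D1 + D2).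
Proof.
move=> h1 h2 A e Z e0 ep h; rewrite dlD.
apply: cvs_ext (cvsD (h1 _ _ _ e0 ep h) (h2 _ _ _ e0 ep h)) => k; ring.
Qed.
Lemma diff1_mul f g D1 D2 : diff1 f D1 -> diff1 g D2 ->
  diff1 (fun X => f X * g X) (g 1%:M *: D1 + f 1%:M *: D2).
Proof.
move=> h1 h2 A e Z e0 ep h; rewrite dlD !dlZ [g _ * _]mulrC.
have := cvsD (cvsM (h1 _ _ _ e0 ep h) (diff1_cvs h2 e0 ep h))
  (cvsM (cvs_cst (f 1%:M)) (h2 _ _ _ e0 ep h)).
by apply: cvs_ext => k; ring.
Qed.
Lemma diff1_inv f D : f 1%:M != 0 -> diff1 f D ->
  diff1 (fun X => (f X)^-1) (- (f 1%:M ^- 2) *: D).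
Proof.
move=> f1 hf A e Z e0 ep h; have hc := diff1_cvs hf e0 ep h.
have := cvsM (cvs_cst (- (f 1%:M)^-1)) (cvsM (hf _ _ _ e0 ep h) (cvsV hc f1)).
rewrite dlZ (_ : - _ * (_ * _) = - f 1%:M ^- 2 * dl D Z); last by rewrite -exprVn; ring.
apply: cvs_near; have [N _ hN] := cvs_neq0 hc f1; exists N => // k /= Nk.
have fk : f (1%:M + A k) != 0.
  by rewrite -(@nc_gt0 R S); apply: lt_le_trans (hN k Nk); rewrite divr_gt0 ?nc_gt0.
move: (f (1%:M + A k)) fk (f 1%:M) f1 (io (e k)^-1) => a a0 b b0 c.
by field; rewrite a0 b0.
Qed.
Lemma diff1_entry i j : diff1 (fun X => X i j) (delta_mx i j).
Proof.
move=> A e Z e0 ep h; have -> : dl (delta_mx i j) Z = Z i j.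
  rewrite /dl (bigD1 i) //= (bigD1 j) //= !mxE !eqxx mulr1.
  rewrite big1 ?addr0 => [|l /negPf lj]; last by rewrite mxE lj andbF mulr0.
  rewrite big1 ?addr0 // => l /negPf li; rewrite big1 // => l' _.
  by rewrite mxE li mulr0.
apply: cvs_ext (cvm_entry i j h) => k; rewrite !mxE; ring.
Qed.

Lemma polyf_diff1 f : polyf f -> exists D, diff1 f D.
Proof.
move: f; apply: polyf_indmx => [c|f g [D1 h1] [D2 h2]|f g [D1 h1] [D2 h2]|i j].
- by exists 0; exact: diff1_cst.
- by exists (D1 + D2); exact: diff1_add.
- by eexists; exact: diff1_mul h1 h2.
- by exists (delta_mx i j); exact: diff1_entry.
Qed.

Lemma polyf_detX k : polyf (fun X : 'M[C]_n => \det X ^+ k).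
Proof. by apply: polyfX; apply: polyf_det => i j; exact: polyf_entry. Qed.

Lemma regular_diff1 G f : regular_on G f ->
  exists f' D, (forall X, G X -> f X = f' X) /\ diff1 f' D.
Proof.
move=> [p [k [pp hf]]]; have [D1 h1] := polyf_diff1 pp.
have [D2 h2] := polyf_diff1 (polyf_detX k).
have d1 : \det (1%:M : 'M[C]_n) ^+ k != 0 by rewrite det1 expr1n oner_neq0.
exists (fun X => p X / \det X ^+ k); eexists; split=> //.
exact: diff1_mul h1 (diff1_inv d1 h2).
Qed.

Lemma regular_cvs G f (A : nat -> 'M[C]_n) L : G `<=` GL -> regular_on G f ->
  (forall k, G (A k)) -> G L -> cvm A L -> cvs (fun k => f (A k)) (f L).
Proof.
move=> GU [p [k [pp hf]]] GA GLL h; rewrite hf //.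
have := cvsM (polyf_cvs pp h) (cvsV (polyf_cvs (polyf_detX k) h) _).
rewrite expf_neq0 -?unitfE -?[_ \is a GRing.unit]/(L \in unitmx) ?GU // => /(_ isT).
by apply: cvs_ext => l; rewrite hf.
Qed.

Lemma expm_curve_inj (X Y : 'M[C]_n) :
  (forall t : R, expm (io t *: X) = expm (io t *: Y)) -> X = Y.
Proof.
move=> h; have ep k : 0 < k.+1%:R^-1 :> R by rewrite invr_gt0.
apply: (cvm_uniq (expm_quot (cvm_cst X) cvg0_inv ep)).
by apply: cvm_ext (expm_quot (cvm_cst Y) cvg0_inv ep) => k; rewrite h.
Qed.
End DifferentialAtOne.

Section RepresentationDifferential.
Variables (n m : nat) (G : set 'M[C]_n) (r : 'M[C]_n -> 'M[C]_m).
Hypothesis sG : subgroup G.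
Hypothesis r1 : r 1%:M = 1%:M.
Hypothesis rM : forall g h, G g -> G h -> r (g *m h) = r g *m r h.
Hypothesis rreg : forall i j, regular_on G (fun g => r g i j).

Lemma rep_X g k : G g -> r (g ^+ k) = r g ^+ k.
Proof.
move=> Gg; elim: k => [|k IH]; first by rewrite !expr0.
by rewrite !exprS -!mulmxE rM ?IH //; exact: group_expX.
Qed.

Lemma rep_V g : G g -> r (invmx g) *m r g = 1%:M.
Proof. by case: sG => GU _ _ GV Gg; rewrite -rM ?mulVmx ?GU //; exact: GV. Qed.

Lemma rep_unit g : G g -> r g \in unitmx.
Proof. by move/rep_V/mulmx1_unit => []. Qed.

Lemma rep_inv g : G g -> r (invmx g) = invmx (r g).
Proof.
move=> Gg; rewrite -[LHS]mulmx1 -(mulmxV (rep_unit Gg)) mulmxA rep_V // mul1mx //.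
Qed.

Lemma rep_cvm (A : nat -> 'M[C]_n) L : (forall k, G (A k)) -> G L -> cvm A L ->
  cvm (fun k => r (A k)) (r L).
Proof.
by case: sG => GU _ _ _ GA GLL h; apply: cvm_entries => i j; exact: (regular_cvs GU (rreg i j)).
Qed.

(** The entries of [r] extend to rational functions differentiable at 1, whose gradients make up
    [dr]; its values outside the Lie algebra depend on the extensions. Writing [exp (t X)] as a
    [k]-th power and letting [k] grow gives the exponential on the other side. *)
Lemma rep_differential : exists dr : {linear 'M[C]_n -> 'M[C]_m},
  forall X, real_lie G X -> forall t : R, r (expm (io t *: X)) = expm (io t *: dr X).
Proof.
have /choice [F hF] : forall x : 'I_m * 'I_m, exists x' : ('M[C]_n -> C) * 'M[C]_n,
    (forall g, G g -> r g x.1 x.2 = x'.1 g) /\ diff1 x'.1 x'.2.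
  by move=> x; have [f' [D h]] := regular_diff1 (rreg x.1 x.2); exists (f', D).
pose dr X : 'M[C]_m := \matrix_(i, j) dl (F (i, j)).2 X.
have lin : linear dr by move=> a X Y; apply/matrixP => i j; rewrite !mxE dl_linear.
pose l := GRing.isLinear.Build C _ _ _ dr lin.
pose L : {linear 'M[C]_n -> 'M[C]_m} := HB.pack dr l.
exists L => X XG t.
have [GU G1 _ _] := sG.
have GX s : G (expm (io s *: X)) by apply/real_lieP: s.
have ep k : 0 < k.+1%:R^-1 :> R by rewrite invr_gt0.
have q := expm_quot (cvm_cst (io t *: X)) (@cvg0_inv R) ep.
have hd : cvm (fun k => io (k.+1%:R^-1)^-1 *:
    (r (expm (io k.+1%:R^-1 *: (io t *: X))) - 1%:M)) (dr (io t *: X)).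
  apply: cvm_entries => i j; have [h1 h2] := hF (i, j).
  have := h2 (fun k => expm (io k.+1%:R^-1 *: (io t *: X)) - 1%:M) _ _ (@cvg0_inv R) ep q.
  rewrite [dr _ i j]mxE; apply: cvs_ext => k; rewrite [_ + (_ - _)]addrC subrK.
  rewrite -h1; last by rewrite scalerA -rmorphM; exact: GX.
  by rewrite -[(F (i, j)).1 1%:M]h1 // r1 !mxE.
have lt : dr (io t *: X) = io t *: dr X.
  apply/matrixP => i j; rewrite !mxE /dl mulr_sumr; apply: eq_bigr => k _.
  by rewrite mulr_sumr; apply: eq_bigr => k' _; rewrite mxE mulrA.
rewrite -[L X]/(dr X) -lt.
pose A k := r (expm (io k.+1%:R^-1 *: (io t *: X))) - 1%:M.
have hA : cvm (fun k => k.+1%:R *: A k) (dr (io t *: X)).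
  by apply: cvm_ext hd => k; rewrite invrK rmorph_nat.
have A0 : cvm A 0.
  have := cvmZ (cvs_io0 (@cvg0_inv R) ep) hd; rewrite scale0r.
  by apply: cvm_ext => k; rewrite scalerA -rmorphM mulfV ?gt_eqF ?invr_gt0 // rmorph1 scale1r.
apply: cvm_uniq (expm_pow_lim A0 hA).
apply: cvm_ext (cvm_cst _) => k; rewrite /A addrC subrK -rep_X; last first.
  by rewrite scalerA -rmorphM.
rewrite -expm_mulrn scalerA -(rmorph_nat io) -rmorphM mulfV ?pnatr_eq0 // rmorph1 scale1r //.
Qed.
End RepresentationDifferential.
End Differentials.

(* Operators on ['M_n] are matrices of size [n * n] acting on the right of [mxvec], so the
   product [Q1 *m Q2] applies [Q1] first. *)
Section Operators.
Context {C : numClosedFieldType} {n : nat}.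
Local Notation N := (n * n)%N.
Implicit Types (Q P : 'M[C]_N) (x y z : 'M[C]_n).

Definition ap Q x : 'M[C]_n := vec_mx (mxvec x *m Q).
Definition br x y : 'M[C]_n := x *m y - y *m x.
Definition Lm x : 'M[C]_N := lin_mulmx x.
Definition Rm x : 'M[C]_N := lin_mulmxr x.
(* Locked so that rewriting with the rules for sums and products does not unfold them. *)
Definition adm x : 'M[C]_N := locked (Lm x - Rm x).
Definition Adm g : 'M[C]_N := locked (Lm g *m Rm (invmx g)).

Lemma apD Q x y : ap Q (x + y) = ap Q x + ap Q y.
Proof. by rewrite /ap linearD mulmxDl linearD. Qed.
Lemma apZ Q a x : ap Q (a *: x) = a *: ap Q x.
Proof. by rewrite /ap linearZ -scalemxAl linearZ. Qed.
Lemma apB Q x y : ap Q (x - y) = ap Q x - ap Q y.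
Proof. by rewrite -scaleN1r apD apZ scaleN1r. Qed.
Lemma ap0 Q : ap Q 0 = 0.
Proof. by have := apZ Q 0 0; rewrite !scale0r. Qed.
Lemma ap_sum Q (I : Type) (r : seq I) (F : I -> 'M[C]_n) :
  ap Q (\sum_(i <- r) F i) = \sum_(i <- r) ap Q (F i).
Proof. by rewrite /ap linear_sum mulmx_suml linear_sum. Qed.
Lemma apDl Q P x : ap (Q + P) x = ap Q x + ap P x.
Proof. by rewrite /ap mulmxDr linearD. Qed.
Lemma apZl a Q x : ap (a *: Q) x = a *: ap Q x.
Proof. by rewrite /ap -scalemxAr linearZ. Qed.
Lemma apNl Q x : ap (- Q) x = - ap Q x.
Proof. by rewrite -scaleN1r apZl scaleN1r. Qed.
Lemma apBl Q P x : ap (Q - P) x = ap Q x - ap P x.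
Proof. by rewrite apDl apNl. Qed.
Lemma ap_suml (I : Type) (r : seq I) (F : I -> 'M[C]_N) x :
  ap (\sum_(i <- r) F i) x = \sum_(i <- r) ap (F i) x.
Proof. by rewrite /ap mulmx_sumr linear_sum. Qed.
Lemma apM Q P x : ap (Q *m P) x = ap P (ap Q x).
Proof. by rewrite /ap vec_mxK mulmxA. Qed.
Lemma ap1 x : ap 1%:M x = x.
Proof. by rewrite /ap mulmx1 mxvecK. Qed.
Lemma apLm x y : ap (Lm x) y = x *m y.
Proof. by rewrite /ap mul_vec_lin mxvecK. Qed.
Lemma apRm x y : ap (Rm x) y = y *m x.
Proof. by rewrite /ap mul_vec_lin mxvecK. Qed.
Lemma apadm x y : ap (adm x) y = br x y.
Proof. by rewrite /adm -lock apBl apLm apRm. Qed.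
Lemma apAdm g x : ap (Adm g) x = g *m x *m invmx g.
Proof. by rewrite /Adm -lock apM apLm apRm. Qed.
Lemma ap_ext Q P : (forall x, ap Q x = ap P x) -> Q = P.
Proof.
move=> h; apply/row_matrixP => i; rewrite !rowE.
have := congr1 mxvec (h (vec_mx (delta_mx 0 i))).
by rewrite /ap !vec_mxK.
Qed.

Lemma LmM x y : Lm x *m Lm y = Lm (y *m x).
Proof. by apply: ap_ext => z; rewrite apM !apLm mulmxA. Qed.
Lemma RmM x y : Rm x *m Rm y = Rm (x *m y).
Proof. by apply: ap_ext => z; rewrite apM !apRm mulmxA. Qed.
Lemma LmRm x y : Lm x *m Rm y = Rm y *m Lm x.
Proof. by apply: ap_ext => z; rewrite !apM !apLm !apRm mulmxA. Qed.

Lemma br_trA x y z : \tr (br x y *m z) = \tr (x *m br y z).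
Proof.
rewrite mulmxBl mulmxBr !linearB /= mulmxA; congr (_ - _).
by rewrite mxtrace_mulC mulmxA mxtrace_mulC !mulmxA.
Qed.
Lemma brN x y : br x y = - br y x.
Proof. by rewrite opprB. Qed.
Lemma brDl x y z : br (x + y) z = br x z + br y z.
Proof. by rewrite /br mulmxDl mulmxDr opprD addrACA. Qed.
Lemma brZl a x y : br (a *: x) y = a *: br x y.
Proof. by rewrite /br -scalemxAl -scalemxAr scalerBr. Qed.
Lemma brDr x y z : br x (y + z) = br x y + br x z.
Proof. by rewrite /br mulmxDl mulmxDr opprD addrACA. Qed.
Lemma brZr a x y : br x (a *: y) = a *: br x y.
Proof. by rewrite /br -scalemxAl -scalemxAr scalerBr. Qed.
Lemma jacobi x y z : br x (br y z) = br (br x y) z + br y (br x z).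
Proof.
rewrite /br !(mulmxBl, mulmxBr) !mulmxA.
move: (x *m y *m z) (x *m z *m y) (y *m z *m x) (z *m y *m x) (y *m x *m z) (z *m x *m y).
by move=> a b c d e f; apply/matrixP => i j; rewrite !mxE; ring.
Qed.
Lemma adm_br x y : adm (br x y) = adm y *m adm x - adm x *m adm y.
Proof. by apply: ap_ext => z; rewrite apadm apBl !apM !apadm (jacobi x y z) addrK. Qed.
Lemma adm_conj g x : g \in unitmx -> adm (g *m x *m invmx g) = Adm (invmx g) *m adm x *m Adm g.
Proof.
move=> gu; apply: ap_ext => z; rewrite apadm (apM (_ *m _) (Adm g)) (apM (Adm _) (adm _)) apadm !apAdm.
rewrite invmxK /br mulmxBr mulmxBl.
by rewrite !mulmxA mulmxV // mul1mx mulmxK.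
Qed.
Lemma AdmV g : g \in unitmx -> Adm g *m Adm (invmx g) = 1%:M.
Proof.
move=> gu; apply: ap_ext => z; rewrite apM !apAdm ap1 invmxK !mulmxA mulVmx //.
by rewrite mul1mx mulmxKV.
Qed.

Lemma mxvec_dot x y : mxvec x *m (mxvec y)^T = (\tr (x *m y^T))%:M.
Proof.
apply/matrixP => i j; rewrite !ord1 !mxE eqxx mulr1n.
under eq_bigr do rewrite mxE.
rewrite (reindex (uncurry (@mxvec_index n n))) /=; last exact: curry_mxvec_bij.
under [RHS]eq_bigr do rewrite mxE; rewrite [RHS]pair_bigA /=.
by apply: eq_bigr => -[a b] _ /=; rewrite !mxvecE mxE.
Qed.

Lemma tr_delta x a b : \tr (x *m delta_mx a b) = x b a.
Proof.
rewrite mxtrace_mulC /mxtrace (bigD1 a) //= big1 ?addr0 => [|i /negPf ia].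
  rewrite mxE (bigD1 b) //= big1 ?addr0 => [|j /negPf jb]; first by rewrite mxE !eqxx mul1r.
  by rewrite mxE jb andbF mul0r.
by rewrite mxE big1 // => j _; rewrite mxE ia mul0r.
Qed.

Lemma tr_op Q : \tr Q = \sum_a \sum_b \tr (ap Q (delta_mx a b) *m delta_mx b a).
Proof.
rewrite [LHS](reindex (uncurry (@mxvec_index n n))) /=; last exact: curry_mxvec_bij.
rewrite [RHS]pair_bigA; apply: eq_bigr => -[a b] _ /=.
by rewrite tr_delta /ap mxvec_delta -rowE !mxE.
Qed.

(** Adjointness for the bilinear trace form [tr (x y)], distinct from the hermitian adjoint: the
    transpose of [ad x] is its opposite, that of [Ad g] its inverse. *)
Definition transposes Q Q' := forall x y, \tr (ap Q x *m y) = \tr (x *m ap Q' y).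

Lemma adm_transposes x : transposes (adm x) (- adm x).
Proof. by move=> y z; rewrite apadm apNl apadm mulmxN linearN /= [br x y]brN mulNmx linearN /= br_trA. Qed.
Lemma Adm_transposes g : g \in unitmx -> transposes (Adm g) (Adm (invmx g)).
Proof.
move=> gu y z; rewrite !apAdm invmxK -!mulmxA.
by rewrite mxtrace_mulC !mulmxA.
Qed.
Lemma transposesM Q1 Q2 P1 P2 : transposes Q1 P1 -> transposes Q2 P2 ->
  transposes (Q1 *m Q2) (P2 *m P1).
Proof. by move=> h1 h2 x y; rewrite !apM h2 h1. Qed.

Lemma tr_transposes Q Q' : transposes Q Q' -> \tr Q = \tr Q'.
Proof.
move=> h; rewrite !tr_op [RHS]exchange_big; apply: eq_bigr => a _; apply: eq_bigr => b _.
by rewrite h mxtrace_mulC.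
Qed.

(** The sum of the tensors of [delta_mx a b] with [delta_mx b a] is the canonical tensor of the
    trace form, so an operator on one leg moves to the other as its transpose. The Casimir
    computations reduce to this. *)
Lemma tensor_transposes (V : lmodType C) (beta : 'M[C]_n -> 'M[C]_n -> V) Q Q' :
  (forall a x y z, beta (a *: x + y) z = a *: beta x z + beta y z) ->
  (forall a x y z, beta z (a *: x + y) = a *: beta z x + beta z y) ->
  transposes Q Q' ->
  \sum_a \sum_b beta (ap Q (delta_mx a b)) (delta_mx b a) =
  \sum_a \sum_b beta (delta_mx a b) (ap Q' (delta_mx b a)).
Proof.
move=> bl br' h.
have bl0 z : beta 0 z = 0 by have := bl (-1) 0 0 z; rewrite scaler0 addr0 scaleN1r addNr.
have br0 z : beta z 0 = 0 by have := br' (-1) 0 0 z; rewrite scaler0 addr0 scaleN1r addNr.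
have El x z : beta x z = \sum_c \sum_d x c d *: beta (delta_mx c d) z.
  rewrite {1}(matrix_sum_delta x).
  have sm (I : Type) (r : seq I) F : beta (\sum_(i <- r) F i) z = \sum_(i <- r) beta (F i) z.
    elim: r => [|i r IH]; first by rewrite !big_nil.
    by rewrite !big_cons; have := bl 1 (F i) (\sum_(j <- r) F j) z; rewrite !scale1r IH.
  rewrite sm; apply: eq_bigr => c _; rewrite sm; apply: eq_bigr => d _.
  by rewrite -[_ *: delta_mx c d]addr0 bl bl0 addr0.
have Er x z : beta z x = \sum_c \sum_d x c d *: beta z (delta_mx c d).
  rewrite {1}(matrix_sum_delta x).
  have sm (I : Type) (r : seq I) F : beta z (\sum_(i <- r) F i) = \sum_(i <- r) beta z (F i).
    elim: r => [|i r IH]; first by rewrite !big_nil.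
    by rewrite !big_cons; have := br' 1 (F i) (\sum_(j <- r) F j) z; rewrite !scale1r IH.
  rewrite sm; apply: eq_bigr => c _; rewrite sm; apply: eq_bigr => d _.
  by rewrite -[_ *: delta_mx c d]addr0 br' br0 addr0.
under eq_bigr => a _ do under eq_bigr => b _ do rewrite El.
under [RHS]eq_bigr => a _ do under eq_bigr => b _ do rewrite Er.
rewrite !pair_bigA /=.
rewrite (reindex_inj (h := fun p : 'I_n * 'I_n * 'I_n * 'I_n =>
  (p.2, p.1.2, p.1.1.1, p.1.1.2))) /=; last first.
  by move=> [[[? ?] ?] ?] [[[? ?] ?] ?] [-> -> -> ->].
apply: eq_bigr => -[[[a b] c] d] _ /=; congr (_ *: _).
by have := h (delta_mx d c) (delta_mx b a); rewrite tr_delta mxtrace_mulC tr_delta.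
Qed.
End Operators.

(** * Trace-orthogonal projections, eigenspaces of [ad x], Cartan's criterion *)

Section TraceProjection.
Context {C : numClosedFieldType} {n : nat}.
Local Notation N := (n * n)%N.
Implicit Types (Q P : 'M[C]_N) (x y z : 'M[C]_n) (V : {vspace 'M[C]_n}).

Definition nondeg V := forall x, x \in V -> (forall y, y \in V -> \tr (x *m y) = 0) -> x = 0.

Definition proj_on V P := (forall x, ap P x \in V) /\
  (forall x y, y \in V -> \tr ((x - ap P x) *m y) = 0).

Lemma nondeg_proj V : nondeg V -> exists P, proj_on V P.
Proof.
move=> nd; pose d := \dim V; pose e (i : 'I_d) := (vbasis V)`_i.
have eV i : e i \in V by rewrite vbasis_mem // mem_nth // size_tuple.
pose M : 'M[C]_d := \matrix_(i, j) \tr (e i *m e j).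
have Mu : M \in unitmx.
  rewrite -row_free_unit -kermx_eq0; apply/eqP/row_matrixP => i; rewrite row0.
  set u := row i _; have uM : u *m M = 0 by rewrite -row_mul mulmx_ker row0.
  have v0 : \sum_j u 0 j *: e j = 0.
    apply: nd => [|y yV]; first by rewrite rpred_sum // => j _; rewrite rpredZ.
    rewrite (coord_vbasis yV) mulmx_sumr linear_sum big1 // => k _.
    rewrite -scalemxAr linearZ mulmx_suml linear_sum /=.
    have := congr1 (fun A : 'rV[C]_d => A 0 k) uM; rewrite !mxE => h.
    rewrite (_ : \sum_j _ = 0) ?mulr0 // -[RHS]h; apply: eq_bigr => j _.
    by rewrite [M j k]mxE -scalemxAl linearZ.
  apply/rowP => j; rewrite [RHS]mxE.
  by have /freeP := basis_free (vbasisP V) => /(_ (fun j => u 0 j) v0 j).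
pose P := \sum_(i < d) \sum_(j < d) invmx M j i *: ((mxvec (e j)^T)^T *m mxvec (e i)).
have PE x : ap P x = \sum_i (\sum_j \tr (x *m e j) * invmx M j i) *: e i.
  rewrite ap_suml; apply: eq_bigr => i _; rewrite ap_suml scaler_suml; apply: eq_bigr => j _.
  rewrite apZl /ap mulmxA mxvec_dot trmxK mul_scalar_mx linearZ /= mxvecK.
  by rewrite scalerA mulrC.
exists P; split=> [x|x y yV].
  by rewrite PE rpred_sum // => i _; rewrite rpredZ.
rewrite (coord_vbasis yV) mulmx_sumr linear_sum big1 // => k _.
rewrite -scalemxAr linearZ /= -/(e k) mulmxBl linearB /=.
suff -> : \tr (ap P x *m e k) = \tr (x *m e k) by rewrite subrr mulr0.
rewrite PE mulmx_suml linear_sum /=.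
pose t : 'rV[C]_d := \row_j \tr (x *m e j).
have := congr1 (fun A : 'rV[C]_d => A 0 k) (mulmxKV Mu t); rewrite mxE [RHS]mxE => <-.
apply: eq_bigr => i _; rewrite -scalemxAl linearZ /= [M i k]mxE; congr (_ * _).
by rewrite mxE; apply: eq_bigr => j _; rewrite [t _ _]mxE.
Qed.

Section Fixed.
Variables (V : {vspace 'M[C]_n}) (P : 'M[C]_N).
Hypotheses (nd : nondeg V) (hP : proj_on V P).

Lemma proj_id x : x \in V -> ap P x = x.
Proof.
move=> xV; have [h1 h2] := hP; apply/esym/eqP; rewrite -subr_eq0; apply/eqP.
by apply: nd => [|y yV]; [rewrite rpredB | exact: h2].
Qed.
Lemma projP x : x \in V <-> ap P x = x.
Proof. by split=> [/proj_id //|<-]; case: hP. Qed.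
Lemma proj_idem : P *m P = P.
Proof. by apply: ap_ext => x; rewrite apM proj_id //; case: hP. Qed.
Lemma proj_trE x y : y \in V -> \tr (ap P x *m y) = \tr (x *m y).
Proof.
move=> yV; have [_ /(_ x y yV) /eqP] := hP.
by rewrite mulmxBl linearB /= subr_eq0 => /eqP.
Qed.
Lemma proj_transposes : transposes P P.
Proof.
move=> x y; have [h1 _] := hP; have := proj_trE y (h1 x).
by rewrite [RHS]mxtrace_mulC -(proj_trE x (h1 y)) mxtrace_mulC => <-; rewrite mxtrace_mulC.
Qed.
Lemma proj_comm Q Q' : transposes Q Q' -> (forall x, x \in V -> ap Q x \in V) ->
  (forall x, x \in V -> ap Q' x \in V) -> P *m Q = Q *m P.
Proof.
move=> h sQ sQ'; have [h1 h2] := hP; apply: ap_ext => x; rewrite !apM.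
apply/eqP; rewrite -subr_eq0; apply/eqP; apply: nd => [|y yV]; first by rewrite rpredB ?sQ.
rewrite mulmxBl linearB /= proj_trE // !h proj_trE ?subrr //; exact: sQ'.
Qed.
End Fixed.
End TraceProjection.

Section BlockOperators.
Context {C : numClosedFieldType} {n : nat}.
Local Notation N := (n.+1 * n.+1)%N.
Variable x : 'M[C]_n.+1.
Implicit Types (c d : C -> C -> C) (z : 'M[C]_n.+1).

(** A function of the pair of left and right eigenvalues, acting on the blocks
    [spr x a *m z *m spr x b]; the operators [ad (gfun x phi)] are those with symbol
    [phi a - phi b]. *)
Definition blk c : 'M[C]_N :=
  \sum_(a <- spec x) \sum_(b <- spec x) c a b *: (Lm (spr x a) *m Rm (spr x b)).

Lemma ap_blk c z :
  ap (blk c) z = \sum_(a <- spec x) \sum_(b <- spec x) c a b *: (spr x a *m z *m spr x b).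
Proof.
rewrite ap_suml; apply: eq_bigr => a _; rewrite ap_suml; apply: eq_bigr => b _.
by rewrite apZl apM apLm apRm.
Qed.

Lemma blk_ext c d : (forall a b, a \in spec x -> b \in spec x -> c a b = d a b) -> blk c = blk d.
Proof.
move=> h; apply: eq_big_seq => a aS; apply: eq_big_seq => b bS; by rewrite h.
Qed.

Lemma blk_block c z a b : a \in spec x -> b \in spec x ->
  spr x a *m ap (blk c) z *m spr x b = c a b *: (spr x a *m z *m spr x b).
Proof.
move=> aS bS; rewrite ap_blk mulmx_sumr mulmx_suml.
rewrite (bigD1_seq a) ?spec_uniq //= [X in _ + X]big1_seq ?addr0.
  rewrite mulmx_sumr mulmx_suml (bigD1_seq b) ?spec_uniq //= [X in _ + X]big1_seq ?addr0.
    by rewrite -scalemxAr -scalemxAl !mulmxA spr_idem // -!mulmxA spr_idem // !mulmxA.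
  move=> b' /andP [b'b b'S].
  by rewrite -scalemxAr -scalemxAl -!mulmxA spr_orth // !mulmx0 scaler0.
move=> a' /andP [a'a _]; rewrite mulmx_sumr mulmx_suml big1 // => b' _.
by rewrite -scalemxAr -scalemxAl !mulmxA spr_orth 1?eq_sym // !mul0mx scaler0.
Qed.

Lemma blkM c d : blk c *m blk d = blk (fun a b => c a b * d a b).
Proof.
apply: ap_ext => z; rewrite apM ap_blk [RHS]ap_blk.
apply: eq_big_seq => a aS; apply: eq_big_seq => b bS.
by rewrite blk_block // scalerA mulrC.
Qed.
Lemma blkD c d : blk c + blk d = blk (fun a b => c a b + d a b).
Proof.
rewrite /blk -big_split; apply: eq_bigr => a _; rewrite -big_split; apply: eq_bigr => b _.
by rewrite scalerDl.
Qed.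
Lemma blkZ e c : e *: blk c = blk (fun a b => e * c a b).
Proof.
rewrite /blk scaler_sumr; apply: eq_bigr => a _; rewrite scaler_sumr.
by apply: eq_bigr => b _; rewrite scalerA.
Qed.
Lemma blk_sum (I : Type) (r : seq I) (F : I -> C -> C -> C) :
  \sum_(i <- r) blk (F i) = blk (fun a b => \sum_(i <- r) F i a b).
Proof.
elim: r => [|i r IH].
  rewrite big_nil -[LHS](scale0r (blk (fun _ _ => 0))) blkZ; apply: blk_ext => a b _ _.
  by rewrite big_nil mul0r.
by rewrite big_cons IH blkD; apply: blk_ext => a b _ _; rewrite big_cons.
Qed.

Lemma adm_gfun (phi : C -> C) : adm (gfun x phi) = blk (fun a b => phi a - phi b).
Proof.
apply: ap_ext => z; rewrite apadm ap_blk /br.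
have -> : gfun x phi *m z = gfun x phi *m z *m (\sum_(b <- spec x) spr x b).
  by rewrite spr_sum mulmx1.
have -> : z *m gfun x phi = (\sum_(a <- spec x) spr x a) *m (z *m gfun x phi).
  by rewrite spr_sum mul1mx.
rewrite /gfun !mulmx_suml -sumrB; apply: eq_bigr => a _.
rewrite !mulmx_sumr -sumrB; apply: eq_bigr => b _.
by rewrite -!scalemxAl -!scalemxAr scalerBl !mulmxA.
Qed.
Lemma blk1 : blk (fun _ _ => 1) = 1%:M.
Proof.
apply: ap_ext => z; rewrite ap_blk ap1.
transitivity ((\sum_(a <- spec x) spr x a) *m z *m (\sum_(b <- spec x) spr x b)).
  rewrite !mulmx_suml; apply: eq_bigr => a _; rewrite !mulmx_sumr.
  by apply: eq_bigr => b _; rewrite scale1r.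
by rewrite spr_sum mul1mx mulmx1.
Qed.

Definition diffs : seq C := undup [seq a - b | a <- spec x, b <- spec x].
Lemma diffsP a b : a \in spec x -> b \in spec x -> a - b \in diffs.
Proof. by move=> aS bS; rewrite mem_undup; apply: allpairs_f. Qed.

(** By interpolation on the finitely many differences of eigenvalues, any function of [a - b] is a
    polynomial in [ad] of the semisimple part, so a property stable under linear combinations and
    under that [ad] passes to it. *)
Lemma blk_closed (Q : 'M[C]_N -> Prop) : Q 1%:M ->
  (forall A B, Q A -> Q B -> Q (A + B)) -> (forall (e : C) A, Q A -> Q (e *: A)) ->
  (forall A, Q A -> Q (A *m adm (gfun x id))) ->
  forall phi : C -> C, Q (blk (fun a b => phi (a - b))).
Proof.
move=> Q1 QD QZ QM phi.
have [h hh] := crt_poly (C := C) 1 phi (undup_uniq [seq a - b | a <- spec x, b <- spec x]).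
have {}hh a b : a \in spec x -> b \in spec x -> h.[a - b] = phi (a - b).
  move=> aS bS; have := hh _ (diffsP aS bS); rewrite expr1 dvdp_XsubCl /root.
  by rewrite !hornerE subr_eq0 => /eqP.
rewrite -(blk_ext hh); elim/poly_ind: h {hh} => [|p c IH].
  have := QZ 0 _ Q1; rewrite scale0r; congr Q.
  by rewrite -[LHS](scale0r (blk (fun _ _ => 0))) blkZ; apply: blk_ext => a b _ _; rewrite mul0r horner0.
have := QD _ _ (QM _ IH) (QZ c _ Q1); congr Q.
rewrite adm_gfun blkM -blk1 blkZ blkD; apply: blk_ext => a b _ _.
by rewrite !hornerE.
Qed.

Definition wproj mu := blk (fun a b => (a - b == mu)%:R).
Lemma wproj_idem mu : wproj mu *m wproj mu = wproj mu.
Proof. by rewrite blkM; apply: blk_ext => a b _ _; case: eqP; rewrite ?mulr1 ?mulr0. Qed.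
Lemma blk_wproj phi : blk (fun a b => phi (a - b)) = \sum_(mu <- diffs) phi mu *: wproj mu.
Proof.
under eq_bigr do rewrite blkZ; rewrite blk_sum; apply: blk_ext => a b aS bS.
rewrite (bigD1_seq (a - b)) ?undup_uniq ?diffsP //= eqxx mulr1 big1_seq ?addr0 //.
by move=> mu /andP [/negPf h _]; rewrite eq_sym h mulr0.
Qed.
Lemma wproj_sum : \sum_(mu <- diffs) wproj mu = 1%:M.
Proof.
rewrite -blk1 (blk_wproj (fun=> 1)); by apply: eq_bigr => mu _; rewrite scale1r.
Qed.
End BlockOperators.

Section NilpotentOperators.
Context {C : numClosedFieldType} {n : nat}.
Implicit Types (A B : 'M[C]_n).

Lemma nilp_mul A B k : A *m B = B *m A -> A ^+ k = 0 -> (A *m B) ^+ k = 0.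
Proof. by move=> AB Ak; rewrite mulmxE exprMn_comm // Ak mul0r. Qed.

Lemma nilp_sub A B k : A *m B = B *m A -> A ^+ k = 0 -> B ^+ k = 0 -> (A - B) ^+ (k + k) = 0.
Proof.
move=> AB Ak Bk; rewrite exprBn_comm // big1 // => i _.
have [ik|ki] := leqP k i.
  have -> : B ^+ i = 0 by rewrite -(subnK ik) exprD Bk mulr0.
  by rewrite !mulr0 mul0rn.
have -> : A ^+ (k + k - i) = 0.
  have -> : (k + k - i = (k - i) + k)%N by lia.
  by rewrite exprD Ak mulr0.
by rewrite mulr0 mul0r mul0rn.
Qed.

End NilpotentOperators.

Section NilpotentAd.
Context {C : numClosedFieldType} {n : nat}.

Lemma adm_nilp (x : 'M[C]_n) k : x ^+ k = 0 -> adm x ^+ (k + k) = 0.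
Proof.
move=> xk; rewrite /adm -lock; apply: nilp_sub; first exact: LmRm.
  have -> : Lm x ^+ k = Lm (x ^+ k).
    elim: k {xk} => [|k IH]; first by apply: ap_ext => z; rewrite !expr0 ap1 apLm mul1mx.
    by rewrite exprS IH -mulmxE LmM -[x in _ *m x]expr1 mulmxE -exprD addn1.
  by rewrite xk; apply: ap_ext => z; rewrite apLm mul0mx /ap mulmx0 linear0.
have -> : Rm x ^+ k = Rm (x ^+ k).
  elim: k {xk} => [|k IH]; first by apply: ap_ext => z; rewrite !expr0 ap1 apRm mulmx1.
  by rewrite exprS IH -mulmxE RmM mulmxE -exprS.
by rewrite xk; apply: ap_ext => z; rewrite apRm mulmx0 /ap mulmx0 linear0.
Qed.

Lemma br_conj a (x y : 'M[C]_n) : a \in unitmx ->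
  br (a *m x *m invmx a) (a *m y *m invmx a) = a *m br x y *m invmx a.
Proof. by move=> au; rewrite /br mulmxBr mulmxBl !mulmxA !mulmxKV. Qed.
End NilpotentAd.

Section SpectralTrace.
Context {C : numClosedFieldType} {n : nat}.
Implicit Types x : 'M[C]_n.+1.

Lemma sum_nonneg_eq0 (I : eqType) (r : seq I) (F : I -> C) : (forall i, i \in r -> 0 <= F i) ->
  \sum_(i <- r) F i = 0 -> forall i, i \in r -> F i = 0.
Proof.
move=> F0 s0 i ir; have := s0; rewrite (big_rem i) //= => /eqP.
rewrite paddr_eq0 ?F0 //; first by case/andP => /eqP.
by rewrite big_seq; apply: sumr_ge0 => j /mem_rem /F0.
Qed.

(** The trace is the sum of [|a| ^ 2] over the spectrum with multiplicities, so all eigenvalues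
    vanish. *)
Lemma tr_conj_nilp x : \tr (x *m gfun x Num.conj) = 0 -> x ^+ n.+1 = 0.
Proof.
rewrite tr_gfun => h; apply: gfun0_nilp; rewrite /gfun big_seq big1 // => a aS.
have := sum_nonneg_eq0 _ h aS => h1.
have /eqP : a^* * a * (\rank (spr x a))%:R = 0.
  by apply: h1 => b _; rewrite mulr_ge0 ?ler0n // mulrC mul_conjC_ge0.
rewrite !mulf_eq0 => /orP [/orP [a0|/eqP a0]|r0].
- by move: a0; rewrite conjC_eq0 => /eqP ->; rewrite scale0r.
- by rewrite a0 scale0r.
- by move: r0; rewrite pnatr_eq0 mxrank_eq0 => /eqP ->; rewrite scaler0.
Qed.

(** Cartan's criterion on the range of [P]: up to a nilpotent operator, which has no trace, the
    trace is the sum of [|mu| ^ 2] times the rank of [wproj x mu *m P]. So only [mu = 0] survives on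
    that range, and every function of the differences that vanishes at 0 is killed. *)
Lemma adm_semisimple_trace x P : P *m P = P -> P *m adm x = adm x *m P ->
  P *m adm (gfun x id) = adm (gfun x id) *m P ->
  \tr (adm x *m adm (gfun x Num.conj) *m P) = 0 ->
  forall phi, phi 0 = 0 -> blk x (fun a b => phi (a - b)) *m P = 0.
Proof.
move=> PP Px Ps tr0 phi phi0; set y := gfun x Num.conj.
have comm psi : P *m blk x (fun a b => psi (a - b)) = blk x (fun a b => psi (a - b)) *m P.
  apply: (blk_closed (Q := fun A => P *m A = A *m P)).
  - by rewrite mulmx1 mul1mx.
  - by move=> A B hA hB; rewrite mulmxDr mulmxDl hA hB.
  - by move=> c A hA; rewrite -scalemxAr -scalemxAl hA.
  - by move=> A hA; rewrite mulmxA hA -!mulmxA Ps.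
have ey : adm y = blk x (fun a b => (a - b)^*).
  by rewrite adm_gfun; apply: blk_ext => a b _ _; rewrite rmorphB.
pose nx := x - gfun x id.
have nxa : adm nx = adm x - adm (gfun x id).
  by apply: ap_ext => z; rewrite apBl !apadm /nx -scaleN1r brDl brZl scaleN1r.
have nil : (adm nx *m (adm y *m P)) ^+ (n.+1 + n.+1) = 0.
  apply: nilp_mul; last exact/adm_nilp/nilp_part.
  have c1 : adm nx *m P = P *m adm nx by rewrite nxa mulmxBl mulmxBr Px Ps.
  have c2 : adm nx *m adm y = adm y *m adm nx.
    have xy : br y nx = 0.
      rewrite /br /nx mulmxBr mulmxBl gfunM gfunM (gfun_comm (Y := x)) //.
      rewrite -/y (_ : gfun x (fun a => a^* * a) = gfun x (fun a => a * a^*)) ?subrr //.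
      by apply: eq_bigr => a _; rewrite mulrC.
    have := adm_br y nx; rewrite xy => /eqP; rewrite eq_sym.
    rewrite (_ : adm 0 = 0) ?subr_eq0 => [/eqP //|].
    by apply: ap_ext => z; rewrite apadm /br mul0mx mulmx0 subrr /ap mulmx0 linear0.
  by rewrite mulmxA c2 -mulmxA c1 mulmxA.
have : \tr (blk x (fun a b => (a - b) * (a - b)^*) *m P) = 0.
  have := tr0; rewrite -/y (_ : adm x = adm nx + adm (gfun x id)); last by rewrite nxa subrK.
  rewrite !mulmxDl linearD /= -(mulmxA (adm nx)) (tr_nilp nil) add0r.
  by rewrite ey adm_gfun blkM.
rewrite (blk_wproj x (fun c => c * c^*)) mulmx_suml linear_sum /= => h.
have trw mu : \tr (wproj x mu *m P) = (\rank (wproj x mu *m P))%:R.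
  apply: tr_idem; rewrite mulmxA -(mulmxA _ P) (comm (fun c => (c == mu)%:R)) mulmxA.
  by rewrite -/(wproj x mu) wproj_idem -mulmxA PP.
have wz mu : mu \in diffs x -> mu != 0 -> wproj x mu *m P = 0.
  move=> muS mu0; have := sum_nonneg_eq0 _ h muS.
  rewrite -scalemxAl linearZ /= trw => h'.
  have /eqP : mu * mu^* * (\rank (wproj x mu *m P))%:R = 0.
    apply: h' => nu _; rewrite -scalemxAl linearZ /= trw mulr_ge0 ?ler0n //.
    exact: mul_conjC_ge0.
  rewrite !mulf_eq0 conjC_eq0 (negPf mu0) pnatr_eq0 mxrank_eq0 /= => /eqP //.
rewrite blk_wproj mulmx_suml big_seq big1 // => mu muS; rewrite -scalemxAl.
have [->|mu0] := eqVneq mu 0; first by rewrite phi0 scale0r.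
by rewrite wz // scaler0.
Qed.
End SpectralTrace.

Section Sums.
Context {C : numClosedFieldType} {n : nat}.
Implicit Types (x y : 'M[C]_n).
Lemma br0r x : br x 0 = 0. Proof. by rewrite /br mulmx0 mul0mx subrr. Qed.
Lemma br_sum2 x (I J : finType) (F : I -> J -> 'M[C]_n) :
  br x (\sum_a \sum_b F a b) = \sum_a \sum_b br x (F a b).
Proof.
rewrite /br mulmx_sumr mulmx_suml -sumrB; apply: eq_bigr => a _.
by rewrite mulmx_sumr mulmx_suml -sumrB.
Qed.
Lemma tr_sum2 x (I J : finType) (F : I -> J -> 'M[C]_n) :
  \tr (x *m \sum_a \sum_b F a b) = \sum_a \sum_b \tr (x *m F a b).
Proof.
rewrite mulmx_sumr (raddf_sum (@mxtrace C n)); apply: eq_bigr => a _.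
by rewrite mulmx_sumr (raddf_sum (@mxtrace C n)).
Qed.
End Sums.

Section ClosedOrbits.
Context {R : realType} {S : realform R}.
Local Notation C := (cC S).
Local Notation io := (@io R S).

Lemma lie_real n (G : set 'M[C]_n) X : lie_algebra G X -> real_lie G X.
Proof. by move=> h s _; exact: h. Qed.
Lemma real_lie_lie n (G : set 'M[C]_n) X :
  algebraic_group G -> real_lie G X -> lie_algebra G X.
Proof. by move=> aG /real_lieP h; apply: lie_real_complex => // t _; exact: h. Qed.

Lemma lie_space n (G : set 'M[C]_n) : algebraic_group G ->
  exists g : {vspace 'M[C]_n}, forall X, lie_algebra G X <-> X \in g.
Proof.
move=> aG; have cG := algebraic_closed aG; have [sG _] := cG.
apply: vspace_of_set.
- exact: real_lie_lie (real_lie0 sG).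
- by move=> X Y /lie_real XG /lie_real YG; apply: real_lie_lie => //; exact: real_lieD.
- by move=> a X XG s; rewrite scalerA; exact: XG.
Qed.

(** * Reductive Lie algebras: centre and semisimple part *)

Section ReductiveStructure.
Variables (n : nat) (G : set 'M[C]_n.+1) (g : {vspace 'M[C]_n.+1}).
Hypothesis redG : reductive G.
Hypothesis gP : forall X, lie_algebra G X <-> X \in g.
Implicit Types (x y : 'M[C]_n.+1) (V : {vspace 'M[C]_n.+1}).

Let aG : algebraic_group G. Proof. by case: redG. Qed.
Let cG : closed_group G. Proof. exact: algebraic_closed aG. Qed.
Let sG : subgroup G. Proof. by case: aG. Qed.

Lemma lie_conj a x : G a -> x \in g -> a *m x *m invmx a \in g.
Proof.
move=> Ga /gP/lie_real h; apply/gP; apply: real_lie_lie => //; exact: real_lie_conj.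
Qed.
Lemma lie_br x y : x \in g -> y \in g -> br x y \in g.
Proof.
move=> /gP/lie_real hx /gP/lie_real hy; apply/gP; apply: real_lie_lie => //; exact: real_lie_bracket.
Qed.
Lemma lie_gfun_in x (phi : C -> C) : (forall a b, phi (a + b) = phi a + phi b) ->
  x \in g -> gfun x phi \in g.
Proof. by move=> h /gP hx; apply/gP; exact: lie_gfun. Qed.

Lemma ideal_nilp0 V : (forall x, x \in V -> x \in g) ->
  (forall a x, G a -> x \in V -> a *m x *m invmx a \in V) ->
  (forall x y, x \in V -> y \in V -> br x y \in V) ->
  (forall x, x \in V -> x ^+ n.+1 = 0) -> forall x, x \in V -> x = 0.
Proof.
move=> Vg VG Vbr Vn x xV; apply: (nil_ideal0 redG (U := V)) => // [y yV|y yV].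
  by apply/gP; exact: Vg.
by exists n.+1; exact: Vn.
Qed.

(** The radical of the trace form on [V] is again stable under [G] and brackets, and its elements
    are nilpotent because they are orthogonal to their conjugates [gfun x Num.conj], which lie in
    [V]; reductivity makes it 0. *)
Lemma ideal_nondeg V : (forall x, x \in V -> x \in g) ->
  (forall a x, G a -> x \in V -> a *m x *m invmx a \in V) ->
  (forall x y, x \in V -> y \in V -> br x y \in V) ->
  (forall x, x \in V -> gfun x Num.conj \in V) -> nondeg V.
Proof.
move=> Vg VG Vbr Vc.
have [|||U hU] := @vspace_of_set _ _ (fun x => x \in V /\ forall y, y \in V -> \tr (x *m y) = 0).
- by split=> [|y _]; rewrite ?mem0v // mul0mx linear0.
- move=> x y [xV hx] [yV hy]; split=> [|z zV]; first exact: rpredD.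
  by rewrite mulmxDl linearD /= hx // hy // addr0.
- move=> a x [xV hx]; split=> [|z zV]; first exact: rpredZ.
  by rewrite -scalemxAl linearZ /= hx // mulr0.
move=> x xV hx; apply: (@ideal_nilp0 U) => [y /hU [/Vg //]|a y Ga|y z|y|].
- move=> /hU [yV hy]; apply/hU; split=> [|z zV]; first exact: VG.
  have [GU _ _ GV] := sG; have au := GU _ Ga.
  have := hy _ (VG _ _ (GV _ Ga) zV); rewrite invmxK => <-.
  by rewrite -!mulmxA mxtrace_mulC !mulmxA.
- move=> /hU [yV hy] /hU [zV _]; apply/hU; split=> [|t tV]; first exact: Vbr.
  by rewrite br_trA hy //; exact: Vbr.
- by move=> /hU [yV hy]; apply: tr_conj_nilp; apply: hy; exact: Vc.
- exact/hU.
Qed.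

Lemma lie_nondeg : nondeg g.
Proof.
apply: ideal_nondeg => //; [exact: lie_conj | exact: lie_br |].
by move=> x; apply: lie_gfun_in => a b; rewrite rmorphD.
Qed.

Lemma center_space : exists z : {vspace 'M[C]_n.+1},
  forall x, x \in z <-> x \in g /\ forall y, y \in g -> br x y = 0.
Proof.
have [|||z hz] := @vspace_of_set _ _ (fun x => x \in g /\ forall y, y \in g -> br x y = 0).
- by split=> [|y _]; rewrite ?mem0v // /br mul0mx mulmx0 subrr.
- move=> x y [xg hx] [yg hy]; split=> [|t tg]; first exact: rpredD.
  by rewrite brDl hx // hy // addr0.
- move=> a x [xg hx]; split=> [|t tg]; first exact: rpredZ.
  by rewrite brZl hx // scaler0.
- by exists z => x; split=> /hz.
Qed.

Variable z : {vspace 'M[C]_n.+1}.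
Hypothesis zP : forall x, x \in z <-> x \in g /\ forall y, y \in g -> br x y = 0.

Lemma center_conj a x : G a -> x \in z -> a *m x *m invmx a \in z.
Proof.
move=> Ga /zP [xg hx]; apply/zP; split=> [|y yg]; first exact: lie_conj.
have [GU _ _ GV] := sG; have au := GU _ Ga.
have := br_conj x (invmx a *m y *m a) au; rewrite hx; last first.
  by have := lie_conj (GV _ Ga) yg; rewrite invmxK.
have -> : a *m (invmx a *m y *m a) *m invmx a = y by rewrite !mulmxA mulmxV // mul1mx mulmxK.
by rewrite mulmx0 mul0mx.
Qed.
Lemma center_gfun x (phi : C -> C) : (forall a b, phi (a + b) = phi a + phi b) ->
  x \in z -> gfun x phi \in z.
Proof.
move=> hphi /zP [xg hx]; apply/zP; split=> [|y yg]; first exact: lie_gfun_in.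
apply/eqP; rewrite subr_eq0; apply/eqP/gfun_comm/eqP; rewrite -subr_eq0.
by apply/eqP; exact: hx.
Qed.
Lemma center_nondeg : nondeg z.
Proof.
apply: ideal_nondeg => [x /zP [] //| |x y|x xz]; first exact: center_conj.
  by move=> /zP [_ hx] /zP [yg _]; rewrite hx // mem0v.
by apply: center_gfun => // a b; rewrite rmorphD.
Qed.

(** [s] is the trace-orthogonal complement of the centre in [g]. The last clause is nondegeneracy of
    its Killing form: [P] projects onto [s], so [\tr (adm x *m adm y *m P)] is a trace over [s]. *)
Lemma semisimple_part : exists (s : {vspace 'M[C]_n.+1}) P,
  [/\ (forall x, x \in s -> x \in g),
      (forall x, x \in g -> exists u v, [/\ u \in z, v \in s & x = u + v]),
      nondeg s /\ proj_on s P,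
      (forall a x, G a -> x \in s -> a *m x *m invmx a \in s) /\
      (forall x y, x \in g -> y \in s -> br x y \in s)
    & forall x, x \in s -> (forall y, \tr (adm x *m adm y *m P) = 0) -> x = 0].
Proof.
have [|||s sP] := @vspace_of_set _ _ (fun x => x \in g /\ forall y, y \in z -> \tr (x *m y) = 0).
- by split=> [|y _]; rewrite ?mem0v // mul0mx linear0.
- move=> x y [xg hx] [yg hy]; split=> [|t tg]; first exact: rpredD.
  by rewrite mulmxDl linearD /= hx // hy // addr0.
- move=> a x [xg hx]; split=> [|t tg]; first exact: rpredZ.
  by rewrite -scalemxAl linearZ /= hx // mulr0.
have [Pz hPz] := nondeg_proj center_nondeg.
have zg x : x \in z -> x \in g by move/zP=> [].
have gzs x : x \in g -> exists u v, [/\ u \in z, v \in s & x = u + v].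
  move=> xg; have [h1 h2] := hPz; exists (ap Pz x), (x - ap Pz x); split=> //.
    apply/sP; split; last exact: h2.
    by apply: rpredB => //; exact: zg.
  by rewrite addrC subrK.
have nds : nondeg s.
  move=> x /sP [xg xz] hx; apply: lie_nondeg => // y /gzs [u [v [uz vs ->]]].
  by rewrite mulmxDr linearD /= xz // hx // addr0.
have [P hP] := nondeg_proj nds.
have [GU _ _ GV] := sG.
have sconj a x : G a -> x \in s -> a *m x *m invmx a \in s.
  move=> Ga /sP [xg hx]; apply/sP; split=> [|y yz]; first exact: lie_conj.
  have := hx _ (center_conj (GV _ Ga) yz); rewrite invmxK => <-.
  by rewrite -!mulmxA mxtrace_mulC !mulmxA.
have sbr x y : x \in g -> y \in s -> br x y \in s.
  move=> xg /sP [yg hy]; apply/sP; split=> [|t tz]; first exact: lie_br.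
  rewrite brN mulNmx linearN /= br_trA.
  have /zP [tg tc] := tz; rewrite brN tc // oppr0 mulmx0 linear0 oppr0 //.
have Pad x : x \in g -> P *m adm x = adm x *m P.
  move=> xg; apply: (proj_comm nds hP (adm_transposes x)) => y ys; rewrite ?apNl apadm.
    exact: sbr.
  by rewrite rpredN; exact: sbr.
have PAd a : G a -> P *m Adm a = Adm a *m P.
  move=> Ga; apply: (proj_comm nds hP (Adm_transposes (GU _ Ga))) => y ys; rewrite apAdm.
    exact: sconj.
  by apply: sconj => //; exact: GV.
exists s, P; split=> // [x /sP [] //|].
have [|||U hU] := @vspace_of_set _ _ (fun x => x \in s /\ forall y, \tr (adm x *m adm y *m P) = 0).
- split=> [|y]; first exact: mem0v.
  rewrite (_ : adm 0 = 0) ?mul0mx ?linear0 //.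
  by apply: ap_ext => t; rewrite apadm /br mul0mx mulmx0 subrr /ap mulmx0 linear0.
- move=> x y [xs hx] [ys hy]; split=> [|t]; first exact: rpredD.
  have -> : adm (x + y) = adm x + adm y by apply: ap_ext => u; rewrite apDl !apadm brDl.
  by rewrite !mulmxDl linearD /= hx hy addr0.
- move=> a x [xs hx]; split=> [|t]; first exact: rpredZ.
  have -> : adm (a *: x) = a *: adm x by apply: ap_ext => u; rewrite apZl !apadm brZl.
  by rewrite -!scalemxAl linearZ /= hx mulr0.
move=> x xs hx; apply: (@ideal_nilp0 U) => [y /hU [/sP [] //]|a y Ga|y y'|y|].
- move=> /hU [ys hy]; apply/hU; split=> [|t]; first exact: sconj.
  have au := GU _ Ga; rewrite -(hy (invmx a *m t *m a)).
  have -> : adm (invmx a *m t *m a) = Adm a *m adm t *m Adm (invmx a).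
    have := @adm_conj _ _ (invmx a) t; rewrite invmxK => -> //; by rewrite unitmx_inv.
  rewrite adm_conj // -!mulmxA mxtrace_mulC -!mulmxA.
  by rewrite -(PAd _ (GV _ Ga)) !mulmxA -(mulmxA _ P) -?mulmxA.
- move=> /hU [ys hy] /hU [ys' hy']; have [/sP [yg _] /sP [yg' _]] := (ys, ys').
  apply/hU; split=> [|t]; first exact: sbr.
  have := hy (br y' t); rewrite adm_br mulmxBr mulmxBl linearB /= => <-.
  rewrite adm_br mulmxBl mulmxBl linearB /=; congr (_ - _); last by rewrite !mulmxA.
  by rewrite -!mulmxA mxtrace_mulC -!mulmxA (Pad _ yg').
(* By Cartan's criterion [ad] of the conjugate of [y] kills [s], so that conjugate is central; [y]
   is orthogonal to the centre, hence nilpotent. *)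
- move=> /hU [ys hy]; have /sP [yg yz] := ys.
  have yc : gfun y Num.conj \in g by apply: lie_gfun_in => // a b; rewrite rmorphD.
  have yi : gfun y id \in g by exact: lie_gfun_in.
  have h0 := adm_semisimple_trace (proj_idem nds hP) (Pad _ yg) (Pad _ yi) (hy _).
  apply: tr_conj_nilp; apply: yz; apply/zP; split=> // t /gzs [u [v [uz vs ->]]].
  rewrite brDr; have /zP [ug uc] := uz.
  rewrite brN uc // oppr0 add0r -(proj_id nds hP vs) -apadm -apM.
  have := Pad _ yc; rewrite adm_gfun => ->.
  have -> : blk y (fun a b => a^* - b^*) = blk y (fun a b => (a - b)^*).
    by apply: blk_ext => a b _ _; rewrite rmorphB.
  by rewrite (h0 (fun a => a^*)) ?conjC0 // /ap mulmx0 linear0.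
- exact/hU.
Qed.
End ReductiveStructure.

(** * Operators on matrices under the commutant of [K] *)

Section OperatorAnalysis.
Variable n : nat.
Local Notation N := (n * n)%N.
Implicit Types (x y z : 'M[C]_n) (Q P : 'M[C]_N).

Lemma cvm_ap (Q : nat -> 'M[C]_N) P (x : nat -> 'M[C]_n) y :
  cvm Q P -> cvm x y -> cvm (fun k => ap (Q k) (x k)) (ap P y).
Proof.
move=> QP xy; apply: (cvm_linear (@vec_mx C n n)); apply: cvmM QP.
exact: (cvm_linear (@mxvec C n n)).
Qed.
Lemma cvm_op (Q : nat -> 'M[C]_N) P :
  (forall x, cvm (fun k => ap (Q k) x) (ap P x)) -> cvm Q P.
Proof.
move=> h; apply: cvm_entries => i j.
have e (A : 'M[C]_N) : A i j = (mxvec (ap A (vec_mx (delta_mx 0 i)))) 0 j.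
  by rewrite /ap !vec_mxK -rowE mxE.
rewrite e; apply: cvs_ext (cvm_entry 0 j (cvm_linear (@mxvec C n n) (h (vec_mx (delta_mx 0 i))))).
by move=> k; rewrite -e.
Qed.
Lemma cvm_br (a b : nat -> 'M[C]_n) x y : cvm a x -> cvm b y ->
  cvm (fun k => br (a k) (b k)) (br x y).
Proof. by move=> h1 h2; apply: cvmB; apply: cvmM. Qed.
Lemma cvm_Adm (h : nat -> 'M[C]_n) g : g \in unitmx -> cvm h g -> cvm (fun k => Adm (h k)) (Adm g).
Proof.
move=> gu hg; apply: cvm_op => x; rewrite apAdm.
apply: cvm_ext (cvmM (cvmM hg (cvm_cst x)) (cvm_inv hg gu)) => k; by rewrite apAdm.
Qed.

Lemma ip_mxvec x y : ip (mxvec x) (mxvec y) = ip x y.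
Proof.
rewrite !ipE.
have -> : (mxvec y)^t* = (mxvec (y^t*)^T)^T.
  apply/matrixP => i j; rewrite !mxE; case/mxvec_indexP: i => a b.
  by rewrite ord1 !mxvecE !mxE.
by rewrite mxvec_dot trmxK mxtrace_scalar mulr1n.
Qed.
Lemma ap_adj Q x y : ip (ap Q x) y = ip x (ap (Q^t*) y).
Proof.
rewrite -ip_mxvec -[RHS]ip_mxvec /ap !vec_mxK !ipE adjM trmxCK mulmxA //.
Qed.
Lemma ip_extr x y : (forall z, ip z x = ip z y) -> x = y.
Proof.
move=> h; apply/eqP; rewrite -subr_eq0 -(@fn_eq0 R S); apply/eqP/(@io_inj R S).
by rewrite rmorph0 -ip_fn ipBr h subrr.
Qed.
Lemma ap_transposes_adj Q Q' x : transposes Q Q' -> ap (Q^t*) x = (ap Q' (x^t*))^t*.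
Proof.
move=> h; apply: ip_extr => z; rewrite -ap_adj !ipE h trmxCK //.
Qed.
Lemma adm_adj x : (adm x)^t* = adm (x^t*).
Proof.
apply: ap_ext => z; rewrite (ap_transposes_adj _ (adm_transposes x)) apNl !apadm.
by rewrite /br adjN adjB !adjM !trmxCK opprB.
Qed.
Lemma Adm_adj (g : 'M[C]_n) : g \in unitmx -> (Adm g)^t* = Adm (g^t*).
Proof.
move=> gu; apply: ap_ext => z; rewrite (ap_transposes_adj _ (Adm_transposes gu)) !apAdm.
by rewrite invmxK !adjM trmxCK adjV mulmxA.
Qed.

Lemma fn0_eq0 m p (A : 'M[C]_(m, p)) : \tr (A *m A^t*) = 0 -> A = 0.
Proof.
rewrite -ipE ip_fn => h; apply/eqP; rewrite -(@fn_eq0 R S); apply/eqP/(@io_inj R S).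
by rewrite h rmorph0.
Qed.

Lemma near1_unit (h : 'M[C]_n) : nm (h - 1%:M) < 1 -> h \in unitmx.
Proof.
move=> h1; rewrite -row_free_unit -kermx_eq0; apply/eqP/row_matrixP => i; rewrite row0.
set u := row i _; have uh : u *m h = 0 by rewrite -row_mul mulmx_ker row0.
apply/eqP; rewrite -(@nm_eq0 R S) eq_le nm_ge0 andbT leNgt; apply/negP => u0.
have := nmM u (h - 1%:M); rewrite mulmxBr uh mulmx1 sub0r nmN leNgt => /negP; apply.
by rewrite gtr_pMr.
Qed.

Lemma min_ortho m p (A : nat -> 'M[C]_(m, p)) L D (e : nat -> R) : cvg0 e -> (forall k, 0 < e k) ->
  cvm (fun k => io ((e k)^-1) *: (A k - L)) D -> (\forall k \near \oo, nm L <= nm (A k)) ->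
  0 <= re (ip D L).
Proof.
move=> e0 ep hD hA; pose B k := io ((e k)^-1) *: (A k - L).
have h1 : cvs (fun k => ip (B k) L + ip L (B k) + io (e k) * ip (B k) (B k)) (ip D L + ip L D + 0 * ip D D).
  apply: cvsD; first by apply: cvsD; apply: cvs_ip => //; exact: cvm_cst.
  by apply: cvsM; [exact: cvs_io0 | exact: cvs_ip].
suff : 0 <= re (ip D L + ip L D + 0 * ip D D).
  by rewrite mul0r addr0 reD -(ipJ D L) reJ; lra.
apply: cvs_ge_re h1 _; apply: filterS hA => k hk.
have eA : A k = L + io (e k) *: B k.
  by rewrite scalerA -rmorphM mulfV ?gt_eqF // (rmorph1 io) scale1r addrC subrK.
have : fn L <= fn (A k) by rewrite -!nm2 lerXn2r ?nnegrE ?nm_ge0.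
have -> : fn (A k) = fn L + e k * re (ip (B k) L + ip L (B k) + io (e k) * ip (B k) (B k)).
  rewrite -reMio -[fn L](@re_io R S) -ip_fn -reD -[LHS](@re_io R S) -ip_fn eA; congr re.
  by rewrite !(ipDl, ipDr, ipZl, ipZr) ioJ; ring.
by rewrite lerDl pmulr_rge0.
Qed.

(** Conjugation of [Q] by [Ad h], written in reverse order since operators act on the right; [dact]
    is the derivative at [h = 1]. *)
Definition act h Q : 'M[C]_N := Adm (invmx h) *m Q *m Adm h.
Definition dact x Q : 'M[C]_N := Q *m adm x - adm x *m Q.

Lemma inv_mulmx (g h : 'M[C]_n) : g \in unitmx -> h \in unitmx ->
  invmx (g *m h) = invmx h *m invmx g.
Proof.
move=> gu hu; have u : g *m h \in unitmx by rewrite unitmx_mul gu.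
by rewrite -[RHS](mulmxK u) !mulmxA mulmxKV // mulVmx // mul1mx.
Qed.
Lemma AdmM (g h : 'M[C]_n) : g \in unitmx -> h \in unitmx -> Adm (g *m h) = Adm h *m Adm g.
Proof.
move=> gu hu; apply: ap_ext => z; rewrite apM !apAdm inv_mulmx //.
by rewrite !mulmxA.
Qed.
Lemma Adm1 : Adm (1%:M : 'M[C]_n) = 1%:M.
Proof. by apply: ap_ext => z; rewrite apAdm ap1 invmx1 mul1mx mulmx1. Qed.
Lemma actM g h Q : g \in unitmx -> h \in unitmx -> act (g *m h) Q = act g (act h Q).
Proof.
move=> gu hu; by rewrite /act inv_mulmx // !AdmM ?unitmx_inv // !mulmxA.
Qed.
Lemma act1 Q : act 1%:M Q = Q.
Proof. by rewrite /act invmx1 Adm1 mul1mx mulmx1. Qed.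
Lemma ap_act h Q x : ap (act h Q) x = h *m ap Q (invmx h *m x *m h) *m invmx h.
Proof. by rewrite /act !apM !apAdm invmxK. Qed.
Lemma cvm_act (h : nat -> 'M[C]_n) g (Q : nat -> 'M[C]_N) P : g \in unitmx -> cvm h g ->
  cvm Q P -> cvm (fun k => act (h k) (Q k)) (act g P).
Proof.
move=> gu hg QP; apply: cvmM (cvm_Adm gu hg); apply: cvmM QP.
by apply: cvm_Adm (cvm_inv hg gu); rewrite unitmx_inv.
Qed.

Lemma act_quot x (e : nat -> R) (Q : nat -> 'M[C]_N) P : cvg0 e -> (forall k, 0 < e k) -> cvm Q P ->
  cvm (fun k => io ((e k)^-1) *: (act (1%:M + io (e k) *: x) (Q k) - Q k)) (dact x P).
Proof.
move=> e0 ep QP; pose h k := 1%:M + io (e k) *: x.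
have h1 : cvm h 1%:M.
  have := cvmD (cvm_cst (1%:M : 'M[C]_n)) (cvmZ (cvs_io0 e0 ep) (cvm_cst x)).
  by rewrite scale0r addr0.
have u1 : (1%:M : 'M[C]_n) \in unitmx by exact: unitmx1.
have hR : cvm (fun k => Rm (invmx (h k))) 1%:M.
  apply: cvm_op => z; rewrite ap1.
  have := cvmM (cvm_cst z) (cvm_inv h1 u1); rewrite invmx1 mulmx1.
  by apply: cvm_ext => k; rewrite apRm.
have hA : cvm (fun k => Adm (invmx (h k))) 1%:M.
  have := cvm_Adm _ (cvm_inv h1 u1); rewrite invmx1 Adm1; exact.
have := cvmM hA (cvmB (cvmM QP (cvmM (cvm_cst (adm x)) hR)) (cvmM (cvmM (cvm_cst (adm x)) hR) QP)).
rewrite mul1mx !mulmx1; apply: cvm_near; apply: filterS (cvm_unit h1 u1) => k hu.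
have Ah : Adm (h k) = 1%:M + io (e k) *: (adm x *m Rm (invmx (h k))).
  apply: ap_ext => z; rewrite apAdm apDl ap1 apZl apM apRm apadm.
  rewrite (_ : h k *m z = z *m h k + io (e k) *: br x z).
    by rewrite mulmxDl mulmxK // scalemxAl.
  rewrite /h /br mulmxDl mulmxDr mul1mx mulmx1 -scalemxAl -scalemxAr scalerBr.
  by rewrite -addrA [X in _ = _ + X]addrC subrK.
have -> : act (h k) (Q k) - Q k = Adm (invmx (h k)) *m (Q k *m Adm (h k) - Adm (h k) *m Q k).
  rewrite mulmxBr /act !mulmxA; congr (_ - _).
  have := AdmV (_ : invmx (h k) \in unitmx); rewrite invmxK unitmx_inv => -> //.
  by rewrite mul1mx.
set B := adm x *m Rm (invmx (h k)) in Ah *.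
have -> : Q k *m Adm (h k) - Adm (h k) *m Q k = io (e k) *: (Q k *m B - B *m Q k).
  rewrite Ah mulmxDr mulmxDl mul1mx mulmx1 opprD addrACA subrr add0r.
  by rewrite -scalemxAl -scalemxAr -scalerBr.
rewrite -scalemxAr scalerA -rmorphM mulVf ?gt_eqF // (rmorph1 io).
by rewrite scale1r.
Qed.
End OperatorAnalysis.

Lemma functional_tr (C : numClosedFieldType) n (L : 'M[C]_n -> C) :
  (forall a x y, L (a *: x + y) = a * L x + L y) ->
  forall x, L x = \tr (x *m \matrix_(b, a) L (delta_mx a b)).
Proof.
move=> lin x; have L0 : L 0 = 0 by have := lin (-1) 0 0; rewrite scaler0 addr0 mulN1r addNr.
rewrite {1}(matrix_sum_delta x).
have sm (I : Type) (r : seq I) F : L (\sum_(i <- r) F i) = \sum_(i <- r) L (F i).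
  elim: r => [|i r IH]; first by rewrite !big_nil.
  by rewrite !big_cons; have := lin 1 (F i) (\sum_(j <- r) F j); rewrite scale1r mul1r IH.
rewrite sm; apply: eq_bigr => a _; rewrite sm mxE; apply: eq_bigr => b _.
by rewrite mxE; have := lin (x a b) (delta_mx a b) 0; rewrite L0 !addr0.
Qed.

Lemma tr_ext (C : numClosedFieldType) n (x x' : 'M[C]_n) :
  (forall y, \tr (y *m x) = \tr (y *m x')) -> x = x'.
Proof.
by move=> h; apply/matrixP => a b; rewrite -!tr_delta ![\tr (_ *m delta_mx _ _)]mxtrace_mulC.
Qed.

Lemma op_unit (C : numClosedFieldType) n (Q : 'M[C]_(n * n)) :
  (forall x, ap Q x = 0 -> x = 0) -> Q \in unitmx.
Proof.
move=> h; rewrite -row_free_unit -kermx_eq0; apply/eqP/row_matrixP => i; rewrite row0.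
have uQ : row i (kermx Q) *m Q = 0 by rewrite -row_mul mulmx_ker row0.
have := h (vec_mx (row i (kermx Q))); rewrite /ap vec_mxK uQ linear0 => /(_ erefl) h0.
by rewrite -[LHS]vec_mxK h0 linear0.
Qed.

Section CentralizerAction.
Variables (n : nat) (K : set 'M[C]_n).
Local Notation N := (n * n)%N.
Implicit Types (x y z : 'M[C]_n) (Q P : 'M[C]_N).
Hypothesis unitK : forall k, K k -> k^t* *m k = 1%:M.

Lemma unitK_unit k : K k -> k \in unitmx /\ invmx k = k^t*.
Proof.
move=> /unitK h; have [_ ku] := mulmx1_unit h; split=> //.
by rewrite -[RHS]mulmx1 -(mulmxV ku) mulmxA h mul1mx.
Qed.

(** The commutant of [K]: an algebra, closed under adjoints since [K] is unitary. Its invertible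
    elements move operators without destroying their commutation with [Ad K]. *)
Definition HH x := forall k, K k -> x *m k = k *m x.
Lemma HH1 : HH 1%:M. Proof. by move=> k _; rewrite mul1mx mulmx1. Qed.
Lemma HHD x y : HH x -> HH y -> HH (x + y).
Proof. by move=> hx hy k Kk; rewrite mulmxDl mulmxDr hx // hy. Qed.
Lemma HHZ a x : HH x -> HH (a *: x).
Proof. by move=> hx k Kk; rewrite -scalemxAl -scalemxAr hx. Qed.
Lemma HHM x y : HH x -> HH y -> HH (x *m y).
Proof. by move=> hx hy k Kk; rewrite -mulmxA hy // mulmxA hx // mulmxA. Qed.
Lemma HHV x : HH x -> HH (invmx x).
Proof.
move=> hx k Kk; have [xu|xu] := boolP (x \in unitmx); last by rewrite /invmx (negPf xu); exact: hx.
by rewrite -[k in LHS](mulmxK xu) -[k *m x]hx // !mulmxA mulVmx // mul1mx.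
Qed.
Lemma HH_adj x : HH x -> HH (x^t*).
Proof.
move=> hx k Kk; have [ku kV] := unitK_unit Kk.
have h : k^t* *m x = x *m k^t*.
  by rewrite -kV -[x in LHS](mulmxK ku) (hx k Kk) !mulmxA mulVmx // mul1mx.
by have := congr1 (fun A : 'M[C]_n => A^t*) h; rewrite /= !adjM trmxCK.
Qed.

(** The matrix [D] representing [L] for the trace form commutes with [K], hence so does its adjoint,
    and [L] at that adjoint is the squared norm of [D]. This does the work of averaging over [K]. *)
Lemma K_functional (L : 'M[C]_n -> C) : (forall a x y, L (a *: x + y) = a * L x + L y) ->
  (forall k x, K k -> L (k *m x *m invmx k) = L x) -> (forall x, HH x -> L x = 0) ->
  forall x, L x = 0.
Proof.
move=> lin inv LH; pose D : 'M[C]_n := \matrix_(b, a) L (delta_mx a b).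
have LD x : L x = \tr (x *m D) := functional_tr lin x.
have DH : HH D.
  move=> k Kk; have [ku _] := unitK_unit Kk.
  have e : invmx k *m D *m k = D.
    apply/matrixP => a b; rewrite -!tr_delta ![\tr (_ *m delta_mx _ _)]mxtrace_mulC -[RHS]LD.
    by rewrite -(inv k _ Kk) LD -!mulmxA [RHS]mxtrace_mulC -!mulmxA [LHS]mxtrace_mulC -!mulmxA [RHS]mxtrace_mulC -!mulmxA.
  by rewrite -{2}e !mulmxA mulmxV // mul1mx.
have D0 : D = 0.
  by apply: (@fn0_eq0); rewrite mxtrace_mulC -LD; apply: LH; exact: HH_adj.
by move=> x; rewrite LD D0 mulmx0 linear0.
Qed.
End CentralizerAction.

Section KillingOperator.
Context {n : nat}.
Local Notation N := (n * n)%N.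
Implicit Types (x y z : 'M[C]_n) (Q P : 'M[C]_N).

Lemma adm_lin a x y : adm (a *: x + y) = a *: adm x + adm y.
Proof. by apply: ap_ext => z; rewrite apDl apZl !apadm brDl brZl. Qed.

Lemma admZ a x : adm (a *: x) = a *: adm x.
Proof. by apply: ap_ext => z; rewrite apZl !apadm brZl. Qed.

(** Represents, for the trace form, the functional [y |-> \tr (adm x *m adm y *m Q)], which is the
    Killing form of the range of [Q] when [Q] projects onto a subalgebra. *)
Definition killing Q x : 'M[C]_n :=
  \matrix_(b, a) \tr (adm x *m adm (delta_mx a b) *m Q).
Lemma killing_tr Q x y : \tr (y *m killing Q x) = \tr (adm x *m adm y *m Q).
Proof.
rewrite -(@functional_tr _ _ (fun y => \tr (adm x *m adm y *m Q))) // => a u v.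
by rewrite adm_lin mulmxDr mulmxDl linearD /= -scalemxAr -scalemxAl linearZ.
Qed.
Definition Om Q : 'M[C]_N := lin_mx (killing Q).
Lemma ap_Om Q x : ap (Om Q) x = killing Q x.
Proof.
have lin : linear (killing Q).
  move=> a u v; apply: tr_ext => y; rewrite mulmxDr linearD /= -scalemxAr linearZ /= !killing_tr.
  by rewrite adm_lin !mulmxDl linearD /= -!scalemxAl linearZ.
pose l := GRing.isLinear.Build C _ _ _ (killing Q) lin.
pose L : {linear 'M[C]_n -> 'M[C]_n} := HB.pack (killing Q) l.
by rewrite /ap (mul_vec_lin L) mxvecK.
Qed.

Lemma det_act (h : 'M[C]_n) Q : h \in unitmx -> \det (act h Q) = \det Q.
Proof.
move=> hu; rewrite /act !det_mulmx mulrAC -det_mulmx.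
have := AdmV (_ : invmx h \in unitmx); rewrite invmxK unitmx_inv => -> //.
by rewrite det1 mul1r.
Qed.
Lemma act_mul (h : 'M[C]_n) Q P : h \in unitmx -> act h Q *m act h P = act h (Q *m P).
Proof. by move=> hu; rewrite /act !mulmxA -(mulmxA _ (Adm h)) AdmV // mulmx1. Qed.
Lemma act_one (h : 'M[C]_n) : h \in unitmx -> act h 1%:M = 1%:M.
Proof.
move=> hu; rewrite /act mulmx1; have := AdmV (_ : invmx h \in unitmx).
by rewrite invmxK unitmx_inv => ->.
Qed.
Lemma actD (h : 'M[C]_n) Q P : act h (Q + P) = act h Q + act h P.
Proof. by rewrite /act mulmxDr mulmxDl. Qed.
Lemma actN (h : 'M[C]_n) Q : act h (- Q) = - act h Q.
Proof. by rewrite /act mulmxN mulNmx. Qed.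

Lemma Om_act (h : 'M[C]_n) Q : h \in unitmx -> Om (act h Q) = act h (Om Q).
Proof.
move=> hu; have hV : invmx h \in unitmx by rewrite unitmx_inv.
apply: ap_ext => x; rewrite ap_Om ap_act ap_Om; apply: tr_ext => y.
rewrite killing_tr.
have -> : \tr (y *m (h *m killing Q (invmx h *m x *m h) *m invmx h)) =
    \tr ((invmx h *m y *m h) *m killing Q (invmx h *m x *m h)).
  by rewrite !mulmxA mxtrace_mulC !mulmxA.
rewrite killing_tr.
have e t : adm (invmx h *m t *m h) = Adm h *m adm t *m Adm (invmx h).
  by have := adm_conj t hV; rewrite invmxK.
have VA : Adm (invmx h) *m Adm h = 1%:M by have := AdmV hV; rewrite invmxK.
rewrite !e /act !mulmxA -(mulmxA _ (Adm (invmx h)) (Adm h)) VA mulmx1.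
by rewrite mxtrace_mulC !mulmxA.
Qed.

(** The compressed Killing operator on the range of [Q] and 1 on its kernel, so that invertibility
    encodes nondegeneracy. Its determinant is constant on orbits of [act], hence on their closures:
    a limit keeps a nondegenerate Killing form. *)
Definition nondeg_op Q : 'M[C]_N := Q *m Om Q *m Q + (1%:M - Q).
Lemma nondeg_op_act (h : 'M[C]_n) Q : h \in unitmx -> nondeg_op (act h Q) = act h (nondeg_op Q).
Proof. by move=> hu; rewrite /nondeg_op Om_act // !act_mul // !actD actN act_one. Qed.
End KillingOperator.

Section SubalgebraProjections.
Variables (n : nat) (K : set 'M[C]_n).
Local Notation N := (n * n)%N.
Implicit Types (x y z : 'M[C]_n) (Q P : 'M[C]_N).
Hypothesis unitK : forall k, K k -> k^t* *m k = 1%:M.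
Local Notation HH := (HH K).

(** Projections onto subalgebras, symmetric for the trace form and commuting with [Ad K]. The four
    conditions are closed and preserved by the commutant, so they persist on orbit closures. *)
Definition subproj Q := [/\ Q *m Q = Q, transposes Q Q,
  (forall x y, ap Q (br (ap Q x) (ap Q y)) = br (ap Q x) (ap Q y)) &
  (forall k, K k -> Q *m Adm k = Adm k *m Q)].

Lemma subproj_act h Q : HH h -> h \in unitmx -> subproj Q -> subproj (act h Q).
Proof.
move=> hH hu [QQ QT Qb QK]; have hV : invmx h \in unitmx by rewrite unitmx_inv.
split.
- by rewrite act_mul // QQ.
- have := transposesM (transposesM (Adm_transposes hV) QT) (Adm_transposes hu).
  by rewrite invmxK mulmxA.
- move=> x y; rewrite !ap_act br_conj //.
  have -> u : invmx h *m (h *m u *m invmx h) *m h = u by rewrite !mulmxA mulVmx // mul1mx mulmxKV.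
  by rewrite Qb.
- move=> k Kk; have [ku _] := unitK_unit unitK Kk.
  have e1 : Adm h *m Adm k = Adm k *m Adm h by rewrite -!AdmM // hH.
  have e2 : Adm (invmx h) *m Adm k = Adm k *m Adm (invmx h).
    by rewrite -!AdmM // (HHV hH).
  by rewrite /act -!mulmxA e1 !mulmxA -(mulmxA _ Q) QK // mulmxA e2.
Qed.

Lemma cvm_tr_transposes (Q : nat -> 'M[C]_N) L :
  (forall k, transposes (Q k) (Q k)) -> cvm Q L -> transposes L L.
Proof.
move=> h QL x y.
have h1 := cvs_trace (cvmM (cvm_ap QL (cvm_cst x)) (cvm_cst y)).
have h2 := cvs_trace (cvmM (cvm_cst x) (cvm_ap QL (cvm_cst y))).
by apply: (cvs_uniq h1); apply: cvs_ext h2 => k; rewrite h.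
Qed.

Lemma subproj_cvm (Q : nat -> 'M[C]_N) L : (forall k, subproj (Q k)) -> cvm Q L -> subproj L.
Proof.
move=> h QL; split.
- apply: (cvm_uniq (cvmM QL QL)); apply: cvm_ext QL => k; by case: (h k) => ->.
- by apply: cvm_tr_transposes QL => k; case: (h k).
- move=> x y; have b := cvm_br (cvm_ap QL (cvm_cst x)) (cvm_ap QL (cvm_cst y)).
  apply: (cvm_uniq (cvm_ap QL b)); apply: cvm_ext b => k; by case: (h k).
- move=> k Kk; apply: (cvm_uniq (cvmM QL (cvm_cst (Adm k)))).
  by apply: cvm_ext (cvmM (cvm_cst (Adm k)) QL) => l; case: (h l) => _ _ _ ->.
Qed.

Lemma subproj_ad Q x : subproj Q -> ap Q x = x -> Q *m adm x = adm x *m Q.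
Proof.
move=> [QQ QT Qb _] xQ.
have e : Q *m adm x *m Q = Q *m adm x.
  by apply: ap_ext => z; rewrite !apM apadm -{1 2}xQ Qb xQ.
have T1 := transposesM QT (adm_transposes x).
have T2 := transposesM T1 QT; rewrite e in T2.
have : - adm x *m Q = Q *m (- adm x *m Q).
  by apply: ap_ext => z; apply: tr_ext => y; rewrite -T1 -T2.
by rewrite mulmxA mulmxN !mulNmx e => /oppr_inj.
Qed.

Lemma cvm_nondeg_op (Q : nat -> 'M[C]_N) L : cvm Q L -> cvm (fun k => nondeg_op (Q k)) (nondeg_op L).
Proof.
move=> QL; apply: cvmD; last exact: cvmB (cvm_cst _) QL.
apply: cvmM (QL); apply: (cvmM (QL)); apply: cvm_op => x; rewrite ap_Om.
apply: (@cvm_ext _ _ _ _ (fun k => killing (Q k) x)) => [k|]; first by rewrite ap_Om.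
apply: cvm_entries => b a; rewrite mxE.
apply: cvs_ext (cvs_trace (cvmM (cvm_cst (adm x *m adm (delta_mx a b))) QL)) => k.
by rewrite mxE.
Qed.

Variable P : 'M[C]_N.
Hypothesis sP : subproj P.
Hypothesis Pnd : forall x, ap P x = x -> (forall y, \tr (adm x *m adm y *m P) = 0) -> x = 0.

Lemma nondeg_op_unit : nondeg_op P \in unitmx.
Proof.
have [PP PT Pb _] := sP; apply: op_unit => x.
rewrite /nondeg_op apDl apBl ap1 !apM => h.
have xP : ap P x = x.
  have PPz z : ap P (ap P z) = ap P z by rewrite -apM PP.
  have := congr1 (ap P) h; rewrite apD apB !PPz subrr addr0 ap0 => h'.
  by move: h; rewrite h' add0r => /eqP; rewrite subr_eq0 => /eqP.
move: h; rewrite xP subrr addr0 => h0; apply: Pnd => // y.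
have yP : \tr (adm x *m adm (ap P y) *m P) = 0.
  by rewrite -killing_tr PT -ap_Om h0 mulmx0 linear0.
(* Bracketing with the component of [y] in the kernel of [P] maps the subalgebra into that kernel,
   by invariance of the trace form; so only [ap P y] contributes to the Killing form. *)
have y0 : P *m adm x *m adm (y - ap P y) *m P = 0.
  apply: ap_ext => z; rewrite [RHS]/ap mulmx0 linear0; apply: tr_ext => t.
  rewrite mulmx0 linear0 !apM !apadm mxtrace_mulC PT br_trA.
  have -> : br (br x (ap P z)) (ap P t) = ap P (br (br x (ap P z)) (ap P t)).
    have e : ap P (br x (ap P z)) = br x (ap P z) by rewrite -xP Pb.
    by rewrite -e Pb.
  by rewrite -PT apB -apM PP subrr mul0mx linear0.
have -> : adm y = adm (ap P y) + adm (y - ap P y).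
  by rewrite -[adm (ap P y)]scale1r -adm_lin scale1r addrC subrK.
rewrite mulmxDr mulmxDl linearD /= yP add0r; set y' := y - ap P y in y0 *.
by rewrite -PP mulmxA mxtrace_mulC !mulmxA y0 linear0.
Qed.

Definition orbit_closure Q := forall e : R, 0 < e ->
  exists h, [/\ HH h, h \in unitmx & nm (act h P - Q) < e].

Lemma orbit_closure_seq Q : orbit_closure Q -> exists h : nat -> 'M[C]_n,
  (forall k, HH (h k) /\ h k \in unitmx) /\ cvm (fun k => act (h k) P) Q.
Proof.
move=> hQ; have /choice [h hh] (k : nat) : exists h, [/\ HH h, h \in unitmx & nm (act h P - Q) < k.+1%:R^-1].
  by apply: hQ; rewrite invr_gt0.
exists h; split=> [k|]; first by case: (hh k).
by apply: cvg0_leA cvg0_inv => k; case: (hh k) => _ _ /ltW.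
Qed.

Lemma orbit_closure_act h Q : HH h -> h \in unitmx -> orbit_closure Q -> orbit_closure (act h Q).
Proof.
move=> hH hu /orbit_closure_seq [g [gH gQ]] e e0.
have := cvm_act hu (cvm_cst h) gQ => /(_ e e0) /near_ex [k hk].
exists (h *m g k); have [gk gu] := gH k; split; first exact: HHM.
  by rewrite unitmx_mul hu.
by rewrite actM.
Qed.

(** A point of least norm in the closure of the orbit. Comparing it with its images under [1 + e x],
    for [x] and for its multiples by [-1], [i] and [-i], makes the whole derivative of the squared
    norm vanish. *)
Lemma min_vector : exists Q, [/\ orbit_closure Q, subproj Q, nondeg_op Q \in unitmx &
  forall x, HH x -> ip (dact x Q) Q = 0].
Proof.
have oP : orbit_closure P.
  by move=> e e0; exists 1%:M; rewrite act1 subrr nm0; split=> //; [exact: HH1 | exact: unitmx1].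
have [|||||Q [oQ _] Qmin] := @min_attained _ _ _ _ (fun Q => orbit_closure Q /\ nm Q <= nm P) (@nm R S N N) (nm P).
- by exists P.
- by move=> Q [].
- move=> A L hA AL; split=> [e e0|]; last first.
    by apply: (cvm_le_nm AL); apply: nearW => k; case: (hA k).
  have e2 : 0 < e / 2 by lra.
  have [k hk] := near_ex (AL _ e2); have [/(_ _ e2) [h [hH hu hh]] _] := hA k.
  exists h; split=> //; apply: le_lt_trans (nm_triB _ (A k) _) _; lra.
- by move=> A L _; exact: cvm_nm.
- by move=> Q; exact: nm_ge0.
have {}Qmin Q' : orbit_closure Q' -> nm Q <= nm Q'.
  move=> oQ'; have [h|/ltW h] := leP (nm Q') (nm P); first exact: Qmin.
  by apply: le_trans h; apply: Qmin.
have [h [hH hQ]] := orbit_closure_seq oQ.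
exists Q; split=> //.
- by apply: subproj_cvm hQ => k; apply: subproj_act => //; case: (hH k).
- rewrite unitmxE unitfE.
  have -> : \det (nondeg_op Q) = \det (nondeg_op P).
    apply: (cvs_uniq (cvs_det (cvm_nondeg_op hQ))); apply: cvs_ext (cvs_cst _) => k.
    by have [_ ku] := hH k; rewrite nondeg_op_act // det_act.
  by rewrite -unitfE -unitmxE nondeg_op_unit.
move=> x xH; have key y : HH y -> 0 <= re (ip (dact y Q) Q).
  move=> yH; have ep (k : nat) : 0 < k.+1%:R^-1 :> R by rewrite invr_gt0.
  apply: min_ortho cvg0_inv (ep) (act_quot y cvg0_inv ep (cvm_cst Q)) _.
  have h1 : cvm (fun k => 1%:M + io k.+1%:R^-1 *: y) 1%:M.
    have := cvmD (cvm_cst (1%:M : 'M[C]_n)) (cvmZ (cvs_io0 cvg0_inv ep) (cvm_cst y)).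
    by rewrite scale0r addr0.
  apply: filterS (cvm_unit h1 (unitmx1 _ _)) => k ku; apply: Qmin; apply: orbit_closure_act => //.
  by apply: HHD; [exact: HH1 | exact: HHZ].
have dZ a y : dact (a *: y) Q = a *: dact y Q.
  by rewrite /dact admZ -scalemxAr -scalemxAl scalerBr.
have h1 := key _ xH; have h2 := key _ (HHZ (-1) xH); have h3 := key _ (HHZ 'i xH).
have h4 := key _ (HHZ (- 'i) xH); move: h2 h3 h4; rewrite !dZ !ipZl mulN1r reN mulNr reN !reM re_i im_i.
rewrite !mul0r !mul1r => h2 h3 h4.
have r0 : re (ip (dact x Q) Q) = 0 by lra.
have i0 : im (ip (dact x Q) Q) = 0 by lra.
by rewrite [LHS]reim r0 i0 rmorph0 mulr0 addr0.
Qed.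
End SubalgebraProjections.

Lemma trB (C : numClosedFieldType) n (A B : 'M[C]_n) : \tr (A - B) = \tr A - \tr B.
Proof. exact: linearB. Qed.

(** With [B] and [Q] the adjoints of [A] and [P], the terms on the left are the squared norms of the
    commutators of [P] with [B] and with [A]; the right side is the moment of [P] at the bracket of
    [A] and [B]. *)
Lemma commutator_trace (C : numClosedFieldType) n (A B P Q : 'M[C]_n) :
  \tr ((P *m B - B *m P) *m (A *m Q - Q *m A)) - \tr ((P *m A - A *m P) *m (B *m Q - Q *m B)) =
  \tr ((B *m A - A *m B) *m (Q *m P - P *m Q)).
Proof.
rewrite !(mulmxBl, mulmxBr) !trB !mulmxA.
have c1 : \tr (P *m B *m A *m Q) = \tr (B *m A *m Q *m P) by rewrite -!mulmxA mxtrace_mulC !mulmxA.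
have c2 : \tr (P *m A *m B *m Q) = \tr (A *m B *m Q *m P) by rewrite -!mulmxA mxtrace_mulC !mulmxA.
have c3 : \tr (P *m B *m Q *m A) = \tr (A *m P *m B *m Q) by rewrite mxtrace_mulC !mulmxA.
have c4 : \tr (P *m A *m Q *m B) = \tr (B *m P *m A *m Q) by rewrite mxtrace_mulC !mulmxA.
have c5 : \tr (B *m P *m Q *m A) = \tr (A *m B *m P *m Q) by rewrite mxtrace_mulC !mulmxA.
have c6 : \tr (A *m P *m Q *m B) = \tr (B *m A *m P *m Q) by rewrite mxtrace_mulC !mulmxA.
rewrite c1 c2 c3 c4 c5 c6; ring.
Qed.

(** * Critical projections are self-adjoint *)

Section CriticalProjection.
Variables (n : nat) (K : set 'M[C]_n).
Local Notation N := (n * n)%N.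
Implicit Types (x y z : 'M[C]_n) (Q : 'M[C]_N).
Hypothesis unitK : forall k, K k -> k^t* *m k = 1%:M.
Local Notation HH := (HH K).
Variable P : 'M[C]_N.
Hypothesis sP : subproj K P.
Hypothesis Pu : nondeg_op P \in unitmx.
Hypothesis Pcrit : forall x, HH x -> ip (dact x P) P = 0.

Let PP : P *m P = P. Proof. by case: sP. Qed.
Let PT : transposes P P. Proof. by case: sP. Qed.
Let Pb x y : ap P (br (ap P x) (ap P y)) = br (ap P x) (ap P y). Proof. by case: sP. Qed.
Let PPx x : ap P (ap P x) = ap P x. Proof. by rewrite -apM PP. Qed.

Lemma adm_unitary_inv k Q : K k -> Q *m Adm k = Adm k *m Q -> Q^t* *m Adm k = Adm k *m Q^t*.
Proof.
move=> Kk h; have [ku kV] := unitK_unit unitK Kk.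
have := congr1 (fun A : 'M[C]_N => A^t*) h; rewrite /= !adjM Adm_adj // -kV => e.
have AV := AdmV ku; have VA : Adm (invmx k) *m Adm k = 1%:M.
  by have := @AdmV _ _ (invmx k); rewrite invmxK unitmx_inv => ->.
by rewrite -[Q^t* in LHS]mul1mx -AV -!mulmxA (mulmxA (Adm (invmx k))) e -!mulmxA VA mulmx1.
Qed.

Lemma trace_invariant (A : 'M[C]_N) k x : k \in unitmx -> A *m Adm k = Adm k *m A ->
  \tr (adm (k *m x *m invmx k) *m A) = \tr (adm x *m A).
Proof.
move=> ku h; rewrite adm_conj // -mulmxA -h !mulmxA mxtrace_mulC !mulmxA AdmV // mul1mx //.
Qed.

(** Criticality is assumed in the directions of the commutant; the functional is invariant under
    [K], so [K_functional] extends its vanishing to all matrices. *)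
Lemma critical_all x : \tr (adm x *m (P^t* *m P - P *m P^t*)) = 0.
Proof.
have lin a y z : \tr (adm (a *: y + z) *m (P^t* *m P - P *m P^t*)) =
    a * \tr (adm y *m (P^t* *m P - P *m P^t*)) + \tr (adm z *m (P^t* *m P - P *m P^t*)).
  by rewrite adm_lin mulmxDl linearD /= -scalemxAl linearZ.
apply: (K_functional unitK lin) => [k y Kk|y yH].
  have [ku _] := unitK_unit unitK Kk; apply: trace_invariant => //.
  have h1 : P *m Adm k = Adm k *m P by case: sP => _ _ _ ->.
  have h2 := adm_unitary_inv Kk h1.
  by rewrite mulmxBl mulmxBr -!mulmxA h1 h2 !mulmxA h1 h2.
have := Pcrit yH; rewrite ipE /dact mulmxBl linearB /= => <-.
rewrite mulmxBr linearB /=; congr (_ - _); last by rewrite mulmxA.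
by rewrite mxtrace_mulC -mulmxA mxtrace_mulC.
Qed.

Definition NZ x := P *m adm x = adm x *m P.

(** The vanishing moment makes the commutators of [P] with [ad x] and with [ad] of the adjoint of
    [x] equally long. *)
Lemma NZ_adj x : NZ x -> NZ (x^t*).
Proof.
move=> h; apply/eqP; rewrite -subr_eq0; apply/eqP; apply: (@fn0_eq0).
have e0 : \tr ((P *m adm x - adm x *m P) *m (P *m adm x - adm x *m P)^t*) = 0.
  by rewrite h subrr mul0mx linear0.
rewrite -[RHS]e0; apply/eqP; rewrite -subr_eq0; apply/eqP.
have := critical_all (br x (x^t*)); rewrite adm_br -adm_adj => <-.
rewrite !adjB !adjM trmxCK; set A := adm x; set B := A^t*; set Q := P^t*.
exact: commutator_trace.
Qed.

Lemma proj_central0 x : ap P x = x -> (forall y, br x (ap P y) = 0) -> x = 0.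
Proof.
move=> xP h; have k0 : ap (nondeg_op P) x = 0.
  rewrite /nondeg_op apDl apBl ap1 !apM xP subrr addr0 ap_Om.
  rewrite (_ : killing P x = 0) ?ap0 //; apply: tr_ext => y; rewrite killing_tr mulmx0 linear0.
  rewrite mxtrace_mulC mulmxA (_ : P *m adm x = 0) ?mul0mx ?linear0 //.
  by apply: ap_ext => z; rewrite apM apadm h /ap mulmx0 linear0.
have := congr1 mxvec k0; rewrite /ap vec_mxK linear0 => e.
by rewrite -[x]mxvecK -[mxvec x](mulmxK Pu) e mul0mx linear0.
Qed.

(** The range of [P] is perfect: its Killing form is nondegenerate, so an element of the range that
    is orthogonal to all its brackets is central in it, hence 0. *)
Lemma proj_perfect c : (forall y z, \tr (c *m br (ap P y) (ap P z)) = 0) -> ap P c = 0.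
Proof.
move=> h; apply: proj_central0 => // y; apply: tr_ext => z; rewrite mulmx0 linear0.
by rewrite mxtrace_mulC -Pb PT br_trA PT Pb h.
Qed.

Lemma NZ_proj x : NZ (ap P x).
Proof. exact: (subproj_ad sP). Qed.

Lemma NZ_ap x y : NZ x -> ap P (br x y) = br x (ap P y).
Proof. by move=> h; rewrite -!apadm -!apM h. Qed.

(** Let [b] be the part of the range of [P] stable under adjoints and [v] an element of the range
    orthogonal to it. The adjoint of [v] normalises the range; its brackets with the range lie in
    [b] and turn out to be 0, so by perfectness it is orthogonal to the range, in particular to [v],
    whose norm is then 0. *)
Lemma proj_selfadj : P^t* = P.
Proof.
have [|||b bP] := @vspace_of_set _ _ (fun x => ap P x = x /\ ap P (x^t*) = x^t*).
- by rewrite adj0 ap0.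
- by move=> x y [hx hx'] [hy hy']; rewrite adjD !apD hx hy hx' hy'.
- by move=> a x [hx hx']; rewrite adjZ !apZ hx hx'.
have bS x : x \in b -> x^t* \in b by move=> /bP [h1 h2]; apply/bP; rewrite trmxCK.
have nd : nondeg b.
  by move=> x xb h; apply: (@fn0_eq0); apply: h; exact: bS.
have [Pb' [hb1 hb2]] := nondeg_proj nd.
have sub x : ap P x = x -> x \in b.
  move=> xP; set u := ap Pb' x; have ub : u \in b := hb1 x; set v := x - u.
  have vP : ap P v = v by rewrite /v apB xP; have /bP [-> _] := ub.
  have vb y : y \in b -> \tr (v *m y) = 0 by exact: hb2.
  have Nv : NZ (v^t*) by apply: NZ_adj; rewrite -vP; exact: NZ_proj.
  have br_adj y z : (br y z)^t* = br (z^t*) (y^t*) by rewrite /br adjB !adjM.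
  have vbr y z : \tr (v^t* *m br (ap P y) (ap P z)) = 0.
    rewrite -br_trA; set s := br (v^t*) (ap P y).
    have Ny : NZ ((ap P y)^t*) by apply: NZ_adj; exact: NZ_proj.
    have sb : s \in b.
      apply/bP; rewrite /s br_adj trmxCK NZ_ap // PPx; split=> //.
      by rewrite NZ_ap // vP.
    rewrite (_ : s = 0) ?mul0mx ?linear0 //; apply: (@fn0_eq0).
    have /bP [tP _] : s^t* \in b by exact: bS.
    have tb := bS _ sb; have /bP [_ t2] := tb; rewrite trmxCK in t2.
    rewrite {1}/s br_trA; have wb : br (ap P y) (s^t*) \in b.
      apply/bP; rewrite -{1 2}tP Pb br_adj trmxCK; split=> //.
      by rewrite brN -scaleN1r apZ NZ_ap // t2.
    have := vb _ (bS _ wb); rewrite -[\tr _]conjCK -adj_tr adjM trmxCK mxtrace_mulC => /eqP.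
    by rewrite conjC_eq0 => /eqP.
  have v0 : v = 0.
    apply: (@fn0_eq0); rewrite mxtrace_mulC -{2}vP -PT.
    by rewrite proj_perfect // mul0mx linear0.
  by move/eqP: v0; rewrite subr_eq0 => /eqP ->.
have e : P^t* *m P = P^t*.
  apply: ap_ext => x; rewrite apM (ap_transposes_adj _ PT).
  by have /bP [_ ->] := sub _ (PPx (x^t*)).
by have := congr1 (fun A : 'M[C]_N => A^t*) e; rewrite /= adjM trmxCK e.
Qed.
End CriticalProjection.

(** * Vanishing of the first cohomology through the Casimir operator *)

Section Rigidity.
Variables (n : nat) (K : set 'M[C]_n).
Local Notation N := (n * n)%N.
Implicit Types (x y z : 'M[C]_n) (Q : 'M[C]_N).
Hypothesis unitK : forall k, K k -> k^t* *m k = 1%:M.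
Local Notation HH := (HH K).
Variables P phi : 'M[C]_N.
Hypothesis sP : subproj K P.
Hypothesis Pu : nondeg_op P \in unitmx.
Hypothesis Padj : P^t* = P.
Hypothesis phiP : phi = phi *m P + P *m phi.
Hypothesis phiT : transposes phi phi.
Hypothesis phiK : forall k, K k -> phi *m Adm k = Adm k *m phi.
Hypothesis phi_der : forall x y, ap phi (br (ap P x) (ap P y)) +
  ap P (br (ap phi x) (ap P y) + br (ap P x) (ap phi y)) =
  br (ap phi x) (ap P y) + br (ap P x) (ap phi y).
Hypothesis phi_ortho : forall x, HH x -> ip phi (dact x P) = 0.

Let PP : P *m P = P. Proof. by case: sP. Qed.
Let PT : transposes P P. Proof. by case: sP. Qed.
Let Pb x y : ap P (br (ap P x) (ap P y)) = br (ap P x) (ap P y). Proof. by case: sP. Qed.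
Let PPx x : ap P (ap P x) = ap P x. Proof. by rewrite -apM PP. Qed.
Let Pbr x y : ap P (br (ap P x) y) = br (ap P x) (ap P y).
Proof. exact: NZ_ap (NZ_proj sP x). Qed.

Lemma PphiP x : ap P (ap phi (ap P x)) = 0.
Proof.
suff : P *m phi *m P = 0 by rewrite -!apM mulmxA => ->; rewrite /ap mulmx0 linear0.
apply: (addrI (P *m phi *m P)); rewrite addr0 -[RHS]/(P *m phi *m P).
rewrite [in RHS]phiP mulmxDr mulmxDl !mulmxA -(mulmxA (P *m phi) P P) PP.
by [].
Qed.

(** A tangent vector to the variety of these projections is, on the subalgebra, a 1-cocycle with
    values in the kernel of [P]. *)
Lemma phi_derivation x y : ap phi (br (ap P x) (ap P y)) =
  br (ap phi (ap P x)) (ap P y) + br (ap P x) (ap phi (ap P y)).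
Proof.
have := phi_der (ap P x) (ap P y); rewrite !PPx => <-.
rewrite apD Pbr PphiP [br (ap phi (ap P x)) _]brN -scaleN1r apZ Pbr PphiP.
by rewrite !br0r scaler0 !addr0.
Qed.

(** Orthogonality to the directions of the commutant, spread to all matrices by [K_functional]. *)
Lemma phi_trace x : \tr (adm x *m (P *m phi)) = 0.
Proof.
have lin a y z : \tr (adm (a *: y + z) *m (P *m phi)) =
    a * \tr (adm y *m (P *m phi)) + \tr (adm z *m (P *m phi)).
  by rewrite adm_lin mulmxDl linearD /= -scalemxAl linearZ.
apply: (K_functional unitK lin) => [k y Kk|y yH].
  have [ku _] := unitK_unit unitK Kk; apply: trace_invariant => //.
  have h1 : P *m Adm k = Adm k *m P by case: sP => _ _ _ ->.
  by rewrite -mulmxA phiK // mulmxA h1 mulmxA.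
have := phi_ortho (HH_adj unitK yH); rewrite ipE /dact adjB !adjM adm_adj trmxCK Padj.
rewrite mulmxBr trB => h.
have e : \tr (adm y *m (P *m phi)) = - \tr (phi *m (P *m adm y)).
  rewrite (tr_transposes (transposesM (adm_transposes y) (transposesM PT phiT))).
  by rewrite !mulmxN mulmxA linearN.
have e2 : \tr (phi *m (adm y *m P)) = \tr (adm y *m (P *m phi)).
  by rewrite mxtrace_mulC mulmxA.
move: h; rewrite e2 -[\tr (phi *m (P *m _))]opprK -e opprK -mulr2n => /eqP.
by rewrite mulrn_eq0 => /eqP.
Qed.

(** The trace condition says that the cocycle is coclosed: its contraction with the canonical tensor
    of the subalgebra vanishes. *)
Lemma phi_moment : \sum_a \sum_b br (ap phi (ap P (delta_mx a b))) (ap P (delta_mx b a)) = 0.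
Proof.
have := @tensor_transposes _ _ _ (fun u v => br (ap phi (ap P u)) v) _ _ _ _ PT.
move=> /(_ _ _) <-; last 2 first.
- by move=> a x y z; rewrite !apD !apZ brDl brZl.
- by move=> a x y z; rewrite brDr brZr.
apply: tr_ext => x; rewrite mulmx0 linear0 -[RHS](phi_trace x) [RHS]mxtrace_mulC tr_op.
rewrite tr_sum2; apply: eq_bigr => a _; apply: eq_bigr => b _ /=.
by rewrite PPx -br_trA !apM apadm.
Qed.

(** Closed and coclosed cocycles are harmonic: by the cocycle identity the Casimir operator at
    [phi z] is a bracket of [z] with the vanishing contraction, up to terms that cancel because the
    canonical tensor is invariant. *)
Lemma phi_casimir y :
  \sum_a \sum_b br (ap P (delta_mx b a)) (br (ap P (delta_mx a b)) (ap phi (ap P y))) = 0.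
Proof.
pose z := ap P y; have Nz : NZ P z := NZ_proj sP y.
have m0 : \sum_a \sum_b br z (br (ap P (delta_mx b a)) (ap phi (ap P (delta_mx a b)))) = 0.
  have := congr1 (br z) phi_moment; rewrite br0r br_sum2 => h.
  rewrite -[RHS]oppr0 -[in RHS]h -sumrN; apply: eq_bigr => a _.
  rewrite -sumrN; apply: eq_bigr => b _.
  by rewrite [br (ap P _) _]brN -scaleN1r brZr scaleN1r.
have := @tensor_transposes _ _ _ (fun u v => br (ap P v) (ap phi (ap P u))) _ _ _ _
  (transposesM PT (adm_transposes z)).
move=> t.
have {}t : \sum_a \sum_b br (ap P (delta_mx b a)) (ap phi (br z (ap P (delta_mx a b)))) =
    - \sum_a \sum_b br (br z (ap P (delta_mx b a))) (ap phi (ap P (delta_mx a b))).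
  rewrite -sumrN; under [RHS]eq_bigr do rewrite -sumrN.
  transitivity (\sum_a \sum_b br (ap P (delta_mx b a)) (ap phi (ap P (ap (P *m adm z) (delta_mx a b))))).
    by apply: eq_bigr => a _; apply: eq_bigr => b _; rewrite apM apadm /z Pb.
  rewrite t; last 2 first.
  - by move=> a u v w; rewrite !apD !apZ brDr brZr.
  - by move=> a u v w; rewrite !apD !apZ brDl brZl.
  apply: eq_bigr => a _; apply: eq_bigr => b _; rewrite apM apNl apadm.
  by rewrite -[- br z _]scaleN1r !apZ PPx NZ_ap // brZl scaleN1r.
rewrite -[RHS]m0.
transitivity (\sum_a \sum_b (br (br z (ap P (delta_mx b a))) (ap phi (ap P (delta_mx a b)))
   + br (ap P (delta_mx b a)) (ap phi (br z (ap P (delta_mx a b))))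
   + br (ap P (delta_mx b a)) (br (ap P (delta_mx a b)) (ap phi z)))).
  have gen (F1 F2 F3 : 'I_n -> 'I_n -> 'M[C]_n) : \sum_a \sum_b F2 a b = - \sum_a \sum_b F1 a b ->
      \sum_a \sum_b (F1 a b + F2 a b + F3 a b) = \sum_a \sum_b F3 a b.
    move=> e; transitivity (\sum_a \sum_b F1 a b + \sum_a \sum_b F2 a b + \sum_a \sum_b F3 a b).
      by rewrite -!big_split /=; apply: eq_bigr => a _; rewrite -!big_split.
    by rewrite e addrN add0r.
  by rewrite gen.
apply: eq_bigr => a _; apply: eq_bigr => b _.
rewrite [RHS]jacobi -addrA; congr (_ + _); rewrite -brDr; congr br.
by rewrite phi_derivation [br (ap phi _) _]brN addrAC addNr add0r.
Qed.

(** As [P] is self-adjoint, pairing the Casimir relation with [v] gives a sum of squared norms of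
    [br (ap P _) v], so the values of [phi] on the subalgebra commute with it. The cocycle identity
    then makes [phi] vanish on brackets, hence everywhere by perfectness. *)
Lemma phi_eq0 : phi = 0.
Proof.
have Pstar x : (ap P x)^t* = ap P (x^t*).
  by have := ap_transposes_adj (x^t*) PT; rewrite Padj trmxCK => ->.
have cen x y : br (ap P x) (ap phi (ap P y)) = 0.
  set v := ap phi (ap P y).
  have w0 a b : br (ap P (delta_mx a b)) v = 0.
    have h : \sum_(p : 'I_n * 'I_n) io (fn (br (ap P (delta_mx p.1 p.2)) v)) = 0.
      rewrite -(pair_bigA _ (fun a b => io (fn (br (ap P (delta_mx a b)) v)))) /=.
      have := congr1 (fun A => \tr (v^t* *m A)) (phi_casimir y); rewrite /= mulmx0 linear0 => h0.
      rewrite -[RHS]h0 tr_sum2; apply: eq_bigr => c _; apply: eq_bigr => d _ /=.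
      rewrite -/v -ip_fn ipE [RHS]mxtrace_mulC [br (ap P (delta_mx d c)) _]brN mulNmx linearN /= [in RHS]br_trA.
      rewrite -linearN /= -mulmxN -brN; congr (\tr (_ *m _)).
      rewrite /br adjB !adjM Pstar; congr (_ *m ap P _ - ap P _ *m _).
        by apply/matrixP => i j; rewrite !mxE rmorph_nat andbC.
      by apply/matrixP => i j; rewrite !mxE rmorph_nat andbC.
    have h' := sum_nonneg_eq0 _ h (mem_index_enum (a, b)).
    apply/eqP; rewrite -(@fn_eq0 R S); apply/eqP/(@io_inj R S).
    by rewrite rmorph0; apply: h' => p _; rewrite io_ge0 fn_ge0.
  rewrite (matrix_sum_delta x) ap_sum /br mulmx_suml mulmx_sumr -sumrB big1 // => i _.
  rewrite ap_sum mulmx_suml mulmx_sumr -sumrB big1 // => j _.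
  by rewrite apZ -/(br _ _) brZl w0 scaler0.
have z0 : phi *m P = 0.
  apply: ap_ext => u; rewrite apM [RHS]/ap mulmx0 linear0.
  apply: (proj_perfect sP Pu) => y z; rewrite phiT phi_derivation cen brN cen oppr0 addr0 mulmx0.
  exact: linear0.
rewrite phiP z0 add0r; apply: ap_ext => x; rewrite [RHS]/ap mulmx0 linear0.
apply: tr_ext => y; have := transposesM phiT PT => /(_ y x) <-.
by rewrite z0 mulmx0 linear0 {1}/ap mulmx0 linear0 mul0mx linear0.
Qed.
End Rigidity.

(** * From the closure of the orbit of the projection to the orbit itself *)

Section CompactRealForm.

Lemma eq0_of_re (u : C) : (forall a : C, 0 <= re (a * u)) -> u = 0.
Proof.
move=> h; have h1 := h 1; have h2 := h (-1); have h3 := h 'i; have h4 := h (- 'i).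
move: h1 h2 h3 h4; rewrite !mulN1r mul1r !mulNr !reN !reM re_i im_i !mul0r !mul1r => h1 h2 h3 h4.
have r0 : re u = 0 by lra.
have i0 : im u = 0 by lra.
by rewrite [LHS]reim r0 i0 rmorph0 mulr0 addr0.
Qed.

Lemma nm_min_ortho m p (A D : 'M[C]_(m, p)) :
  (forall a : C, nm A <= nm (A + a *: D)) -> ip A D = 0.
Proof.
move=> h; have e0 := @cvg0_inv R; have ep (k : nat) : 0 < k.+1%:R^-1 :> R by rewrite invr_gt0.
suff : ip D A = 0 by rewrite -(ipJ D A) => ->; rewrite conjC0.
apply: eq0_of_re => a; rewrite -ipZl; apply: (min_ortho (A := fun k => A + io k.+1%:R^-1 *: (a *: D)) e0 ep).
  apply: cvm_ext (cvm_cst (a *: D)) => k; rewrite addrC addKr scalerA -rmorphM mulVf ?gt_eqF //.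
  by rewrite (rmorph1 io) scale1r.
by apply: nearW => k; rewrite scalerA.
Qed.

Variables (n : nat) (K : set 'M[C]_n).
Local Notation N := (n * n)%N.
Implicit Types (x y z : 'M[C]_n) (Q : 'M[C]_N).
Hypothesis unitK : forall k, K k -> k^t* *m k = 1%:M.
Local Notation HH := (HH K).
Variable P : 'M[C]_N.
Hypothesis sP : subproj K P.
Hypothesis Pnd : forall x, ap P x = x -> (forall y, \tr (adm x *m adm y *m P) = 0) -> x = 0.

(** The weight [c] is a penalty that keeps the minimiser near 1; the radius 1/2 keeps the
    competitors invertible. *)
Lemma penalised_min (Pk P0 : 'M[C]_N) (c : R) : 0 <= c ->
  exists h, [/\ HH h, nm (h - 1%:M) <= 2^-1 & forall h', HH h' -> nm (h' - 1%:M) <= 2^-1 ->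
    nm (act h Pk - P0) + c * nm (h - 1%:M) <= nm (act h' Pk - P0) + c * nm (h' - 1%:M)].
Proof.
move=> c0; pose f (h : 'M[C]_n) := nm (act h Pk - P0) + c * nm (h - 1%:M).
have un (h : 'M[C]_n) : nm (h - 1%:M) <= 2^-1 -> h \in unitmx.
  by move=> hh; apply: (@near1_unit); apply: le_lt_trans hh _; rewrite invf_lt1 ?ltr1n.
have [|||||h [hH h1] hmin] := @min_attained _ _ _ _ (fun h => HH h /\ nm (h - 1%:M) <= 2^-1) f (2^-1 + nm (1%:M : 'M[C]_n)).
- by exists 1%:M; split; [exact: HH1 | rewrite subrr nm0 invr_ge0].
- by move=> h [_ hh]; rewrite -[h](subrK 1%:M); apply: le_trans (nmD _ _) _; rewrite lerD2r.
- move=> A L hA AL; split.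
    move=> k Kk; apply: (cvm_uniq (cvmM AL (cvm_cst k))).
    by apply: cvm_ext (cvmM (cvm_cst k) AL) => l; have [-> ] := hA l.
  apply: (cvm_le_nm (cvmB AL (cvm_cst 1%:M))); apply: nearW => k; by case: (hA k).
- move=> A L hA AL.
  have Lu : L \in unitmx.
    apply: un; apply: (cvm_le_nm (cvmB AL (cvm_cst 1%:M))); apply: nearW => k; by case: (hA k).
  have a1 := cvm_nm (cvmB (cvm_act Lu AL (cvm_cst Pk)) (cvm_cst P0)).
  have a2 := cvm_nm (cvmB AL (cvm_cst 1%:M)).
  apply: cvg0_leA (cvg0D a1 (cvg0Z c0 a2)) => k; rewrite /f opprD addrACA.
  apply: le_trans (ler_normD _ _) _; rewrite lerD2l -mulrBr normrM ger0_norm //.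
- by move=> h; rewrite addr_ge0 ?nm_ge0 // mulr_ge0 ?nm_ge0.
by exists h; split=> // h' hH' h1'; apply: hmin.
Qed.

Lemma subproj_tangent P0 (Q : nat -> 'M[C]_N) (e : nat -> R) phi : cvg0 e -> (forall k, 0 < e k) ->
  (forall k, subproj K (Q k)) -> subproj K P0 ->
  cvm Q P0 -> cvm (fun k => io ((e k)^-1) *: (Q k - P0)) phi ->
  [/\ phi = phi *m P0 + P0 *m phi, transposes phi phi,
    (forall k, K k -> phi *m Adm k = Adm k *m phi) &
    (forall x y, ap phi (br (ap P0 x) (ap P0 y)) +
      ap P0 (br (ap phi x) (ap P0 y) + br (ap P0 x) (ap phi y)) =
      br (ap phi x) (ap P0 y) + br (ap P0 x) (ap phi y))].
Proof.
move=> e0 ep sQ [PP PT Pb PK] QP hphi; pose F k := io ((e k)^-1) *: (Q k - P0).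
split.
- have := cvmD (cvmM hphi QP) (cvmM (cvm_cst P0) hphi).
  apply: cvm_uniq; apply: cvm_ext hphi => k; have [QQ _ _ _] := sQ k.
  rewrite -scalemxAl -scalemxAr -scalerDr mulmxBl mulmxBr QQ PP; congr (_ *: _).
  by rewrite addrA subrK.
- move=> x y; have h1 := cvs_trace (cvmM (cvm_ap hphi (cvm_cst x)) (cvm_cst y)).
  have h2 := cvs_trace (cvmM (cvm_cst x) (cvm_ap hphi (cvm_cst y))).
  apply: (cvs_uniq h1); apply: cvs_ext h2 => k; have [_ QT _ _] := sQ k.
  by rewrite !apZl !apBl -scalemxAl -scalemxAr !linearZ /= mulmxBl mulmxBr !linearB /= QT PT.
- move=> k Kk; apply: (cvm_uniq (cvmM hphi (cvm_cst (Adm k)))).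
  apply: cvm_ext (cvmM (cvm_cst (Adm k)) hphi) => l; have [_ _ _ QK] := sQ l.
  by rewrite -scalemxAl -scalemxAr mulmxBl mulmxBr QK // PK.
- move=> x y; pose w k := br (ap (F k) x) (ap (Q k) y) + br (ap P0 x) (ap (F k) y).
  have hw : cvm w (br (ap phi x) (ap P0 y) + br (ap P0 x) (ap phi y)).
    by apply: cvmD; apply: cvm_br; apply: cvm_ap => //; exact: cvm_cst.
  apply: (cvm_uniq _ hw).
  apply: cvm_ext (cvmD (cvm_ap hphi (cvm_br (cvm_ap QP (cvm_cst x)) (cvm_ap QP (cvm_cst y)))) (cvm_ap (cvm_cst P0) hw)) => k.
  have [_ _ Qb _] := sQ k.
  have wE : w k = io ((e k)^-1) *: (br (ap (Q k) x) (ap (Q k) y) - br (ap P0 x) (ap P0 y)).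
    rewrite /w /F !apZl brZl brZr -scalerDr !apBl; congr (_ *: _).
    have brBl (u v t : 'M[C]_n) : br (u - v) t = br u t - br v t.
      by rewrite -scaleN1r brDl brZl scaleN1r.
    have brBr (u v t : 'M[C]_n) : br t (u - v) = br t u - br t v.
      by rewrite -scaleN1r brDr brZr scaleN1r.
    by rewrite brBl brBr addrA subrK.
  rewrite wE apZl apBl apZ apB Qb Pb -scalerDr; congr (_ *: _).
  by rewrite addrA subrK.
Qed.

(** The point [P0] of least norm in the closure is self-adjoint. If it were off the orbit, take
    points of the orbit tending to it, each corrected by an element near 1 that nearly minimises the
    distance: their rescaled differences from [P0] would have a limit [phi] of norm 1, tangent to
    the variety and orthogonal to the directions of the commutant, which rigidity excludes. *)
Lemma selfadj_conjugate : exists h, [/\ HH h, h \in unitmx & (act h P)^t* = act h P].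
Proof.
have [P0 [oP0 sP0 P0u P0c]] := min_vector unitK sP Pnd.
have P0a := proj_selfadj unitK sP0 P0u P0c.
apply: contrapT => nex.
have ne h : HH h -> h \in unitmx -> act h P <> P0.
  by move=> hH hu e; apply: nex; exists h; rewrite e.
have [g [gH gP]] := orbit_closure_seq oP0.
(* The penalty is the square root of the distance: it tends to 0, so minimality becomes exact in the
   limit, yet [c |h - 1| <= d] still forces [h] to tend to 1. *)
pose d k := nm (act (g k) P - P0); pose c k := Num.sqrt (d k).
have d0 k : 0 < d k by rewrite nm_gt0 subr_eq0; apply/eqP; apply: ne; case: (gH k).
have c0 k : 0 < c k by rewrite sqrtr_gt0.
have c2 k : c k * c k = d k by rewrite -expr2 sqr_sqrtr // ltW.
have cl : cvg0 c.
  move=> e e0; have := gP (e * e) (mulr_gt0 e0 e0); apply: filterS => k hk.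
  by rewrite ltNge; apply/negP => ec; move: hk; rewrite -/(d k) -c2 ltNge ler_pM // ltW.
clearbody c.
have /choice [h hh] := fun k => penalised_min (act (g k) P) P0 (ltW (c0 k)).
have hu k : h k \in unitmx.
  have [_ h1 _] := hh k; apply: (@near1_unit); apply: le_lt_trans h1 _.
  by rewrite invf_lt1 ?ltr1n.
pose Q k := act (h k) (act (g k) P); pose e k := nm (Q k - P0).
have hle k : e k + c k * nm (h k - 1%:M) <= d k.
  have [_ _ /(_ 1%:M (HH1 (K := K)))] := hh k; rewrite act1 subrr nm0 mulr0 addr0 => hm.
  by apply: hm; rewrite invr_ge0 ler0n.
have ed k : e k <= d k.
  by apply: le_trans (hle k); rewrite lerDl mulr_ge0 ?nm_ge0 // ltW.
have e0 k : 0 < e k.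
  rewrite nm_gt0 subr_eq0; apply/eqP; have [hH _ _] := hh k; have [gHk gu] := gH k.
  by rewrite /Q -actM //; apply: ne; [exact: HHM | rewrite unitmx_mul hu].
have dl0 : cvg0 d by exact: gP.
have el : cvg0 e by apply: cvg0_leA dl0.
have hl : cvm h 1%:M.
  apply: cvg0_leA cl => k; have hk := hle k; rewrite -(ler_pM2l (c0 k)) c2.
  by have := e0 k; lra.
have QP0 : cvm Q P0 by [].
have sQ k : subproj K (Q k).
  have [hH _ _] := hh k; have [gHk gu] := gH k.
  by apply: subproj_act => //; exact: subproj_act.
have nF k : nm (io ((e k)^-1) *: (Q k - P0)) = 1.
  have ei0 : 0 < (e k)^-1 by rewrite invr_gt0; exact: e0.
  by rewrite nmZ nc_io (gtr0_norm ei0) (mulVf (lt0r_neq0 (e0 k))).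
have nF1 k : nm (io ((e k)^-1) *: (Q k - P0)) <= 1 by rewrite nF.
have [psi psiS [phi hphi]] := bw_mx nF1.
pose e' := e \o psi; pose Q' := Q \o psi.
have e'l : cvg0 e' by exact: cvg0_subseq.
have e'0 k : 0 < e' k by exact: e0.
have Q'P : cvm Q' P0 by exact: (cvm_subseq psiS QP0).
have [t1 t2 t3 t4] := subproj_tangent e'l e'0 (fun k => sQ (psi k)) sP0 Q'P hphi.
have nphi : nm phi = 1.
  apply/eqP; rewrite eq_le (cvm_le_nm hphi) ?(cvm_ge_nm hphi) //; apply: nearW => k /=; by rewrite nF.
(* Compare [h] with [(1 + e m) h]: to first order the difference from [P0] moves by [e] times
   [dact m P0], while the penalty grows by at most [c e B], negligible after division by [e]. *)
have key m : HH m -> nm phi <= nm (phi + dact m P0).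
  move=> mH; rewrite nphi.
  have q := cvmD hphi (act_quot m e'l e'0 Q'P).
  pose B := nm m * (nm (1%:M : 'M[C]_n) + 1); have B0 : 0 <= B by rewrite mulr_ge0 ?nm_ge0 // addr_ge0 ?nm_ge0.
  apply/ler_addgt0Pr => del del0; rewrite -lerBlDr; apply: (cvm_ge_nm q).
  have h'l : cvm (fun k => (1%:M + io (e' k) *: m) *m h (psi k)) 1%:M.
    have := cvmM (cvmD (cvm_cst (1%:M : 'M[C]_n)) (cvmZ (cvs_io0 e'l e'0) (cvm_cst m))) (cvm_subseq psiS hl).
    by rewrite scale0r addr0 mulmx1.
  have m1l : cvm (fun k => 1%:M + io (e' k) *: m) 1%:M.
    have := cvmD (cvm_cst (1%:M : 'M[C]_n)) (cvmZ (cvs_io0 e'l e'0) (cvm_cst m)).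
    by rewrite scale0r addr0.
  have cB : cvg0 (fun k => B * c (psi k)) by exact: (cvg0Z B0 (cvg0_subseq psiS cl)).
  have h2 : 0 < 2^-1 :> R by rewrite invr_gt0.
  apply: filterS2 (filterI (h'l _ h2) (cB _ del0))
    (filterI (cvm_unit m1l (unitmx1 _ _)) (cvm_bd (cvm_subseq psiS hl))) => k [a1 a2] [a3 a4].
  set h' := (1%:M + io (e' k) *: m) *m h (psi k) in a1.
  have [hH hk1 /(_ h' _ (ltW a1))] := hh (psi k).
  have h'H : HH h' by apply: HHM => //; apply: HHD; [exact: HH1 | exact: HHZ].
  move=> /(_ h'H); rewrite -/(e (psi k)) {1}/h' actM // -/(Q (psi k)) => ineq.
  have b1 : nm (h' - 1%:M) <= e' k * B + nm (h (psi k) - 1%:M).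
    rewrite /h' mulmxDl mul1mx -addrA addrC addrAC -addrA addrC; apply: le_trans (nmD _ _) _.
    rewrite [X in X <= _]addrC lerD2r -scalemxAl nmZ nc_io (gtr0_norm (e'0 k)) (ler_pM2l (e'0 k)).
    by apply: le_trans (nmM _ _) _; exact: (ler_wpM2l (nm_ge0 m) a4).
  rewrite /=.
  have -> : io (e' k)^-1 *: (Q (psi k) - P0) + io (e' k)^-1 *: (act (1%:M + io (e' k) *: m) (Q' k) - Q' k)
      = io (e' k)^-1 *: (act (1%:M + io (e' k) *: m) (Q (psi k)) - P0).
    by rewrite -scalerDr addrC addrA subrK.
  have ei0 : 0 < (e' k)^-1 by rewrite invr_gt0; exact: e'0.
  rewrite nmZ nc_io (gtr0_norm ei0) mulrC (ler_pdivlMr _ _ (e'0 k)).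
  have b2 : c (psi k) * nm (h' - 1%:M) <= c (psi k) * (e' k * B + nm (h (psi k) - 1%:M)).
    exact: (ler_wpM2l (ltW (c0 _)) b1).
  have b3 : e' k * (B * c (psi k)) <= e' k * del by exact: (ler_wpM2l (ltW (e'0 k)) (ltW a2)).
  move: ineq; rewrite -/(e (psi k)) -[e (psi k)]/(e' k); lra.
have dactZ a m Q1 : dact (a *: m) Q1 = a *: dact m Q1.
  by rewrite /dact admZ -scalemxAr -scalemxAl scalerBr.
have phi0 := phi_eq0 unitK sP0 P0u P0a t1 t2 t3 t4.
have : phi = 0.
  apply: phi0 => x xH; apply: nm_min_ortho => a; rewrite -dactZ; apply: key; exact: HHZ.
by move=> p0; move: nphi; rewrite p0 nm0 => /eqP; rewrite eq_sym oner_eq0.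
Qed.
End CompactRealForm.

(** * Hermitian matrices and the invariant form of a bounded group *)

Section HermitianMatrices.
Variable n : nat.
Implicit Types (M u : 'M[C]_n) (v : 'cV[C]_n).

Definition dgr (d : 'I_n -> R) : 'M[C]_n := diag_mx (\row_i io (d i)).

Lemma dgr_adj d : (dgr d)^t* = dgr d.
Proof. by rewrite adj_diag; congr diag_mx; apply/rowP => i; rewrite !mxE ioJ. Qed.
Lemma dgrM d e : dgr d *m dgr e = dgr (fun i => d i * e i).
Proof. by rewrite mulmx_diag; congr diag_mx; apply/rowP => i; rewrite !mxE rmorphM. Qed.
Lemma dgr1 : dgr (fun=> 1) = 1%:M.
Proof. by apply/matrixP => i j; rewrite !mxE (rmorph1 io). Qed.

Lemma herm_diag M : M^t* = M -> exists u (d : 'I_n -> R),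
  [/\ u *m u^t* = 1%:M, u^t* *m u = 1%:M & M = u^t* *m dgr d *m u].
Proof.
move=> hM; have nM : M \is normalmx by apply/normalmxP; rewrite hM.
have /orthomx_spectralP := nM; set u := spectralmx M; set d := spectral_diag M => e.
have uu : u *m u^t* = 1%:M by apply/unitarymxP; exact: spectral_unitarymx.
have uV : invmx u = u^t* by apply: invmx_unitary; exact: spectral_unitarymx.
have uu' : u^t* *m u = 1%:M by rewrite -uV mulVmx // spectral_unit.
have ed : diag_mx d = u *m M *m u^t*.
  by rewrite e uV !mulmxA uu mul1mx -mulmxA uu mulmx1.
exists u, (fun i => re (d 0 i)); split=> //; rewrite [LHS]e uV; congr (_ *m _ *m _).
have : (diag_mx d)^t* = diag_mx d by rewrite ed !adjM trmxCK hM mulmxA.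
rewrite adj_diag => h; congr diag_mx; apply/rowP => i; rewrite mxE.
have := congr1 (fun A : 'M[C]_n => A i i) h; rewrite /= !mxE eqxx !mulr1n => /CrealP dr.
by rewrite reE; apply/esym/Creal_ReP.
Qed.
Lemma posdef_factor M : M^t* = M -> (forall v : 'cV[C]_n, v != 0 -> 0 < re (ip (M *m v) v)) ->
  exists a, a \in unitmx /\ a^t* *m a = M.
Proof.
move=> hM Mp; have [u [d [uu uu' eM]]] := herm_diag hM.
have dp i : 0 < d i.
  have v0 : u^t* *m delta_mx i (0 : 'I_1) != 0.
    apply/eqP => h; have := congr1 (fun x => u *m x) h; rewrite /= mulmxA uu mul1mx mulmx0.
    by move/matrixP/(_ i 0)/eqP; rewrite !mxE !eqxx oner_eq0.
  have := Mp _ v0; apply: contraTT; rewrite -!leNgt => di.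
  have -> : re (ip (M *m (u^t* *m delta_mx i 0)) (u^t* *m delta_mx i (0 : 'I_1))) = d i * fn (u^t* *m delta_mx i (0 : 'I_1)).
    set x := u^t* *m _; transitivity (re (io (d i) * ip x x)); last by rewrite reMio ip_fn re_io.
    congr re; rewrite /x.
    have -> : M *m (u^t* *m delta_mx i 0) = io (d i) *: (u^t* *m delta_mx i (0 : 'I_1)).
      rewrite eM -!mulmxA (mulmxA u) uu mul1mx scalemxAr; congr (_ *m _).
      apply/matrixP => a b; rewrite /dgr mul_diag_mx !mxE.
      by case: eqP => [->|]; rewrite ?mulr0.
    by rewrite ipZl.
  by have := fn_ge0 (u^t* *m delta_mx i (0 : 'I_1)); nra.
pose a := dgr (fun i => Num.sqrt (d i)) *m u.
have au : a \in unitmx.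
  have h : (u^t* *m dgr (fun i => (Num.sqrt (d i))^-1)) *m a = 1%:M.
    rewrite /a !mulmxA -(mulmxA (u^t* ) (dgr _) (dgr _)) dgrM.
    have -> : dgr (fun i => (Num.sqrt (d i))^-1 * Num.sqrt (d i)) = 1%:M :> 'M[C]_n.
      rewrite -dgr1; congr dgr; apply/funext => i; by rewrite mulVf // gt_eqF // sqrtr_gt0.
    by rewrite mulmx1.
  by case: (mulmx1_unit h).
have aa : a^t* *m a = M.
  rewrite /a adjM dgr_adj !mulmxA -(mulmxA (u^t* ) (dgr _) (dgr _)) dgrM eM; congr (_ *m dgr _ *m _).
  by apply/funext => i; rewrite -expr2 sqr_sqrtr // ltW.
by exists a.
Qed.
End HermitianMatrices.

Section InvariantForm.
Variables (n : nat) (K : set 'M[C]_n) (B : R).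
Hypothesis sK : subgroup K.
Hypothesis KB : forall k, K k -> nm k <= B.
Implicit Types (M k : 'M[C]_n) (v : 'cV[C]_n).

Let B1 := B + 1.
Let B0 : 0 < B1.
Proof. by have [_ K1 _ _] := sK; have := KB K1; have := nm_ge0 (1%:M : 'M[C]_n); rewrite /B1; lra. Qed.
Let KB1 k : K k -> nm k <= B1.
Proof. by move/KB; rewrite /B1; lra. Qed.
Let KU k : K k -> k \in unitmx.
Proof. by have [GU _ _ _] := sK => /GU. Qed.
Let KV k : K k -> K (invmx k).
Proof. by have [_ _ _ GV] := sK => /GV. Qed.
Let KM k l : K k -> K l -> K (k *m l).
Proof. by have [_ _ GM _] := sK; exact: GM. Qed.

Definition tw k M := k^t* *m M *m k.
Lemma nm_tw k M : K k -> nm (tw k M) <= B1 ^+ 2 * nm M.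
Proof.
move=> Kk; apply: le_trans (nmM _ _) _; apply: (@le_trans _ _ (B1 * nm M * B1)); last by lra.
apply: ler_pM; rewrite ?nm_ge0 ?KB1 //; apply: le_trans (nmM _ _) _.
by rewrite nm_adj ler_wpM2r ?nm_ge0 ?KB1.
Qed.
Lemma twM k l M : tw (k *m l) M = tw l (tw k M).
Proof. by rewrite /tw adjM !mulmxA. Qed.
Lemma twK k M : K k -> tw (invmx k) (tw k M) = M.
Proof.
by move=> Kk; rewrite -twM mulmxV ?KU // /tw adj1 mul1mx mulmx1.
Qed.
Lemma nm_tw_ge k M : K k -> nm M <= B1 ^+ 2 * nm (tw k M).
Proof. by move=> Kk; rewrite -{1}(twK M Kk); apply: nm_tw; exact: KV. Qed.

(* A strictly convex function of [M], invariant under the action [M |-> k^* M k] of [K];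
   its minimiser over an invariant convex set of positive definite matrices is therefore
   an invariant form. *)
Definition twsup M : R := sup [set nm (tw k M) | k in K].
Lemma twsup_has M : has_sup [set nm (tw k M) | k in K].
Proof.
split; first by have [_ K1 _ _] := sK; exists (nm (tw 1%:M M)); exists 1%:M.
by exists (B1 ^+ 2 * nm M) => _ [k Kk <-]; exact: nm_tw.
Qed.
Lemma twsup_ge k M : K k -> nm (tw k M) <= twsup M.
Proof. by move=> Kk; apply: sup_upper_bound; [exact: twsup_has | exists k]. Qed.
Lemma twsup_le M b : (forall k, K k -> nm (tw k M) <= b) -> twsup M <= b.
Proof.
move=> h; apply: sup_le_ub; first by case: (twsup_has M).
by move=> _ [k Kk <-]; exact: h.
Qed.
Lemma nm_twsup M : nm M <= twsup M.
Proof.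
have [_ K1 _ _] := sK; have := twsup_ge M K1.
by rewrite /tw adj1 mul1mx mulmx1.
Qed.

(** Positivity is required along whole [K]-orbits, which makes the set invariant; [B1 ^- 2] is a
    constant that the identity satisfies, as [K] distorts norms by at most the factor [B1]. *)
Definition pdset M := M^t* = M /\ forall k v, K k -> (B1 ^- 2) * fn v <= re (ip (M *m (k *m v)) (k *m v)).

Lemma pdset1 : pdset 1%:M.
Proof.
split=> [|k v Kk]; first exact: adj1.
rewrite mul1mx ip_fn re_io -!nm2 ler_pdivrMl ?exprn_gt0 // -exprMn lerXn2r ?nnegrE ?nm_ge0 //.
  by rewrite mulr_ge0 ?nm_ge0 // ltW.
rewrite -{1}[v](mulKmx (KU Kk)); apply: le_trans (nmM _ _) _.
by rewrite ler_wpM2r ?nm_ge0 // KB1 //; exact: KV.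
Qed.
Lemma pdset_tw k M : K k -> pdset M -> pdset (tw k M).
Proof.
move=> Kk [hM hp]; split=> [|l v Kl]; first by rewrite /tw !adjM trmxCK hM mulmxA.
have := hp (k *m l) v (KM Kk Kl); congr (_ <= re _).
by rewrite !ipE /tw -[k *m l *m v]mulmxA (adjM k) !mulmxA [LHS]mxtrace_mulC !mulmxA.
Qed.
Lemma pdset_mid M M' : pdset M -> pdset M' -> pdset (2^-1 *: (M + M')).
Proof.
move=> [hM hp] [hM' hp']; split=> [|k v Kk].
  by rewrite adjZ adjD hM hM' -(rmorph_nat io 2) -rmorphV ?unitfE ?pnatr_eq0 // ioJ.
rewrite -(rmorph_nat io 2) -fmorphV -scalemxAl mulmxDl ipZl ipDl reMio reD.
by have := hp k v Kk; have := hp' k v Kk; lra.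
Qed.

Lemma pdset_min : exists M, pdset M /\ forall M', pdset M' -> twsup M <= twsup M'.
Proof.
have [|||||M [pM _] Mmin] := @min_attained _ _ _ _ (fun M => pdset M /\ nm M <= twsup 1%:M) twsup (twsup 1%:M).
- by exists 1%:M; split; [exact: pdset1 | exact: nm_twsup].
- by move=> M [].
- move=> A L hA AL; split; last by apply: (cvm_le_nm AL); apply: nearW => k; case: (hA k).
  split=> [|k v Kk].
    by apply: (cvm_uniq (cvm_adj AL)); apply: cvm_ext AL => k; case: (hA k) => -[->].
  have c := cvs_ip (cvmM AL (cvm_cst (k *m v))) (cvm_cst (k *m v)).
  by apply: (cvs_ge_re c); apply: nearW => l; case: (hA l) => -[_ h] _; exact: h.
- move=> A L _ AL; have lip M M' : twsup M <= twsup M' + B1 ^+ 2 * nm (M - M').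
    apply: twsup_le => k Kk; have -> : tw k M = tw k M' + tw k (M - M').
      by rewrite /tw -mulmxDl -mulmxDr addrC subrK.
    by apply: le_trans (nmD _ _) _; apply: lerD; [exact: twsup_ge | exact: nm_tw].
  apply: cvg0_leA (cvg0Z (exprn_ge0 2 (ltW B0)) AL) => k.
  rewrite ler_norml; have := lip (A k) L; have := lip L (A k).
  by rewrite (nmBC L); lra.
- by move=> M; apply: le_trans (nm_twsup M); exact: nm_ge0.
exists M; split=> // M' pM'.
have [h|/ltW h] := leP (nm M') (twsup 1%:M); first exact: Mmin.
apply: le_trans (le_trans h (nm_twsup M')); apply: Mmin; split; [exact: pdset1 | exact: nm_twsup].
Qed.

Lemma parallelogram m p (X Y : 'M[C]_(m, p)) :
  fn (2^-1 *: (X + Y)) = (fn X + fn Y) / 2 - fn (X - Y) / 4.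
Proof.
apply: (@io_inj R S); rewrite -ip_fn !ipZl !ipZr rmorphB /= !rmorphM /= rmorphD /= -!ip_fn.
rewrite !(ipDl, ipDr, ipNl, ipNr, ipBl, ipBr) !fmorphV /= !rmorph_nat; by field.
Qed.

(** If [tw k M] differed from the minimiser [M], the parallelogram law at every [l] in [K] would
    make the midpoint strictly better; the gain is uniform because [tw l] shrinks norms by at most
    [B1 ^ 2]. *)
Lemma invariant_form : exists M, [/\ M^t* = M, (forall k, K k -> tw k M = M) &
  exists2 c : R, 0 < c & forall v, c * fn v <= re (ip (M *m v) v)].
Proof.
have [M [pM Mmin]] := pdset_min; have [hM hp] := pM; exists M; split=> // [k Kk|]; last first.
  exists (B1 ^- 2); first by rewrite invr_gt0 exprn_gt0.
  by move=> v; have [_ K1 _ _] := sK; have := hp _ v K1; rewrite mul1mx.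
set M' := tw k M; set m := twsup M.
have m0 : 0 <= m by apply: le_trans (nm_twsup M); exact: nm_ge0.
have pM' : pdset M' by exact: pdset_tw.
have M'm l : K l -> nm (tw l M') <= m by move=> Kl; rewrite -twM; apply: twsup_ge; exact: KM.
pose de := B1 ^- 2 * nm (M' - M).
have de0 : 0 <= de by rewrite mulr_ge0 ?nm_ge0 // invr_ge0 exprn_ge0 // ltW.
have key : forall l, K l -> nm (tw l (2^-1 *: (M' + M))) ^+ 2 <= m ^+ 2 - de ^+ 2 / 4.
  move=> l Kl; have -> : tw l (2^-1 *: (M' + M)) = 2^-1 *: (tw l M' + tw l M).
    by rewrite /tw -scalemxAr -scalemxAl mulmxDr mulmxDl.
  rewrite nm2 parallelogram -!nm2.
  have a1 : nm (tw l M') ^+ 2 <= m ^+ 2 by rewrite lerXn2r ?nnegrE ?nm_ge0 // M'm.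
  have a2 : nm (tw l M) ^+ 2 <= m ^+ 2 by rewrite lerXn2r ?nnegrE ?nm_ge0 // twsup_ge.
  have a3 : de ^+ 2 <= nm (tw l M' - tw l M) ^+ 2.
    rewrite lerXn2r ?nnegrE ?nm_ge0 // ler_pdivrMl ?exprn_gt0 //.
    have -> : tw l M' - tw l M = tw l (M' - M) by rewrite /tw mulmxBr mulmxBl.
    exact: nm_tw_ge.
  lra.
have d0 : 0 <= m ^+ 2 - de ^+ 2 / 4.
  by have [_ K1 _ _] := sK; apply: le_trans (key _ K1); exact: sqr_ge0.
have : m <= Num.sqrt (m ^+ 2 - de ^+ 2 / 4).
  apply: le_trans (Mmin _ (pdset_mid pM' pM)) _; apply: twsup_le => l Kl.
  rewrite -[nm _]ger0_norm ?nm_ge0 // -sqrtr_sqr; apply: ler_wsqrtr; exact: key.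
move=> h0; have : m ^+ 2 <= Num.sqrt (m ^+ 2 - de ^+ 2 / 4) ^+ 2.
  by rewrite lerXn2r ?nnegrE ?sqrtr_ge0.
rewrite sqr_sqrtr // => h.
have : de = 0 by apply/eqP; rewrite -sqrf_eq0 eq_le sqr_ge0 andbT; lra.
move/eqP; rewrite mulf_eq0 invr_eq0 expf_eq0 /= gt_eqF //= nm_eq0 subr_eq0 => /eqP.
by [].
Qed.

Lemma unitarizable : exists a, a \in unitmx /\ forall k, K k ->
  (a *m k *m invmx a)^t* *m (a *m k *m invmx a) = 1%:M.
Proof.
have [M [hM MK [c c0 Mp]]] := invariant_form.
have [|a [au aa]] := posdef_factor hM.
  by move=> v v0; apply: lt_le_trans (Mp v); rewrite mulr_gt0 // lt_def fn_ge0 fn_eq0 v0.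
exists a; split=> // k Kk; rewrite !adjM adjV -!mulmxA (mulmxA (a^t* )) aa.
have := MK k Kk; rewrite /tw => h; rewrite (mulmxA M) (mulmxA (k^t* )) (mulmxA (k^t* )) h -aa.
by rewrite -mulmxA mulmxV // mulmx1 mulVmx // unitmx_adj.
Qed.
End InvariantForm.

Lemma uncountable_real : ~ countable [set: R].
Proof.
move=> h; have c : countable `]0 : R, 1 : R[%classic.
  by apply: sub_countable h; apply: subset_card_le.
have := countable_lebesgue_measure0 c.
rewrite lebesgue_measure_itv /= lte_fin ltr01 -EFinB subr0 => /eqP.
by rewrite eqe oner_eq0.
Qed.

(** * Regular functions on [G]: Nullstellensatz and connectedness *)

Section RegularFunctions.
Variables (n : nat) (G : set 'M[C]_n).
Hypothesis aG : algebraic_group G.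
Local Notation fct := ('M[C]_n -> C).
Implicit Types (f h q : fct) (M : set fct).
Local Notation Reg := (regular_on G).

Let GU g : G g -> g \in unitmx. Proof. by have [[GU _ _ _] _] := aG => /GU. Qed.
Let dU g k : G g -> \det g ^+ k != 0.
Proof. by move=> /GU; rewrite unitmxE unitfE => ?; rewrite expf_neq0. Qed.

Lemma Reg_ext f h : (forall g, G g -> f g = h g) -> Reg f -> Reg h.
Proof. by move=> e [p [k [pp hf]]]; exists p, k; split=> // g Gg; rewrite -e // hf. Qed.
Lemma Reg_poly f : polyf f -> Reg f.
Proof. by move=> pf; exists f, 0%N; split=> // g _; rewrite expr0 divr1. Qed.
Lemma Reg_cst c : Reg (fun=> c). Proof. exact/Reg_poly/polyf_cst. Qed.
Lemma RegD f h : Reg f -> Reg h -> Reg (fun g => f g + h g).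
Proof.
move=> [p [k [pp hf]]] [q [l [pq hh]]].
exists (fun g => p g * \det g ^+ l + q g * \det g ^+ k), (k + l)%N; split.
  by apply: polyfD; apply: polyfM => //; exact: polyf_detX.
move=> g Gg; rewrite hf // hh // exprD; field.
by rewrite !dU.
Qed.
Lemma RegM f h : Reg f -> Reg h -> Reg (fun g => f g * h g).
Proof.
move=> [p [k [pp hf]]] [q [l [pq hh]]].
exists (fun g => p g * q g), (k + l)%N; split; first exact: polyfM.
by move=> g Gg; rewrite hf // hh // exprD; field; rewrite !dU.
Qed.
Lemma RegB f h : Reg f -> Reg h -> Reg (fun g => f g - h g).
Proof.
move=> rf rh; apply: Reg_ext (RegD rf (RegM (Reg_cst (-1)) rh)) => g _.
by rewrite mulN1r.
Qed.
Lemma Reg_sum (I : Type) (r : seq I) (F : I -> fct) :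
  (forall i, Reg (F i)) -> Reg (fun g => \sum_(i <- r) F i g).
Proof.
move=> h; elim: r => [|i r IH]; first by apply: Reg_ext (Reg_cst 0) => g _; rewrite big_nil.
by apply: Reg_ext (RegD (h i) IH) => g _; rewrite big_cons.
Qed.
Lemma Reg_prod (I : Type) (r : seq I) (F : I -> fct) (P : pred I) :
  (forall i, Reg (F i)) -> Reg (fun g => \prod_(i <- r | P i) F i g).
Proof.
move=> h; elim: r => [|i r IH]; first by apply: Reg_ext (Reg_cst 1) => g _; rewrite big_nil.
case: (boolP (P i)) => Pi.
  by apply: Reg_ext (RegM (h i) IH) => g _; rewrite big_cons Pi.
by apply: Reg_ext IH => g _; rewrite big_cons (negPf Pi).
Qed.
Lemma Reg_detV : Reg (fun g => (\det g)^-1).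
Proof.
exists (fun=> 1), 1%N; split; first exact: polyf_cst.
by move=> g _; rewrite expr1 mul1r.
Qed.

(* A countable family of functions spanning the regular functions. *)
Definition mono (s : seq ('I_n * 'I_n)) : fct := fun g => \prod_(p <- s) g p.1 p.2.
Definition bas (i : nat) : fct :=
  if @unpickle (seq ('I_n * 'I_n) * nat)%type i is Some x then fun g => mono x.1 g / \det g ^+ x.2
  else fun=> 0.
Definition span m f := exists c : nat -> C, forall g, G g -> f g = \sum_(i < m) c i * bas i g.

Lemma span_le m m' f : (m <= m')%N -> span m f -> span m' f.
Proof.
move=> mm' [c hc]; exists (fun i => if (i < m)%N then c i else 0) => g Gg; rewrite hc //.
rewrite (big_ord_widen _ (fun i => c i * bas i g) mm') [LHS]big_mkcond; apply: eq_bigr => i _.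
by case: ifP => _; rewrite ?mul0r.
Qed.
Lemma span_add m f h : span m f -> span m h -> span m (fun g => f g + h g).
Proof.
move=> [c hc] [d hd]; exists (fun i => c i + d i) => g Gg; rewrite hc // hd // -big_split.
by apply: eq_bigr => i _; rewrite mulrDl.
Qed.

Lemma poly_mono f : polyf f -> exists l : seq (C * seq ('I_n * 'I_n)),
  forall g, f g = \sum_(x <- l) x.1 * mono x.2 g.
Proof.
move: f; apply: polyf_indmx => [c|f h [l hl] [l' hl']|f h [l hl] [l' hl']|i j].
- by exists [:: (c, [::])] => g; rewrite big_seq1 /mono big_nil mulr1.
- by exists (l ++ l') => g; rewrite big_cat hl hl'.
- exists [seq (x.1 * y.1, x.2 ++ y.2) | x <- l, y <- l'] => g.
  rewrite sum_allpairs hl hl' mulr_suml; apply: eq_bigr => x _.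
  rewrite mulr_sumr; apply: eq_bigr => y _; rewrite /mono big_cat /=; ring.
- by exists [:: (1, [:: (i, j)])] => g; rewrite big_seq1 /mono big_seq1 mul1r.
Qed.

Lemma Reg_span f : Reg f -> exists m, span m f.
Proof.
move=> [p [k [/poly_mono [l hl] hf]]].
have {hl hf} : forall g, G g -> f g = \sum_(x <- l) x.1 * (mono x.2 g / \det g ^+ k).
  by move=> g Gg; rewrite hf // hl mulr_suml; apply: eq_bigr => x _; rewrite mulrA.
elim: l f => [|x l IH] f hf.
  by exists 0%N, (fun=> 0) => g Gg; rewrite hf // big_nil big_ord0.
have [m hm] := IH (fun g => \sum_(y <- l) y.1 * (mono y.2 g / \det g ^+ k)) (fun g _ => erefl).
pose i := pickle (x.2, k).
have hx : span i.+1 (fun g => x.1 * (mono x.2 g / \det g ^+ k)).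
  exists (fun j => if j == i then x.1 else 0) => g Gg.
  rewrite big_ord_recr /= eqxx big1 ?add0r; first by rewrite /bas /i pickleK.
  by move=> j _; rewrite ltn_eqF ?mul0r.
exists (maxn i.+1 m).
have [c hc] := span_add (span_le (leq_maxl i.+1 m) hx) (span_le (leq_maxr i.+1 m) hm).
by exists c => g Gg; rewrite -hc // hf // big_cons.
Qed.

(** Ideals of the coordinate ring of [G], carried by functions on all matrices: functions that agree
    on [G] are identified by making every function that vanishes on [G] a member. *)
Definition ideal M := [/\ (forall f, M f -> Reg f),
  (forall f, (forall g, G g -> f g = 0) -> M f),
  (forall f h, M f -> M h -> M (fun g => f g + h g)) &
  (forall a f, Reg a -> M f -> M (fun g => a g * f g))].

Lemma ideal_ext M f h : ideal M -> (forall g, G g -> f g = h g) -> M f -> M h.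
Proof.
move=> [_ M0 MD _] e Mf; have z : M (fun g => h g - f g).
  by apply: M0 => g Gg; rewrite e // subrr.
by have := MD _ _ Mf z; congr M; apply/funext => g; rewrite addrC subrK.
Qed.

Lemma ideal_vanish : ideal [set f | forall g, G g -> f g = 0].
Proof.
split=> [f f0|f //|f h f0 h0 g Gg|a f _ f0 g Gg].
- by apply: Reg_ext (Reg_cst 0) => g Gg; rewrite f0.
- by rewrite f0 // h0 // addr0.
- by rewrite f0 // mulr0.
Qed.

Lemma ideal_sum M (I : Type) (r : seq I) (F : I -> fct) : ideal M ->
  (forall i, M (F i)) -> M (fun g => \sum_(i <- r) F i g).
Proof.
move=> [_ M0 MD _] h; elim: r => [|i r IH]; first by apply: M0 => g _; rewrite big_nil.
by have := MD _ _ (h i) IH; congr M; apply/funext => g; rewrite big_cons.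
Qed.

Lemma row_dependence d (A : 'M[C]_(d.+1, d)) : exists2 u : 'rV[C]_d.+1, u != 0 & u *m A = 0.
Proof.
have : kermx A != 0.
  by rewrite kermx_eq0 -row_leq_rank -ltnNge ltnS rank_leq_col.
by case/rowV0Pn => u /sub_kermxP uA u0; exists u.
Qed.

(* The inverses of [f - c] for uncountably many [c] are linearly dependent, since the
   regular functions have countable dimension; clearing denominators yields a polynomial
   relation for [f]. *)
Lemma algebraic_mod_ideal M f (D : set R) : ideal M -> Reg f -> countable D ->
  (forall t, ~ D t -> exists2 a, Reg a & M (fun g => a g * (f g - io t) - 1)) ->
  exists2 F : {poly C}, F != 0 & M (fun g => F.[f g]).
Proof.
move=> iM rf cD hinv; have [MR M0 MD MM] := iM.
have /choice [a ha] : forall t, exists a, ~ D t -> Reg a /\ M (fun g => a g * (f g - io t) - 1).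
  move=> t; have [Dt|/hinv [a ra Ma]] := pselect (D t); first by exists (fun=> 0).
  by exists a.
have /choice [m hm] : forall t, exists m, ~ D t -> span m (a t).
  move=> t; have [Dt|nD] := pselect (D t); first by exists 0%N.
  by have [m hm] := Reg_span (ha t nD).1; exists m.
have [d inf] : exists d, infinite_set [set t | ~ D t /\ m t = d].
  apply: contrapT => /forallNP fin; apply: uncountable_real.
  have e : [set: R] `<=` D `|` \bigcup_i [set t | ~ D t /\ m t = i].
    move=> t _; have [Dt|nD] := pselect (D t); first by left.
    by right; exists (m t).
  apply: sub_countable (subset_card_le e) _.
  have c2 : countable (\bigcup_i [set t | ~ D t /\ m t = i]).
    apply: bigcup_countable => [|i _]; first exact: countableP.
    by apply: finite_set_countable; have := fin i; exact: contrapT.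
  rewrite -bigcup2E; apply: bigcup_countable => [|i _]; first exact: countableP.
  by rewrite /bigcup2; case: i => [|[|i]] //=; apply: finite_set_countable.
have [B Bs Bd] := infinite_set_fset d.+1 inf.
pose ts := take d.+1 (finmap.enum_fset B).
have sts : size ts = d.+1 by rewrite size_takel.
have uts : uniq ts by rewrite take_uniq // finmap.fset_uniq.
have tsP t : t \in ts -> ~ D t /\ m t = d.
  by move=> /mem_take tB; apply: Bs; exact: tB.
pose t (j : 'I_d.+1) := nth 0 ts j.
have tP j : ~ D (t j) /\ m (t j) = d by apply: tsP; rewrite mem_nth // sts.
have tinj : injective t.
  by move=> i j /eqP; rewrite nth_uniq ?sts // => /eqP /val_inj.
have /choice [c hc] j : exists c : nat -> C, forall g, G g -> a (t j) g = \sum_(i < d) c i * bas i g.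
  by have [nD <-] := tP j; exact: hm.
have [u u0 uA] := row_dependence (\matrix_(j < d.+1, i < d) c j i).
have lin g : G g -> \sum_j u 0 j * a (t j) g = 0.
  move=> Gg; transitivity (\sum_(i < d) (u *m \matrix_(j < d.+1, i < d) c j i) 0 i * bas i g).
    under eq_bigr do rewrite hc // mulr_sumr.
    rewrite exchange_big; apply: eq_bigr => i _; rewrite mxE mulr_suml.
    by apply: eq_bigr => j _; rewrite mxE mulrA.
  by rewrite uA big1 // => i _; rewrite mxE mul0r.
pose F : {poly C} := \sum_j u 0 j *: \prod_(i | i != j) ('X - (io (t i))%:P).
have Fx x : F.[x] = \sum_j u 0 j * \prod_(i | i != j) (x - io (t i)).
  rewrite horner_sum; apply: eq_bigr => j _; rewrite hornerZ horner_prod; congr (_ * _).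
  by apply: eq_bigr => i _; rewrite !hornerE.
exists F.
  have /rV0Pn [j uj] := u0; apply/eqP => F0; move: uj; apply/negP; rewrite negbK.
  have := Fx (io (t j)); rewrite F0 horner0 (bigD1 j) //= [X in _ + X]big1 ?addr0 => [/esym /eqP|l lj].
    rewrite mulf_eq0 => /orP [//|]; rewrite prodf_seq_eq0 => /hasP [i _ /andP [ij]].
    by rewrite subr_eq0 => /eqP /(@io_inj R S) /tinj e; rewrite e eqxx in ij.
  by rewrite (bigD1 j) 1?eq_sym //= subrr mul0r mulr0.
have key j : M (fun g => u 0 j * \prod_(i | i != j) (f g - io (t i)) -
    (u 0 j * a (t j) g) * \prod_i (f g - io (t i))).
  have [nD _] := tP j; have [ra Ma] := ha _ nD.
  have rp : Reg (fun g => - (u 0 j * \prod_(i | i != j) (f g - io (t i)))).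
    apply: Reg_ext (RegM (Reg_cst (- u 0 j)) (Reg_prod _ _ (fun i => RegB rf (Reg_cst (io (t i)))))) => g _.
    by rewrite mulNr.
  apply: ideal_ext iM _ (MM _ _ rp Ma) => g Gg.
  by rewrite [\prod_i (f g - io (t i))](bigD1 j) //=; ring.
apply: ideal_ext iM _ (ideal_sum (index_enum _) iM key) => g Gg.
by rewrite sumrB -mulr_suml lin // mul0r subr0 Fx.
Qed.

(** Weak Nullstellensatz. Otherwise [q - c] lies in a maximal ideal; the scalars being uncountable
    and the ring of countable dimension, every residue is algebraic over the scalars, hence a
    scalar. The residues of the entries form a point of [G] at which [q] equals [c]. *)
Lemma Reg_inverse q c : Reg q -> (forall g, G g -> q g != c) ->
  exists2 a, Reg a & forall g, G g -> a g * (q g - c) = 1.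
Proof.
move=> rq qc; apply: contrapT => nex.
have G1 : G 1%:M by have [[_ G1 _ _] _] := aG.
(* The ideals considered are unions of a set with [I0], the ideal generated by [q - c]; in this form
   the empty chain also has an admissible union for Zorn's lemma. *)
pose I0 : set fct := [set f | Reg f /\ exists2 a, Reg a & forall g, G g -> f g = a g * (q g - c)].
pose good M := ideal (M `|` I0) /\ ~ (M `|` I0) (fun=> 1).
have iI0 : ideal I0.
  split=> [f []//|f f0|f h [rf [a ra ea]] [rh [b rb eb]]|a f ra [rf [b rb eb]]].
  - split; first by apply: Reg_ext (Reg_cst 0) => g Gg; rewrite f0.
    by exists (fun=> 0); [exact: Reg_cst | move=> g Gg; rewrite f0 // mul0r].
  - split; first exact: RegD.
    by exists (fun g => a g + b g); [exact: RegD | move=> g Gg; rewrite ea // eb // mulrDl].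
  - split; first exact: RegM.
    by exists (fun g => a g * b g); [exact: RegM | move=> g Gg; rewrite eb // mulrA].
have n1 : ~ I0 (fun=> 1).
  by move=> [_ [a ra ea]]; apply: nex; exists a => // g Gg; rewrite -ea.
have [A [[iM M1] Mmax]] : exists A, good A /\ (forall B, A `<` B -> ~ good B).
  apply: Zorn_bigcup => F FP Ftot; split; last first.
    by move=> [[X FX X1]|]; [have [_] := FP X FX; apply; left | exact: n1].
  have cs f h : ((\bigcup_(X in F) X) `|` I0) f -> ((\bigcup_(X in F) X) `|` I0) h ->
      exists X, [/\ good X \/ X = set0, X `|` I0 `<=` (\bigcup_(X in F) X) `|` I0, (X `|` I0) f & (X `|` I0) h].
    have up X : F X -> X `|` I0 `<=` (\bigcup_(X in F) X) `|` I0.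
      by move=> FX k [Xk|]; [left; exists X | right].
    move=> [[X FX Xf]|If] [[Y FY Yh]|Ih].
    - have [XY|YX] := Ftot X Y FX FY.
        by exists Y; split; [left; exact: FP | exact: up | left; exact: XY | left].
      by exists X; split; [left; exact: FP | exact: up | left | left; exact: YX].
    - by exists X; split; [left; exact: FP | exact: up | left | right].
    - by exists Y; split; [left; exact: FP | exact: up | right | left].
    - by exists set0; split; [right | rewrite set0U => k ?; right | right | right].
  have ig X : good X \/ X = set0 -> ideal (X `|` I0) by case=> [[]|->] //; rewrite set0U.
  split=> [f hf|f f0|f h hf hh|a f ra hf].
  - by have [X [/ig [XR _ _ _] _ Xf _]] := cs f f hf hf; exact: XR.
  - by right; have [_ h _ _] := iI0; exact: h.
  - by have [X [/ig [_ _ XD _] up Xf Xh]] := cs f h hf hh; apply: up; exact: XD.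
  - by have [X [/ig [_ _ _ XM] up Xf Xh]] := cs f f hf hf; apply: up; exact: XM.
set M := A `|` I0 in iM M1; have [MR M0 MD MM] := iM.
have maxi f : Reg f -> ~ M f -> exists2 a, Reg a & M (fun g => a g * f g - 1).
  move=> rf nMf.
  pose M' : set fct := [set h | Reg h /\ exists a k, [/\ Reg a, M k & forall g, G g -> h g = a g * f g + k g]].
  have M0z : M (fun=> 0) by exact: M0.
  have iM' : ideal M'.
    split=> [h []//|h h0|h l [rh [a [k [ra Mk e]]]] [rl [b [k' [rb Mk' e']]]]|b h rb [rh [a [k [ra Mk e]]]]].
    - split; first by apply: Reg_ext (Reg_cst 0) => g Gg; rewrite h0.
      exists (fun=> 0), (fun=> 0); split=> //; first exact: Reg_cst.
      by move=> g Gg; rewrite h0 // mul0r addr0.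
    - split; first exact: RegD.
      exists (fun g => a g + b g), (fun g => k g + k' g); split; [exact: RegD | exact: MD |].
      by move=> g Gg; rewrite e // e' //; ring.
    - split; first exact: RegM.
      exists (fun g => b g * a g), (fun g => b g * k g); split; [exact: RegM | exact: MM |].
      by move=> g Gg; rewrite e //; ring.
  have MM' : M `<=` M'.
    move=> h Mh; split; first exact: MR.
    by exists (fun=> 0), h; split=> //; [exact: Reg_cst | move=> g _; rewrite mul0r add0r].
  have M'f : M' f.
    split=> //; exists (fun=> 1), (fun=> 0); split=> //; first exact: Reg_cst.
    by move=> g _; rewrite mul1r addr0.
  have I0M' : M' `|` I0 = M' by apply/setUidPl => h Ih; apply: MM'; right.
  have [[_ [a [k [ra Mk e]]]]|no1] := pselect (M' (fun=> 1)).
    exists a => //; have := MM _ _ (Reg_cst (-1)) Mk; apply: ideal_ext iM _ => g Gg.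
    have -> : a g * f g - 1 = a g * f g - (a g * f g + k g) by rewrite -e.
    by ring.
  have AM' : A `<` M'.
    split=> [h Ah|h]; first by apply: MM'; left.
    by apply: nMf; left; exact: h.
  by case: (Mmax _ AM'); rewrite /good I0M'.
have prime f h : Reg h -> M (fun g => f g * h g) -> Reg f -> ~ M f -> M h.
  move=> rh Mfh rf nMf; have [a ra Ma] := maxi f rf nMf.
  have := MD _ _ (MM _ _ ra Mfh) (MM _ _ (RegM (Reg_cst (-1)) rh) Ma).
  by apply: ideal_ext iM _ => g Gg; ring.
have val f : Reg f -> exists r, M (fun g => f g - r).
  move=> rf; apply: contrapT => /forallNP nr.
  have [F F0 MF] : exists2 F : {poly C}, F != 0 & M (fun g => F.[f g]).
    apply: (algebraic_mod_ideal (D := set0) iM rf) => [|t _]; first exact: countable0.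
    exact: maxi (RegB rf (Reg_cst _)) (nr _).
  have [rs hrs] := closed_field_poly_normal F.
  have {}MF : M (fun g => lead_coef F * \prod_(r <- rs) (f g - r)).
    move: MF; congr M; apply/funext => g; rewrite {1}hrs hornerZ horner_prod; congr (_ * _).
    by apply: eq_bigr => r _; rewrite !hornerE.
  have : M (fun g => \prod_(r <- rs) (f g - r)).
    have := MM _ _ (Reg_cst (lead_coef F)^-1) MF; apply: ideal_ext iM _ => g _.
    by rewrite mulKf // lead_coef_eq0.
  elim: rs {hrs MF} => [|r rs IH] h.
    by apply: M1; move: h; congr M; apply/funext => g; rewrite big_nil.
  apply: IH; apply: (prime (fun g => f g - r)) => //.
  - apply: Reg_prod => r'; exact: RegB rf (Reg_cst _).
  - by move: h; congr M; apply/funext => g; rewrite big_cons.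
  - exact: RegB rf (Reg_cst _).
have cst0 (x : C) : M (fun=> x) -> x = 0.
  move=> Mx; apply/eqP/negPn/negP => x0; apply: M1.
  have := MM _ _ (Reg_cst x^-1) Mx; congr M; apply/funext => g; by rewrite mulVf.
have /choice [r hr] (p : 'I_n * 'I_n) : exists r, M (fun g => g p.1 p.2 - r).
  by apply: val; apply/Reg_poly/polyf_entry.
pose L : 'M[C]_n := \matrix_(i, j) r (i, j).
have Mp f : polyf f -> M (fun g => f g - f L).
  move: f; apply: polyf_indmx => [x|f h hf hh|f h hf hh|i j].
  - by apply: M0 => g _; rewrite subrr.
  - by have := MD _ _ hf hh; apply: ideal_ext iM _ => g _; ring.
  - have rh : Reg h.
      by apply: Reg_ext (RegD (MR _ hh) (Reg_cst (h L))) => g _; rewrite subrK.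
    have := MD _ _ (MM _ _ rh hf) (MM _ _ (Reg_cst (f L)) hh).
    by apply: ideal_ext iM _ => g _; ring.
  - by have := hr (i, j); congr M; apply/funext => g; rewrite mxE.
(* The residue of the inverse determinant certifies that [L] is invertible, so that [L] lies in [G]
   and not merely in its closed set. *)
have [de hde] := val _ Reg_detV.
have dd : \det L * de = 1.
  apply/eqP; rewrite eq_sym -subr_eq0; apply/eqP/cst0.
  have pd : polyf (fun g : 'M[C]_n => \det g).
    by apply: polyf_det => i j; exact: polyf_entry.
  have := MD _ _ (MM _ _ Reg_detV (Mp _ pd)) (MM _ _ (Reg_cst (\det L)) hde).
  apply: ideal_ext iM _ => g Gg; have := dU 1 Gg; rewrite expr1 => dg.
  by field.
have dL : \det L != 0 by apply/eqP => d0; move: dd; rewrite d0 mul0r => /eqP; rewrite eq_sym oner_eq0.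
have GL' : G L.
  have [_ [Z [F Fp ZF] GZ]] := aG; rewrite GZ; split; first by rewrite /GL /= unitmxE unitfE.
  rewrite ZF => f Ff; apply: cst0.
  have Mf : M f by apply: M0 => g; rewrite GZ ZF => -[_]; apply.
  have := MD _ _ (MM _ _ (Reg_cst (-1)) (Mp f (Fp f Ff))) Mf.
  by apply: ideal_ext iM _ => g _; ring.
have Mq : M (fun g => q g - q L).
  have [p [k [pp hq]]] := rq.
  have Mk : M (fun g => (\det g)^-1 ^+ k - (\det L)^-1 ^+ k).
    have dV : (\det L)^-1 = de by apply: (mulfI dL); rewrite mulfV.
    rewrite dV; elim: k {hq} => [|k IH].
      by apply: M0 => g _; rewrite !expr0 subrr.
    have := MD _ _ (MM _ _ Reg_detV IH) (MM _ _ (Reg_cst (de ^+ k)) hde).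
    by apply: ideal_ext iM _ => g _; rewrite !exprS; ring.
  have rk : Reg (fun g => (\det g)^-1 ^+ k).
    by apply: Reg_ext (RegD (MR _ Mk) (Reg_cst ((\det L)^-1 ^+ k))) => g _; rewrite subrK.
  have := MD _ _ (MM _ _ rk (Mp _ pp)) (MM _ _ (Reg_cst (p L)) Mk).
  by apply: ideal_ext iM _ => g Gg; rewrite !hq // -!exprVn; ring.
have Mc : M (fun g => q g - c).
  right; split; first exact: RegB rq (Reg_cst c).
  by exists (fun=> 1); [exact: Reg_cst | move=> g _; rewrite mul1r].
have /eqP := qc L GL'; apply; apply/eqP; rewrite -subr_eq0; apply/eqP/cst0.
by have := MD _ _ (MM _ _ (Reg_cst (-1)) Mq) Mc; apply: ideal_ext iM _ => g _; ring.
Qed.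
End RegularFunctions.

Section ConnectedGroups.
Variables (n : nat) (G : set 'M[C]_n).
Hypothesis aG : algebraic_group G.
Hypothesis conG : zariski_connected G.
Implicit Types (q : 'M[C]_n -> C).

Let sG : subgroup G. Proof. by case: aG. Qed.
Let GU g : G g -> g \in unitmx. Proof. by have [GU _ _ _] := sG => /GU. Qed.
Let dU g k : G g -> \det g ^+ k != 0.
Proof. by move=> /GU; rewrite unitmxE unitfE => ?; rewrite expf_neq0. Qed.

Lemma zero_set_closed (f : 'M[C]_n -> C) : polyf f ->
  zariski_closed [set g | f g = 0].
Proof.
move=> pf; exists [set f] => [_ -> //|].
by rewrite eqEsubset; split=> g /= h; [move=> _ -> | exact: h].
Qed.

Lemma finite_values_constant q (F : {poly C}) : regular_on G q -> F != 0 ->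
  (forall g, G g -> F.[q g] = 0) -> forall g, G g -> q g = q 1%:M.
Proof.
move=> [p [k [pp hq]]] F0 Fq; have [_ G1 _ _] := sG.
have [rs hrs] := closed_field_poly_normal F; pose v := q 1%:M.
pose fA g := p g - v * \det g ^+ k.
pose fB g := \prod_(r <- rs | r != v) (p g - r * \det g ^+ k).
have pl r : polyf (fun g : 'M[C]_n => p g - r * \det g ^+ k).
  by apply: polyfB => //; apply: polyfM; [exact: polyf_cst | exact: polyf_detX].
have eq r g : G g -> (p g - r * \det g ^+ k == 0) = (q g == r).
  move=> Gg; have d0 := dU k Gg; rewrite hq // subr_eq0.
  by apply/eqP/eqP => [->|<-]; rewrite ?mulfK // divfK.
have Gcov : G `<=` [set g | fA g = 0] `|` [set g | fB g = 0].
  move=> g Gg; have [qv|qv] := eqVneq (q g) v; [left | right].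
    by apply/eqP; rewrite /fA eq // qv.
  have : root F (q g) by rewrite /root Fq.
  rewrite hrs rootZ ?lead_coef_eq0 // root_prod_XsubC => qrs.
  apply/eqP; rewrite prodf_seq_eq0; apply/hasP; exists (q g) => //=.
  by rewrite qv eq ?eqxx.
have disj : G `&` [set g | fA g = 0] `&` [set g | fB g = 0] = set0.
  rewrite -subset0 => g [[Gg /eqP]]; rewrite eq // => /eqP qv /= /eqP.
  rewrite prodf_seq_eq0 => /hasP [r _ /andP [rv]]; rewrite eq // qv => /eqP e.
  by rewrite e eqxx in rv.
have clA : zariski_closed [set g | fA g = 0] by apply: zero_set_closed; exact: pl.
have clB : zariski_closed [set g | fB g = 0].
  by apply: zero_set_closed; apply: polyf_prod => r; exact: pl.
have [GA|GB] := conG clA clB Gcov disj.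
  by move=> g Gg; apply/eqP; rewrite -eq //; apply/eqP/GA.
have A1 : fA 1%:M = 0 by apply/eqP; rewrite eq.
have : (G `&` [set g | fA g = 0] `&` [set g | fB g = 0]) 1%:M by split=> //; exact: GB.
by rewrite disj.
Qed.

(** For every real [t] that is not a value, [q - t] has a regular inverse. With only countably many
    exceptions this forces a polynomial equation on [q], so its values are finite in number. *)
Lemma countable_values_constant q : regular_on G q -> countable [set q g | g in G] ->
  forall g, G g -> q g = q 1%:M.
Proof.
move=> rq cq; pose D : set R := [set t | exists2 g, G g & q g = io t].
have cD : countable D.
  have e : D `<=` [set ro z | z in [set q g | g in G]].
    by move=> t [g Gg qt]; exists (q g); [exists g | rewrite qt ioK].
  apply: card_le_trans (subset_card_le e) _; exact: card_le_trans (card_image_le _ _) cq.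
have [t nD|F F0 hF] := algebraic_mod_ideal aG (ideal_vanish G) rq cD.
  have [g Gg|a ra ha] := @Reg_inverse _ _ aG q (io t) rq.
    by apply/eqP => e; apply: nD; exists g.
  by exists a => // g Gg; rewrite ha // subrr.
exact: finite_values_constant rq F0 hF.
Qed.

(** Matrices whose entries have rational real and imaginary parts with one common denominator: a
    countable family that approximates all matrices. *)
Definition grid (x : {ffun 'I_n * 'I_n -> int * int} * nat) : 'M[C]_n :=
  \matrix_(i, j) (io ((x.1 (i, j)).1%:~R / x.2.+1%:R) + 'i * io ((x.1 (i, j)).2%:~R / x.2.+1%:R)).

Lemma grid_near (g : 'M[C]_n) k : exists x, x.2 = k /\
  nm (g - grid x) <= (n * n)%:R * 2 / k.+1%:R.
Proof.
pose x := ([ffun p : 'I_n * 'I_n => (Num.floor (re (g p.1 p.2) * k.+1%:R), Num.floor (im (g p.1 p.2) * k.+1%:R))], k).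
exists x; split=> //; have k0 : 0 < k.+1%:R :> R by [].
have fl (y : R) : `|y - (Num.floor (y * k.+1%:R))%:~R / k.+1%:R| <= k.+1%:R^-1.
  have /andP [h1 h2] := floor_itv (y * k.+1%:R).
  rewrite ger0_norm; last by rewrite subr_ge0 ler_pdivrMr.
  rewrite lerBlDr -{1}[k.+1%:R^-1]mul1r -mulrDl ler_pdivlMr //; apply: ltW.
  by rewrite addrC; move: h2; rewrite intrD.
apply: le_trans (nm_le_sum _) _.
apply: (@le_trans _ _ (\sum_(i < n) \sum_(j < n) (2 / k.+1%:R))).
  apply: ler_sum => i _; apply: ler_sum => j _; rewrite !mxE !ffunE /=.
  rewrite {1}[g i j]reim opprD addrACA -rmorphB -mulrBr -rmorphB.
  apply: le_trans (ncD _ _) _; rewrite ncM nc_i mul1r !nc_io.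
  by rewrite -[2]/(1 + 1) [X in _ <= X]mulrDl !mul1r; apply: lerD; exact: fl.
rewrite (eq_bigr (fun=> 2 / k.+1%:R *+ n)) => [|i _]; last by rewrite sumr_const card_ord.
by rewrite sumr_const card_ord -mulrnA -[X in X <= _]mulr_natl mulrA.
Qed.

(* The values form a countable set, because [q] is locally constant on [G]; connectedness
   enters only through [countable_values_constant]. *)
Lemma locally_constant q : regular_on G q ->
  (forall X g, lie_algebra G X -> G g -> q (expm X *m g) = q g) ->
  forall g, G g -> q g = q 1%:M.
Proof.
move=> rq loc; apply: countable_values_constant => //.
have cG := algebraic_closed aG; have [e e0 he] := closed_subgroup_nbhd cG.
have [_ _ GM GV] := sG.
have lc L : G L -> exists2 d : R, 0 < d & forall g, G g -> nm (g - L) < d -> q g = q L.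
  move=> GL'; exists (e / (nm (invmx L) + 1)).
    by rewrite divr_gt0 // ltr_pwDr ?nm_ge0.
  move=> g Gg gL; have [|X XG hX] := he (g *m invmx L) (GM _ _ Gg (GV _ GL')).
    have -> : g *m invmx L - 1%:M = (g - L) *m invmx L by rewrite mulmxBl mulmxV ?GU.
    apply: le_lt_trans (nmM _ _) _.
    move: gL; rewrite ltr_pdivlMr ?ltr_pwDr ?nm_ge0 //.
    by have := nm_ge0 (g - L); have := nm_ge0 (invmx L); nra.
  rewrite -(mulmxKV (GU GL') g) hX loc //; exact: real_lie_lie.
(* Each grid point selects one nearby element of [G]. By local constancy every value of [q] is taken
   at a selected element, so the values are indexed by a countable type. *)
pose U x : set 'M[C]_n := [set g | G g /\ nm (g - grid x) <= (n * n)%:R * 2 / x.2.+1%:R].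
pose psi x : C := q (xget 1%:M (U x)).
have sub : [set q g | g in G] `<=` range psi.
  move=> _ [g Gg <-]; have [d d0 hd] := lc g Gg.
  pose A : R := (n * n)%:R * 2; have A0 : 0 <= A by rewrite mulr_ge0.
  have [k hk] := near_ex (cvg0Z (mulr_ge0 A0 (ler0n R 2)) (@cvg0_inv R) d0).
  have [x [xk hx]] := grid_near g k; exists x => //.
  have Ux : U x g by split; rewrite ?xk.
  have [Gg' hg'] : U x (xget 1%:M (U x)) by apply: xgetPex; exists g.
  rewrite /psi; apply: hd => //.
  apply: le_lt_trans (nm_triB _ (grid x) _) _; apply: le_lt_trans hk.
  have -> : A * 2 / k.+1%:R = (n * n)%:R * 2 / k.+1%:R + (n * n)%:R * 2 / k.+1%:R by rewrite /A; ring.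
  by apply: lerD; [move: hg'; rewrite xk | rewrite nmBC].
apply: card_le_trans (subset_card_le sub) _; apply: card_le_trans (card_image_le _ _) _.
exact: countableP.
Qed.
End ConnectedGroups.

Section BoundedSubgroups.
Variable n : nat.
Implicit Types (X A : 'M[C]_n) (G H K : set 'M[C]_n).

Lemma expm_comm X A : X *m A = A *m X -> expm X *m A = A *m expm X.
Proof.
move=> h; apply: (cvm_uniq (cvmM (expm_cvm X) (cvm_cst A))).
apply: cvm_ext (cvmM (cvm_cst A) (expm_cvm X)) => N; rewrite /epart mulmx_sumr mulmx_suml.
apply: eq_bigr => i _; rewrite -scalemxAr -scalemxAl; congr (_ *: _).
elim: (i : nat) => [|j IH]; first by rewrite expr0 mul1mx mulmx1.
by rewrite !exprS -!mulmxE mulmxA -h -!mulmxA IH.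
Qed.

Lemma bounded_closure G H (B : R) : closed_group G -> subgroup H -> H `<=` G ->
  (forall h, H h -> nm h <= B) ->
  exists Q, [/\ compact_subgroup Q G, H `<=` Q &
    forall x, Q x <-> exists2 h : nat -> 'M[C]_n, (forall k, H (h k)) & cvm h x].
Proof.
move=> [sG clG] sH HG HB; have [HU H1 HM HV] := sH.
pose Q : set 'M[C]_n := [set x | exists2 h : nat -> 'M[C]_n, (forall k, H (h k)) & cvm h x].
have inv x : Q x -> x \in unitmx /\ Q (invmx x).
  move=> [h hH hx]; have [psi psiS [y hy]] := bw_mx (fun k => HB _ (HV _ (hH k))).
  have e : x *m y = 1%:M.
    apply: (cvm_uniq (cvmM (cvm_subseq psiS hx) hy)); apply: cvm_ext (cvm_cst _) => k.
    by rewrite /= mulmxV //; exact: HU.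
  have [xu _] := mulmx1_unit e; split=> //.
  have -> : invmx x = y by rewrite -[LHS]mulmx1 -e mulmxA mulVmx // mul1mx.
  by exists ((fun k => invmx (h k)) \o psi) => // k; exact: HV.
have QG : Q `<=` G by move=> x Qx; have [xu _] := inv x Qx; case: Qx => h hH hx; apply: (clG h x _ hx xu) => k; exact: HG.
have QB x : Q x -> nm x <= B.
  by move=> [h hH hx]; apply: (cvm_le_nm hx); apply: nearW => k; exact: HB.
exists Q; split=> //; last by move=> h Hh; exists (fun=> h) => //; exact: cvm_cst.
split=> //.
  split=> [x /inv [] //||x y [h hH hx] [g gH gy]|x /inv [] //].
    by exists (fun=> 1%:M) => //; exact: cvm_cst.
  by exists (fun k => h k *m g k) => [k|]; [exact: HM | exact: cvmM].
apply: bounded_compact QB _ => A L QA AL.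
have /choice [h hh] (k : nat) : exists h, H h /\ nm (h - A k) < k.+1%:R^-1.
  have [h hH hx] := QA k; have k0 : 0 < k.+1%:R^-1 :> R by rewrite invr_gt0.
  by have [l hl] := near_ex (hx _ k0); exists (h l).
exists h => [k|]; first by case: (hh k).
have : cvm (fun k => h k - A k) 0.
  by apply: cvg0_leA cvg0_inv => k; rewrite subr0; case: (hh k) => _ /ltW.
move=> h0; have := cvmD h0 AL; rewrite add0r; apply: cvm_ext => k; exact: subrK.
Qed.

Lemma unitary_nm X : X^t* *m X = 1%:M -> nm X <= Num.sqrt n%:R.
Proof.
move=> h; rewrite /nm ler_sqrt //; have := ip_fn X; rewrite ipE mxtrace_mulC h mxtrace1 => e.
by rewrite -(@io_leE R S) -e rmorph_nat.
Qed.

Lemma unitary_skew X : (forall t : R, (expm (io t *: X))^t* *m expm (io t *: X) = 1%:M) <-> X^t* = - X.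
Proof.
split=> [h|h t]; last first.
  by rewrite -expm_adj adjZ ioJ h scalerN expmVl.
apply: (@expm_curve_inj R S) => t; rewrite -[X in io t *: X^t*]scale1r -[io t *: _]scale1r.
have -> : 1 *: (io t *: (1 *: X)^t*) = (io t *: X)^t* by rewrite !scale1r adjZ ioJ.
rewrite expm_adj scalerN -invmx_expm -[LHS]mulmx1 -(mulmxV (expm_unit (io t *: X))) mulmxA h mul1mx //.
Qed.
End BoundedSubgroups.

(** * [K] as the unitary part of [G], and stability of [g] under adjoints *)

Section CompactForm.
Variables (n : nat) (G K : set 'M[C]_n.+1) (g : {vspace 'M[C]_n.+1}).
Hypothesis redG : reductive G.
Hypothesis conG : zariski_connected G.
Hypothesis maxK : maximal_compact_subgroup K G.
Hypothesis gP : forall X, lie_algebra G X <-> X \in g.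
Implicit Types (X Y : 'M[C]_n.+1).

Let aG : algebraic_group G. Proof. by case: redG. Qed.
Let cG : closed_group G. Proof. exact: algebraic_closed aG. Qed.
Let sG : subgroup G. Proof. by case: aG. Qed.
Let GU a : G a -> a \in unitmx. Proof. by have [GU _ _ _] := sG => /GU. Qed.
Let sK : subgroup K. Proof. by case: maxK => -[]. Qed.
Let KG : K `<=` G. Proof. by case: maxK => -[]. Qed.
Let cK : compact K. Proof. by case: maxK => -[]. Qed.

Lemma regular_conj X i j : regular_on G (fun a => (a *m X *m invmx a) i j).
Proof.
exists (fun a => (a *m X *m \adj a) i j), 1%N; split.
  apply: polyf_mulmx => [k l|k l].
    apply: polyf_mulmx => [p q|p q]; [exact: polyf_entry | exact: polyf_cst].
  apply: (@polyf_ext _ _ (fun a : 'M[C]_n.+1 => cofactor a l k)).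
    by move=> a; rewrite !mxE.
  apply: polyfM; first exact: polyf_cst.
  apply: polyf_det => p q; apply: (@polyf_ext _ _ (fun a : 'M[C]_n.+1 => a (lift l p) (lift k q))).
    by move=> a; rewrite !mxE.
  exact: polyf_entry.
move=> a Ga; rewrite expr1 /invmx GU // -scalemxAr mxE mulrC //.
Qed.

Variable z : {vspace 'M[C]_n.+1}.
Hypothesis zP : forall X, X \in z <-> X \in g /\ forall Y, Y \in g -> br X Y = 0.

(** Conjugates of [X] stay central, so [a *m X *m invmx a] does not change when [a] is multiplied by
    an exponential; its entries are regular functions, hence constant on the connected group [G]. *)
Lemma center_fixed X a : X \in z -> G a -> a *m X *m invmx a = X.
Proof.
move=> Xz Ga; apply/matrixP => i j.
rewrite (locally_constant aG conG (regular_conj X i j)) ?invmx1 ?mulmx1 ?mul1mx // => Y b YG Gb.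
have YE := expm_unit Y; rewrite inv_mulmx ?YE ?GU // !mulmxA.
have -> : expm Y *m b *m X *m invmx b = b *m X *m invmx b *m expm Y.
  have /zP [_ h] := center_conj redG gP zP Gb Xz.
  have := h Y; rewrite -gP => /(_ YG) /eqP; rewrite subr_eq0 => /eqP e.
  by rewrite -expm_comm ?e // !mulmxA.
by rewrite mulmxK.
Qed.

(** The nilpotent part of a central element spans a line fixed by [G], an ideal of nilpotents, which
    reductivity makes 0. *)
Lemma center_semisimple X : X \in z -> gfun X id = X.
Proof.
move=> Xz; have nz : X - gfun X id \in z.
  by rewrite rpredB //; exact: (center_gfun redG gP zP).
apply/esym/eqP; rewrite -subr_eq0; apply/eqP.
have /zP [ng _] := nz.
apply: (@ideal_nilp0 _ _ _ redG gP <[X - gfun X id]>%VS) => [Y|a Y Ga|Y Y'|Y|].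
- by move=> /vlineP [c ->]; exact: rpredZ.
- move=> /vlineP [c ->]; rewrite -scalemxAr -scalemxAl center_fixed //.
  by rewrite rpredZ // memv_line.
- move=> /vlineP [c ->] /vlineP [c' ->]; rewrite brZl brZr /br subrr !scaler0; exact: mem0v.
- by move=> /vlineP [c ->]; rewrite mx_exprZ nilp_part scaler0.
- exact: memv_line.
Qed.

(** [Y] is semisimple with real eigenvalues and commutes with [K], so the products of [K] with
    [exp (i t Y)] form a bounded group; its closure is compact and equals [K] by maximality. *)
Lemma center_compact X (phi : C -> R) : X \in z -> (forall a b, phi (a + b) = phi a + phi b) ->
  real_lie K ('i *: gfun X (fun a => io (phi a))) /\ gfun X (fun a => io (phi a)) \in z.
Proof.
move=> Xz phiD; set Y := gfun X _.
have Yz : Y \in z by apply: (center_gfun redG gP zP) => // a b; rewrite phiD rmorphD.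
split=> //; have /zP [Yg _] := Yz.
have eY t : expm (io t *: ('i *: Y)) = gfun X (fun a => expc (io t * ('i * io (phi a)))).
  by rewrite scalerA gfunZ gfun_expc; apply: eq_bigr => a _; rewrite mulrA.
have GE t : G (expm (io t *: ('i *: Y))) by have /gP h := Yg; rewrite scalerA; exact: h.
have KE k t : K k -> k *m expm (io t *: ('i *: Y)) = expm (io t *: ('i *: Y)) *m k.
  move=> Kk; rewrite expm_comm // scalerA -scalemxAl -scalemxAr; congr (_ *: _).
  by rewrite -{1}(center_fixed Yz (KG Kk)) mulmxKV // GU //; exact: KG.
have [_ K1 KM KV] := sK; have [B hB] := compact_bounded cK.
pose H : set 'M[C]_n.+1 := [set a | exists k t, K k /\ a = k *m expm (io t *: ('i *: Y))].
have sH : subgroup H.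
  split=> [_ [k [t [Kk ->]]]||_ _ [k [t [Kk ->]]] [l [s [Kl ->]]]|_ [k [t [Kk ->]]]].
  - by rewrite /GL /= unitmx_mul expm_unit GU //; exact: KG.
  - by exists 1%:M, 0; rewrite (rmorph0 io) scale0r expm0 mulmx1.
  - exists (k *m l), (t + s); split; first exact: KM.
    by rewrite rmorphD expm_adds -!mulmxA (mulmxA _ l) -KE // !mulmxA.
  - exists (invmx k), (- t); split; first exact: KV.
    rewrite inv_mulmx ?expm_unit ?GU //; last exact: KG.
    have := KE _ (- t) (KV _ Kk); rewrite rmorphN scaleNr => ->; by rewrite invmx_expm.
have HG : H `<=` G.
  by move=> _ [k [t [Kk ->]]]; have [_ _ GM _] := sG; apply: GM => //; exact: KG.
have HB a : H a -> nm a <= B * \sum_(b <- spec X) nm (spr X b).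
  move=> [k [t [Kk ->]]]; apply: le_trans (nmM _ _) _.
  apply: ler_pM; rewrite ?nm_ge0 ?hB // eY; apply: le_trans (nm_sum _ _ _) _.
  apply: ler_sum => b _; rewrite nmZ nc_expc reMio reM re_i im_i re_io im_io.
  by rewrite mul0r mulr0 subrr mulr0 expR0 mul1r.
have [Q [cQ HQ _]] := bounded_closure cG sH HG HB.
have QK : Q = K.
  apply: (maxK.2) => // k Kk; apply: HQ; exists k, 0; split=> //.
  by rewrite (rmorph0 io) scale0r expm0 mulmx1.
apply/real_lieP => t; rewrite -QK; apply: HQ; exists 1%:M, t; split=> //.
by rewrite mul1mx.
Qed.

Lemma center_split X : X \in z -> exists Y1 Y2,
  [/\ real_lie K Y1, real_lie K Y2 & X = Y1 + 'i *: Y2].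
Proof.
move=> Xz; have [k1 _] := center_compact Xz (@reD R S).
have [k2 _] := center_compact Xz (@imD R S).
exists ('i *: gfun X (fun a => io (im a))), (- ('i *: gfun X (fun a => io (re a)))); split=> //.
  exact: real_lieN.
rewrite scalerN scalerA -expr2 sqrCi scaleN1r opprK gfunZ gfunD -[LHS](center_semisimple Xz).
by apply: eq_bigr => a _; rewrite {1}[a]reim addrC.
Qed.

(** The adjoint for the hermitian form whose Gram matrix is the adjoint of [b] times [b]. *)
Definition dagger (b X : 'M[C]_n.+1) := invmx b *m (b *m X *m invmx b)^t* *m b.

(** [a] makes [K] unitary; [h], in the commutant of the conjugated group, leaves it unchanged and
    makes the projection onto [s] self-adjoint. So [b = h a] serves both purposes. *)
Lemma compact_form : exists b, [/\ b \in unitmx,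
  (forall k, K k -> (b *m k *m invmx b)^t* *m (b *m k *m invmx b) = 1%:M),
  (forall a, G a -> (b *m a *m invmx b)^t* *m (b *m a *m invmx b) = 1%:M -> K a) &
  (forall X, X \in g -> dagger b X \in g)].
Proof.
have [B hB] := compact_bounded cK; have [a [au aK]] := unitarizable sK hB.
have [s [P [sg gzs [nds hP] [sconj sbr] Pnd]]] := semisimple_part redG gP zP.
have PP := proj_idem nds hP; have PT := proj_transposes hP.
pose K' : set 'M[C]_n.+1 := [set a *m k *m invmx a | k in K].
have uK' k : K' k -> k^t* *m k = 1%:M by move=> [k' Kk' <-]; exact: aK.
have aV : invmx a \in unitmx by rewrite unitmx_inv.
have cj u : invmx a *m (a *m u *m invmx a) *m a = u by rewrite !mulmxA mulVmx // mul1mx mulmxKV.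
have sP : subproj K' (act a P).
  split.
  - by rewrite act_mul // PP.
  - have := transposesM (transposesM (Adm_transposes aV) PT) (Adm_transposes au).
    by rewrite invmxK mulmxA.
  - move=> x y; rewrite !ap_act br_conj // cj; congr (_ *m _ *m _).
    by apply/(projP nds hP)/sbr; [apply: sg|]; case: hP.
  - move=> _ [k Kk <-]; have ku := GU (KG Kk).
    have Pk : P *m Adm k = Adm k *m P.
      apply: (proj_comm nds hP (Adm_transposes ku)) => x xs; rewrite apAdm; apply: sconj => //.
        exact: KG.
      by have [_ _ _ GV] := sG; apply: GV; exact: KG.
    have -> : Adm (a *m k *m invmx a) = act a (Adm k).
      by rewrite /act !AdmM ?unitmx_mul ?au ?unitmx_inv // mulmxA.
    by rewrite !act_mul // Pk.
have Pnd' x : ap (act a P) x = x -> (forall y, \tr (adm x *m adm y *m act a P) = 0) -> x = 0.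
  rewrite ap_act => xP h; set x' := invmx a *m x *m a in xP.
  have x0 : x' = 0.
    apply: Pnd => [|y].
      apply/(projP nds hP); by rewrite /x' -{2}xP cj.
    have := h (a *m y *m invmx a); rewrite -xP -/x'.
    have -> : a *m ap P x' *m invmx a = a *m x' *m invmx a.
      by congr (_ *m _ *m _); rewrite /x' -{2}xP cj.
    rewrite !adm_conj // /act.
    have VA : Adm a *m Adm (invmx a) = 1%:M by exact: AdmV.
    rewrite -!mulmxA (mulmxA (Adm a)) VA mul1mx (mulmxA (Adm a)) VA mul1mx => <-.
    by rewrite [RHS]mxtrace_mulC -!mulmxA VA mulmx1.
  by rewrite -xP x0 ap0 mulmx0 mul0mx.
have [h [hH hu hadj]] := selfadj_conjugate uK' sP Pnd'.
pose b := h *m a; have bu : b \in unitmx by rewrite unitmx_mul hu.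
have bk k : K k -> b *m k *m invmx b = a *m k *m invmx a.
  move=> Kk; have := hH (a *m k *m invmx a) (ex_intro2 _ _ k Kk erefl) => e.
  by rewrite /b inv_mulmx // !mulmxA; move: e; rewrite !mulmxA => ->; rewrite mulmxK.
have hb : act b P = act h (act a P) by rewrite actM.
clearbody b; have bK k : K k -> (b *m k *m invmx b)^t* *m (b *m k *m invmx b) = 1%:M.
  by move=> Kk; rewrite bk //; exact: aK.
exists b; split=> // [x Gx xu|X Xg].
  pose K2 : set 'M[C]_n.+1 := [set x | G x /\ (b *m x *m invmx b)^t* *m (b *m x *m invmx b) = 1%:M].
  have cj2 u : invmx b *m (b *m u *m invmx b) *m b = u by rewrite !mulmxA mulVmx // mul1mx mulmxKV.
  have [_ G1 GM GV] := sG.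
  have bM x1 x2 : b *m (x1 *m x2) *m invmx b = (b *m x1 *m invmx b) *m (b *m x2 *m invmx b).
    by rewrite !mulmxA mulmxKV.
  have <- : K2 = K; last by split.
  apply: (maxK.2); last by move=> k Kk; split; [exact: KG | exact: bK].
  split; last first.
  - apply: (@bounded_compact _ _ _ _ _ (nm (invmx b) * Num.sqrt n.+1%:R * nm b)) => [y [Gy yu]|A L hA AL].
      rewrite -(cj2 y); apply: le_trans (nmM _ _) _; rewrite ler_wpM2r ?nm_ge0 //.
      by apply: le_trans (nmM _ _) _; rewrite ler_wpM2l ?nm_ge0 //; exact: unitary_nm.
    have cb := cvmM (cvmM (cvm_cst b) AL) (cvm_cst (invmx b)).
    have Lu : (b *m L *m invmx b)^t* *m (b *m L *m invmx b) = 1%:M.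
      apply: (cvm_uniq (cvmM (cvm_adj cb) cb)); apply: cvm_ext (cvm_cst _) => k.
      by have [_ ->] := hA k.
    split=> //; have [_ clG] := cG; apply: clG AL _ => [k|]; first by case: (hA k).
    have [_] := mulmx1_unit Lu; rewrite !unitmx_mul => /andP [/andP []] //.
  - by move=> y [].
  - split=> [y [/GU] //||y1 y2 [Gy1 u1] [Gy2 u2]|y [Gy u]].
    + by split=> //; rewrite mulmx1 mulmxV // adj1 mulmx1.
    + split; first exact: GM.
      rewrite bM; move: (b *m y1 *m _) (b *m y2 *m _) u1 u2 => p q hp hq.
      by rewrite adjM -mulmxA (mulmxA (p^t* )) hp mul1mx.
    + split; first exact: GV.
      have yu := GU Gy; have e : b *m invmx y *m invmx b = invmx (b *m y *m invmx b).
        by rewrite !inv_mulmx ?invmxK ?unitmx_mul ?bu ?unitmx_inv // mulmxA.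
      have [_ wu] := mulmx1_unit u; rewrite e adjV -inv_mulmx ?unitmx_adj //.
      by rewrite (mulmx1C u) invmx1.
have dD x y : dagger b (x + y) = dagger b x + dagger b y.
  by rewrite /dagger mulmxDr mulmxDl adjD mulmxDr mulmxDl.
have dZ c x : dagger b (c *: x) = c^* *: dagger b x.
  by rewrite /dagger -scalemxAr -scalemxAl adjZ -scalemxAr -scalemxAl.
have dk Y : real_lie K Y -> dagger b Y = - Y.
  move=> /real_lieP hY; have : (b *m Y *m invmx b)^t* = - (b *m Y *m invmx b).
    apply/unitary_skew => t; rewrite scalemxAl scalemxAr expm_conj //; exact: bK.
  by rewrite /dagger => ->; rewrite mulmxN mulNmx !mulmxA mulVmx // mul1mx mulmxKV.
have kg Y : real_lie K Y -> Y \in g.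
  move=> /real_lieP hY; apply/gP; apply: real_lie_lie => //; apply/real_lieP => t; exact: KG.
(* The central summand splits into elements of the Lie algebra of [K], on which [dagger b] is the
   opposite; the summand in [s] is handled by the self-adjoint projection. *)
have [u [v [uz vs ->]]] := gzs X Xg; rewrite dD; apply: rpredD.
  have [Y1 [Y2 [k1 k2 ->]]] := center_split uz; rewrite dD dZ !dk //.
  by rewrite rpredD ?rpredZ ?rpredN // kg.
apply: sg; apply/(projP nds hP); set y := b *m v *m invmx b.
have bT : transposes (act b P) (act b P).
  have bV : invmx b \in unitmx by rewrite unitmx_inv.
  have := transposesM (transposesM (Adm_transposes bV) PT) (Adm_transposes bu).
  by rewrite invmxK mulmxA.
have yb : ap (act b P) y = y.
  rewrite ap_act /y (_ : invmx b *m _ *m b = v) ?(proj_id nds hP vs) //.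
  by rewrite !mulmxA mulVmx // mul1mx mulmxKV.
have := ap_transposes_adj (y^t* ) bT; rewrite {1}hb hadj -hb trmxCK yb ap_act => e.
rewrite /dagger -/y; apply/esym; rewrite -{1}e !mulmxA mulVmx // mul1mx mulmxKV //.
Qed.
End CompactForm.

(** * Invariant polynomials separating points from a critical [K]-orbit *)

Section LogarithmDirection.
Variable n : nat.
Implicit Types (X Y : 'M[C]_n) (G : set 'M[C]_n).

Lemma expm_fix m (A : 'M[C]_m) (v : 'cV[C]_m) : A *m v = 0 -> expm A *m v = v.
Proof.
move=> h; apply: (cvm_uniq (cvmM (expm_cvm A) (cvm_cst v))).
apply: cvm_near (cvm_cst v); exists 1%N => // -[|N] //= _.
rewrite /epart big_ord_recl /= expr0 fact0 invr1 scale1r mulmxDl mul1mx mulmx_suml big1 ?addr0 //.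
by move=> i _; rewrite -scalemxAl exprSr -mulmxE -mulmxA h mulmx0 scaler0.
Qed.

Lemma cvg0_near_le (a : nat -> R) : (forall k, 0 <= a k) ->
  (forall e, 0 < e -> \forall k \near \oo, a k <= e) -> cvg0 a.
Proof.
move=> a0 h e e0; have e2 : 0 < e / 2 by lra.
by apply: filterS (h _ e2) => k hk; apply: le_lt_trans hk _; lra.
Qed.

(** The logarithms from [closed_subgroup_exp] differ from [h - 1] by a multiple of [|h - 1| ^ 2], so
    after division by [e] they have the same limit. *)
Lemma log_direction G (h : nat -> 'M[C]_n) (e : nat -> R) Y : closed_group G ->
  (forall k, G (h k)) -> cvg0 e -> (forall k, 0 < e k) ->
  cvm (fun k => io (e k)^-1 *: (h k - 1%:M)) Y ->
  exists X : nat -> 'M[C]_n, [/\ forall k, real_lie G (X k), cvm X Y &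
    \forall k \near \oo, h k = expm (io (e k) *: X k)].
Proof.
move=> cG Gh e0 ep hY; have h1 : cvm h 1%:M.
  have := cvmD (cvmZ (cvs_io0 e0 ep) hY) (cvm_cst 1%:M); rewrite scale0r add0r; apply: cvm_ext => k.
  by rewrite scalerA -rmorphM mulfV ?gt_eqF // (rmorph1 io) scale1r subrK.
have [X [GX X0 hX]] := closed_subgroup_exp cG Gh h1.
exists (fun k => io (e k)^-1 *: X k); split=> [k||]; first exact: real_lieZ.
  have eV k : 0 < (e k)^-1 by rewrite invr_gt0.
  have c0 : 0 <= cn (S := S) n * (4 * expR 1 * (nm Y + 1)) :> R.
    by rewrite mulr_ge0 ?cn_ge0 // !mulr_ge0 ?expR_ge0 // addr_ge0 ?nm_ge0.
  suff d0 : cvm (fun k => io (e k)^-1 *: X k - io (e k)^-1 *: (h k - 1%:M)) 0.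
    by have := cvmD d0 hY; rewrite add0r; apply: cvm_ext => k; rewrite subrK.
  apply: cvg0_le (cvg0Z c0 (cvg0Z (c := nm Y + 1) _ e0)); last by rewrite addr_ge0 ?nm_ge0.
  apply: filterS3 hX (cvm_bd hY) (X0 _ (small_rad_gt0 (S := S) n)) => k hk Yk.
  rewrite !subr0 => Xk; have h2 := expm_inj_small (ltW Xk).
  rewrite -scalerBr nmZ nc_io gtr0_norm //.
  rewrite nmZ nc_io gtr0_norm // in Yk.
  rewrite hk in Yk *; have := expm_tail2 (X k); rewrite -nmN !opprB => h3.
  have hb : nm (expm (X k) - 1%:M) <= e k * (nm Y + 1) by rewrite -ler_pdivrMl.
  have X1 : nm (X k) <= 1 by apply: le_trans (ltW Xk) (small_rad_le1 (S := S) n).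
  rewrite ler_pdivrMl //; apply: le_trans h3 _.
  have x0 := nm_ge0 (X k).
  have -> : e k * (cn (S := S) n * (4 * expR 1 * (nm Y + 1)) * ((nm Y + 1) * e k)) =
     cn (S := S) n * ((2 * (e k * (nm Y + 1))) ^+ 2 * expR 1) by rewrite expr2; ring.
  rewrite ler_wpM2l ?cn_ge0 //; apply: ler_pM; rewrite ?expR_ge0 ?sqr_ge0 ?ler_expR //.
  rewrite ler_pXn2r ?nnegrE //; first by lra.
  by rewrite mulr_ge0 // mulr_ge0 ?(ltW (ep _)) // addr_ge0 ?nm_ge0.
apply: filterS hX => k ->.
by rewrite scalerA -rmorphM mulfV ?gt_eqF // (rmorph1 io) scale1r.
Qed.
End LogarithmDirection.

Lemma multinomial_types (m N : nat) (z : 'I_m -> C) :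
  (\sum_j z j) ^+ N = \sum_(a : {ffun 'I_m -> 'I_N.+1})
    #|[pred f : {ffun 'I_N -> 'I_m} | [ffun j => inord #|[pred i | f i == j]|] == a]|%:R
      * \prod_j z j ^+ a j.
Proof.
rewrite -[N in LHS]card_ord -prodr_const bigA_distr_bigA /=.
pose tau (f : {ffun 'I_N -> 'I_m}) : {ffun 'I_m -> 'I_N.+1} := [ffun j => inord #|[pred i | f i == j]|].
rewrite (partition_big tau predT) //=; apply: eq_bigr => a _.
rewrite (eq_bigr (fun=> \prod_j z j ^+ a j)) => [|f /eqP <-].
  by rewrite sumr_const mulr_natl; congr (_ *+ _); apply: eq_card => f; rewrite !inE.
rewrite (partition_big f predT) //=; apply: eq_bigr => j _.
rewrite ffunE inordK; last first.
  by rewrite ltnS; apply: leq_trans (max_card _) _; rewrite card_ord.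
rewrite (eq_bigr (fun=> z j)) => [|i /eqP -> //].
by rewrite prodr_const; congr (_ ^+ _); apply: eq_card => i; rewrite !inE.
Qed.

Definition homog m (x : 'cV[C]_m) (j : 'I_m.+1) : C :=
  if unlift ord0 j is Some i then x i 0 else 1.

Lemma homog_sum m (x y : 'cV[C]_m) : \sum_j homog x j * (homog y j)^* = ip x y + 1.
Proof.
rewrite big_ord_recl /homog unlift_none rmorph1 mulr1 addrC; congr (_ + _).
by rewrite /ip; apply: eq_bigr => i _; rewrite liftK big_ord1.
Qed.

(** Coordinates of the symmetric power: monomials in [(x, 1)] weighted by square roots of
    multinomial coefficients. Exponent vectors of total degree other than [N] get the coefficient 0.
    The dimension [(N + 1) ^ (m + 1)] is polynomial in [N]. *)
Lemma feature_map m N : exists psi : 'cV[C]_m -> 'cV[C]_(#|{ffun 'I_m.+1 -> 'I_N.+1}|),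
  (forall i, polyf (fun x => psi x i 0)) /\
  forall x y, ip (psi x) (psi y) = (ip x y + 1) ^+ N.
Proof.
pose cnt (a : {ffun 'I_m.+1 -> 'I_N.+1}) :=
  #|[pred f : {ffun 'I_N -> 'I_m.+1} | [ffun j => inord #|[pred i | f i == j]|] == a]|.
exists (fun x => \col_i (io (Num.sqrt (cnt (enum_val i))%:R) * \prod_j homog x j ^+ (enum_val i : {ffun _}) j)).
split=> [i|x y].
  apply: (@polyf_ext _ _ (fun x : 'cV[C]_m => io (Num.sqrt (cnt (enum_val i))%:R) *
      \prod_j homog x j ^+ (enum_val i : {ffun _}) j)) => [x|]; first by rewrite mxE.
  apply: polyfM; first exact: polyf_cst.
  apply: polyf_prod => j; apply: polyfX; rewrite /homog.
  by case: (unlift ord0 j) => [k|]; [exact: polyf_entry | exact: polyf_cst].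
rewrite -homog_sum multinomial_types (big_enum_val (A := {ffun 'I_m.+1 -> 'I_N.+1})) /ip.
apply: eq_bigr => i _; rewrite big_ord1 !mxE rmorphM /= ioJ rmorph_prod mulrACA -rmorphM -expr2.
rewrite sqr_sqrtr // rmorph_nat -big_split /=; congr (_ * _); apply: eq_bigr => j _.
by rewrite rmorphXn exprMn.
Qed.

(* The matrix [sum c x x^*] has trace [sum c |x|^2] and Frobenius norm as on the right. *)
Lemma gram_rank (I : Type) (s : seq I) D (c : I -> R) (x : I -> 'cV[C]_D) :
  (\sum_(i <- s) c i * fn (x i)) ^+ 2 <=
  D%:R * \sum_(i <- s) \sum_(j <- s) c i * c j * nc (ip (x i) (x j)) ^+ 2.
Proof.
pose P : 'M[C]_D := \sum_(i <- s) io (c i) *: (x i *m (x i)^t*).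
have trP : \tr P = io (\sum_(i <- s) c i * fn (x i)).
  rewrite /P raddf_sum rmorph_sum; apply: eq_bigr => i _.
  by rewrite /= mxtraceZ -ipE ip_fn rmorphM.
have fP : fn P = \sum_(i <- s) \sum_(j <- s) c i * c j * nc (ip (x i) (x j)) ^+ 2.
  apply: (@io_inj R S); rewrite -ip_fn ip_suml rmorph_sum; apply: eq_bigr => i _.
  rewrite ip_sumr rmorph_sum; apply: eq_bigr => j _.
  rewrite ipZl ipZr ioJ mulrA 2!rmorphM -mulJ_nc; congr (_ * _).
  rewrite ipE adjM trmxCK -mulmxA mxtrace_mulC -!mulmxA.
  have e1 (A : 'M[C]_1) : \tr A = A 0 0 by rewrite /mxtrace big_ord1.
  rewrite mulmxA e1 mxE big_ord1 -!e1 ipJ !ipE (mxtrace_mulC (x i)) (mxtrace_mulC (x j)).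
  by rewrite mulrC.
rewrite -fP -nm2; have := CSip P (1%:M); rewrite ipE adj1 mulmx1 trP nc_io => h.
have n1 : nm (1%:M : 'M[C]_D) ^+ 2 = D%:R.
  apply: (@io_inj R S); rewrite nm2 -ip_fn ipE adj1 mulmx1 mxtrace1 rmorph_nat //.
rewrite -n1 mulrC -exprMn -real_normK ?num_real //.
by rewrite ler_pXn2r ?nnegrE ?mulr_ge0 ?nm_ge0.
Qed.

(** Origin of the 8: [z ^ k] is within [4 k |im z|] times [|z| ^ k] of [|z| ^ k], and the hypothesis
    makes this at most half of it. *)
Lemma near_power (z : C) k : 2^-1 <= re z -> 8 * k%:R * `|im z| <= 1 ->
  nc z ^+ k / 2 <= re (z ^+ k).
Proof.
move=> rz iz; set p := nc z; set b := `|im z| in iz.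
have hp : 2^-1 <= p := le_trans rz (re_le_nc z).
have b0 : 0 <= b by exact: normr_ge0.
have p0 : 0 <= p := nc_ge0 z.
have zp : nc (z - io p) <= 2 * b.
  apply: le_trans (nc_le_reim _) _; rewrite reB imB re_io im_io subr0 -/b.
  have := re_le_nc z; have := nc_le_reim z; rewrite -/p -/b (ger0_norm (_ : 0 <= re z)); last lra.
  by move=> h1 h2; rewrite ler0_norm; lra.
have key j : nc (z ^+ j - io (p ^+ j)) <= 4 * j%:R * b * p ^+ j.
  elim: j => [|j IH]; first by rewrite !expr0 (rmorph1 io) subrr nc0 mulr0 !mul0r.
  have -> : z ^+ j.+1 - io (p ^+ j.+1) = z * (z ^+ j - io (p ^+ j)) + (z - io p) * io (p ^+ j).
    by rewrite !exprS rmorphM; ring.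
  apply: le_trans (ncD _ _) _; rewrite !ncM nc_io (ger0_norm (exprn_ge0 _ p0)) -/p.
  have pj := exprn_ge0 j p0; have h1 := ler_wpM2l p0 IH; have h2 := ler_wpM2r pj zp.
  apply: le_trans (lerD h1 h2) _; rewrite exprS -natr1.
  have h3 : 0 <= b * p ^+ j by rewrite mulr_ge0.
  nra.
have := key k; have := lerB_nc (io (p ^+ k)) (z ^+ k).
have pk := exprn_ge0 k p0; have := ler_re_nc (z ^+ k - io (p ^+ k)).
rewrite reB re_io ler_norml => /andP [h1 _] _ h2.
by have h3 := ler_wpM2r pk iz; nra.
Qed.

Lemma fnB m n (x y : 'M[C]_(m, n)) : fn (x - y) = fn x + fn y - 2 * re (ip x y).
Proof.
apply: (@io_inj R S); rewrite -ip_fn ipBl !ipBr !rmorphB !rmorphD -!ip_fn /=.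
have -> : io (2 * re (ip x y)) = ip x y + ip y x.
  rewrite -(ipJ x y) [in RHS](reim (ip x y)) [in RHS]rmorphD [in RHS]rmorphM /= !ioJ conjCi.
  by rewrite rmorphM rmorph_nat; ring.
by ring.
Qed.

(** The terms [2 re (ip x y)] of the two sides cancel, leaving Cauchy-Schwarz. Without the added 1
    the modulus could not tell [x] from its multiples by phases. *)
Lemma far_bound m n (x y : 'M[C]_(m, n)) a : fn x <= a -> fn y <= a ->
  nc (ip x y + 1) ^+ 2 <= (a + 1) ^+ 2 - fn (x - y).
Proof.
move=> xa ya; rewrite nc2E reD imD re1 fnB -(rmorph1 io) im_io addr0.
have h : nc (ip x y) ^+ 2 <= a ^+ 2.
  have a0 : 0 <= a := le_trans (fn_ge0 x) xa.
  apply: (@le_trans _ _ (fn x * fn y)); last by rewrite expr2; apply: ler_pM; rewrite ?fn_ge0.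
  by rewrite -!nm2 -exprMn ler_pXn2r ?nnegrE ?mulr_ge0 ?nm_ge0 ?nc_ge0 // CSip.
by rewrite nc2E in h; nra.
Qed.

Lemma cvs_le_nc (u : nat -> C) a B : cvs u a ->
  (\forall k \near \oo, nc (u k) <= B) -> nc a <= B.
Proof.
move=> ua h; rewrite -subr_le0; apply: cvg0_cst; apply: cvg0_le ua; apply: filterS h => k.
by have := lerB_nc a (u k); rewrite (ncBC a); lra.
Qed.

Lemma exp_beats_power (y c : R) p M0 : 0 < y -> exists M : nat, [/\ (0 < M)%N, (M0 <= M)%N &
  c * M%:R ^+ p < expR (y * M%:R)].
Proof.
move=> y0; have f0 : 0 < (p.+1)`!%:R :> R by rewrite ltr0n fact_gt0.
pose B := `|c| * (p.+1)`!%:R / y ^+ p.+1.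
pose M := (Num.truncn B + M0).+1; exists M; split=> //; first by rewrite leqW // leq_addl.
have M1 : 0 < M%:R :> R by [].
have BM : B < M%:R.
  apply: lt_le_trans (truncnS_gt B) _; by rewrite ler_nat ltnS leq_addr.
apply: lt_le_trans (_ : 1 + (y * M%:R) ^+ p.+1 / p.+1`!%:R <= _); last first.
  by apply: expR_ge1Dxn; rewrite mulr_ge0 // ltW.
apply: le_lt_trans (_ : `|c| * M%:R ^+ p < _).
  by rewrite ler_wpM2r ?exprn_ge0 // ler_norm.
apply: (@lt_trans _ _ ((y * M%:R) ^+ p.+1 / p.+1`!%:R)); last by rewrite ltrDr.
rewrite ltr_pdivlMr // exprMn [M%:R ^+ p.+1]exprS mulrAC [X in _ < X]mulrA ltr_pM2r ?exprn_gt0 //.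
by rewrite [X in _ < X]mulrC; move: BM; rewrite ltr_pdivrMr ?exprn_gt0.
Qed.

Lemma one_minus_power (t : R) k : 0 <= 1 - t -> (1 - t) ^+ k <= expR (- (t * k%:R)).
Proof.
move=> h; rewrite -mulNr mulrC expRM_natl.
by apply: lerXn2r; rewrite ?nnegrE ?expR_ge0 // expR_ge1Dx.
Qed.

Section OrbitSeparation.
Variables (n m : nat) (K : set 'M[C]_n) (r : 'M[C]_n -> 'M[C]_m) (dr : {linear 'M[C]_n -> 'M[C]_m}).
Hypothesis sK : subgroup K.
Hypothesis cK : compact K.
Hypothesis r1 : r 1%:M = 1%:M.
Hypothesis rM : forall g h, K g -> K h -> r (g *m h) = r g *m r h.
Hypothesis ru : forall k, K k -> (r k)^t* *m r k = 1%:M.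
Hypothesis rc : forall A L, (forall k, K (A k)) -> K L -> cvm A L -> cvm (fun k => r (A k)) (r L).
Hypothesis rdr : forall X, real_lie K X -> forall t : R, r (expm (io t *: X)) = expm (io t *: dr X).
Variable w : 'cV[C]_m.
Hypothesis crit : forall X, real_lie K X -> ip (dr X *m w) w = 0.

Lemma ip_mulmx p q (A : 'M[C]_(q, p)) (x : 'cV[C]_p) (y : 'cV[C]_q) : ip (A *m x) y = ip x (A^t* *m y).
Proof. by rewrite !ipE adjM trmxCK -mulmxA mxtrace_mulC mulmxA. Qed.

Lemma lie_skew X : real_lie K X -> (dr X)^t* = - dr X.
Proof.
move=> hX; apply/unitary_skew => t; rewrite -rdr //; apply: ru; by move/real_lieP: hX.
Qed.

(* Criticality kills the linear term of [ip (r (expm X) w) w]; its quadratic term is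
   [- nm (dr X w) ^+ 2 / 2], which is real. *)
Lemma phase_expm X : real_lie K X ->
  `|im (ip (r (expm X) *m w) w)| <= cn (S := S) m * (nm (dr X) ^+ 3 * expR (nm (dr X))) * nm w ^+ 2.
Proof.
move=> hX; have := rdr hX 1; rewrite (rmorph1 io) !scale1r => ->.
set Z := dr X; pose E := expm Z - 1%:M - Z - 2^-1 *: (Z *m Z).
have -> : expm Z = E + 2^-1 *: (Z *m Z) + Z + 1%:M by rewrite /E !subrK.
have E3 : nm E <= cn (S := S) m * (nm Z ^+ 3 * expR (nm Z)) by exact: expm_tail3.
clearbody E.
rewrite !mulmxDl mul1mx !ipDl crit // addr0 -scalemxAl ipZl -mulmxA (ip_mulmx Z) /Z lie_skew // -/Z.
rewrite mulNmx (ipNr (Z *m w)) !ip_fn !imD im_io addr0.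
have -> : 2^-1 * - io (fn (Z *m w)) = io (- (2^-1 * fn (Z *m w))).
  by rewrite rmorphN rmorphM fmorphV rmorph_nat mulrN.
rewrite im_io addr0; apply: le_trans (ler_im_nc _) _; apply: le_trans (CSip _ _) _.
rewrite expr2 mulrA ler_wpM2r ?nm_ge0 //; apply: le_trans (nmM _ _) _.
by rewrite ler_wpM2r ?nm_ge0.
Qed.

(** Taking the representative nearest to 1 in a coset of the stabiliser of [w] is what later
    excludes directions of approach tangent to the stabiliser. *)
Lemma coset_nearest k : K k -> exists h, [/\ K h, r h *m w = r k *m w &
  forall h', K h' -> r h' *m w = r h *m w -> nm (h - 1%:M) <= nm (h' - 1%:M)].
Proof.
move=> Kk; have [B hB] := compact_bounded cK.
have [|X [KX _]|A L hA AL|A L _ AL|X|h [Kh hw] hmin] := @min_attained _ S _ _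
    [set h | K h /\ r h *m w = r k *m w] (fun h => nm (h - 1%:M)) B.
- by exists k.
- exact: hB.
- have KL : K L by apply: (compact_cvm cK _ AL) => j; case: (hA j).
  split=> //; have KA j : K (A j) by case: (hA j).
  apply: (cvm_uniq (cvmM (rc KA KL AL) (cvm_cst w))); apply: cvm_ext (cvm_cst _) => j.
  by case: (hA j).
- exact: cvm_nm (cvmB AL (cvm_cst _)).
- exact: nm_ge0.
by exists h; split=> // h' Kh' hw'; apply: hmin; rewrite /= hw' hw.
Qed.

Lemma rV k : K k -> r (invmx k) *m r k = 1%:M.
Proof.
by move=> Kk; have [KU _ _ KV] := sK; rewrite -rM ?mulVmx //; [exact: KU | exact: KV].
Qed.

Lemma ip_unitary k (x y : 'cV[C]_m) : K k -> ip (r k *m x) (r k *m y) = ip x y.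
Proof. by move=> Kk; rewrite ip_mulmx mulmxA ru // mul1mx. Qed.

Lemma nm_unitary k (x : 'cV[C]_m) : K k -> nm (r k *m x) = nm x.
Proof.
move=> Kk; rewrite /nm; congr Num.sqrt; apply: (@io_inj R S); by rewrite -!ip_fn ip_unitary.
Qed.

Lemma near_stabilizer (h : nat -> 'M[C]_n) : (forall j, K (h j)) ->
  cvm (fun j => r (h j) *m w) w ->
  (forall j h', K h' -> r h' *m w = r (h j) *m w -> nm (h j - 1%:M) <= nm (h' - 1%:M)) ->
  exists2 psi, subseq_ix psi & cvm (h \o psi) 1%:M.
Proof.
move=> Kh hw hmin; have [KU K1 KM KV] := sK; have [B hB] := compact_bounded cK.
have [psi psiS [L hL]] := bw_mx (fun j => hB _ (Kh j)).
have KL : K L by apply: (compact_cvm cK _ hL) => j; exact: Kh.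
have rL : r L *m w = w.
  apply: cvm_uniq (cvm_subseq psiS hw); apply: cvmM (cvm_cst w).
  by apply: rc hL => // j; exact: Kh.
have rL' : r (invmx L) *m w = w by rewrite -{1}rL mulmxA rV // mul1mx.
exists psi => //; have := cvmM hL (cvm_cst (invmx L)); rewrite mulmxV ?KU // => h1.
apply: cvg0_leA h1 => j; apply: hmin => /=; first exact: KM (KV _ _).
by rewrite (rM (Kh _) (KV _ KL)) -mulmxA rL'.
Qed.

(** Otherwise a sequence of nearest representatives tends to 1 in some direction [Y]. If [Y] kills
    [w], moving by [exp (- e Y)] gets nearer to 1 within the coset; if not, [|h w - w|] has order
    [e], while the phase has order [e ^ 3] by [phase_expm]. *)
Lemma phase_cubic : exists2 c : R, 0 <= c &
  forall k, K k -> `|im (ip (r k *m w) w)| <= c * nm (r k *m w - w) ^+ 3.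
Proof.
apply: contrapT => hno.
have /choice [h hh] (j : nat) : exists h, [/\ K h,
    j.+1%:R * nm (r h *m w - w) ^+ 3 < `|im (ip (r h *m w) w)| &
    forall h', K h' -> r h' *m w = r h *m w -> nm (h - 1%:M) <= nm (h' - 1%:M)].
  apply: contrapT => hj; apply: hno; exists j.+1%:R => // k Kk; rewrite leNgt; apply/negP => hk.
  by apply: hj; have [h [Kh hw hm]] := coset_nearest Kk; exists h; split=> //; rewrite hw.
have Kh j : K (h j) by case: (hh j).
have hw : cvm (fun j => r (h j) *m w) w.
  apply: cvg0_near_le => [j|e e0]; first exact: nm_ge0.
  have a0 : 0 <= nm w ^+ 2 / e ^+ 3 by rewrite divr_ge0 ?exprn_ge0 ?nm_ge0 ?ltW.
  apply: filterS (cvg0Z a0 (@cvg0_inv R) ltr01) => j; rewrite ltr_pdivrMr // mul1r => hj.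
  rewrite leNgt; apply/negP => ej; have [_ hb _] := hh j.
  have : j.+1%:R * e ^+ 3 < nm w ^+ 2.
    apply: le_lt_trans (lt_le_trans hb _).
      by rewrite ler_wpM2l // ler_pXn2r ?nnegrE ?nm_ge0 // ltW.
    apply: le_trans (ler_im_nc _) _; apply: le_trans (CSip _ _) _.
    by rewrite nm_unitary // expr2.
  by rewrite -ltr_pdivlMr ?exprn_gt0 // ltNge ltW.
have [psi psiS h1] := near_stabilizer Kh hw (fun j => let: And3 _ _ x := hh j in x).
pose e j := nm (h (psi j) - 1%:M).
have ep j : 0 < e j.
  rewrite lt_neqAle nm_ge0 andbT eq_sym nm_eq0; apply/eqP => /eqP; rewrite subr_eq0 => /eqP e1.
  have [_ + _] := hh (psi j); rewrite e1 r1 mul1mx subrr nm0 ip_fn im_io normr0 expr0n mulr0.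
  by rewrite ltxx.
have e0 : cvg0 e by exact: h1.
have [j|phi phiS [Y hY]] := @bw_mx _ _ _ _ (fun j => io (e j)^-1 *: (h (psi j) - 1%:M)) 1.
  by rewrite nmZ nc_io gtr0_norm ?invr_gt0 // mulVf ?gt_eqF.
have Y1 : 1 <= nm Y.
  apply: (cvm_ge_nm hY); apply: nearW => j /=.
  by rewrite nmZ nc_io gtr0_norm ?invr_gt0 // mulVf ?gt_eqF.
have cG := compact_closed_group sK cK.
have e0' := cvg0_subseq phiS e0; have ep' j : 0 < (e \o phi) j by exact: ep.
have [X [KX XY hX]] := log_direction cG (fun j => Kh (psi (phi j))) e0' ep' hY.
have KY : real_lie K Y.
  apply: (@lie_direction _ _ _ _ (fun j => h (psi (phi j))) (fun j => (e (phi j))^-1)) => //.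
  by move=> j; rewrite invr_ge0 ltW.
have rq := cvmM (expm_quot (cvm_linear dr XY) e0' ep') (cvm_cst w).
have [Yw|Yw] := eqVneq (dr Y *m w) 0.
  have fixw t : r (expm (io t *: - Y)) *m w = w.
    rewrite rdr; last exact: real_lieN.
    by apply: expm_fix; rewrite -scalemxAl raddfN mulNmx Yw oppr0 scaler0.
  have KE t : K (expm (io t *: - Y)) by move: (real_lieN KY) => /real_lieP; exact.
  have q2 := expm_quot (cvm_cst (- Y)) e0' ep'.
  have eE : cvm (fun j => expm (io ((e \o phi) j) *: - Y)) 1%:M.
    have := cvm_expm (cvmZ (cvs_io0 e0' ep') (cvm_cst (- Y))).
    by rewrite scale0r expm0.
  have := cvmD (cvmM hY eE) q2; rewrite mulmx1 addrN => lim.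
  have : 1 <= nm (0 : 'M[C]_n).
    apply: (cvm_ge_nm lim); apply: nearW => j /=.
    set E := expm _; have -> : io (e (phi j))^-1 *: (h (psi (phi j)) - 1%:M) *m E +
      io (e (phi j))^-1 *: (E - 1%:M) = io (e (phi j))^-1 *: (h (psi (phi j)) *m E - 1%:M).
      by rewrite -scalemxAl -scalerDr mulmxBl mul1mx addrA subrK.
    rewrite nmZ nc_io gtr0_norm ?invr_gt0 // ler_pdivlMl // mulr1.
    have [_ _ hm] := hh (psi (phi j)); apply: hm.
      by have [_ _ KM _] := sK; apply: KM (Kh _) (KE _).
    by rewrite (rM (Kh _) (KE _)) -mulmxA fixw.
  by rewrite nm0 ler10.
have c0 : 0 < nm (dr Y *m w) by rewrite nm_gt0.
set c := nm (dr Y *m w) in c0; pose b := nm (dr Y) + 1.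
have b0 : 0 <= b by rewrite addr_ge0 ?nm_ge0.
pose M := cn (S := S) m * (b ^+ 3 * expR b) * nm w ^+ 2.
have M0 : 0 <= M by rewrite !mulr_ge0 ?cn_ge0 ?expR_ge0 ?exprn_ge0 ?nm_ge0.
have c2 : 0 < c / 2 by lra.
have Mc : 0 <= M / (c / 2) ^+ 3 by rewrite divr_ge0 ?exprn_ge0 // ltW.
have n1 := cvm_nm rq c2; have n2 := cvm_bd (cvm_linear dr XY).
have n3 := e0' _ ltr01.
have n4 := near_subseq phiS (near_subseq psiS (cvg0Z Mc (@cvg0_inv R) ltr01)).
have [j [[[nq nX] ne] [nM hj]]] := near_ex (filterI (filterI (filterI n1 n2) n3) (filterI n4 hX)).
have [_ bad _] := hh (psi (phi j)); move: bad; rewrite /= in nX hj ne nM *; rewrite {}hj.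
set t := e (phi j) in ne *; have t0 : 0 < t := ep _.
apply/negP; rewrite -leNgt.
have KX' : real_lie K (io t *: X j) by exact: real_lieZ.
apply: le_trans (phase_expm KX') _.
have nq' : c / 2 * t <= nm (r (expm (io t *: X j)) *m w - w).
  have tV : 0 < t^-1 by rewrite invr_gt0.
  have := nq; rewrite /= -/t -scalemxAl nmZ nc_io (gtr0_norm tV) mulmxBl mul1mx -rdr // -/c.
  rewrite ltr_norml => /andP [h3 _]; rewrite -ler_pdivlMr // mulrC; lra.
apply: (@le_trans _ _ (M * t ^+ 3)).
  rewrite linearZ nmZ nc_io gtr0_norm // /M.
  rewrite [X in _ <= X](_ : _ = cn (S := S) m * ((t * b) ^+ 3 * expR b) * nm w ^+ 2); last first.
    by rewrite exprMn; ring.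
  rewrite ler_wpM2r ?exprn_ge0 ?nm_ge0 // ler_wpM2l ?cn_ge0 //.
  have x0 := nm_ge0 (dr (X j)).
  have tx : t * nm (dr (X j)) <= t * b by rewrite ler_wpM2l // ltW.
  apply: ler_pM; rewrite ?expR_ge0 ?exprn_ge0 ?mulr_ge0 ?(ltW t0) //.
    by rewrite ler_pXn2r ?nnegrE ?mulr_ge0 ?(ltW t0).
  rewrite ler_expR; apply: le_trans tx _; rewrite ler_piMl //.
  exact: ltW.
apply: (@le_trans _ _ ((psi (phi j)).+1%:R * (c / 2 * t) ^+ 3)); last first.
  by rewrite ler_wpM2l // ler_pXn2r ?nnegrE ?nm_ge0 // mulr_ge0 // ltW.
rewrite exprMn [X in _ <= X]mulrA ler_wpM2r ?exprn_ge0 ?(ltW t0) //.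
rewrite -ler_pdivrMr ?exprn_gt0 //.
by move: nM; rewrite ltr_pdivrMr // mul1r => /ltW.
Qed.

(** Finitely supported probability measures on [K], as lists of weights and points. *)
Definition convex_weights (s : seq (R * 'M[C]_n)) : Prop :=
  [/\ forall x, x \in s -> 0 <= x.1, \sum_(x <- s) x.1 = 1 & forall x, x \in s -> K x.2].

Definition translate (k : 'M[C]_n) (s : seq (R * 'M[C]_n)) := [seq (x.1, k *m x.2) | x <- s].

Definition halve (s t : seq (R * 'M[C]_n)) := [seq (x.1 / 2, x.2) | x <- s ++ t].

Lemma translate_weights k s : K k -> convex_weights s -> convex_weights (translate k s).
Proof.
have [_ _ KM _] := sK; move=> Kk [s0 s1 sk]; split=> [x /mapP [y ys ->]||x /mapP [y ys ->]] /=.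
- exact: s0.
- by rewrite big_map.
- by apply: KM => //; exact: sk.
Qed.

Lemma halve_weights s t : convex_weights s -> convex_weights t -> convex_weights (halve s t).
Proof.
move=> [s0 s1 sk] [t0 t1 tk]; split=> [x /mapP [y]||x /mapP [y]] /=.
- by rewrite mem_cat => /orP [/s0|/t0] h -> /=; rewrite divr_ge0.
- rewrite big_map big_cat /= -!mulr_suml s1 t1; lra.
- by rewrite mem_cat => /orP [/sk|/tk] h ->.
Qed.

Section SeparatingPolynomials.
Variables (D : nat) (psi : 'cV[C]_m -> 'cV[C]_D) (N : nat).
Hypothesis psi_ip : forall x y, ip (psi x) (psi y) = (ip x y + 1) ^+ N.

Definition comb (s : seq (R * 'M[C]_n)) : 'cV[C]_D := \sum_(x <- s) io x.1 *: psi (r x.2 *m w).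

Lemma comb_halve s t : comb (halve s t) = 2^-1 *: (comb s + comb t).
Proof.
rewrite /comb /halve big_map big_cat /= scalerDr !scaler_sumr.
congr (_ + _); apply: eq_bigr => x _; rewrite scalerA; congr (_ *: _);
  by rewrite rmorphM fmorphV rmorph_nat mulrC.
Qed.

Lemma psi_translate k x y : K k -> ip (psi (r k *m x)) (psi (r k *m y)) = ip (psi x) (psi y).
Proof. by move=> Kk; rewrite !psi_ip ip_unitary. Qed.

Lemma comb_translate k s : (forall x, x \in s -> K x.2) -> K k ->
  comb (translate k s) = \sum_(x <- s) io x.1 *: psi (r k *m (r x.2 *m w)).
Proof.
move=> sk Kk; rewrite /comb big_map big_seq [RHS]big_seq; apply: eq_bigr => x xs /=.
by rewrite (rM Kk (sk _ xs)) mulmxA.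
Qed.

Lemma ip_comb_translate k s x : convex_weights s -> K k ->
  ip (psi (r k *m x)) (comb (translate k s)) = ip (psi x) (comb s).
Proof.
move=> [_ _ sk] Kk; rewrite comb_translate // /comb !ip_sumr; apply: eq_bigr => y _.
by rewrite !ipZr psi_translate.
Qed.

Lemma fn_comb_translate k s : convex_weights s -> K k -> fn (comb (translate k s)) = fn (comb s).
Proof.
move=> cs Kk; apply: (@io_inj R S); rewrite -!ip_fn; have [_ _ sk] := cs.
rewrite {1}comb_translate // [in RHS]/comb !ip_suml; apply: eq_bigr => y _.
by rewrite !ipZl ip_comb_translate.
Qed.

(* The vector of minimal norm in the closed convex hull of the orbit of [psi w]; it is unique by
   the parallelogram law, hence fixed by [K], which makes [ip (psi x) w0] invariant in [x]. *)
Lemma minimal_combination : exists w0 (s : nat -> seq (R * 'M[C]_n)),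
  [/\ forall j, convex_weights (s j), cvm (fun j => comb (s j)) w0 &
      forall k, K k -> cvm (fun j => comb (translate k (s j))) w0].
Proof.
have [_ K1 _ _] := sK.
pose A : set R := [set fn (comb s) | s in convex_weights].
have c1 : convex_weights [:: (1, 1%:M)].
  by split=> [x||x]; rewrite ?big_seq1 // inE => /eqP -> //=; exact: ler01.
have hA : has_inf A by split; [exists (fn (comb [:: (1, 1%:M)])); exists [:: (1, 1%:M)] |
  exists 0 => _ [s _ <-]; exact: fn_ge0].
pose d := inf A.
have dle s : convex_weights s -> d <= fn (comb s).
  by move=> cs; apply: (ge_inf hA.2); exists s.
have /choice [s hs] (j : nat) : exists s, convex_weights s /\ fn (comb s) < d + j.+1%:R^-1.
  have j0 : 0 < j.+1%:R^-1 :> R by rewrite invr_gt0.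
  by have [_ [s cs <-] h] := inf_adherent j0 hA; exists s.
have close a b e : convex_weights a -> convex_weights b -> fn (comb a) < d + e ->
    fn (comb b) < d + e -> fn (comb a - comb b) <= 4 * e.
  move=> ca cb ha hb; have := dle _ (halve_weights ca cb).
  by rewrite comb_halve parallelogram; lra.
have bd j : nm (comb (s j)) <= Num.sqrt (d + 1).
  have [cs h] := hs j; apply: ler_wsqrtr; apply: le_trans (ltW h) _.
  by rewrite lerD2l invf_le1 // ler1n.
have [phi phiS [w0 hw0]] := bw_mx bd.
exists w0, (s \o phi); split=> // [j|k Kk]; first by case: (hs (phi j)).
suff h0 : cvm (fun j => comb (translate k (s (phi j))) - comb (s (phi j))) 0.
  by have := cvmD h0 hw0; rewrite add0r; apply: cvm_ext => j; rewrite subrK.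
apply: cvg0_near_le => [j|e e0]; first exact: nm_ge0.
have h4 := near_subseq phiS (cvg0Z (ler0n R 4) (@cvg0_inv R) (exprn_gt0 2 e0)).
apply: filterS h4 => j /= hj; rewrite subr0 -(@ler_pXn2r _ 2%N) ?nnegrE ?nm_ge0 ?(ltW e0) // nm2.
have [cs h] := hs (phi j); apply: le_trans (ltW hj); apply: close => //.
  exact: translate_weights.
by rewrite fn_comb_translate.
Qed.

Hypothesis psi_poly : forall i, polyf (fun x => psi x i 0).

(** The polynomial is the pairing with the fixed vector [w0]. At [w] it is [|w0| ^ 2], a limit of
    squared norms of convex combinations; at [v] it is a limit of weighted averages of the
    kernel. *)
Lemma invariant_polynomial (lo up : R) v :
  (forall s, convex_weights s -> lo <= fn (comb s)) ->
  (forall k, K k -> nc (ip v (r k *m w) + 1) ^+ N <= up) ->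
  exists f, [/\ polyf f, (forall k x, K k -> f (r k *m x) = f x),
    lo <= re (f w) & nc (f v) <= up].
Proof.
move=> hlo hup; have [w0 [s [cs sw0 kw0]]] := minimal_combination.
exists (fun x => ip (psi x) w0).
have finv k x : K k -> ip (psi (r k *m x)) w0 = ip (psi x) w0.
  move=> Kk; apply: cvs_uniq (cvs_ip (cvm_cst _) (kw0 k Kk)) _.
  by apply: cvs_ext (cvs_ip (cvm_cst (psi x)) sw0) => j; rewrite ip_comb_translate.
split=> //.
- apply: (@polyf_ext _ _ (fun x : 'cV[C]_m => \sum_i psi x i 0 * (w0 i 0)^*)) => [x|].
    by rewrite /ip; apply: eq_bigr => i _; rewrite big_ord1.
  by apply: polyf_sum => i; apply: polyfM; [exact: psi_poly | exact: polyf_cst].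
- have e j : ip (comb (s j)) w0 = ip (psi w) w0.
    have [s0 s1 sk] := cs j; rewrite /comb ip_suml big_seq.
    rewrite (eq_bigr (fun x => io x.1 * ip (psi w) w0)) => [|x xs]; last by rewrite ipZl (finv _ _ (sk _ xs)).
    by rewrite -big_seq -mulr_suml -rmorph_sum s1 rmorph1 mul1r.
  have -> : ip (psi w) w0 = ip w0 w0.
    by apply: (cvs_uniq _ (cvs_ip sw0 (cvm_cst w0))); apply: cvs_ext (cvs_cst _) => j.
  apply: (cvs_ge_re (cvs_ip sw0 sw0)); apply: nearW => j.
  by rewrite ip_fn re_io hlo.
- apply: (@cvs_le_nc _ _ _ (cvs_ip (cvm_cst (psi v)) sw0)); apply: nearW => j.
  have [s0 s1 sk] := cs j; rewrite /comb ip_sumr; apply: le_trans (nc_sum _ _ _) _.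
  rewrite -[up]mul1r -s1 mulr_suml big_seq [X in _ <= X]big_seq; apply: ler_sum => x xs.
  rewrite ipZr ncM ncJ nc_io ger0_norm ?s0 // ler_wpM2l ?s0 // psi_ip ncX; exact: hup (sk _ xs).
Qed.
End SeparatingPolynomials.

Lemma orbit_distance v : (forall k, K k -> r k *m w <> v) ->
  exists2 e : R, 0 < e & forall k, K k -> e <= nm (v - r k *m w).
Proof.
move=> hv; have [_ K1 _ _] := sK; have [B hB] := compact_bounded cK.
have [|||A L KA AL|k|k Kk hk] := @min_attained _ S _ _ K (fun k => nm (v - r k *m w)) B.
- by exists 1%:M.
- exact: hB.
- by move=> A L KA AL; exact: compact_cvm cK KA AL.
- apply: cvm_nm; apply: cvmB (cvm_cst v) (cvmM (rc KA _ AL) (cvm_cst w)).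
  exact: compact_cvm cK KA AL.
- exact: nm_ge0.
exists (nm (v - r k *m w)) => //; rewrite nm_gt0 subr_eq0; apply/eqP => e; exact: (hv k).
Qed.

Lemma kernel_translate k l : K k -> K l -> exists2 h, K h &
  ip (r k *m w) (r l *m w) = ip (r h *m w) w.
Proof.
move=> Kk Kl; have [KU _ KM KV] := sK; exists (invmx l *m k); first exact: KM (KV _ Kl) Kk.
by rewrite -(ip_unitary (_ *m w) w Kl) mulmxA -(rM Kl (KM _ _ (KV _ Kl) Kk)) mulKVmx ?KU //; exact: KU.
Qed.

(* Near the diagonal [nm (r h w - w) <= d] the phases of the kernel do not cancel, and away
   from it the kernel is small. *)
Lemma kernel_real_part c d N : 0 <= c -> 0 <= d -> d <= 1 ->
  (forall h, K h -> `|im (ip (r h *m w) w)| <= c * nm (r h *m w - w) ^+ 3) ->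
  8 * (N + N)%:R * (c * d ^+ 3) <= 1 ->
  forall h, K h -> nc (ip (r h *m w) w + 1) ^+ (N + N) / 2
    - 2 * ((fn w + 1) ^+ 2 - d ^+ 2) ^+ N <= re ((ip (r h *m w) w + 1) ^+ (N + N)).
Proof.
move=> c0 d0 d1 hc hN h Kh; set z := ip _ w + 1.
have fh : fn (r h *m w) = fn w by rewrite -!nm2 nm_unitary.
have fle : fn (r h *m w) <= fn w by rewrite fh.
have far := far_bound fle (lexx (fn w)); rewrite -/z in far.
have E0 : 0 <= (fn w + 1) ^+ 2 - d ^+ 2.
  rewrite subr_ge0; apply: (@le_trans _ _ 1); first by rewrite exprn_ile1.
  by rewrite exprn_ege1 // lerDr fn_ge0.
have En := exprn_ge0 N E0.
have [sd|sd] := leP (nm (r h *m w - w)) d; last first.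
  have zE : nc z ^+ (N + N) <= ((fn w + 1) ^+ 2 - d ^+ 2) ^+ N.
    rewrite addnn -mul2n exprM; apply: lerXn2r; rewrite ?nnegrE ?sqr_ge0 //.
    apply: le_trans far _; rewrite lerD2l lerN2 -nm2 ler_pXn2r ?nnegrE ?nm_ge0 //.
    exact: ltW.
  have := ler_re_nc (z ^+ (N + N)); rewrite ncX ler_norml => /andP [h1 _].
  by have z0 := exprn_ge0 (N + N) (nc_ge0 z); lra.
have d2 : d ^+ 2 <= 1 by rewrite exprn_ile1.
have s2 : fn (r h *m w - w) <= d ^+ 2 by rewrite -nm2 ler_pXn2r ?nnegrE ?nm_ge0.
suff : nc z ^+ (N + N) / 2 <= re (z ^+ (N + N)) by lra.
apply: near_power.
  by move: s2; rewrite fnB fh /z reD re1; have := fn_ge0 w; lra.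
apply: le_trans hN; rewrite ler_wpM2l ?mulr_ge0 //.
rewrite /z imD -(rmorph1 io) im_io addr0; apply: le_trans (hc _ Kh) _.
by rewrite ler_wpM2l // ler_pXn2r ?nnegrE ?nm_ge0.
Qed.

(** Two symmetric powers cooperate: degree [N + N] carries the polynomial and degree [N] its lower
    bound. Squared moduli of the kernel in degree [N] are moduli in degree [N + N], and [gram_rank]
    bounds their average below by an inverse dimension. *)
Lemma invariant_gap c d N v : 0 <= c -> 0 <= d -> d <= 1 ->
  (forall h, K h -> `|im (ip (r h *m w) w)| <= c * nm (r h *m w - w) ^+ 3) ->
  8 * (N + N)%:R * (c * d ^+ 3) <= 1 -> nm v <= nm w ->
  forall e, 0 <= e -> (forall k, K k -> e <= nm (v - r k *m w)) ->
  exists f, [/\ polyf f, (forall k x, K k -> f (r k *m x) = f x),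
    (fn w + 1) ^+ (N + N) / 2 / (#|{ffun 'I_m.+1 -> 'I_N.+1}|)%:R
       - 2 * ((fn w + 1) ^+ 2 - d ^+ 2) ^+ N <= re (f w) &
    nc (f v) <= ((fn w + 1) ^+ 2 - e ^+ 2) ^+ N].
Proof.
move=> c0 d0 d1 hc hN vw e e0 he.
have [psi [psip psik]] := @feature_map m N.
have [psi2 [psi2p psi2k]] := @feature_map m (N + N).
have fv : fn v <= fn w by rewrite -!nm2 ler_pXn2r ?nnegrE ?nm_ge0.
apply: (invariant_polynomial psi2k psi2p) => [s [s0 s1 sk]|k Kk].
- have fpsi k : K k -> fn (psi (r k *m w)) = (fn w + 1) ^+ N.
    move=> Kk; apply: (@io_inj R S); rewrite -ip_fn psik ip_unitary // ip_fn.
    by rewrite rmorphXn rmorphD rmorph1.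
  have := gram_rank s (fun x => x.1) (fun x => psi (r x.2 *m w)).
  have -> : \sum_(x <- s) x.1 * fn (psi (r x.2 *m w)) = (fn w + 1) ^+ N.
    rewrite big_seq (eq_bigr (fun x => x.1 * (fn w + 1) ^+ N)) => [|x xs]; last by rewrite fpsi //; exact: sk.
    by rewrite -big_seq -mulr_suml s1 mul1r.
  rewrite -exprM muln2 -addnn; set A := _ ^+ (N + N); set D := #|_|; set Sg := \sum_(x <- s) _ => hA.
  have D0 : 0 < D%:R :> R.
    rewrite ltr0n; apply/card_gt0P; by exists [ffun=> ord0].
  have ASg : A / 2 / D%:R <= Sg / 2 by rewrite mulrAC ler_wpM2r // ler_pdivrMr // mulrC.
  apply: (@le_trans _ _ (Sg / 2 - 2 * ((fn w + 1) ^+ 2 - d ^+ 2) ^+ N)); first by rewrite lerD2r.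
  have -> : fn (comb psi2 s) = \sum_(x <- s) \sum_(y <- s) x.1 * y.1 *
      re ((ip (r x.2 *m w) (r y.2 *m w) + 1) ^+ (N + N)).
    rewrite -[LHS](@re_io R S) -ip_fn /comb ip_suml re_sum; apply: eq_bigr => x _.
    rewrite ip_sumr re_sum; apply: eq_bigr => y _.
    by rewrite ipZl ipZr ioJ mulrA -rmorphM reMio psi2k.
  have e2 : 2 * ((fn w + 1) ^+ 2 - d ^+ 2) ^+ N =
      \sum_(x <- s) \sum_(y <- s) x.1 * y.1 * (2 * ((fn w + 1) ^+ 2 - d ^+ 2) ^+ N).
    transitivity (\sum_(x <- s) x.1 * (2 * ((fn w + 1) ^+ 2 - d ^+ 2) ^+ N)).
      by rewrite -mulr_suml s1 mul1r.
    by apply: eq_bigr => x _; rewrite -mulr_suml -mulr_sumr s1 mulr1.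
  rewrite {}e2 /Sg mulr_suml -sumrB big_seq [X in _ <= X]big_seq; apply: ler_sum => x xs.
  rewrite mulr_suml -sumrB big_seq [X in _ <= X]big_seq; apply: ler_sum => y ys.
  rewrite -[_ / 2]mulrA -mulrBr ler_wpM2l ?mulr_ge0 ?s0 //.
  have [h Kh hh] := kernel_translate (sk _ xs) (sk _ ys).
  by rewrite psik hh ncX -exprM muln2 -addnn; exact: (kernel_real_part c0 d0 d1 hc hN).
- rewrite addnn -mul2n exprM.
  have fk : fn (r k *m w) <= fn w by rewrite -!nm2 nm_unitary.
  have far := far_bound fv fk.
  have ev : e ^+ 2 <= fn (v - r k *m w) by rewrite -nm2 ler_pXn2r ?nnegrE ?nm_ge0 // he.
  have := sqr_ge0 (nc (ip v (r k *m w) + 1)).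
  by move=> h0; apply: lerXn2r; rewrite ?nnegrE; lra.
Qed.

Lemma separating_invariant v : nm v <= nm w -> (forall k, K k -> r k *m w <> v) ->
  exists f, [/\ polyf f, (forall k x, K k -> f (r k *m x) = f x) & f v <> f w].
Proof.
move=> vw hv; have [e e0 he] := orbit_distance hv.
have [c c0 hc] := phase_cubic.
pose A2 := (fn w + 1) ^+ 2; have A1 : 1 <= fn w + 1 by rewrite lerDr fn_ge0.
have A20 : 0 < A2 by rewrite exprn_gt0 // (lt_le_trans ltr01).
(* A rate of decay [y M] common to the two error terms, the one from [d] and the one from [e]. *)
pose y := Num.min 1 (e ^+ 2) / A2.
have y0 : 0 < y by rewrite divr_gt0 // lt_min ltr01 exprn_gt0.
(* [(2 M) ^ (5 (m + 1))] bounds the dimension [(N + 1) ^ (m + 1)]; the 6 sets three error terms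
   against the factor 1/2; the lower bound on [M] absorbs the [16 c] of the phase condition. *)
have [M [M0 Mc hM]] := exp_beats_power (6 * 2 ^+ (5 * m.+1)) (5 * m.+1) (Num.truncn (16 * c)).+1 y0.
have Mp : 0 < M%:R :> R by rewrite ltr0n.
have M1 : 1 <= M%:R :> R by rewrite ler1n.
have Mn0 : M%:R != 0 :> R by rewrite gt_eqF.
(* The scale [d] has to make [N d ^ 2] large, so that the kernel is small away from the diagonal,
   and [N d ^ 3] small, so that phases do not cancel near it: here they are [M] and [1 / M]. A phase
   bound of second order would leave no room. *)
pose N := (M ^ 5)%N; pose d : R := (M%:R ^+ 2)^-1.
have d0 : 0 <= d by rewrite invr_ge0 exprn_ge0 // ltW.
have d1 : d <= 1 by rewrite invf_le1 ?exprn_gt0 // exprn_ege1.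
have NM : N%:R = M%:R ^+ 5 :> R by rewrite natrX.
have hN : 8 * (N + N)%:R * (c * d ^+ 3) <= 1.
  have -> : 8 * (N + N)%:R * (c * d ^+ 3) = 16 * c / M%:R.
    by rewrite natrD NM /d; field.
  rewrite ler_pdivrMr // mul1r; apply: le_trans (ltW (truncnS_gt _)) _.
  by rewrite ler_nat.
have [f [fp fi flo fup]] := invariant_gap c0 d0 d1 hc hN vw (ltW e0) he.
exists f; split=> // fvw; have := le_trans flo (le_trans (re_le_nc _) _).
rewrite -fvw => /(_ _ fup); apply/negP; rewrite -ltNge.
rewrite addnn -mul2n exprM -/A2; set D : R := #|_|%:R.
have D0 : 0 < D by rewrite ltr0n; apply/card_gt0P; exists [ffun=> ord0].
have DM : D <= 2 ^+ (5 * m.+1) * M%:R ^+ (5 * m.+1).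
  rewrite /D card_ffun !card_ord natrX -exprMn exprM ler_pXn2r ?nnegrE ?exprn_ge0 ?mulr_ge0 ?(ltW Mp) //.
  rewrite exprMn -natr1 NM; have : 1 <= M%:R ^+ 5 :> R by rewrite exprn_ege1.
  by have -> : 2 ^+ 5 = 32 :> R by [rewrite -natrX]; lra.
have e2 : e ^+ 2 <= A2.
  have [_ K1 _ _] := sK; have := he _ K1; rewrite r1 mul1mx => ew.
  have fv : fn v <= fn w by rewrite -!nm2 ler_pXn2r ?nnegrE ?nm_ge0.
  have := far_bound fv (lexx (fn w)); have := sqr_ge0 (nc (ip v w + 1)).
  have : e ^+ 2 <= fn (v - w) by rewrite -nm2 ler_pXn2r ?nnegrE ?nm_ge0 // ltW.
  by rewrite /A2; lra.
have small t : 0 <= A2 - t -> y * M%:R * A2 <= t * N%:R -> (A2 - t) ^+ N <= A2 ^+ N * expR (- (y * M%:R)).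
  move=> t0 ht; have -> : A2 - t = A2 * (1 - t / A2) by rewrite mulrBr mulr1 mulrCA mulfV ?mulr1 // gt_eqF.
  have t1 : 0 <= 1 - t / A2 by rewrite subr_ge0 ler_pdivrMr // mul1r -subr_ge0.
  rewrite exprMn ler_wpM2l //; first exact: exprn_ge0 (ltW A20).
  apply: le_trans (one_minus_power _ t1) _; rewrite ler_expR lerN2 [X in _ <= X]mulrAC ler_pdivlMr //.
have yA : y * A2 = Num.min 1 (e ^+ 2) by rewrite /y divfK // gt_eqF.
have MN : M%:R <= N%:R :> R by rewrite NM exprS ler_peMr ?exprn_ege1 // ltW.
have s1 : (A2 - d ^+ 2) ^+ N <= A2 ^+ N * expR (- (y * M%:R)).
  apply: small.
    by rewrite subr_ge0; apply: (@le_trans _ _ 1); [exact: exprn_ile1 | exact: exprn_ege1].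
  have -> : d ^+ 2 * N%:R = M%:R by rewrite NM /d; field.
  by rewrite mulrAC yA ler_piMl ?(ltW Mp) // ge_min lexx.
have s2 : (A2 - e ^+ 2) ^+ N <= A2 ^+ N * expR (- (y * M%:R)).
  apply: small; first by rewrite subr_ge0.
  rewrite mulrAC yA; apply: ler_pM; rewrite ?le_min ?ler01 ?sqr_ge0 ?(ltW Mp) //.
  by rewrite ge_min lexx orbT.
have P0 : 0 < A2 ^+ N by rewrite exprn_gt0.
have x0 : 0 < expR (- (y * M%:R)) :> R := expR_gt0 _.
have key : 3 * expR (- (y * M%:R)) < 1 / 2 / D.
  rewrite ltr_pdivlMr // expRN -mulrA mulrC -mulrA mulrC ltr_pdivrMr ?expR_gt0 //.
  have := hM; rewrite -mulrA; nra.
have := ltr_pM2l P0; move=> /(_ (3 * expR (- (y * M%:R))) (1 / 2 / D)); rewrite key => h.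
have {h}: A2 ^+ N * (3 * expR (- (y * M%:R))) < A2 ^+ N / 2 / D.
  by rewrite -[A2 ^+ N / 2 / D]mulrA -invfM; move: h; rewrite mul1r invfM => ->.
by lra.
Qed.
End OrbitSeparation.

(** * Rank, kernels and the Kempf-Ness slice argument *)

Lemma rank_minor p q (A : 'M[C]_(p, q)) : exists (M : 'M[C]_(\rank A, p)) (Q : 'M[C]_(q, \rank A)),
  M *m A *m Q = 1%:M.
Proof.
exists (pid_mx (\rank A) *m invmx (col_ebase A)), (invmx (row_ebase A) *m pid_mx (\rank A)).
have e : invmx (col_ebase A) *m A *m invmx (row_ebase A) = pid_mx (\rank A).
  rewrite -[X in _ *m X *m _ = _](mulmx_ebase A) -!mulmxA mulmxV ?row_ebase_unit // mulmx1.
  by rewrite mulKmx ?col_ebase_unit.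
rewrite !mulmxA -(mulmxA _ _ A) -(mulmxA _ (_ *m A)) e.
rewrite !mul_pid_mx; set k := minn _ _; have -> : k = \rank A.
  by rewrite /k; have := rank_leq_row A; have := rank_leq_col A; lia.
by rewrite pid_mx_1.
Qed.

Lemma minor_rank p q c (A : 'M[C]_(p, q)) (M : 'M[C]_(c, p)) (Q : 'M[C]_(q, c)) :
  M *m A *m Q \in unitmx -> (c <= \rank A)%N.
Proof.
move=> h; rewrite -(mxrank_unit h); apply: leq_trans (mxrankM_maxl _ _) _; exact: mxrankM_maxr.
Qed.

Lemma rank_semicontinuous p q (A : nat -> 'M[C]_(p, q)) L : cvm A L ->
  \forall k \near \oo, (\rank L <= \rank (A k))%N.
Proof.
move=> AL; have [M [Q e]] := rank_minor L.
have := cvm_unit (cvmM (cvmM (cvm_cst M) AL) (cvm_cst Q)); rewrite e => /(_ (unitmx1 _ _)).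
by apply: filterS => k; exact: minor_rank.
Qed.

(** A minor of full rank corrects [z] so that it annihilates [A *m Q]; as the rank is constant,
    [A *m Q] has the same left kernel as [A]. *)
Lemma kernel_limit p q (A : nat -> 'M[C]_(p, q)) L (z : 'rV[C]_p) : cvm A L ->
  (forall k, \rank (A k) = \rank L) -> z *m L = 0 ->
  exists2 u : nat -> 'rV[C]_p, cvm u z & \forall k \near \oo, u k *m A k = 0.
Proof.
move=> AL hr zL; have [M [Q e]] := rank_minor L.
pose B k := M *m A k *m Q; have BL : cvm B 1%:M.
  by rewrite -e; exact: cvmM (cvmM (cvm_cst M) AL) (cvm_cst Q).
exists (fun k => z - z *m A k *m Q *m invmx (B k) *m M).
  have := cvmB (cvm_cst z) (cvmM (cvmM (cvmM (cvmM (cvm_cst z) AL) (cvm_cst Q))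
    (cvm_inv BL (unitmx1 _ _))) (cvm_cst M)).
  by rewrite zL !mul0mx subr0.
have := cvm_unit BL (unitmx1 _ _); apply: filterS => k Bu.
set u := z - _; have uQ : u *m (A k *m Q) = 0.
  rewrite mulmxA /u 2!mulmxBl -!mulmxA (mulmxA M) -/(B k) mulVmx // mulmx1 !mulmxA subrr //.
have rQ : \rank (A k *m Q) = \rank (A k).
  apply/eqP; rewrite eqn_leq mxrankM_maxl hr /=.
  by apply: (@minor_rank _ _ _ _ M 1%:M); rewrite mulmx1 mulmxA.
have kk : (kermx (A k *m Q) <= kermx (A k))%MS.
  rewrite -(geq_leqif (mxrank_leqif_sup _)) ?mxrank_ker ?rQ //.
  by rewrite sub_kermx mulmxA mulmx_ker mul0mx.
apply/sub_kermxP; apply: submx_trans kk; exact/sub_kermxP.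
Qed.

Lemma nm_nondecreasing_direction m (h : nat -> 'M[C]_m) (t : nat -> R) (D : 'M[C]_m) (y : 'cV[C]_m) :
  cvg0 t -> (forall k, 0 < t k) -> cvm (fun k => io (t k)^-1 *: (h k - 1%:M)) D ->
  (\forall k \near \oo, nm y <= nm (h k *m y)) -> 0 <= re (ip (D *m y) y).
Proof.
move=> t0 tp hD hy; pose v k := io (t k)^-1 *: (h k - 1%:M) *m y.
have vD : cvm v (D *m y) := cvmM hD (cvm_cst y).
have lim : cvs (fun k => 2 * ip (v k) y + io (t k) * ip (v k) (v k)) (2 * ip (D *m y) y).
  have := cvsD (cvsM (cvs_cst 2) (cvs_ip vD (cvm_cst y)))
    (cvsM (cvs_io0 t0 tp) (cvs_ip vD vD)).
  by rewrite mul0r addr0.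
have := cvs_ge_re (B := 0) lim; rewrite -(rmorph_nat io) reMio pmulr_rge0 //; apply.
apply: filterS hy => k hk; rewrite reD !reMio ip_fn re_io.
have e : h k *m y = y + io (t k) *: v k.
  rewrite /v -scalemxAl scalerA -rmorphM mulfV ?gt_eqF // rmorph1 scale1r mulmxBl mul1mx.
  by rewrite addrC subrK.
have : fn y <= fn (y + io (t k) *: v k).
  by rewrite -e -!nm2 ler_pXn2r ?nnegrE ?nm_ge0.
rewrite -[io (t k) *: _]opprK fnB -scaleNr -rmorphN ipZr ioJ reMio -!nm2 nmZ nc_io exprMn.
rewrite real_normK ?num_real // -ipJ reJ sqrrN !nm2.
have tk := tp k; set a := re _; set b := fn (v k) => le_y.
rewrite -(ler_pM2l tk) mulr0; nra.
Qed.

(** In an eigenbasis the hypotheses give a nonpositive sum of terms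
    [(expR (2 d) - 1 - 2 d) |v| ^ 2], each nonnegative and zero only where [d v = 0]. *)
Lemma expm_herm_fix n (A : 'M[C]_n) (w : 'cV[C]_n) : A^t* = A -> ip (A *m w) w = 0 ->
  nm (expm A *m w) <= nm w -> A *m w = 0.
Proof.
move=> hA aw le; have [u [d [uu uu' eA]]] := herm_diag hA.
have uV : invmx u = u^t*.
  by rewrite -[LHS]mulmx1 -uu mulmxA mulVmx ?mul1mx //; have [] := mulmx1_unit uu.
have uu2 : u^t* \in unitmx by have [] := mulmx1_unit uu'.
have uV' : invmx (u^t*) = u by rewrite -uV invmxK.
pose v := u *m w; have wv : w = u^t* *m v by rewrite mulmxA uu' mul1mx.
have fu (y : 'cV[C]_n) : fn (u^t* *m y) = fn y.
  by apply: (@io_inj R S); rewrite -!ip_fn ip_mulmx trmxCK mulmxA uu mul1mx.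
have s1 : \sum_i d i * nc (v i 0) ^+ 2 = 0.
  apply: (@io_inj R S); rewrite (rmorph0 io) -aw eA -!mulmxA -/v ip_mulmx trmxCK -/v.
  rewrite /ip rmorph_sum; apply: eq_bigr => i _.
  by rewrite big_ord1 mul_diag_mx !mxE -mulrA mulJ_nc rmorphM.
have s2 : \sum_i expR (d i *+ 2) * nc (v i 0) ^+ 2 <= \sum_i nc (v i 0) ^+ 2.
  have f1 : fn w = \sum_i nc (v i 0) ^+ 2.
    by rewrite wv fu /fn; apply: eq_bigr => i _; rewrite big_ord1.
  rewrite -f1; have -> : \sum_i expR (d i *+ 2) * nc (v i 0) ^+ 2 = fn (expm A *m w).
    have -> : expm A = u^t* *m expm (dgr d) *m u.
      by rewrite -{2}uV' -expm_conj // uV' -eA.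
    rewrite -!mulmxA fu -/v /dgr expm_diag /fn; apply: eq_bigr => i _.
    by rewrite big_ord1 mul_diag_mx !mxE expc_io ncM nc_io ger0_norm ?expR_ge0 // exprMn -mulr_natl expRM_natl.
  by rewrite -!nm2 ler_pXn2r ?nnegrE ?nm_ge0.
have pos i : 0 <= (expR (d i *+ 2) - 1 - d i *+ 2) * nc (v i 0) ^+ 2.
  by rewrite mulr_ge0 ?sqr_ge0 // -addrA -opprD subr_ge0 expR_ge1Dx.
have z : \sum_i (expR (d i *+ 2) - 1 - d i *+ 2) * nc (v i 0) ^+ 2 = 0.
  apply/eqP; rewrite eq_le sumr_ge0 ?andbT //.
  rewrite (eq_bigr (fun i => (expR (d i *+ 2) * nc (v i 0) ^+ 2 - nc (v i 0) ^+ 2)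
    - 2 * (d i * nc (v i 0) ^+ 2))) => [|i _]; last by rewrite -[d i *+ 2]mulr_natl; ring.
  by rewrite !sumrB -mulr_sumr s1 mulr0 subr0 subr_le0.
have dv i : d i * nc (v i 0) = 0.
  have := psumr_eq0P (fun i _ => pos i) z (i := i) isT => /eqP; rewrite mulf_eq0 expf_eq0 /=.
  case/orP => [/eqP h|/eqP ->]; last by rewrite mulr0.
  have [->|d0] := eqVneq (d i) 0; first by rewrite mul0r.
  have := expR_gt1Dx (x := d i *+ 2); rewrite mulrn_eq0 (negPf d0) => /(_ isT); lra.
rewrite eA -!mulmxA -/v (_ : dgr d *m v = 0) ?mulmx0 //; move: (v) dv => v' dv'.
apply/matrixP => i j; rewrite ord1 mul_diag_mx !mxE; apply/eqP.
by rewrite -(@nc_eq0 R S) ncM nc_io mulf_eq0 normr_eq0 -mulf_eq0 dv'.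
Qed.

Lemma re_ip_eq0 m n (A D : 'M[C]_(m, n)) :
  (forall t : R, nm A <= nm (A + io t *: D)) -> re (ip A D) = 0.
Proof.
move=> h; set a := re _; have b0 := fn_ge0 D; set b := fn D in b0.
have b1 : 0 < b + 1 by lra.
have key t : 0 <= 2 * t * a + t ^+ 2 * b.
  have := h t; rewrite -(@ler_pXn2r _ 2%N) ?nnegrE ?nm_ge0 // !nm2.
  rewrite -[io t *: D]opprK fnB -scaleNr -rmorphN ipZr ioJ reMio -/a -nm2 -(nm2 (_ *: _)) nmZ nc_io.
  by rewrite exprMn real_normK ?num_real // sqrrN !nm2 -/b; nra.
apply/eqP; rewrite -sqrf_eq0 eq_le sqr_ge0 andbT.
have := key (- (a / (b + 1))); rewrite sqrrN expr_div_n.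
have -> : 2 * - (a / (b + 1)) * a + a ^+ 2 / (b + 1) ^+ 2 * b = - (a ^+ 2 * (b + 2)) / (b + 1) ^+ 2.
  by field; rewrite gt_eqF.
by rewrite ler_pdivlMr ?exprn_gt0 // mul0r oppr_ge0; nra.
Qed.

(* The derivative of the exponential at [A] in direction [B], up to a right translation. *)
Lemma exp_derivative n (A B : 'M[C]_n) (t : nat -> R) : nm A <= 1 -> cvg0 t -> (forall k, 0 < t k) ->
  exists phi D, [/\ subseq_ix phi,
    cvm (fun k => io (t (phi k))^-1 *: (expm (A + io (t (phi k)) *: B) *m expm (- A) - 1%:M)) D &
    nm (D - B) <= (cn (S := S) n * expR 1 + cn (S := S) n ^+ 2 * expR 2 * expR 1) * nm B * nm A].
Proof.
move=> A1 t0 tp; have c0 := cn_ge0 (S := S) n; set c := cn n in c0 *.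
have B0 := nm_ge0 B; have A0 := nm_ge0 A.
pose e k := io (t k)^-1 *: (expm (A + io (t k) *: B) *m expm (- A) - 1%:M).
pose M := c * expR 1 + c ^+ 2 * expR 2 * expR 1.
have M0 : 0 <= M by rewrite addr_ge0 ?mulr_ge0 ?expR_ge0 ?exprn_ge0.
have est k : t k * nm B <= 1 -> nm (e k - B) <= M * nm B * (nm A + t k * nm B).
  move=> tB; have tk := tp k; set X := io (t k) *: B; set E := expm (- A).
  have tB0 : 0 <= t k * nm B by rewrite mulr_ge0 // ltW.
  have nX : nm X = t k * nm B by rewrite nmZ nc_io gtr0_norm.
  pose F := expm (A + X) - expm A - (A + X - A).
  have -> : e k - B = io (t k)^-1 *: (F *m E) + B *m (E - 1%:M).
    rewrite /e -/X -/E -{1}(expmV A) -mulmxBl -/E (_ : expm (A + X) - expm A = F + X); last first.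
      by rewrite /F [A + X]addrC addrK subrK.
    rewrite mulmxDl scalerDr -addrA; congr (_ + _).
    rewrite -scalemxAl scalerA -rmorphM mulVf ?gt_eqF // rmorph1 scale1r mulmxBr mulmx1 //.
  apply: le_trans (nmD _ _) _; rewrite nmZ nc_io gtr0_norm ?invr_gt0 //.
  have rho : nm (A + X) <= nm A + t k * nm B by rewrite -nX nmD.
  have rho2 : nm A <= nm A + t k * nm B by rewrite lerDl.
  have := expm_lip rho rho2; rewrite -/F (addrC A X) addrK nX -/c => hF.
  set p := nm A + t k * nm B in hF rho2 *.
  have p0 : 0 <= p by rewrite addr_ge0.
  have p2 : expR p <= expR 2 by rewrite ler_expR /p; lra.
  have nA : nm (- A) <= 1 by rewrite nmN.
  have hE : nm E <= c * expR 1.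
    apply: le_trans (expm_bound _) _; rewrite ler_wpM2l // ler_expR //.
  have hE1 : nm (E - 1%:M) <= c * expR 1 * p.
    apply: le_trans (expm_tail1 _) _; rewrite -mulrA ler_wpM2l // mulrC nmN.
    by apply: ler_pM; rewrite ?expR_ge0 // ler_expR.
  have h1 : (t k)^-1 * nm (F *m E) <= c ^+ 2 * expR 2 * expR 1 * nm B * p.
    rewrite ler_pdivrMl //; apply: le_trans (nmM _ _) _.
    apply: (@le_trans _ _ ((c * (p * expR p) * (t k * nm B)) * (c * expR 1))).
      by apply: ler_pM; rewrite ?nm_ge0.
    rewrite [X in _ <= X](_ : _ = (c * (p * expR 2) * (t k * nm B)) * (c * expR 1)); last by ring.
    rewrite ler_wpM2r ?mulr_ge0 ?expR_ge0 // ler_wpM2r // ler_wpM2l // ler_wpM2l //.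
  have h2 : nm (B *m (E - 1%:M)) <= nm B * (c * expR 1 * p).
    by apply: le_trans (nmM _ _) _; rewrite ler_wpM2l.
  by rewrite /M; lra.
have tB : cvg0 (fun k => nm B * t k) by exact: cvg0Z.
have [N _ hN] := tB _ ltr01.
have eb k : nm (e (k + N)%N) <= M * nm B * 2 + nm B.
  have hk : t (k + N)%N * nm B <= 1 by rewrite mulrC ltW // hN //= leq_addl.
  have := est _ hk; rewrite -{2}(subrK B (e _)) => h; apply: le_trans (nmD _ _) _.
  rewrite lerD2r; apply: le_trans h _; rewrite ler_wpM2l ?mulr_ge0 //; lra.
have [psi psiS [D hD]] := bw_mx eb.
have phS : subseq_ix (fun k => (psi k + N)%N) by move=> k; apply: leq_trans (psiS k) (leq_addr _ _).
exists (fun k => (psi k + N)%N), D; split=> //; rewrite -/M.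
apply/ler_addgt0Pr => x x0.
have MB0 : 0 <= M * nm B by rewrite mulr_ge0.
apply: (cvm_le_nm (cvmB hD (cvm_cst B))).
apply: filterS (cvg0Z MB0 (cvg0_subseq phS tB) x0) => k /= hk.
apply: le_trans (est _ _) _; first by rewrite mulrC ltW // hN //= leq_addl.
by rewrite mulrDr lerD2l [t _ * _]mulrC ltW.
Qed.

Section KempfNess.
Variables (n m : nat) (G K : set 'M[C]_n) (g : {vspace 'M[C]_n}).
Variables (r : 'M[C]_n -> 'M[C]_m) (dr : {linear 'M[C]_n -> 'M[C]_m}).
Hypothesis aG : algebraic_group G.
Hypothesis conG : zariski_connected G.
Hypothesis gP : forall X, lie_algebra G X <-> X \in g.
Hypothesis sK : subgroup K.
Hypothesis cK : compact K.
Hypothesis KG : K `<=` G.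
Hypothesis gK : forall X, X \in g -> exists Y Z,
  [/\ real_lie K Y, real_lie K Z & X = Y + 'i *: Z].
Hypothesis r1 : r 1%:M = 1%:M.
Hypothesis rM : forall a b, G a -> G b -> r (a *m b) = r a *m r b.
Hypothesis rreg : forall i j, regular_on G (fun a => r a i j).
Hypothesis ru : forall k, K k -> (r k)^t* *m r k = 1%:M.
Hypothesis rdr : forall X, real_lie G X -> forall t : R, r (expm (io t *: X)) = expm (io t *: dr X).

Let sG : subgroup G. Proof. by case: aG. Qed.
Let GU a : G a -> a \in unitmx. Proof. by have [h _ _ _] := sG => /h. Qed.
Let cG : closed_group G. Proof. exact: algebraic_closed aG. Qed.

Lemma lieK_g X : real_lie K X -> X \in g.
Proof.
by move=> h; apply/gP/(@real_lie_lie _ _ _ aG) => s sr; apply: KG; exact: h.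
Qed.

Lemma g_real X : X \in g -> real_lie G X.
Proof. by move=> /gP h s _; exact: h. Qed.

Lemma g_expm X : X \in g -> G (expm X).
Proof. by move=> /gP /(_ 1); rewrite scale1r. Qed.

Lemma rep_expm X : X \in g -> r (expm X) = expm (dr X).
Proof. by move=> Xg; have := rdr (g_real Xg) 1; rewrite (rmorph1 io) !scale1r. Qed.

Lemma rdrK X : real_lie K X -> forall t : R, r (expm (io t *: X)) = expm (io t *: dr X).
Proof. by move=> /lieK_g /g_real; exact: rdr. Qed.

Lemma dr_skew X : real_lie K X -> (dr X)^t* = - dr X.
Proof. by move=> h; exact: (lie_skew ru rdrK). Qed.

Lemma dr_herm X : real_lie K X -> (dr ('i *: X))^t* = dr ('i *: X).
Proof. by move=> h; rewrite linearZ adjZ dr_skew // conjCi scalerN scaleNr opprK. Qed.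

Lemma dr_conj a X : G a -> X \in g -> dr (a *m X *m invmx a) = r a *m dr X *m invmx (r a).
Proof.
move=> Ga Xg; have [_ _ GM GV] := sG; have ra := rep_unit sG r1 rM Ga.
have cg : a *m X *m invmx a \in g.
  by apply/gP => s; rewrite scalemxAl scalemxAr expm_conj ?GU //; move/gP: Xg => Xg;
    apply: GM (GM _ _ Ga (Xg s)) (GV _ Ga).
apply: (@expm_curve_inj R S) => t; rewrite -rdr; last exact: g_real.
have e p (u M : 'M[C]_p) : io t *: (u *m M *m invmx u) = u *m (io t *: M) *m invmx u.
  by rewrite -scalemxAr -scalemxAl.
rewrite !e expm_conj ?GU // expm_conj // -(rdr (g_real Xg)).
have GE : G (expm (io t *: X)) by move/gP: Xg.
by rewrite (rM (GM _ _ Ga GE) (GV _ Ga)) (rM Ga GE) (rep_inv sG r1 rM Ga).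
Qed.

Section InvariantFunction.
Variable f : 'cV[C]_m -> C.
Hypothesis fp : polyf f.
Hypothesis fK : forall k x, K k -> f (r k *m x) = f x.

(* Invariance passes from real to complex parameters because [f] is holomorphic. *)
Lemma invariant_lieK X (c : C) x : real_lie K X -> f (expm (c *: dr X) *m x) = f x.
Proof.
move=> KX; apply/eqP; rewrite -subr_eq0; apply/eqP.
apply: (@polyf_real_complex _ _ _ (dr X) (fun M => f (M *m x) - f x)) => [|t _].
  apply: polyfB; last exact: polyf_cst.
  apply: (polyf_compmx fp) => i j; apply: polyf_mulmx => k l; [exact: polyf_entry | exact: polyf_cst].
by rewrite -rdrK // fK ?subrr //; move/real_lieP: KX.
Qed.

(** [exp (A + B)] is the limit of the powers of [exp (A / k) exp (B / k)], and [f] is invariant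
    under each factor by [invariant_lieK]. *)
Lemma invariant_g X x : X \in g -> f (expm (dr X) *m x) = f x.
Proof.
move=> Xg; have [Y [Z [KY KZ ->]]] := gK Xg; rewrite linearD linearZ.
set A := dr Y; set B := 'i *: dr Z.
have ep (k : nat) : 0 < k.+1%:R^-1 :> R by rewrite invr_gt0.
have qA := expm_quot (cvm_cst A) (@cvg0_inv R) ep; have qB := expm_quot (cvm_cst B) (@cvg0_inv R) ep.
pose E k (M : 'M[C]_m) := expm (io k.+1%:R^-1 *: M).
have lim (M : 'M[C]_m) : cvm (fun k => E k M) 1%:M.
  by have := cvm_expm (cvmZ (cvs_io0 (@cvg0_inv R) ep) (cvm_cst M)); rewrite scale0r expm0.
have h0 : cvm (fun k => E k A *m E k B - 1%:M) 0.
  by have := cvmB (cvmM (lim A) (lim B)) (cvm_cst 1%:M); rewrite mulmx1 subrr.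
have h1 : cvm (fun k => k.+1%:R *: (E k A *m E k B - 1%:M)) (A + B).
  have := cvmD (cvmM qA (lim B)) qB; rewrite mulmx1; apply: cvm_ext => k.
  rewrite invrK rmorph_nat -scalemxAl -scalerDr mulmxBl mul1mx; congr (_ *: _).
  by rewrite addrA subrK.
have := polyf_cvs (f := f) fp (cvmM (expm_pow_lim h0 h1) (cvm_cst x)) => hf.
apply: cvs_uniq hf _; apply: cvs_ext (cvs_cst _) => k.
rewrite [1%:M + _]addrC subrK; have e1 y : f (E k A *m y) = f y by exact: invariant_lieK.
have e2 y : f (E k B *m y) = f y by rewrite /E /B scalerA; exact: invariant_lieK.
elim: {1}k.+1 => [|j IH]; first by rewrite expr0 mul1mx.
by rewrite exprS -mulmxE -!mulmxA e1 e2.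
Qed.

Lemma invariant_G a x : G a -> f (r a *m x) = f x.
Proof.
have [_ G1 GM _] := sG.
move=> Ga; rewrite (locally_constant (q := fun a => f (r a *m x)) aG conG) ?r1 ?mul1mx //.
  apply: (@polyf_indmx _ _ _ (fun f => regular_on G (fun a => f (r a *m x)))) fp => [c|f1 f2|f1 f2|i j].
  - exact: Reg_cst.
  - exact: (RegD aG).
  - exact: (RegM aG).
  - apply: (@Reg_ext _ _ (fun a => \sum_k r a i k * x k j)) => [b _|]; first by rewrite mxE.
    by apply: (Reg_sum aG) => k; apply: (RegM aG) => //; exact: Reg_cst.
by move=> X b /gP Xg Gb; rewrite (rM (g_expm Xg) Gb) -mulmxA rep_expm // invariant_g.
Qed.
End InvariantFunction.

Let KM k l : K k -> K l -> r (k *m l) = r k *m r l.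
Proof. by move=> Kk Kl; exact: rM (KG Kk) (KG Kl). Qed.
Let rcK A L : (forall k, K (A k)) -> K L -> cvm A L -> cvm (fun k => r (A k)) (r L).
Proof. by move=> KA KL; apply: (rep_cvm sG rreg) => [k|]; exact: KG. Qed.

Definition critical (y : 'cV[C]_m) : Prop := forall X, X \in g -> ip (dr X *m y) y = 0.

Lemma critical_re y : (forall X, X \in g -> 0 <= re (ip (dr X *m y) y)) -> critical y.
Proof.
move=> h X Xg; apply: eq0_of_re => a; rewrite -ipZl scalemxAl -linearZ; apply: h.
exact: rpredZ.
Qed.

Variable w : 'cV[C]_m.
Hypothesis wcrit : critical w.

Definition orbit_hull : set 'cV[C]_m :=
  [set x | forall f, polyf f -> (forall a, G a -> f (r a *m w) = 0) -> f x = 0].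
Implicit Types x y : 'cV[C]_m.

Lemma orbit_hull_closed : zariski_closed orbit_hull.
Proof.
exists [set f | polyf f /\ forall a, G a -> f (r a *m w) = 0] => [f []//|].
rewrite eqEsubset; split=> x /= h f; first by case=> pf fG; exact: h.
by move=> pf fG; exact: h.
Qed.

Lemma orbit_hull_orbit a : G a -> orbit_hull (r a *m w).
Proof. by move=> Ga f _; apply. Qed.

Lemma orbit_hull_G a x : G a -> orbit_hull x -> orbit_hull (r a *m x).
Proof.
move=> Ga hx f pf fG; apply: (hx (fun y => f (r a *m y))) => [|b Gb].
  apply: (polyf_compmx pf) => i j; apply: polyf_mulmx => k l; [exact: polyf_cst | exact: polyf_entry].
by rewrite mulmxA -rM // fG //; have [_ _ GM _] := sG; exact: GM.
Qed.

Lemma orbit_hull_cvm u x : (forall j, orbit_hull (u j)) -> cvm u x -> orbit_hull x.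
Proof.
move=> hu ux f pf fG; apply: cvs_uniq (polyf_cvs pf ux) _.
by apply: cvs_ext (cvs_cst 0) => j; rewrite hu.
Qed.

Lemma orbit_hull_invariant f x : polyf f ->
  (forall k y, K k -> f (r k *m y) = f y) -> orbit_hull x -> f x = f w.
Proof.
move=> fp fK hx; apply/eqP; rewrite -subr_eq0; apply/eqP.
apply: (hx (fun y => f y - f w)) => [|a Ga]; first by apply: polyfB => //; exact: polyf_cst.
by rewrite (invariant_G fp fK) // subrr.
Qed.

Lemma critical_unique y : orbit_hull y -> critical y -> exists2 k, K k & y = r k *m w.
Proof.
move=> hy yc; have critK z : critical z -> forall X, real_lie K X -> ip (dr X *m z) z = 0.
  by move=> zc X /lieK_g; exact: zc.
apply: contrapT => no; have [le|/ltW le] := leP (nm y) (nm w).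
  have [k Kk e|f [fp fK]] := separating_invariant sK cK r1 KM ru rcK rdrK (critK _ wcrit) le.
    by apply: no; exists k.
  by apply; exact: orbit_hull_invariant.
have [k Kk e|f [fp fK]] := separating_invariant sK cK r1 KM ru rcK rdrK (critK _ yc) le.
  have [KU _ _ KV] := sK; apply: no; exists (invmx k); first exact: KV.
  by rewrite -e mulmxA (rV sK r1 KM) // mul1mx.
by apply; rewrite (orbit_hull_invariant fp fK hy).
Qed.

Lemma minimal_in_closure x : orbit_hull x -> exists a y,
  [/\ forall j : nat, G (a j), cvm (fun j => r (a j) *m x) y & critical y].
Proof.
move=> hx; have [_ G1 GM _] := sG.
pose A : set R := [set nm (r a *m x) | a in G].
have hA : has_inf A by split; [exists (nm (r 1%:M *m x)); exists 1%:M |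
  exists 0 => _ [a _ <-]; exact: nm_ge0].
pose d := inf A; have dle a : G a -> d <= nm (r a *m x).
  by move=> Ga; apply: (ge_inf hA.2); exists a.
have /choice [a ha] (j : nat) : exists a, G a /\ nm (r a *m x) < d + j.+1%:R^-1.
  have j0 : 0 < j.+1%:R^-1 :> R by rewrite invr_gt0.
  by have [_ [a Ga <-] h] := inf_adherent j0 hA; exists a.
have [j|phi phiS [y hy]] := @bw_mx _ _ _ _ (fun j => r (a j) *m x) (d + 1).
  by have [_ h] := ha j; apply: le_trans (ltW h) _; rewrite lerD2l invf_le1 // ler1n.
have yd : nm y <= d.
  apply/ler_addgt0Pr => e e0; apply: (cvm_le_nm hy).
  apply: filterS (near_subseq phiS (@cvg0_inv R _ e0)) => j /= hj.
  by have [_ h] := ha (phi j); apply: le_trans (ltW h) _; rewrite lerD2l ltW.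
exists (a \o phi), y; split=> [j||]; [by case: (ha (phi j)) | exact: hy |].
apply: critical_re => X Xg; have ep (k : nat) : 0 < k.+1%:R^-1 :> R by rewrite invr_gt0.
apply: (nm_nondecreasing_direction (@cvg0_inv R) ep (expm_quot (cvm_cst (dr X)) (@cvg0_inv R) ep)).
apply: nearW => k; apply: le_trans yd _; rewrite -rdr; last exact: g_real.
have GE : G (expm (io k.+1%:R^-1 *: X)) by move/gP: Xg.
apply: (cvm_ge_nm (cvmM (cvm_cst _) hy)); apply: nearW => j /=.
have [Ga _] := ha (phi j); rewrite mulmxA -rM //; apply: dle; exact: GM.
Qed.

Lemma orbit_approaches x : orbit_hull x -> exists2 a : nat -> 'M[C]_n, (forall j, G (a j)) &
  cvm (fun j => r (a j) *m x) w.
Proof.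
move=> hx; have [a [y [Ga hy yc]]] := minimal_in_closure hx; have [_ _ GM _] := sG.
have hy' : orbit_hull y by apply: orbit_hull_cvm hy => j; exact: orbit_hull_G.
have [k Kk e] := critical_unique hy' yc; have [_ _ _ KV] := sK.
have GV : G (invmx k) by apply: KG; exact: KV.
exists (fun j => invmx k *m a j) => [j|]; first exact: GM.
have := cvmM (cvm_cst (r (invmx k))) hy; rewrite e mulmxA (rV sK r1 KM) // mul1mx.
by apply: cvm_ext => j; rewrite mulmxA -rM.
Qed.

Local Notation d := (\dim g).
Let e (i : 'I_d) : 'M[C]_n := (vbasis g)`_i.
Let eg i : e i \in g. Proof. by apply: vbasis_mem; rewrite mem_nth // size_tuple. Qed.
Let EX (z : 'cV[C]_d) : 'M[C]_n := \sum_i z i 0 *: e i.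
Let EXg z : EX z \in g. Proof. by apply: rpred_sum => i _; apply: rpredZ; exact: eg. Qed.
Let co (X : 'M[C]_n) : 'cV[C]_d := \col_i coord (vbasis g) i X.
Let coK X : X \in g -> EX (co X) = X.
Proof. by move=> Xg; rewrite [RHS](coord_vbasis Xg); apply: eq_bigr => i _; rewrite mxE. Qed.
Let EXK z : co (EX z) = z.
Proof.
apply/matrixP => i j; rewrite ord1 mxE coord_sum_free //; exact: basis_free (vbasisP g).
Qed.
Let co_lin : linear co. Proof. by move=> a X Y; apply/matrixP => i j; rewrite !mxE linearP. Qed.
Let coL : {linear 'M[C]_n -> 'cV[C]_d} := HB.pack co (GRing.isLinear.Build C _ _ _ co co_lin).

Definition tangent x : 'M[C]_(d, m) := \matrix_(i, j) (dr (e i) *m x) j 0.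

Lemma tangent_entry x i j : tangent x i j = (dr (e i) *m x) j 0.
Proof. by rewrite /tangent mxE. Qed.

Lemma tangentE z x : z^T *m tangent x = (dr (EX z) *m x)^T.
Proof.
apply/matrixP => i j; rewrite ord1 mxE mxE /EX linear_sum mulmx_suml summxE.
by apply: eq_bigr => k _; rewrite linearZ -scalemxAl !mxE.
Qed.

Lemma tangent_cvm u x : cvm u x -> cvm (fun j => tangent (u j)) (tangent x).
Proof.
move=> ux; apply: cvm_entries => i j.
rewrite tangent_entry; apply: cvs_ext (cvm_entry j 0 (cvmM (cvm_cst (dr (e i))) ux)) => k.
by rewrite tangent_entry.
Qed.

Lemma tangent_rank_le a x : G a -> (\rank (tangent (r a *m x)) <= \rank (tangent x))%N.
Proof.
move=> Ga; have [_ _ GM GV] := sG; have aV := GV _ Ga.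
pose P : 'M[C]_d := \matrix_(i, j) co (invmx a *m e i *m a) j 0.
have -> : tangent (r a *m x) = P *m tangent x *m (r a)^T.
  apply/row_matrixP => i; rewrite !row_mul.
  have -> : row i P = (co (invmx a *m e i *m a))^T by apply/rowP => j; rewrite !mxE.
  have cg : invmx a *m e i *m a \in g.
    have /gP eG := eg i; apply/gP => s; rewrite -{2}[a]invmxK scalemxAl scalemxAr.
    rewrite expm_conj ?unitmx_inv ?GU // invmxK; exact: GM (GM _ _ aV (eG s)) Ga.
  rewrite tangentE coK // -trmx_mul mulmxA.
  have ei : e i = a *m (invmx a *m e i *m a) *m invmx a.
    by rewrite !mulmxA mulmxV ?GU // mul1mx mulmxK ?GU.
  have de := dr_conj Ga cg; rewrite -ei in de.
    have re : r a *m dr (invmx a *m e i *m a) = dr (e i) *m r a.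
    by rewrite de mulmxKV // (rep_unit sG r1 rM).
  by rewrite re -mulmxA; apply/rowP => j; rewrite [LHS]mxE tangent_entry [RHS]mxE.
by apply: leq_trans (mxrankM_maxl _ _) (mxrankM_maxr _ _).
Qed.

Lemma tangent_rank_orbit a x : G a -> \rank (tangent (r a *m x)) = \rank (tangent x).
Proof.
move=> Ga; apply/eqP; rewrite eqn_leq tangent_rank_le //=.
have [_ _ _ GV] := sG; rewrite -{1}(mul1mx x) -(rep_V sG r1 rM Ga) -mulmxA.
by apply: tangent_rank_le; exact: GV.
Qed.

(** The rank cannot exceed that at [w], because minors vanishing on the orbit of [w] vanish on its
    closure; nor can it be smaller, because the orbit of [x] approaches [w] and the rank is lower
    semicontinuous. *)
Lemma tangent_rank x : orbit_hull x -> \rank (tangent x) = \rank (tangent w).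
Proof.
move=> hx; apply/eqP; rewrite eqn_leq; apply/andP; split; last first.
  have [a Ga ha] := orbit_approaches hx.
  have [j] := near_ex (rank_semicontinuous (tangent_cvm ha)).
  by rewrite tangent_rank_orbit.
rewrite leqNgt; apply/negP => lt.
have [M [Q eMQ]] := rank_minor (tangent x).
have f0 : \det (M *m tangent x *m Q) = 0.
  apply: (hx (fun y => \det (M *m tangent y *m Q))) => [|a Ga].
    apply: polyf_det => i j; apply: polyf_mulmx => k l; last exact: polyf_cst.
    apply: polyf_mulmx => p q; first exact: polyf_cst.
    apply: (@polyf_ext _ _ (fun y : 'cV[C]_m => (dr (e p) *m y) q 0)); first by move=> y; rewrite tangent_entry.
    by apply: polyf_mulmx => s t; [exact: polyf_cst | exact: polyf_entry].
  apply/eqP; rewrite -[_ == 0]negbK -unitfE -[_ \is a GRing.unit]/(_ \in unitmx); apply/negP => /minor_rank.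
  by rewrite tangent_rank_orbit // leqNgt lt.
by move/eqP: f0; rewrite eMQ det1 oner_eq0.
Qed.

(** The moment map in coordinates of [g], conjugated so that pairing it with [z] is linear in [z];
    it vanishes exactly at critical vectors. *)
Let gradient y : 'cV[C]_d := \col_i (ip (dr (e i) *m y) y)^*.

Let gradientE z y : ip z (gradient y) = ip (dr (EX z) *m y) y.
Proof.
rewrite /EX linear_sum mulmx_suml ip_suml /ip; apply: eq_bigr => i _.
rewrite big_ord1 mxE conjCK linearZ -scalemxAl -/(ip _ _).
by rewrite -/(ip (dr (e i) *m y) y) -ipZl.
Qed.

Lemma critical_gradient y : gradient y = 0 -> critical y.
Proof. by move=> h X Xg; rewrite -(coK Xg) -gradientE h ip0r. Qed.

(** The factor [i] is left to [E]. Orthogonality is for the real inner product, since the stabiliser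
    of [w] in the Lie algebra of [K] is a real subspace. *)
Definition slice : set 'M[C]_n := [set X | real_lie K X /\
  forall Z, real_lie K Z -> dr Z *m w = 0 -> re (ip X Z) = 0].

Lemma slice_split X : real_lie K X -> exists Z,
  [/\ real_lie K Z, dr Z *m w = 0 & slice (X - Z)].
Proof.
have cK' := compact_closed_group sK cK.
move=> KX; pose P : set 'M[C]_n := [set Z | [/\ real_lie K Z, dr Z *m w = 0 & nm Z <= nm X + nm X]].
have P0 : P 0.
  by split; [exact: real_lie0 | rewrite linear0 mul0mx | rewrite nm0 addr_ge0 ?nm_ge0].
have [|Z [_ _ //]|A L hA AL|A L _ AL|Z|Z [KZ Zw ZB] hmin] :=
    @min_attained _ S _ _ P (fun Z => nm (X - Z)) (nm X + nm X).
- by exists 0.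
- split.
  + by apply: (real_lie_cvm cK' _ AL) => k; case: (hA k).
  + apply: cvm_uniq (cvmM (cvm_linear dr AL) (cvm_cst w)) _.
    by apply: cvm_ext (cvm_cst 0) => k; case: (hA k).
  + by apply: (cvm_le_nm AL); apply: nearW => k; case: (hA k).
- exact: cvm_nm (cvmB (cvm_cst X) AL).
- exact: nm_ge0.
have ZX : nm (X - Z) <= nm X by have := hmin _ P0; rewrite subr0.
exists Z; split=> //; split; first by apply: real_lieD => //; exact: real_lieN.
move=> D KD Dw; apply: re_ip_eq0 => t; pose Z' := Z - io t *: D.
have -> : X - Z + io t *: D = X - Z' by rewrite /Z' opprB addrA addrAC.
have [le|/ltW le] := leP (nm (X - Z')) (nm X); last exact: le_trans ZX le.
apply: hmin; split.
- by apply: real_lieD => //; apply: real_lieN; exact: real_lieZ.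
- by rewrite linearB linearZ mulmxBl -scalemxAl Zw Dw scaler0 subrr.
- by rewrite -[Z'](subKr X); apply: le_trans (nmD _ _) _; rewrite nmN lerD2l.
Qed.

Let E (X : 'M[C]_n) := expm ('i *: X).
Let rE X : real_lie K X -> r (E X) = expm (dr ('i *: X)).
Proof. by move=> /lieK_g Xg; rewrite /E rep_expm // rpredZ. Qed.
Let GE X : real_lie K X -> G (E X).
Proof. by move=> /lieK_g /gP; apply. Qed.

Lemma slice_cvm A L : (forall k, slice (A k)) -> cvm A L -> slice L.
Proof.
move=> hA AL; have cK' := compact_closed_group sK cK; split.
  by apply: (real_lie_cvm cK' _ AL) => k; case: (hA k).
move=> Z KZ Zw; have h := cvs_ip AL (cvm_cst Z); apply/eqP; rewrite eq_le.
by apply/andP; split; [apply: (cvs_le_re h) | apply: (cvs_ge_re h)];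
  apply: nearW => k; have [_ ->] := hA k.
Qed.

Lemma sliceD X Z t : slice X -> slice Z -> slice (X + io t *: Z).
Proof.
have cK' := compact_closed_group sK cK.
move=> [KX hX] [KZ hZ]; split; first by apply: real_lieD => //; exact: real_lieZ.
by move=> D KD Dw; rewrite ipDl ipZl reD reMio hX // hZ // mulr0 addr0.
Qed.

Lemma slice0 : slice 0.
Proof. by split=> [|Z _ _]; [exact: real_lie0 | rewrite ip0l re0]. Qed.

Lemma slice_minimum x : exists X, [/\ slice X, nm X <= 1 &
  forall Y, slice Y -> nm Y <= 1 -> nm (r (E X) *m x) <= nm (r (E Y) *m x)].
Proof.
pose P : set 'M[C]_n := [set X | slice X /\ nm X <= 1].
have [|Z [_ //]|A L hA AL|A L hA AL|Z|X [sX X1] hmin] :=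
    @min_attained _ S _ _ P (fun X => nm (expm (dr ('i *: X)) *m x)) 1.
- by exists 0; split; [exact: slice0 | rewrite nm0].
- split; first by apply: slice_cvm AL => k; case: (hA k).
  by apply: (cvm_le_nm AL); apply: nearW => k; case: (hA k).
- apply: cvm_nm; apply: cvmM (cvm_expm _) (cvm_cst x).
  exact: cvm_linear (cvmZ (cvs_cst 'i) AL).
- exact: nm_ge0.
exists X; split=> [||Y sY Y1]; [exact: sX | exact: X1 |].
by rewrite (rE (proj1 sX)) (rE (proj1 sY)); exact: (hmin Y (conj sY Y1)).
Qed.

(** [D] is the direction in which [E (X + e Z)] leaves [E X]: it is [i Z] up to an error
    proportional to [|X|]. The strict bound on [nm X] leaves room for the variation, and minimality
    gives the sign. *)
Lemma slice_derivative X x : slice X -> nm X < 1 ->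
  (forall Y, slice Y -> nm Y <= 1 -> nm (r (E X) *m x) <= nm (r (E Y) *m x)) ->
  forall Z, slice Z -> exists D, [/\ D \in g,
    nm (D - 'i *: Z) <= (cn (S := S) n * expR 1 + cn (S := S) n ^+ 2 * expR 2 * expR 1) * nm Z * nm X &
    0 <= re (ip (dr D *m (r (E X) *m x)) (r (E X) *m x))].
Proof.
move=> sX X1 hX Z sZ; have [KX _] := sX; have [KZ _] := sZ; have [_ _ GM _] := sG.
have ep (k : nat) : 0 < k.+1%:R^-1 :> R by rewrite invr_gt0.
have nI (Y : 'M[C]_n) : nm ('i *: Y) = nm Y by rewrite nmZ nc_i mul1r.
have [|phi [D [phiS hD nD]]] := @exp_derivative _ ('i *: X) ('i *: Z) _ _ (@cvg0_inv R) ep.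
  by rewrite nI ltW.
have e0 := cvg0_subseq phiS (@cvg0_inv R).
have ep' k : 0 < ((fun k : nat => k.+1%:R^-1 : R) \o phi) k by exact: ep.
have eE t : 'i *: X + io t *: ('i *: Z) = 'i *: (X + io t *: Z).
  by rewrite scalerDr !scalerA [io t * _]mulrC.
have EN : expm (- ('i *: X)) = invmx (E X) by rewrite -invmx_expm.
pose h k := E (X + io (phi k).+1%:R^-1 *: Z) *m invmx (E X).
have Kt t : real_lie K (X + io t *: Z) by have [] := sliceD t sX sZ.
have Gh k : G (h k).
  by apply: GM; [exact: GE | have [_ _ _ GV] := sG; apply: GV; exact: GE].
have hD' : cvm (fun k => io (((fun k : nat => k.+1%:R^-1 : R) \o phi) k)^-1 *: (h k - 1%:M)) D.
  by apply: cvm_ext hD => k /=; rewrite eE EN.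
have [Y [GY YD hY]] := log_direction cG Gh e0 ep' hD'.
have Dg : D \in g.
  by apply/gP/(@real_lie_lie _ _ _ aG)/(real_lie_cvm cG GY YD).
exists D; split=> //; first by rewrite !nI in nD.
apply: (nm_nondecreasing_direction e0 ep' (expm_quot (cvm_linear dr YD) e0 ep')).
have X0 : 0 < 1 - nm X by rewrite subr_gt0.
apply: filterS2 hY (cvg0Z (nm_ge0 Z) e0 X0) => k hk nk; rewrite -rdr // -hk mulmxA -rM //; last exact: GE.
have -> : h k *m E X = E (X + io (phi k).+1%:R^-1 *: Z) by rewrite /h (mulmxKV (expm_unit _)).
apply: hX; first exact: sliceD.
apply: le_trans (nmD _ _) _; rewrite nmZ nc_io gtr0_norm // mulrC.
have nk' : nm Z / (phi k).+1%:R < 1 - nm X by exact: nk.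
by rewrite -lerBrDl ltW.
Qed.

(** A limit [L] of the minimisers satisfies [|exp (i L) w| <= |w|], so [i L] kills [w] by
    [expm_herm_fix] and criticality; then [L] lies in the stabiliser and is orthogonal to it, hence
    0. *)
Lemma slice_limit u X : (forall j, orbit_hull (u j)) -> cvm u w -> (forall j, slice (X j)) ->
  (forall j, nm (r (E (X j)) *m u j) <= nm (u j)) -> (forall j, nm (X j) <= 1) ->
  exists phi, [/\ subseq_ix phi, cvm (X \o phi) 0 & cvm (fun j => r (E (X (phi j))) *m u (phi j)) w].
Proof.
move=> hu uw sX le X1; have [phi phiS [L hL]] := bw_mx X1.
have sL := slice_cvm (fun j => sX (phi j)) hL; have [KL sL2] := sL.
have lim : cvm (fun j => r (E (X (phi j))) *m u (phi j)) (expm (dr ('i *: L)) *m w).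
  have h := cvmM (cvm_expm (cvm_linear dr (cvmZ (cvs_cst 'i) hL))) (cvm_subseq phiS uw).
  by apply: cvm_ext h => j /=; rewrite (rE (proj1 (sX (phi j)))).
have nL : nm (expm (dr ('i *: L)) *m w) <= nm w.
  apply/ler_addgt0Pr => x x0; apply: (cvm_le_nm lim).
  apply: filterS (near_subseq phiS (uw _ x0)) => j /= hj.
  apply: le_trans (le _) _; have := nmB (u (phi j)) w; lra.
have Lw : dr ('i *: L) *m w = 0.
  apply: expm_herm_fix => //; first exact: dr_herm.
  by apply: wcrit; rewrite rpredZ // lieK_g.
have L0 : L = 0.
  have Lw' : dr L *m w = 0.
    apply: (scalerI (neq0Ci C)); rewrite scaler0 scalemxAl -linearZ; exact: Lw.
  apply/eqP; rewrite -(@fn_eq0 R S); apply/eqP.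
  by have := sL2 _ KL Lw'; rewrite ip_fn re_io.
exists phi; split=> //; first by rewrite -L0.
by move: lim; rewrite L0 scaler0 linear0 expm0 mul1mx.
Qed.

(** As the rank of [tangent] is constant, an element killing [w] is a limit of elements killing the
    [s j], on which the moment at [s j] is 0. *)
Lemma gradient_kernel (s : nat -> 'cV[C]_m) v (N : nat -> R) : (forall j, orbit_hull (s j)) ->
  cvm s w -> cvm (fun j => io (N j) *: gradient (s j)) v ->
  forall z, dr (EX z) *m w = 0 -> ip z v = 0.
Proof.
move=> hy yw hv z zw.
have [|||q qz hq] := @kernel_limit _ _ (fun j => tangent (s j)) (tangent w) z^T.
- exact: tangent_cvm.
- by move=> j; rewrite tangent_rank.
- by rewrite tangentE zw trmx0.
have qz' : cvm (fun j => (q j)^T) z.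
  by rewrite -(trmxK z); apply: cvm_entries => i j; rewrite mxE; apply: cvs_ext (cvm_entry j i qz) => k;
    rewrite [RHS]mxE.
apply: cvs_uniq (cvs_ip qz' hv) _; apply: cvs_near (cvs_cst 0); apply: filterS hq => j hj.
have : (q j)^T^T *m tangent (s j) = 0 by rewrite trmxK.
rewrite tangentE => /(congr1 trmx); rewrite trmxK trmx0 => h.
by rewrite ipZr gradientE h ip0l mulr0.
Qed.

(** Minimality gives a nonnegative real part for [Z] and for [- Z]; the imaginary part vanishes
    because [dr ('i *: Z)] is hermitian. *)
Lemma gradient_slice u X v (N : nat -> R) : cvm X 0 -> (forall j, slice (X j)) ->
  (forall j Y, slice Y -> nm Y <= 1 -> nm (r (E (X j)) *m u j) <= nm (r (E Y) *m u j)) ->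
  (forall j, 0 <= N j) ->
  cvm (fun j => io (N j) *: gradient (r (E (X j)) *m u j)) v ->
  forall Z, slice Z -> ip (co ('i *: Z)) v = 0.
Proof.
move=> X0 sX hmin N0 hv.
have re_ge Z : slice Z -> 0 <= re (ip (co ('i *: Z)) v).
  move=> sZ; set c := (cn (S := S) n * expR 1 + cn (S := S) n ^+ 2 * expR 2 * expR 1) * nm Z.
  have c0 : 0 <= c by rewrite mulr_ge0 ?nm_ge0 // addr_ge0 ?mulr_ge0 ?expR_ge0 ?exprn_ge0 ?cn_ge0.
  have /choice [D hD] j : exists D, nm (X j) < 1 -> [/\ D \in g,
      nm (D - 'i *: Z) <= c * nm (X j) &
      0 <= re (ip (dr D *m (r (E (X j)) *m u j)) (r (E (X j)) *m u j))].
    have [X1|X1] := ltP (nm (X j)) 1; last by exists 0.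
    by have [D hD] := slice_derivative (sX j) X1 (hmin j) sZ; exists D.
  have nX : cvg0 (fun j => nm (X j)).
    by apply: cvg0_leA X0 => j; rewrite subr0.
  have DZ : cvm D ('i *: Z).
    by apply: cvg0_le (cvg0Z c0 nX); apply: filterS (nX _ ltr01) => j /hD [].
  apply: (cvs_ge_re (cvs_ip (cvm_linear coL DZ) hv)).
  apply: filterS (nX _ ltr01) => j /hD [Dg _ h].
  by rewrite ipZr ioJ reMio -[coL _]/(co (D j)) gradientE coK // mulr_ge0.
move=> Z sZ; have [KZ _] := sZ; have h1 := re_ge _ sZ.
have sN : slice (- Z) by have := sliceD (-1) slice0 sZ; rewrite add0r rmorphN1 scaleN1r.
have h2 := re_ge _ sN; rewrite scalerN -[co _]/(coL _) linearN ipNl reN in h2.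
have iZg : 'i *: Z \in g by rewrite rpredZ // lieK_g.
have lim := cvs_ip (cvm_cst (co ('i *: Z))) hv.
have J : (ip (co ('i *: Z)) v)^* = ip (co ('i *: Z)) v.
  apply: cvs_uniq (cvsJ lim) _; apply: cvs_ext lim => j.
  rewrite ipZr ioJ gradientE coK // rmorphM /= ioJ; congr (_ * _).
  by rewrite ipJ ip_mulmx dr_herm.
rewrite [LHS]reim; have -> : re (ip (co ('i *: Z)) v) = 0.
  by apply/eqP; rewrite eq_le h1 andbT -oppr_ge0.
have -> : im (ip (co ('i *: Z)) v) = 0 by have := congr1 im J; rewrite imJ; lra.
by rewrite (rmorph0 io) mulr0 addr0.
Qed.

(** Otherwise the moments at the slice minimisers can be normalised and have a limit of norm at
    least 1, orthogonal to the stabiliser of [w] and to the slice, hence to all of [g]. *)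
Lemma critical_nearby u : (forall j, orbit_hull (u j)) -> cvm u w ->
  exists j a, G a /\ critical (r a *m u j).
Proof.
move=> hu uw; apply: contrapT => no; have [_ G1 _ _] := sG.
have /choice [X hX] j := slice_minimum (u j).
have E0 : E 0 = 1%:M by rewrite /E scaler0 expm0.
have [j|j|j|phi [phiS X0 yw]] := @slice_limit u X hu uw.
- by case: (hX j).
- have [_ _ h] := hX j; have := h 0 slice0; rewrite nm0 E0 r1 mul1mx; apply; exact: ler01.
- by case: (hX j).
have sX j : slice (X (phi j)) by case: (hX (phi j)).
pose y j := r (E (X (phi j))) *m u (phi j).
have hy j : orbit_hull (y j) by apply: orbit_hull_G => //; exact: GE (proj1 (sX j)).
have g0 j : 0 < nm (gradient (y j)).
  rewrite nm_gt0; apply/eqP => h; apply: no; exists (phi j), (E (X (phi j))).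
  by split; [exact: GE (proj1 (sX j)) | exact: critical_gradient].
have [j|chi chiS [v hv]] := @bw_mx _ _ _ _ (fun j => io (nm (gradient (y j)))^-1 *: gradient (y j)) 1.
  by rewrite nmZ nc_io gtr0_norm ?invr_gt0 // mulVf ?gt_eqF.
have v1 : 1 <= nm v.
  apply: (cvm_ge_nm hv); apply: nearW => j /=.
  by rewrite nmZ nc_io gtr0_norm ?invr_gt0 // mulVf ?gt_eqF.
have A := @gradient_kernel (y \o chi) v _ (fun j => hy (chi j)) (cvm_subseq chiS yw) hv.
have B : forall Z, slice Z -> ip (co ('i *: Z)) v = 0.
  apply: (@gradient_slice (u \o (phi \o chi)) (X \o (phi \o chi)) v _ (cvm_subseq chiS X0) _ _ _ hv) => [j|j|j].
  - exact: sX.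
  - by case: (hX (phi (chi j))).
  - by rewrite invr_ge0 nm_ge0.
have D Z : real_lie K Z -> ip (co ('i *: Z)) v = 0.
  move=> KZ; have [Z1 [KZ1 Z1w sZ]] := slice_split KZ.
  have -> : co ('i *: Z) = coL ('i *: (Z - Z1)) + coL ('i *: Z1).
    by rewrite -linearD -scalerDr subrK.
  rewrite ipDl -[coL ('i *: (Z - Z1))]/(co _) B // add0r; apply: A.
  rewrite coK; last by rewrite rpredZ // lieK_g.
  by rewrite linearZ -scalemxAl Z1w scaler0.
have all z : ip z v = 0.
  rewrite -(EXK z); have [Y [Z [KY KZ ->]]] := gK (EXg z).
  rewrite -[co _]/(coL _) linearD ipDl [X in _ + X](D _ KZ) addr0.
  apply: (mulfI (neq0Ci C)); rewrite mulr0 -ipZl -linearZ; exact: D.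
have : fn v = 0 by apply: (@io_inj R S); rewrite -ip_fn all rmorph0.
by move/eqP; rewrite fn_eq0 => /eqP v0; move: v1; rewrite v0 nm0 ler10.
Qed.

Theorem critical_orbit_closed : zariski_closed [set r a *m w | a in G].
Proof.
have -> : [set r a *m w | a in G] = orbit_hull; last exact: orbit_hull_closed.
rewrite eqEsubset; split=> [_ [a Ga <-]|x hx]; first exact: orbit_hull_orbit.
have [a Ga ax] := orbit_approaches hx; have [_ _ GM GV] := sG.
have [j [b [Gb bc]]] := critical_nearby (fun j => orbit_hull_G (Ga j) hx) ax.
have Gc := GM _ _ Gb (Ga j).
have [k Kk ek] := critical_unique (orbit_hull_G Gb (orbit_hull_G (Ga j) hx)) bc.
exists (invmx (b *m a j) *m k); first exact: GM (GV _ Gc) (KG Kk).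
by rewrite (rM (GV _ Gc) (KG Kk)) -mulmxA -ek (mulmxA (r b)) -(rM Gb (Ga j)) mulmxA (rep_V sG r1 rM) // mul1mx.
Qed.
End KempfNess.

(** * Maximal tori: centralisers, joint eigenvectors, characters *)

Section TorusCentralizer.
Variable n : nat.
Implicit Types (X Y : 'M[C]_n) (G H K : set 'M[C]_n).

(* Both [B] and its complement in [H] are unions of translates of a neighbourhood of [1]. *)
Lemma connected_group_exp H (P : 'M[C]_n -> Prop) : closed_group H -> connected H ->
  P 1%:M -> (forall X h, real_lie H X -> H h -> P h -> P (expm X *m h)) ->
  forall h, H h -> P h.
Proof.
move=> cH conH P1 PX; have [[HU H1 HM HV] _] := cH; have [e e0 he] := closed_subgroup_nbhd cH.
pose U (Q : set 'M[C]_n) : set 'M[C]_n := [set X | exists b, [/\ H b, Q b & nm (X *m invmx b - 1%:M) < e]].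
have oU Q : open (U Q).
  rewrite openE => X [b [Hb Qb hX]].
  have p0 : 0 < nm (invmx b) + 1 by rewrite ltr_pwDr ?nm_ge0.
  have d0 : 0 < (e - nm (X *m invmx b - 1%:M)) / (nm (invmx b) + 1) by rewrite divr_gt0 // subr_gt0.
  apply: filterS (nbhs_nm X d0) => Y; rewrite /= ltr_pdivlMr // => hY; exists b; split=> //.
  have -> : Y *m invmx b - 1%:M = (Y - X) *m invmx b + (X *m invmx b - 1%:M).
    by rewrite mulmxBl addrA subrK.
  apply: le_lt_trans (nmD _ _) _; rewrite -ltrBrDr; apply: le_lt_trans hY.
  by apply: le_trans (nmM _ _) _; rewrite ler_wpM2l ?nm_ge0 // lerDl.
have near X b : H X -> H b -> nm (X *m invmx b - 1%:M) < e ->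
    exists2 Z, real_lie H Z & X = expm Z *m b.
  move=> HX Hb hX; have [Z HZ eZ] := he _ (HM _ _ HX (HV _ Hb)) hX.
  by exists Z => //; rewrite -eZ mulmxKV //; exact: HU.
have self b : H b -> nm (b *m invmx b - 1%:M) < e.
  by move=> Hb; rewrite mulmxV ?subrr ?nm0 //; exact: HU.
suff eP : H `&` [set h | P h] = H by move=> h Hh; have [] : (H `&` [set h | P h]) h by rewrite eP.
apply: conH; first by exists 1%:M.
  exists (U [set h | P h]); first exact: oU.
  rewrite eqEsubset; split=> [X [HX PX']|X [HX [b [Hb Pb hX]]]]; split=> //.
    by exists X; split=> //; exact: self.
  by have [Z HZ ->] := near _ _ HX Hb hX; exact: PX.
exists (~` U (~` [set h | P h])); first by apply: open_closedC; exact: oU.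
rewrite eqEsubset; split=> [X [HX PX']|X [HX nX]]; split=> //.
  move=> [b [Hb nPb hX]]; apply: nPb; have [Z HZ e1] := near _ _ HX Hb hX.
  have -> : b = expm (- Z) *m X by rewrite e1 mulmxA expmVl mul1mx.
  by apply: PX => //; exact: real_lieN.
by apply: contrapT => nP; apply: nX; exists X; split=> //; exact: self.
Qed.

Lemma commuting_lie H X Y : (forall s t, H s -> H t -> s *m t = t *m s) ->
  subgroup H -> real_lie H X -> real_lie H Y -> X *m Y = Y *m X.
Proof.
move=> cm sH HX HY; have ep (k : nat) : 0 < k.+1%:R^-1 :> R by rewrite invr_gt0.
have c1 h : H h -> h *m Y *m invmx h = Y.
  move=> Hh; have hu : h \in unitmx by have [HU _ _ _] := sH; exact: HU.
  apply: (@expm_curve_inj R S) => t; have -> : io t *: (h *m Y *m invmx h) = h *m (io t *: Y) *m invmx h.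
    by rewrite -scalemxAr -scalemxAl.
  have HE : H (expm (io t *: Y)) by move/real_lieP: HY.
  by rewrite expm_conj // (cm _ _ Hh HE) mulmxK.
have := bracket_limit X Y (@cvg0_inv R) ep => lim; apply/eqP; rewrite -subr_eq0; apply/eqP.
apply: (cvm_uniq lim); apply: cvm_ext (cvm_cst 0) => k.
by rewrite c1 ?subrr ?scaler0 //; move/real_lieP: HX.
Qed.

Lemma commute_group H Y : closed_group H -> connected H ->
  (forall X, real_lie H X -> X *m Y = Y *m X) -> forall h, H h -> h *m Y = Y *m h.
Proof.
move=> cH conH hY; apply: (connected_group_exp cH conH) => [|X h HX Hh hh].
  by rewrite mul1mx mulmx1.
by rewrite -mulmxA hh mulmxA expm_comm ?hY // mulmxA.
Qed.

Lemma expm_line_connected (A Y : 'M[C]_n) : connected [set A *m expm (io t *: Y) | t in [set: R]].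
Proof.
apply: connected_continuous_connected.
  by apply/connected_intervalP => x y _ _ z _.
apply: continuous_subspaceT => t U /nbhs_nmP [e e0 hU].
pose c := nm (A *m expm (io t *: Y)) * (cn (S := S) n * (nm Y * expR (nm Y))).
have c0 : 0 <= c by rewrite !mulr_ge0 ?nm_ge0 ?cn_ge0 ?expR_ge0.
have d0 : 0 < Num.min 1 (e / (c + 1)) by rewrite lt_min ltr01 divr_gt0 // ltr_wpDl.
apply/nbhs_ballP; exists (Num.min 1 (e / (c + 1))) => //= s; rewrite /ball /= lt_min => /andP [s1 s2].
apply: hU; have -> : A *m expm (io s *: Y) - A *m expm (io t *: Y) =
    A *m expm (io t *: Y) *m (expm (io (s - t) *: Y) - 1%:M).
  have -> : expm (io s *: Y) = expm (io t *: Y) *m expm (io (s - t) *: Y).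
    by rewrite -expm_adds -rmorphD addrC subrK.
  by rewrite mulmxA mulmxBr mulmx1.
apply: le_lt_trans (nmM _ _) _.
apply: (@le_lt_trans _ _ (c * `|t - s|)).
  rewrite /c -mulrA ler_wpM2l ?nm_ge0 //; apply: le_trans (expm_tail1 _) _.
  rewrite -mulrA ler_wpM2l ?cn_ge0 // nmZ nc_io distrC mulrC mulrA mulrC mulrA.
  rewrite ler_wpM2r ?normr_ge0 // ler_wpM2l ?nm_ge0 // ler_expR ler_piMl ?nm_ge0 //; exact: ltW.
have := normr_ge0 (t - s); move: s2; rewrite ltr_pdivlMr; last by rewrite ltr_wpDl.
by nra.
Qed.

Lemma bounded_closureE H Q : (forall x, Q x <-> exists2 h : nat -> 'M[C]_n, (forall k, H (h k)) & cvm h x) ->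
  Q = closure H.
Proof.
move=> hQ; rewrite eqEsubset; split=> x.
  move=> /hQ [h Hh hx] U /nbhs_nmP [e e0 hU]; have [k hk] := near_ex (hx _ e0).
  by exists (h k); split=> //; exact: hU.
move=> cx; apply/hQ; have /choice [h hh] (k : nat) : exists h, H h /\ nm (h - x) < k.+1%:R^-1.
  have k0 : 0 < k.+1%:R^-1 :> R by rewrite invr_gt0.
  by have [h [Hh hx]] := cx _ (nbhs_nm x k0); exists h.
exists h => [k|]; first by case: (hh k).
by apply: cvg0_leA (@cvg0_inv R) => k; have [_ /ltW] := hh k.
Qed.

(** The closure of the group generated by the torus and the [exp (t Y)] is compact, connected and
    abelian, so by maximality it is the torus. *)
Lemma maximal_torus_centralizer TR K Y : subgroup K -> compact K -> maximal_torus TR K ->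
  real_lie K Y -> (forall X, real_lie TR X -> X *m Y = Y *m X) ->
  real_lie TR Y.
Proof.
move=> sK cK [[[sT TK cT] conT comT] maxT] KY hY.
have cgT := compact_closed_group sT cT; have cgK := compact_closed_group sK cK.
have comY := commute_group cgT conT hY; have [TU T1 TM TV] := sT; have [KU K1 KM KV] := sK.
have KE t : K (expm (io t *: Y)) by move/real_lieP: KY.
have comE h t : TR h -> h *m expm (io t *: Y) = expm (io t *: Y) *m h.
  move=> Th; rewrite expm_comm // -scalemxAl -scalemxAr comY //.
pose H : set 'M[C]_n := [set x | exists h t, TR h /\ x = h *m expm (io t *: Y)].
have sH : subgroup H.
  split=> [_ [h [t [Th ->]]]||_ _ [h [t [Th ->]]] [l [s [Tl ->]]]|_ [h [t [Th ->]]]].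
  - by rewrite /GL /= unitmx_mul expm_unit andbT; exact: TU.
  - by exists 1%:M, 0; rewrite (rmorph0 io) scale0r expm0 mulmx1.
  - exists (h *m l), (t + s); split; first exact: TM.
    by rewrite rmorphD expm_adds -!mulmxA (mulmxA _ l) -comE // !mulmxA.
  - exists (invmx h), (- t); split; first exact: TV.
    rewrite inv_mulmx ?expm_unit //; last exact: TU.
    by rewrite comE ?rmorphN ?scaleNr ?invmx_expm //; exact: TV.
have HK : H `<=` K by move=> _ [h [t [Th ->]]]; apply: KM => //; exact: TK.
have [B hB] := compact_bounded cK.
have [Q [[sQ QK cQ] HQ Qlim]] := bounded_closure cgK sH HK (fun h Hh => hB h (HK h Hh)).
have conH : connected H.
  have -> : H = \bigcup_(h in TR) (TR `|` [set h *m expm (io t *: Y) | t in [set: R]]).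
    rewrite eqEsubset; split=> x.
      by move=> [h [t [Th ->]]]; exists h => //; right; exists t.
    move=> [h Th [Tx|[t _ <-]]]; last by exists h, t.
    by exists x, 0; rewrite (rmorph0 io) scale0r expm0 mulmx1.
  apply: bigcup_connected; first by exists 1%:M => h _; left.
  move=> h Th; apply: connectedU; [ | exact: conT | exact: expm_line_connected].
  by exists h; split=> //; exists 0 => //; rewrite (rmorph0 io) scale0r expm0 mulmx1.
have comH x y : H x -> H y -> x *m y = y *m x.
  move=> [h [t [Th ->]]] [l [s [Tl ->]]].
  have gen (a b c d : 'M[C]_n) : b *m c = c *m b -> a *m d = d *m a -> a *m c = c *m a ->
      b *m d = d *m b -> a *m b *m (c *m d) = c *m d *m (a *m b).
    move=> bc ad ac bd; rewrite mulmxA -(mulmxA a b c) bc mulmxA ac -!mulmxA bd (mulmxA a d) ad.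
    by rewrite -!mulmxA.
  apply: gen; [by rewrite comE | exact: comE | exact: comT |].
  by rewrite -!expm_adds addrC.
have comQ x y : Q x -> Q y -> x *m y = y *m x.
  move=> /Qlim [h Hh hx] /Qlim [l Hl ly]; apply: (cvm_uniq (cvmM hx ly)).
  by apply: cvm_ext (cvmM ly hx) => k; exact: comH.
have QT : Q = TR.
  apply: maxT; last by move=> h Th; apply: HQ; exists h, 0; rewrite (rmorph0 io) scale0r expm0 mulmx1.
  by split=> //; rewrite (bounded_closureE Qlim); exact: connected_closure.
by apply/real_lieP => t; rewrite -QT; apply: HQ; exists 1%:M, t; rewrite mul1mx.
Qed.
End TorusCentralizer.

Section JointEigenvectors.
Variable n : nat.
Implicit Types (X Y H : 'M[C]_n.+1).

(** The matrix is diagonalisable, so its nilpotent part, a polynomial in it, is both diagonalisable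
    and nilpotent. *)
Lemma skew_semisimple b H : b \in unitmx ->
  (b *m H *m invmx b)^t* = - (b *m H *m invmx b) -> gfun H id = H.
Proof.
move=> bu hs; set A := b *m H *m invmx b in hs.
have hB : ('i *: A)^t* = 'i *: A by rewrite adjZ hs conjCi scalerN scaleNr opprK.
have [u [d [uu uu' eB]]] := herm_diag hB.
have uV : invmx u = u^t*.
  by rewrite -[LHS]mulmx1 -uu mulmxA mulVmx ?mul1mx //; have [] := mulmx1_unit uu.
have uu1 : u \in unitmx by have [] := mulmx1_unit uu.
pose P := u *m b; have Pu : P \in unitmx by rewrite unitmx_mul uu1.
pose e : 'rV[C]_n.+1 := \row_i (- 'i * io (d i)).
have eH : H = invmx P *m diag_mx e *m P.
  have eA : A = u^t* *m diag_mx e *m u.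
    have -> : diag_mx e = - 'i *: dgr d.
      by apply/matrixP => i j; rewrite /dgr !mxE mulrnAr.
    by rewrite -scalemxAr -scalemxAl -eB scalerA mulNr -expr2 sqrCi opprK scale1r.
  have eHA : H = invmx b *m A *m b by rewrite /A !mulmxA mulVmx // mul1mx mulmxKV.
  by rewrite /P inv_mulmx // uV [LHS]eHA eA !mulmxA.
clearbody P; pose q : {poly C} := 'X - \sum_(a <- spec H) a *: sprp H a.
have eN : H - gfun H id = horner_mx H q.
  have -> : gfun H id = horner_mx H (\sum_(a <- spec H) a *: sprp H a).
    by rewrite rmorph_sum /=; apply: eq_bigr => a _; rewrite linearZ sprE.
  by rewrite rmorphB /= horner_mx_X.
have PV : invmx P \is a GRing.unit by rewrite unitmx_inv.
have qH : horner_mx H q = invmx P *m diag_mx (map_mx (horner q) e) *m P.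
  rewrite {1}eH -{2}(invmxK P) horner_mx_uconj //; congr (_ *m _ *m _); last by rewrite invmxK.
  exact: horner_mx_diag.
have nil := nilp_part H; rewrite eN qH in nil.
have powE k (D : 'M[C]_n.+1) : (invmx P *m D *m P) ^+ k = invmx P *m D ^+ k *m P.
  elim: k => [|k IH]; first by rewrite !expr0 mulmx1 mulVmx.
  by rewrite !exprS IH -!mulmxE !mulmxA mulmxK.
rewrite powE diag_mxX in nil.
have z : map_mx (horner q) e = 0.
  have /matrixP h : diag_mx (map_mx (fun z => z ^+ n.+1) (map_mx (horner q) e)) = 0.
    have := congr1 (fun M => P *m M *m invmx P) nil.
    by rewrite /= !mulmxA mulmxV // mul1mx mulmxK // mulmx0 mul0mx.
  apply/rowP => i; have := h i i; rewrite !mxE eqxx mulr1n => /eqP.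
  by rewrite expf_eq0 /= => /eqP.
apply/eqP; rewrite eq_sym -subr_eq0 eN qH z.
by rewrite (_ : diag_mx 0 = 0) ?mulmx0 ?mul0mx //; apply/matrixP => i j; rewrite !mxE mul0rn.
Qed.

Lemma wproj_stable H mu (g : {vspace 'M[C]_n.+1}) : gfun H id = H ->
  (forall X, X \in g -> br H X \in g) -> forall X, X \in g -> ap (wproj H mu) X \in g.
Proof.
move=> sH hg; apply: (blk_closed (Q := fun A => forall X, X \in g -> ap A X \in g)) (fun c => (c == mu)%:R).
- by move=> X; rewrite ap1.
- by move=> A B hA hB X Xg; rewrite apDl rpredD ?hA ?hB.
- by move=> c A hA X Xg; rewrite apZl rpredZ ?hA.
- by move=> A hA X Xg; rewrite apM sH apadm hg // hA.
Qed.

Lemma wproj_eigen H mu X : gfun H id = H -> br H (ap (wproj H mu) X) = mu *: ap (wproj H mu) X.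
Proof.
move=> sH; have e : adm H = adm (gfun H id) by rewrite sH.
rewrite -apadm -apM e adm_gfun blkM -apZl blkZ; congr (ap _ X).
by apply: blk_ext => a b _ _; case: eqP => [->|]; rewrite ?mul1r ?mulr1 ?mul0r ?mulr0.
Qed.

Lemma wproj_comm H H' mu X : gfun H id = H -> H *m H' = H' *m H ->
  br H' (ap (wproj H mu) X) = ap (wproj H mu) (br H' X).
Proof.
move=> sH hh; rewrite -!apadm -!apM; congr (ap _ X).
apply: (blk_closed (Q := fun A => A *m adm H' = adm H' *m A) (x := H)) (fun c => (c == mu)%:R).
- by rewrite mulmx1 mul1mx.
- by move=> A B hA hB; rewrite mulmxDr mulmxDl hA hB.
- by move=> c A hA; rewrite -scalemxAr -scalemxAl hA.
- move=> A hA; rewrite [RHS]mulmxA -hA -!mulmxA sH; congr (_ *m _); apply/esym.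
  have := adm_br H' H; rewrite /br hh subrr => /eqP; rewrite eq_sym.
  rewrite (_ : adm 0 = 0) ?subr_eq0 => [/eqP //|].
  by apply: ap_ext => z; rewrite apadm /br mul0mx mulmx0 subrr /ap mulmx0 linear0.
Qed.

(** Split by the eigenprojections of one [ad H] at a time; they preserve [g] and commute with the
    [ad] of the others. As an induction principle it serves any property closed under sums. *)
Lemma joint_eigen_ind (Hs : seq 'M[C]_n.+1) (g : {vspace 'M[C]_n.+1}) (Q : 'M[C]_n.+1 -> Prop) :
  (forall H, H \in Hs -> gfun H id = H) ->
  (forall H H', H \in Hs -> H' \in Hs -> H *m H' = H' *m H) ->
  (forall H X, H \in Hs -> X \in g -> br H X \in g) ->
  Q 0 -> (forall X Y, Q X -> Q Y -> Q (X + Y)) ->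
  (forall X, X \in g -> (forall H, H \in Hs -> exists a, br H X = a *: X) -> Q X) ->
  forall X, X \in g -> Q X.
Proof.
elim: Hs => [|H Hs IH] ss cm hg Q0 QD hQ; first by move=> X Xg; apply: hQ.
have sub H' : H' \in Hs -> H' \in H :: Hs by rewrite inE orbC => ->.
have HH : H \in H :: Hs by rewrite inE eqxx.
apply: IH => // [H' /sub|H1 H2 /sub h1 /sub|H' X /sub|X Xg hX].
- exact: ss.
- exact: cm.
- exact: hg.
rewrite -[X]ap1 -(wproj_sum H) ap_suml; apply: (big_ind Q) => // mu _.
apply: hQ => [|H']; first by apply: wproj_stable => //; [exact: ss | move=> Y; exact: hg].
rewrite inE => /orP [/eqP ->|H'S]; first by exists mu; rewrite wproj_eigen // ss.
have [a ha] := hX _ H'S; exists a; rewrite wproj_comm ?ss //; last by apply: cm => //; exact: sub.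
by rewrite ha -/(ap _ _) /ap linearZ -scalemxAl linearZ.
Qed.
End JointEigenvectors.

Section Characters.

Lemma derive1_expc (f : C -> C) a : (forall s, f s = expc (s * a)) ->
  derive1 (f : C -> C^o) 0 = a.
Proof.
move=> hf; rewrite /derive1; apply: cvg_lim; first exact: norm_hausdorff.
apply/(@cvgrPdist_lt _ C^o) => eps eps0.
have er : io (ro eps) = eps by rewrite roK // gtr0_real.
have e0 : 0 < ro eps by rewrite -(io_gt0 (S := S)) er.
pose c := cn (S := S) 1 * (nc a ^+ 2 * expR (nc a)).
have c0 : 0 <= c by rewrite mulr_ge0 ?cn_ge0 // mulr_ge0 ?sqr_ge0 ?expR_ge0.
pose d := Num.min 1 (ro eps / (c + 1)).
have d0 : 0 < d by rewrite lt_min ltr01 divr_gt0 // ltr_wpDl.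
apply/nbhs_ballP; exists (io d) => [|h]; first by rewrite /= io_gt0.
rewrite /ball /= sub0r normrN -(ncE (S := S)) io_lt lt_min => /andP [h1 h2] hn0.
rewrite -er -(ncE (S := S)) io_lt !hf mul0r expc0 addr0.
have h0 : 0 < nc h by rewrite nc_gt0.
have aux (x y z : C) : x != 0 -> z - x^-1 * y = - (x^-1 * (y - x * z)) by move=> x0; field.
rewrite [_ *: _]/(_ * _) (aux _ _ _ hn0).
rewrite ncN ncM ncV; apply: (@le_lt_trans _ _ (c * nc h)); last first.
  by move: h2; rewrite ltr_pdivlMr; [nra | rewrite ltr_wpDl].
rewrite ler_pdivrMl //; apply: le_trans (expc_tail2 _) _; rewrite ncM exprMn.
have -> : nc h * (c * nc h) = cn (S := S) 1 * ((nc h ^+ 2 * nc a ^+ 2) * expR (nc a)).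
  by rewrite /c; ring.
rewrite ler_wpM2l ?cn_ge0 //; apply: ler_wpM2l; first by rewrite mulr_ge0 ?sqr_ge0.
rewrite ler_expR ler_piMl ?nc_ge0 //.
exact: ltW.
Qed.

Variable n : nat.
Implicit Types (X Y H : 'M[C]_n) (T G : set 'M[C]_n).

(** A character is a representation of size 1, so its exponent comes from [rep_differential]. *)
Lemma weight_exponent T lam : subgroup T -> weight T lam ->
  exists a : 'M[C]_n -> C, forall X, lie_algebra T X -> forall s, lam (expm (s *: X)) = expc (s * a X).
Proof.
move=> sT [rl l1 lM l0].
have [|g h Tg Th|i j|dr hdr] := @rep_differential R S n 1 T (fun g => (lam g)%:M) sT.
- by rewrite l1.
- by rewrite lM // scalar_mxM.
- by apply: (Reg_ext _ rl) => g _; rewrite !ord1 mxE eqxx mulr1n.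
exists (fun X => dr X 0 0) => X TX s.
have sX : real_lie T (s *: X) by move=> u _; rewrite scalerA; exact: TX.
have := hdr _ sX 1; rewrite (rmorph1 io) !scale1r linearZ expmE1 mxE => /matrixP /(_ 0 0).
by rewrite !mxE !eqxx !mulr1n.
Qed.

Lemma differential_exponent lam X (a : C) : (forall s, lam (expm (s *: X)) = expc (s * a)) ->
  differential lam X = a.
Proof. exact: derive1_expc. Qed.

Lemma weight_mul T (lam mu : 'M[C]_n -> C) : subgroup T -> weight T lam -> weight T mu ->
  weight T (fun t => lam t * mu t).
Proof.
move=> [TU _ _ _] [[p [k [pp hp]]] l1 lM l0] [[q [l [pq hq]]] m1 mM m0]; split.
- exists (fun g => p g * q g), (k + l)%N; split; first exact: polyfM.
  move=> g Tg; rewrite hp // hq // exprD; field.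
  by rewrite !expf_neq0 -?unitfE -?[_ \is a GRing.unit]/(g \in unitmx) ?TU //; exact: TU.
- by rewrite l1 m1 mulr1.
- by move=> s t Ts Tt; rewrite lM // mM // mulrACA.
- by move=> g nT; rewrite l0 // mul0r.
Qed.

Lemma differential_mul T lam mu X : subgroup T -> weight T lam -> weight T mu -> lie_algebra T X ->
  differential (fun t => lam t * mu t) X = differential lam X + differential mu X.
Proof.
move=> sT wl wm TX; have [a ha] := weight_exponent sT wl; have [c hc] := weight_exponent sT wm.
rewrite (differential_exponent (ha X TX)) (differential_exponent (hc X TX)).
by apply: (differential_exponent) => s; rewrite ha // hc // -expcD mulrDr.
Qed.

Lemma expm_intertwine X (A B : 'M[C]_n) : A *m X = X *m B -> expm A *m X = X *m expm B.
Proof.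
move=> h; apply: (cvm_uniq (cvmM (expm_cvm A) (cvm_cst X))).
apply: cvm_ext (cvmM (cvm_cst X) (expm_cvm B)) => N; rewrite /epart mulmx_sumr mulmx_suml.
apply: eq_bigr => i _; rewrite -scalemxAr -scalemxAl; congr (_ *: _).
elim: (i : nat) => [|j IH]; first by rewrite !expr0 mul1mx mulmx1.
by rewrite !exprSr -!mulmxE mulmxA IH -!mulmxA h.
Qed.

Lemma expm_eigen H X a : br H X = a *: X -> expm H *m X *m invmx (expm H) = expc a *: X.
Proof.
move=> h; have e : H *m X = X *m (H + a%:M).
  by rewrite mulmxDr mul_mx_scalar -h /br addrC subrK.
rewrite (expm_intertwine e) expmD; last by rewrite scalar_mxC.
rewrite expm_scalar mul_mx_scalar -scalemxAr -scalemxAl -mulmxA mulmxV ?mulmx1 //; exact: expm_unit.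
Qed.

Lemma expm_scaling m (A : 'M[C]_m) (x : 'cV[C]_m) a :
  (forall t : R, expm (io t *: A) *m x = expc (io t * a) *: x) -> A *m x = a *: x.
Proof.
move=> h; have ep (k : nat) : 0 < k.+1%:R^-1 :> R by rewrite invr_gt0.
have q1 := cvmM (expm_quot (cvm_cst A) (@cvg0_inv R) ep) (cvm_cst x).
have q2 := cvmM (expm_quot (cvm_cst (a%:M : 'M[C]_m)) (@cvg0_inv R) ep) (cvm_cst x).
rewrite mul_scalar_mx in q2; apply: (cvm_uniq q1); apply: cvm_ext q2 => k.
by rewrite scale_scalar_mx expm_scalar -!scalemxAl !mulmxBl !mul1mx mul_scalar_mx h.
Qed.
End Characters.

(** * Criticality of a balanced vector with uncramped supports *)

Section BalancedCritical.
Variables (n m : nat) (G K TR T : set 'M[C]_n.+1) (g : {vspace 'M[C]_n.+1}).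
Variables (r : 'M[C]_n.+1 -> 'M[C]_m) (dr : {linear 'M[C]_n.+1 -> 'M[C]_m}).
Variable b : 'M[C]_n.+1.
Hypothesis redG : reductive G.
Hypothesis gP : forall X, lie_algebra G X <-> X \in g.
Hypothesis sK : subgroup K.
Hypothesis cK : compact K.
Hypothesis KG : K `<=` G.
Hypothesis maxT : maximal_torus TR K.
Hypothesis hT : T = torus_complexification TR.
Hypothesis bu : b \in unitmx.
Hypothesis Kskew : forall X, real_lie K X -> dagger b X = - X.
Hypothesis skewK : forall X, X \in g -> dagger b X = - X -> real_lie K X.
Hypothesis gdag : forall X, X \in g -> dagger b X \in g.
Hypothesis r1 : r 1%:M = 1%:M.
Hypothesis rM : forall a c, G a -> G c -> r (a *m c) = r a *m r c.
Hypothesis rdr : forall X, real_lie G X -> forall t : R, r (expm (io t *: X)) = expm (io t *: dr X).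

Let aG : algebraic_group G. Proof. by case: redG. Qed.
Let sG : subgroup G. Proof. by case: aG. Qed.
Let GU a : G a -> a \in unitmx. Proof. by have [h _ _ _] := sG => /h. Qed.
Let sT : subgroup TR. Proof. by case: maxT => -[[]]. Qed.
Let cT : closed_group TR.
Proof. by case: maxT => -[[sT' _ cT'] _ _] _; exact: compact_closed_group. Qed.
Let TK X : real_lie TR X -> real_lie K X.
Proof. by case: maxT => -[[_ TK' _] _ _] _ h s sr; apply: TK'; exact: h. Qed.
Let Tcomm X Y : real_lie TR X -> real_lie TR Y -> X *m Y = Y *m X.
Proof. by case: maxT => -[_ _ cm] _; exact: commuting_lie. Qed.
Let lieK_in X : real_lie K X -> X \in g. Proof. exact: (lieK_g aG gP KG). Qed.

Lemma daggerD X Y : dagger b (X + Y) = dagger b X + dagger b Y.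
Proof. by rewrite /dagger mulmxDr mulmxDl adjD mulmxDr mulmxDl. Qed.
Lemma daggerZ c X : dagger b (c *: X) = c^* *: dagger b X.
Proof. by rewrite /dagger -scalemxAr -scalemxAl adjZ -scalemxAr -scalemxAl. Qed.
Lemma daggerM X Y : dagger b (X *m Y) = dagger b Y *m dagger b X.
Proof.
have e : b *m (X *m Y) *m invmx b = (b *m X *m invmx b) *m (b *m Y *m invmx b).
  by rewrite !mulmxA mulmxKV.
by rewrite /dagger e adjM !mulmxA mulmxK.
Qed.
Lemma daggerK X : dagger b (dagger b X) = X.
Proof.
rewrite /dagger; set A := (b *m X *m invmx b)^t*.
have -> : b *m (invmx b *m A *m b) *m invmx b = A by rewrite !mulmxA mulmxV // mul1mx mulmxK.
by rewrite /A trmxCK !mulmxA mulVmx // mul1mx mulmxKV.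
Qed.

Lemma torus_space : exists tC : {vspace 'M[C]_n.+1}, forall X,
  (exists Y Z, [/\ real_lie TR Y, real_lie TR Z & X = Y + 'i *: Z]) <-> X \in tC.
Proof.
apply: vspace_of_set => [|X X' [Y [Z [hY hZ ->]]] [Y' [Z' [hY' hZ' ->]]]|a X [Y [Z [hY hZ ->]]]].
- exists 0, 0; rewrite scaler0 addr0; split=> //; exact: real_lie0.
- exists (Y + Y'), (Z + Z'); split; [exact: real_lieD | exact: real_lieD |].
  by rewrite scalerDr addrACA.
- exists (io (re a) *: Y + io (- im a) *: Z), (io (im a) *: Y + io (re a) *: Z).
  split; try by apply: real_lieD => //; exact: real_lieZ.
  rewrite {1}[a]reim scalerDl !scalerDr !scalerA mulrAC -expr2 sqrCi mulN1r rmorphN.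
  rewrite ['i * io (im a)]mulrC [io (re a) * 'i]mulrC -!addrA; congr (_ + _).
  by rewrite addrCA [RHS]addrCA; congr (_ + _); exact: addrC.
Qed.

Variable tC : {vspace 'M[C]_n.+1}.
Hypothesis tCP : forall X,
  (exists Y Z, [/\ real_lie TR Y, real_lie TR Z & X = Y + 'i *: Z]) <-> X \in tC.

Lemma torusE t : T t <-> exists2 H, H \in tC & t = expm H.
Proof.
rewrite hT; split=> [[X hX [Y hY <-]]|[H /tCP [Y [Z [hY hZ ->]]] ->]]; last by exists Y => //; exists Z.
by exists (X + 'i *: Y) => //; apply/tCP; exists X, Y.
Qed.

Lemma torus_g X : X \in tC -> X \in g.
Proof.
by move=> /tCP [Y [Z [hY hZ ->]]]; rewrite rpredD ?rpredZ // lieK_in //; exact: TK.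
Qed.

Lemma torus_comm X Y : X \in tC -> Y \in tC -> X *m Y = Y *m X.
Proof.
move=> /tCP [A [B [hA hB ->]]] /tCP [D [E [hD hE ->]]].
rewrite !mulmxDl !mulmxDr -!scalemxAl -!scalemxAr -?scalemxAl.
rewrite (Tcomm hA hD) (Tcomm hA hE) (Tcomm hB hD) (Tcomm hB hE).
by rewrite -!addrA; congr (_ + _); rewrite addrCA.
Qed.

Lemma torus_lie X : X \in tC -> lie_algebra T X.
Proof. by move=> Xt s; apply/torusE; exists (s *: X) => //; exact: rpredZ. Qed.

Lemma torus_G t : T t -> G t.
Proof. by move=> /torusE [H /torus_g /gP /(_ 1) + ->]; rewrite scale1r. Qed.

Lemma torus_subgroup : subgroup T.
Proof.
split=> [t /torus_G /GU //||s t /torusE [X Xt ->] /torusE [Y Yt ->]|t /torusE [X Xt ->]].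
- by apply/torusE; exists 0; rewrite ?mem0v // expm0.
- by apply/torusE; exists (X + Y); rewrite ?rpredD // expmD //; exact: torus_comm.
- by apply/torusE; exists (- X); rewrite ?rpredN // invmx_expm.
Qed.

(** Skew and hermitian parts for [dagger b]; they are combinations of [X] and [dagger b X], so
    whatever commutes with both commutes with them. *)
Lemma real_split X : X \in g -> exists Y Z, [/\ real_lie K Y, real_lie K Z,
  X = Y + 'i *: Z & forall H, H *m X = X *m H -> H *m dagger b X = dagger b X *m H ->
    H *m Y = Y *m H /\ H *m Z = Z *m H].
Proof.
move=> Xg; have i0 : ('i : C) != 0 := neq0Ci C.
pose Y := 2^-1 *: (X - dagger b X); pose Z := (2 * 'i)^-1 *: (X + dagger b X).
have c2 : (2^-1 : C)^* = 2^-1 by rewrite fmorphV rmorph_nat.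
have dN A : dagger b (- A) = - dagger b A by rewrite -scaleN1r daggerZ rmorphN1 scaleN1r.
have comm (c : C) (A H : 'M[C]_n.+1) : H *m A = A *m H -> H *m (c *: A) = (c *: A) *m H.
  by move=> e; rewrite -scalemxAr -scalemxAl e.
exists Y, Z; split.
- apply: skewK; first by rewrite rpredZ // rpredB // gdag.
  by rewrite /Y daggerZ daggerD dN daggerK c2 -scalerN opprB.
- apply: skewK; first by rewrite rpredZ // rpredD // gdag.
  rewrite /Z daggerZ daggerD daggerK fmorphV rmorphM /= conjCi rmorph_nat mulrN invrN scaleNr.
  by rewrite [dagger b X + X]addrC.
- rewrite /Y /Z scalerA invfM mulrCA mulfV // mulr1 -scalerDr addrACA addNr addr0.
  by rewrite -[X + X]mulr2n -(scaler_nat 2 X) scalerA mulVf ?scale1r // pnatr_eq0.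
- move=> H h1 h2; split; apply: comm; first by rewrite mulmxBr mulmxBl h1 h2.
  by rewrite mulmxDr mulmxDl h1 h2.
Qed.

(** The zero weight space of [g] is the complexified torus: the two parts of [X] lie in the Lie
    algebra of [K] and commute with the torus, so maximality applies to each. *)
Lemma torus_centralizer X : X \in g -> (forall H, real_lie TR H -> H *m X = X *m H) -> X \in tC.
Proof.
move=> Xg hX; have dX H : real_lie TR H -> H *m dagger b X = dagger b X *m H.
  move=> hH; have := congr1 (dagger b) (hX H hH); rewrite !daggerM (Kskew (TK hH)).
  by rewrite mulmxN mulNmx => /oppr_inj ->.
have [Y [Z [KY KZ e comm]]] := real_split Xg.
have cYZ H (hH : real_lie TR H) := comm H (hX H hH) (dX H hH).
apply/tCP; exists Y, Z; split=> //.
- by apply: (maximal_torus_centralizer sK cK maxT KY) => H /cYZ [].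
- by apply: (maximal_torus_centralizer sK cK maxT KZ) => H /cYZ [].
Qed.

Lemma eigen_span (Hs : seq 'M[C]_n.+1) X : (forall H, H \in Hs -> exists a, br H X = a *: X) ->
  (forall i : 'I_(\dim tC), exists Y Z, [/\ Y \in Hs, Z \in Hs & (vbasis tC)`_i = Y + 'i *: Z]) ->
  forall H, H \in tC -> exists a, br H X = a *: X.
Proof.
move=> hX hb; pose Q H := exists a, br H X = a *: X.
have QD H H' : Q H -> Q H' -> Q (H + H').
  by move=> [a ha] [c hc]; exists (a + c); rewrite brDl ha hc scalerDl.
have QZ c H : Q H -> Q (c *: H).
  by move=> [a ha]; exists (c * a); rewrite brZl ha scalerA.
have Q0 : Q 0 by exists 0; rewrite scale0r /br mul0mx mulmx0 subrr.
move=> H Ht; rewrite -/(Q H) (coord_vbasis Ht); apply: (big_ind Q) => // i _; apply: (QZ).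
have [Y [Z [YH ZH ->]]] := hb i; apply: (QD); first exact: hX.
by apply: (QZ); exact: hX.
Qed.

Section RootVector.
Variables (X : 'M[C]_n.+1) (a : 'M[C]_n.+1 -> C).
Hypothesis Xg : X \in g.
Hypothesis Xa : forall H, H \in tC -> br H X = a H *: X.
Variables (i j : 'I_n.+1).
Hypothesis Xij : X i j != 0.

(** The eigenvalue is read off a nonzero entry of [X], which makes the character visibly regular;
    the value 0 outside [T] is the convention of [weight]. *)
Definition root_character (t : 'M[C]_n.+1) : C :=
  if `[< T t >] then (t *m X *m invmx t) i j / X i j else 0.

Lemma root_characterE H : H \in tC -> root_character (expm H) = expc (a H).
Proof.
move=> Ht; rewrite /root_character asboolT; last by apply/torusE; exists H.
by rewrite (expm_eigen (Xa Ht)) mxE mulfK.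
Qed.

Lemma root_character_conj t : T t -> t *m X *m invmx t = root_character t *: X.
Proof.
by move=> /torusE [H Ht ->]; rewrite root_characterE // (expm_eigen (Xa Ht)).
Qed.

Lemma root_character_weight : weight T root_character.
Proof.
have [_ T1 TM _] := torus_subgroup; have inT t : T t -> exists2 H, H \in tC & t = expm H by move/torusE.
split=> [||s t /inT [A At ->] /inT [B Bt ->]|t nT].
- have [p [k [pp hp]]] := regular_conj redG X i j.
  exists (fun t => p t * (X i j)^-1), k; split; first by apply: polyfM => //; exact: polyf_cst.
  move=> t Tt; rewrite /root_character asboolT // hp; last exact: torus_G.
  by rewrite mulrAC.
- by rewrite -(@expm0 R S) root_characterE ?mem0v // -[X in expc X]/(a 0);
    have := Xa (mem0v tC); rewrite /br mul0mx mulmx0 subrr => /esym/eqP; rewrite scaler_eq0;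
    case/orP => [/eqP ->|/eqP X0]; [exact: expc0 | move: Xij; rewrite X0 mxE eqxx].
- have sAB : br (A + B) X = (a A + a B) *: X by rewrite brDl !Xa // scalerDl.
  rewrite -expmD; last exact: torus_comm.
  rewrite !root_characterE ?rpredD // -expcD; congr expc.
  apply: (mulIf Xij); have := congr1 (fun M : 'M[C]_n.+1 => M i j) (etrans (esym (Xa (rpredD At Bt))) sAB).
  by rewrite !mxE.
- by rewrite /root_character asboolF.
Qed.

Lemma root_character_differential H : H \in tC -> differential root_character H = a H.
Proof.
move=> Ht; apply: (@derive1_expc) => s; rewrite root_characterE ?rpredZ //; congr expc.
apply: (mulIf Xij); have e : br (s *: H) X = (s * a H) *: X by rewrite brZl Xa // scalerA.
have := congr1 (fun M : 'M[C]_n.+1 => M i j) (etrans (esym (Xa (rpredZ s Ht))) e).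
by rewrite !mxE.
Qed.

Lemma root_character_root H : H \in tC -> a H != 0 -> Defs.root G T root_character.
Proof.
move=> Ht aH; split; first exact: root_character_weight.
- by exists H; [exact: torus_lie | rewrite root_character_differential].
- exists X; split; [exact/gP | | exact: root_character_conj].
  by apply: contraNneq Xij => ->; rewrite mxE.
Qed.
End RootVector.

(** The weight vectors [x k] are indexed by [s], with [jj] the summand and [lam] the weight. The
    same weight may occur in several summands, so both are recorded. *)
Variables (J I : eqType) (s : seq I) (jj : I -> J) (lam : I -> 'M[C]_n.+1 -> C) (x : I -> 'cV[C]_m).
Variable U : J -> {vspace 'cV[C]_m}.
Hypothesis s_uniq : uniq s.
Hypothesis jlam_inj : forall k l, k \in s -> l \in s -> jj k = jj l -> lam k = lam l -> k = l.
Hypothesis lam_weight : forall k, k \in s -> weight T (lam k).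
Hypothesis x_weight : forall k t, k \in s -> T t -> r t *m x k = lam k t *: x k.
Hypothesis xU : forall k, k \in s -> x k \in U (jj k).
Hypothesis U_stable : forall j a u, G a -> u \in U j -> r a *m u \in U j.
Hypothesis U_ortho : forall k l u, k \in s -> l \in s -> jj k != jj l -> u \in U (jj k) -> ip u (x l) = 0.
Hypothesis weight_ortho : forall l u nu, l \in s -> u \in U (jj l) -> weight T nu ->
  (forall t, T t -> r t *m u = nu t *: u) -> nu <> lam l -> ip u (x l) = 0.
Hypothesis no_adjacent : forall k l, k \in s -> l \in s -> jj k = jj l -> ~ root_adjacent G T (lam l) (lam k).
Hypothesis balanced : forall X, lie_algebra T X ->
  \sum_(k <- s) ip (x k) (x k) * differential (lam k) X = 0.

Let w := \sum_(k <- s) x k.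

Lemma U_dr X k u : X \in g -> u \in U k -> dr X *m u \in U k.
Proof.
move=> Xg uU; have ep (l : nat) : 0 < l.+1%:R^-1 :> R by rewrite invr_gt0.
apply: (vspace_cvm _ (cvmM (expm_quot (cvm_cst (dr X)) (@cvg0_inv R) ep) (cvm_cst u))) => l.
rewrite -scalemxAl rpredZ // mulmxBl mul1mx rpredB // -rdr; last exact: (g_real gP Xg).
by apply: U_stable => //; move/gP: Xg; exact.
Qed.

Lemma torus_critical X : X \in tC -> ip (dr X *m w) w = 0.
Proof.
move=> Xt; have TX := torus_lie Xt; have Xg := torus_g Xt.
have dx k : k \in s -> dr X *m x k = differential (lam k) X *: x k.
  move=> ks; have [a ha] := weight_exponent torus_subgroup (lam_weight ks).
  rewrite (differential_exponent (ha X TX)); apply: expm_scaling => t.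
  by rewrite -rdr; [rewrite x_weight // ha | exact: (g_real gP Xg)].
rewrite /w mulmx_sumr ip_suml -[RHS](balanced TX); apply: eq_big_seq => k ks.
rewrite dx // ipZl mulrC; congr (_ * _); rewrite ip_sumr (bigD1_seq k) //= big1_seq ?addr0 // => l /andP [lk ls].
have [jkl|jkl] := eqVneq (jj k) (jj l); last by apply: (U_ortho ks ls jkl); exact: xU.
apply: (weight_ortho (nu := lam k)) => //; first by rewrite -jkl; exact: xU.
- exact: lam_weight.
- by move=> t Tt; exact: x_weight.
- by move=> e; move: lk; rewrite (jlam_inj ks ls jkl e) eqxx.
Qed.

(** [dr X] moves [x k] to the weight [al * lam k] within its summand. Orthogonality to [x l] could
    fail only in that summand and for [lam l] equal to that weight, that is for a root-adjacent
    pair. *)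
Lemma root_critical X a H : X \in g -> (forall H, H \in tC -> br H X = a H *: X) ->
  H \in tC -> a H != 0 -> ip (dr X *m w) w = 0.
Proof.
move=> Xg Xa Ht aH; have [->|/matrix0Pn [i [j Xij]]] := eqVneq X 0.
  by rewrite linear0 mul0mx ip0l.
have rt := root_character_root Xg Xa Xij Ht aH; have [wa _ _] := rt.
set al := root_character X i j in rt wa.
rewrite /w mulmx_sumr ip_suml big1_seq // => k /andP [_ ks]; rewrite ip_sumr big1_seq // => l /andP [_ ls].
have uU : dr X *m x k \in U (jj k) by apply: U_dr => //; exact: xU.
have [jkl|jkl] := eqVneq (jj k) (jj l); last exact: U_ortho uU.
rewrite jkl in uU.
apply: (weight_ortho (nu := fun t => al t * lam k t)) => //.
- exact: weight_mul torus_subgroup wa (lam_weight ks).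
- move=> t Tt; have Gt := torus_G Tt; have ru := rep_unit sG r1 rM Gt.
  have := dr_conj aG gP r1 rM rdr Gt Xg; rewrite (root_character_conj Xa Xij Tt) linearZ -/al => e.
  have e2 : r t *m dr X = al t *: (dr X *m r t) by rewrite -[LHS](mulmxKV ru) -e scalemxAl.
  by rewrite mulmxA e2 -scalemxAl -mulmxA x_weight // -scalemxAr scalerA.
- move=> e; apply: (no_adjacent ks ls jkl); exists al => // Y TY.
  by rewrite -e (differential_mul torus_subgroup wa (lam_weight ks) TY) addrK.
Qed.

(** [g] is spanned by joint eigenvectors of the torus: one with a nonzero eigenvalue is a root
    vector, and one with all eigenvalues 0 commutes with the torus, so it lies in [tC]. *)
Theorem balanced_critical X : X \in g -> ip (dr X *m w) w = 0.
Proof.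
have /choice [f hf] (i : 'I_(\dim tC)) : exists YZ : 'M[C]_n.+1 * 'M[C]_n.+1,
    [/\ real_lie TR YZ.1, real_lie TR YZ.2 & (vbasis tC)`_i = YZ.1 + 'i *: YZ.2].
  have /tCP [Y [Z [hY hZ e]]] : (vbasis tC)`_i \in tC by apply: vbasis_mem; rewrite mem_nth // size_tuple.
  by exists (Y, Z).
pose Hs := [seq (f i).1 | i <- enum 'I_(\dim tC)] ++ [seq (f i).2 | i <- enum 'I_(\dim tC)].
have HsT H : H \in Hs -> real_lie TR H.
  by rewrite mem_cat => /orP [] /mapP [i _ ->]; have [h1 h2 _] := hf i.
have Hsb (i : 'I_(\dim tC)) : exists Y Z, [/\ Y \in Hs, Z \in Hs & (vbasis tC)`_i = Y + 'i *: Z].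
  have [_ _ e] := hf i; exists (f i).1, (f i).2; split=> //; rewrite mem_cat; apply/orP; [left | right];
    by apply/mapP; exists i; rewrite ?mem_enum.
move: X; apply: (joint_eigen_ind (Hs := Hs) (Q := fun X => ip (dr X *m w) w = 0)) => [H /HsT hH|H H' /HsT hH /HsT hH'|H Y /HsT hH Yg||Y Z hY hZ|Y Yg hY].
- apply: (skew_semisimple bu); have := Kskew (TK hH); rewrite /dagger => e.
  have -> : (b *m H *m invmx b)^t* = b *m (invmx b *m (b *m H *m invmx b)^t* *m b) *m invmx b.
    by rewrite !mulmxA mulmxV // mul1mx mulmxK.
  by rewrite e mulmxN mulNmx.
- exact: Tcomm.
- by apply: (lie_br redG gP) => //; apply: lieK_in; exact: TK.
- by rewrite linear0 mul0mx ip0l.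
- by rewrite linearD mulmxDl ipDl hY hZ addr0.
have /choice [a ha] (H : 'M[C]_n.+1) : exists a, H \in tC -> br H Y = a *: Y.
  have [Ht|] := boolP (H \in tC); last by exists 0.
  by have [a ha] := eigen_span hY Hsb Ht; exists a.
have [[H [Ht aH]]|no] := pselect (exists H, H \in tC /\ a H != 0); first exact: root_critical Yg ha Ht aH.
apply: torus_critical; apply: torus_centralizer => // H hH.
have Ht : H \in tC by apply/tCP; exists H, 0; rewrite scaler0 addr0; split=> //; exact: real_lie0.
have aH : a H = 0 by apply/eqP; apply: contrapT => /negP aH; apply: no; exists H.
by have := ha H Ht; rewrite aH scale0r /br => /eqP; rewrite subr_eq0 => /eqP.
Qed.
End BalancedCritical.

(** * Orthonormal coordinates for the direct sum form *)

Section OrthonormalCoordinates.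
Variable V : vectType C.
Local Notation m := (\dim {:V}).

Lemma re_gt0 (z : C) : 0 < z -> 0 < re z.
Proof.
by move=> z0; rewrite -(io_gt0 (S := S)) reE (Creal_ReP _ (gtr0_real z0)).
Qed.

Lemma orthonormal_coordinates (D : V -> V -> C) :
  (forall a u v x, D (a *: u + v) x = a * D u x + D v x) ->
  (forall u v, (D u v)^* = D v u) -> (forall v, v != 0 -> 0 < D v v) ->
  exists (c : {linear V -> 'cV[C]_m}) (ci : {linear 'cV[C]_m -> V}),
    [/\ cancel c ci, cancel ci c & forall u v, ip (c u) (c v) = D u v].
Proof.
move=> Dl DJ D0; pose e (i : 'I_m) : V := (vbasis {:V})`_i.
have Dr a u v x : D x (a *: u + v) = a^* * D x u + D x v.
  by rewrite -DJ Dl rmorphD rmorphM /= !DJ.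
have D0l x : D 0 x = 0 by have := Dl 1 0 0 x; rewrite scaler0 addr0 mul1r => /eqP;
  rewrite -subr_eq0 opprD addNKr oppr_eq0 => /eqP.
have D0r x : D x 0 = 0 by rewrite -DJ D0l conjC0.
have Dsuml (F : 'I_m -> C) (E : 'I_m -> V) x : D (\sum_i F i *: E i) x = \sum_i F i * D (E i) x.
  by elim/big_rec2: _ => [|i a u _ <-]; rewrite ?D0l ?Dl.
have Dsumr (F : 'I_m -> C) (E : 'I_m -> V) x : D x (\sum_i F i *: E i) = \sum_i (F i)^* * D x (E i).
  by elim/big_rec2: _ => [|i a u _ <-]; rewrite ?D0r ?Dr.
pose co (v : V) : 'cV[C]_m := \col_i coord (vbasis {:V}) i v.
pose EX (x : 'cV[C]_m) : V := \sum_i x i 0 *: e i.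
have coK v : EX (co v) = v.
  by rewrite [RHS](coord_vbasis (memvf v)); apply: eq_bigr => i _; rewrite mxE.
have EXK x : co (EX x) = x.
  by apply/matrixP => i j; rewrite ord1 mxE coord_sum_free //; exact: basis_free (vbasisP _).
have EXl : linear EX.
  move=> a x y; rewrite scaler_sumr -big_split; apply: eq_bigr => i _.
  by rewrite !mxE scalerDl scalerA.
have col : linear co by move=> a u v; apply/matrixP => i j; rewrite !mxE linearP.
pose N : 'M[C]_m := \matrix_(i, j) D (e j) (e i).
have hN : N^t* = N by apply/matrixP => i j; rewrite !mxE DJ.
have ipN x y : ip (N *m x) y = D (EX x) (EX y).
  rewrite [D _ (EX y)]Dsumr /ip; apply: eq_bigr => i _; rewrite big_ord1 !mxE Dsuml mulrC.
  by congr (_ * _); apply: eq_bigr => j _; rewrite mxE mulrC.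
have [v v0|a [au aa]] := posdef_factor hN.
  rewrite ipN; apply/re_gt0/D0; apply: contra_neq v0 => h.
  by rewrite -(EXK v) h; apply/matrixP => i j; rewrite !mxE linear0.
have cl : linear (fun v => a *m co v) by move=> k u v; rewrite col linearP.
have il : linear (fun y => EX (invmx a *m y)) by move=> k x y; rewrite linearP EXl.
pose lc : {linear V -> 'cV[C]_m} := HB.pack (fun v => a *m co v) (GRing.isLinear.Build C _ _ _ _ cl).
pose li : {linear 'cV[C]_m -> V} := HB.pack (fun y => EX (invmx a *m y)) (GRing.isLinear.Build C _ _ _ _ il).
exists lc, li; split=> [v|y|u v] /=.
- by rewrite mulKmx.
- by rewrite EXK mulKVmx.
- by rewrite ip_mulmx mulmxA aa -{1}hN -ip_mulmx ipN !coK.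
Qed.

Variables (n : nat) (rho : 'M[C]_n -> 'End(V)) (c : {linear V -> 'cV[C]_m}) (ci : {linear 'cV[C]_m -> V}).

Definition coord_rep (g : 'M[C]_n) : 'M[C]_m := \matrix_(i, k) (c (rho g (ci (delta_mx k 0)))) i 0.

Lemma coord_repE g y : coord_rep g *m y = c (rho g (ci y)).
Proof.
apply/matrixP => i j; rewrite ord1 mxE.
have {2}-> : y = \sum_k y k 0 *: delta_mx k 0.
  by rewrite {1}[y]matrix_sum_delta; apply: eq_bigr => k _; rewrite big_ord1.
rewrite !linear_sum summxE; apply: eq_bigr => k _.
by rewrite !linearZ mxE [in RHS]mxE mulrC.
Qed.
End OrthonormalCoordinates.

Section DirectSumForm.
Variables (V : vectType C) (J : finType) (Wj : J -> {vspace V}).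
Hypothesis hsum : (\sum_j Wj j)%VS = {:V}%VS.
Hypothesis hdirect : directv (\sum_j Wj j).
Variable h : forall j, {dot subvs_of (Wj j) for Num.conj}.
Local Notation comp := (component Wj).
Local Notation D := (direct_sum_form h).

Lemma component_in j v : comp j v \in Wj j.
Proof. exact: memv_sum_pi. Qed.

Lemma component_sum v : \sum_j comp j v = v.
Proof. by apply: sumv_pi_sum; rewrite hsum memvf. Qed.

Lemma component_uniq (us : J -> V) v j : (forall i, us i \in Wj i) -> \sum_i us i = v -> comp j v = us j.
Proof.
move=> usW e; have /directv_sum_unique u := hdirect.
have /(_ (fun i _ => component_in i v) (fun i _ => usW i)) := u (fun i => comp i v) us.
by rewrite component_sum e eqxx => /esym /forallP /(_ j) /eqP.
Qed.

Lemma component_self j v : v \in Wj j -> comp j v = v.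
Proof.
move=> vj; have := @component_uniq (fun i => if i == j then v else 0) v j; rewrite eqxx; apply.
  by move=> i; case: eqP => [->|_] //; exact: mem0v.
by rewrite -big_mkcond big_pred1_eq.
Qed.

Lemma component_other j i v : v \in Wj j -> i != j -> comp i v = 0.
Proof.
move=> vj ij; have := @component_uniq (fun i => if i == j then v else 0) v i; rewrite (negPf ij); apply.
  by move=> k; case: eqP => [->|_] //; exact: mem0v.
by rewrite -big_mkcond big_pred1_eq.
Qed.

Lemma component_linear j a u v : comp j (a *: u + v) = a *: comp j u + comp j v.
Proof. exact: linearP. Qed.

Lemma component_map (f : 'End(V)) j v : (forall i, (f @: Wj i <= Wj i)%VS) -> comp j (f v) = f (comp j v).
Proof.
move=> fW; apply: (component_uniq (us := fun i => f (comp i v))).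
  by move=> i; apply: (subvP (fW i)); apply: memv_img; exact: component_in.
by rewrite -linear_sum component_sum.
Qed.

Lemma form_linear a u v x : D (a *: u + v) x = a * D u x + D v x.
Proof.
rewrite /direct_sum_form mulr_sumr -big_split; apply: eq_bigr => j _.
by rewrite component_linear linearP linearDl linearZl_LR.
Qed.

Lemma form_conj u v : (D u v)^* = D v u.
Proof.
rewrite /direct_sum_form rmorph_sum; apply: eq_bigr => j _.
by rewrite [RHS]hermC expr0 mul1r.
Qed.

Lemma form_gt0 v : v != 0 -> 0 < D v v.
Proof.
move=> v0; have p j : 0 <= h j (vsproj (Wj j) (comp j v)) (vsproj (Wj j) (comp j v)) by exact: dnorm_ge0.
rewrite lt_def sumr_ge0 ?andbT // /direct_sum_form psumr_neq0 //.
have [j vj] : exists j, comp j v != 0.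
  apply: contrapT => no; move: v0; rewrite -(component_sum v) big1 ?eqxx // => j _.
  by apply/eqP; apply: contrapT => /negP nj; apply: no; exists j.
apply/hasP; exists j; rewrite ?mem_index_enum //= dnorm_gt0.
apply: contra_neq vj => e; by rewrite -(vsprojK (component_in j v)) e linear0.
Qed.

Lemma form_ortho j i u v : u \in Wj j -> v \in Wj i -> j != i -> D u v = 0.
Proof.
move=> uj vi ji; rewrite /direct_sum_form big1 // => k _.
have [ki|ki] := eqVneq k i; last by rewrite (component_other vi ki) linear0 linear0r.
by rewrite (component_other uj) ?ki 1?eq_sym // linear0 linear0l.
Qed.

Variables (n : nat) (K T : set 'M[C]_n) (rho : 'M[C]_n -> 'End(V)).
Hypothesis hcomp : forall j, compatible_form K T (subrep rho (Wj j)) (h j).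

Lemma subrepE g j v : (forall i, (rho g @: Wj i <= Wj i)%VS) ->
  vsproj (Wj j) (comp j (rho g v)) = subrep rho (Wj j) g (vsproj (Wj j) (comp j v)).
Proof.
move=> gW; have l : linear (fun u : subvs_of (Wj j) => vsproj (Wj j) (rho g (vsval u))).
  by move=> a u u'; rewrite !linearP.
rewrite component_map // -[in LHS](vsprojK (component_in j v)).
exact/esym/(lfunE (HB.pack (fun u : subvs_of (Wj j) => vsproj (Wj j) (rho g (vsval u))) (GRing.isLinear.Build C _ _ _ _ l))).
Qed.

Lemma form_invariant k u v : (forall i, (rho k @: Wj i <= Wj i)%VS) -> K k ->
  D (rho k u) (rho k v) = D u v.
Proof.
move=> kW Kk; apply: eq_bigr => j _; rewrite !subrepE //.
by have [inv _] := hcomp j; rewrite inv.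
Qed.

Lemma form_weight_ortho lam mu u v : (forall t i, T t -> (rho t @: Wj i <= Wj i)%VS) ->
  weight T lam -> weight T mu -> lam <> mu ->
  weight_space T rho lam u -> weight_space T rho mu v -> D u v = 0.
Proof.
move=> TW wl wm lm ul vm; rewrite /direct_sum_form big1 // => j _.
have [_ ort] := hcomp j; apply: (ort lam mu) => // t Tt.
  by rewrite -subrepE => [|i]; [rewrite (ul t Tt) /component !linearZ | exact: TW].
by rewrite -subrepE => [|i]; [rewrite (vm t Tt) /component !linearZ | exact: TW].
Qed.
End DirectSumForm.

(** * Transfer of closedness from coordinates to the representation space *)

Section ClosedOrbit.

Lemma point_closed (V : vectType C) (w : V) : zariski_closed [set w].
Proof.
exists [set f | exists i, f = fun v => coord (vbasis {:V}) i v - coord (vbasis {:V}) i w].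
  by move=> _ [i ->]; apply: polyfB; [exact: polyf_coord | exact: polyf_cst].
rewrite eqEsubset; split=> [_ -> _ [i ->]|v hv]; first by rewrite subrr.
rewrite /= (coord_vbasis (memvf v)) (coord_vbasis (memvf w)); apply: eq_bigr => i _; congr (_ *: _).
by apply/eqP; rewrite -subr_eq0; apply/eqP; apply: (hv (fun v => _ - _)); exists i.
Qed.

Lemma linear_preimage_closed (V : vectType C) m (c : {linear V -> 'cV[C]_m}) (Z : set 'cV[C]_m) :
  zariski_closed Z -> zariski_closed [set v | Z (c v)].
Proof.
move=> [F Fp ->]; exists [set f \o c | f in F].
  move=> _ [f Ff <-]; apply: (polyf_compmx (Fp _ Ff)) => i j.
  apply: (@polyf_ext _ _ (fun v => \sum_k coord (vbasis {:V}) k v * c (vbasis {:V})`_k i j)) => [v|].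
    rewrite [in RHS](coord_vbasis (memvf v)) linear_sum summxE.
    by apply: eq_bigr => k _; rewrite linearZ mxE.
  by apply: polyf_sum => k; apply: polyfM; [exact: polyf_coord | exact: polyf_cst].
rewrite eqEsubset; split=> v /= hv f; first by move=> [f' Ff <-]; exact: hv.
by move=> Ff; apply: (hv (f \o c)); exists f.
Qed.

Lemma finite_sum_seq (I : choiceType) (A : set I) : finite_set A -> exists s : seq I,
  [/\ uniq s, forall x, x \in s <-> A x &
    forall (V : nmodType) (F : I -> V), \sum_(x \in A) F x = \sum_(x <- s) F x].
Proof.
move=> fin; exists (finmap.enum_fset (fset_set A)); split=> [|x|V F]; last exact: fsbig_finite.
  exact: finmap.fset_uniq.
by have := in_fset_set fin x; rewrite -topredE /= => ->; rewrite inE.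
Qed.

Section Positive.
Variables (n : nat) (G K TR T : set 'M[C]_n.+1).
Hypothesis hG : reductive G.
Hypothesis hGconn : zariski_connected G.
Hypothesis hK : maximal_compact_subgroup K G.
Hypothesis hTR : maximal_torus TR K.
Hypothesis hT : T = torus_complexification TR.
Variables (W : vectType C) (rho : 'M[C]_n.+1 -> 'End(W)).
Hypothesis hrho : representation G rho.
Variables (w : W) (J : finType) (Wj : J -> {vspace W}).
Hypothesis hWsub : forall j, invariant_subspace G rho (Wj j).
Hypothesis hWsum : (\sum_j Wj j)%VS = {:W}%VS.
Hypothesis hWdirect : directv (\sum_j Wj j).
Variable h : forall j, {dot subvs_of (Wj j) for Num.conj}.
Hypothesis hh : forall j, compatible_form K T (subrep rho (Wj j)) (h j).
Variable wc : J -> ('M[C]_n.+1 -> C) -> W.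
Hypothesis hwc : forall j, weight_decomposition T rho (component Wj j w) (wc j).
Hypothesis huncramped : forall j, uncramped G T (supp (wc j)).
Hypothesis hbalanced : forall X, lie_algebra T X ->
  \sum_j \sum_(lam \in supp (wc j))
    direct_sum_form h (wc j lam) (wc j lam) * differential lam X = 0.

Let TG t : T t -> G t.
Proof.
have aG : algebraic_group G by case: hG.
have [g gP] := lie_space aG; have [tC tCP] := @torus_space _ K TR hTR.
have KG : K `<=` G by case: hK => -[].
by apply: torus_G; [exact: hG | exact: gP | exact: KG | exact: hTR | exact: hT | exact: tCP].
Qed.

Let D := direct_sum_form h.

(* [component j (wc j lam)] is another weight decomposition of [component j w]. *)
Lemma weight_component_in j lam : supp (wc j) lam -> wc j lam \in Wj j.
Proof.
move=> slam; have [sw ws fin e] := hwc j.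
have [s [us sP ss]] := finite_sum_seq fin.
pose v mu := wc j mu - component Wj j (wc j mu).
have stab t i : T t -> (rho t @: Wj i <= Wj i)%VS by move=> /TG; exact: hWsub.
have vw mu : supp (wc j) mu -> weight_space T rho mu (v mu).
  move=> smu t Tt; rewrite /v linearB /= (ws mu smu t Tt) scalerBr; congr (_ - _).
  rewrite -(component_map hWsum hWdirect); last by move=> i; exact: stab.
  by rewrite (ws mu smu t Tt) /component linearZ.
have s0 : \sum_(mu <- s) v mu = 0.
  rewrite /v sumrB -ss -e /component -linear_sum /=.
  rewrite -ss -e; apply/eqP; rewrite subr_eq0; apply/eqP/esym.
  exact: component_self (component_in _ _ _).
have v0 : D (v lam) (v lam) = 0.
  have := congr1 (fun u => D u (v lam)) s0.
  have D0 : D 0 (v lam) = 0.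
    have := form_linear h 1 0 0 (v lam); rewrite -/(D _ _) scaler0 addr0 mul1r => /eqP.
    by rewrite -subr_eq0 opprD addNKr oppr_eq0 => /eqP.
  have Ds (r : seq _) : D (\sum_(mu <- r) v mu) (v lam) = \sum_(mu <- r) D (v mu) (v lam).
    elim: r => [|mu r IH]; first by rewrite !big_nil.
    by rewrite !big_cons -IH -[v mu in LHS]scale1r /D form_linear mul1r.
  rewrite /= D0 Ds (bigD1_seq lam) //=; last exact/sP.
  rewrite big1_seq ?addr0 // => mu /andP [mul mus].
  have smu : supp (wc j) mu by exact/sP.
  apply: (form_weight_ortho hWsum hWdirect hh (lam := mu) (mu := lam)); [by move=> t i; exact: stab | | | | |].
  - exact: sw.
  - exact: sw.
  - by apply/eqP.
  - exact: vw.
  - exact: vw.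
have [vz|vz] := eqVneq (v lam) 0; last by have := form_gt0 hWsum h vz; rewrite -/(D _ _) v0 ltxx.
by move/eqP: vz; rewrite subr_eq0 => /eqP ->; exact: component_in.
Qed.
Theorem closed_orbit : zariski_closed [set rho g w | g in G].
Proof.
have aG : algebraic_group G by case: hG.
have sG : subgroup G by case: aG.
have [[sK KG cK] _] := hK.
have [g gP] := lie_space aG; have [z zP] := center_space g.
have [b [bu bK bG gdag]] := compact_form hG hGconn hK gP zP.
have eb t X : expm (io t *: (b *m X *m invmx b)) = b *m expm (io t *: X) *m invmx b.
  by rewrite -expm_conj // -scalemxAr -scalemxAl.
have Kskew X : real_lie K X -> dagger b X = - X.
  move=> /real_lieP KX; rewrite /dagger.
  have -> : (b *m X *m invmx b)^t* = - (b *m X *m invmx b).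
    by apply/unitary_skew => t; rewrite eb; apply: bK.
  by rewrite mulmxN mulNmx !mulmxA mulVmx // mul1mx mulmxKV.
have skewK X : X \in g -> dagger b X = - X -> real_lie K X.
  move=> Xg dX; apply/real_lieP => t; apply: bG; first by have /gP := Xg; exact.
  rewrite -eb; move: t; apply/unitary_skew.
  have := congr1 (fun Y => b *m Y *m invmx b) dX.
  by rewrite /dagger !mulmxA mulmxV // mul1mx mulmxK // mulmxN mulNmx.
have [tC tCP] := torus_space hTR.
have [c [ci [cK' ciK cD]]] := orthonormal_coordinates (form_linear h) (form_conj h) (form_gt0 hWsum h).
pose r := coord_rep rho c ci.
have rE a v : r a *m c v = c (rho a v) by rewrite coord_repE cK'.
have [h1 hM hreg] := hrho.
have mxext p q (A B : 'M[C]_(p, q)) : (forall y : 'cV_q, A *m y = B *m y) -> A = B.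
  by move=> e; apply/matrixP => i j; have := congr1 (fun M : 'cV_p => M i 0) (e (delta_mx j 0)); rewrite -!colE !mxE.
have r1 : r 1%:M = 1%:M.
  by apply: mxext => y; rewrite -[y]ciK rE h1 id_lfunE mul1mx.
have rM a a' : G a -> G a' -> r (a *m a') = r a *m r a'.
  by move=> Ga Ga'; apply: mxext => y; rewrite -[y]ciK -mulmxA !rE hM // comp_lfunE.
have rreg i j : regular_on G (fun a => r a i j).
  have lin : linear (fun v => c v i 0 : C^o) by move=> k u v; rewrite linearP !mxE.
  pose phi : {linear W -> C^o} := HB.pack (fun v => c v i 0 : C^o) (GRing.isLinear.Build C _ _ _ _ lin).
  have [p [k [pp e]]] := hreg (linfun phi) (ci (delta_mx j 0)).
  by exists p, k; split=> // a Ga; rewrite -e // lfunE /= mxE.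
have stab a i : G a -> (rho a @: Wj i <= Wj i)%VS by exact: hWsub.
have ru k : K k -> (r k)^t* *m r k = 1%:M.
  move=> Kk; apply: mxext => y; rewrite mul1mx.
  suff e x : ip x ((r k)^t* *m r k *m y) = ip x y.
    apply/eqP; rewrite -subr_eq0 -(@fn_eq0 R S); apply/eqP/(@io_inj R S).
    by rewrite rmorph0 -ip_fn ipBr e subrr.
  rewrite -mulmxA -ip_mulmx -[x]ciK -[y]ciK !rE !cD.
  by apply: (form_invariant hWsum hWdirect hh) => // i; apply/stab/KG.
have [dr rdr] := rep_differential sG r1 rM rreg.
have gK X : X \in g -> exists Y Z, [/\ real_lie K Y, real_lie K Z & X = Y + 'i *: Z].
  by move=> /(real_split bu skewK gdag) [Y [Z [KY KZ e _]]]; exists Y, Z.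
have /boolp.choice [sj sjP] j := finite_sum_seq (let: And4 _ _ fin _ := hwc j in fin).
pose s := [seq (j, l) | j <- enum J, l <- sj j].
have sP k : k \in s -> supp (wc k.1) k.2.
  by move=> /allpairsPdep [j [l [_ lj ->]]]; have [_ m _] := sjP j; exact/m.
pose x (k : J * ('M[C]_n.+1 -> C)) := c (wc k.1 k.2).
have sum_s (V : nmodType) (F : J * ('M[C]_n.+1 -> C) -> V) :
    \sum_(k <- s) F k = \sum_j \sum_(l \in supp (wc j)) F (j, l).
  rewrite big_allpairs_dep big_enum; apply: eq_bigr => j _.
  by have [_ _ e] := sjP j; rewrite e.
have wE : \sum_(k <- s) x k = c w.
  rewrite -linear_sum sum_s /= -[w in RHS](component_sum hWsum); congr (c _).
  by apply: eq_bigr => j _; have [_ _ _ ->] := hwc j.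
pose U j := (linfun c @: Wj j)%VS.
have UP j u : u \in U j -> exists2 v, v \in Wj j & u = c v.
  by move=> /memv_imgP [v vj ->]; exists v; rewrite // lfunE.
have cU j v : v \in Wj j -> c v \in U j.
  by move=> vj; have := memv_img (linfun c) vj; rewrite lfunE.
have crit : forall X, X \in g -> ip (dr X *m c w) (c w) = 0.
  rewrite -wE; apply: (@balanced_critical _ _ G K TR T g r dr b hG gP sK cK KG hTR hT bu Kskew
    skewK gdag r1 rM rdr tC tCP _ _ s fst snd x U).
  - apply: allpairs_uniq_dep => [|j _|[j l] [j' l'] _ _ /= [-> ->]] //; first exact: enum_uniq.
    by have [] := sjP j.
  - by move=> [j l] [j' l'] _ _ /= -> ->.
  - by move=> k /sP; have [sub _ _ _] := hwc k.1; exact: sub.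
  - move=> k t /sP sk Tt; have [_ ws _ _] := hwc k.1.
    by rewrite /x rE (ws _ sk t Tt) linearZ.
  - by move=> k /sP sk; apply/cU/weight_component_in.
  - move=> j a u Ga /UP [v vj ->]; rewrite rE; apply/cU/(subvP (stab a j Ga)); exact: memv_img.
  - move=> k l u /sP sk /sP sl kl /UP [v vk ->]; rewrite cD.
    by apply: (form_ortho hWsum hWdirect h vk _ kl); exact: weight_component_in.
  - move=> l u nu /sP sl /UP [v vl ->] wnu vnu nl; rewrite cD.
    have [sub ws _ _] := hwc l.1.
    apply: (form_weight_ortho hWsum hWdirect hh (lam := nu) (mu := l.2)) => //.
    + by move=> t i /TG; exact: stab.
    + exact: sub.
    + by move=> t Tt; apply: (can_inj cK'); rewrite linearZ -rE vnu.
    + exact: ws.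
  - by move=> k l /sP sk /sP sl /= kl; apply: (huncramped (j := l.1)) => //; rewrite -kl.
  - move=> X TX; rewrite sum_s -[RHS](hbalanced TX); apply: eq_bigr => j _.
    by apply: eq_fsbigr => l _; rewrite /x cD.
have := critical_orbit_closed aG hGconn gP sK cK KG gK r1 rM rreg ru rdr crit.
move=> /(linear_preimage_closed c); congr zariski_closed.
rewrite eqEsubset; split=> v /= [a Ga]; last by move=> <-; exists a; rewrite ?rE.
by rewrite rE => /(can_inj cK') <-; exists a.
Qed.
End Positive.
End ClosedOrbit.
End ClosedOrbits.

Section ComplexNumbers.
Variable R : realType.

Let real_complex_le : {mono (real_complex R : R -> Cx R) : x y / x <= y}.
Proof. by move=> x y; rewrite lecR. Qed.

Let Re_real (z : Cx R) : z \is Num.real -> real_complex R (complex.Re z) = z.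
Proof. by move=> /complex_realP [x ->]. Qed.

Definition complex_realform : realform R :=
  @Realform R (Cx R) (real_complex R) (@complex.Re R) (fun x => erefl) Re_real real_complex_le.
End ComplexNumbers.

Theorem theorem6p4 (R : realType) (n : nat) (G K TR T : set 'M[Cx R]_n)
    (hG : reductive G) (hGconn : zariski_connected G)
    (hK : maximal_compact_subgroup K G)
    (hTR : maximal_torus TR K)
    (hT : T = torus_complexification TR)
    (W : vectType (Cx R)) (rho : 'M[Cx R]_n -> 'End(W))
    (hrho : representation G rho) (w : W)
    (J : finType) (Wj : J -> {vspace W})
    (hWsub : forall j, invariant_subspace G rho (Wj j))
    (hWsum : (\sum_j Wj j)%VS = {:W}%VS)
    (hWdirect : directv (\sum_j Wj j))
    (h : forall j, {dot subvs_of (Wj j) for Num.conj})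
    (hh : forall j, compatible_form K T (subrep rho (Wj j)) (h j))
    (wc : J -> ('M[Cx R]_n -> Cx R) -> W)
    (hwc : forall j, weight_decomposition T rho (component Wj j w) (wc j))
    (huncramped : forall j, uncramped G T (supp (wc j)))
    (hbalanced : forall X, lie_algebra T X ->
       \sum_j \sum_(lam \in supp (wc j))
          direct_sum_form h (wc j lam) (wc j lam) * differential lam X = 0) :
  zariski_closed [set rho g w | g in G].
Proof.
(* In size 0 the group is trivial and the orbit is the point [w]; the spectral calculus is set up in
   size [n.+1]. *)
case: n => [|n] in G K TR T hG hGconn hK hTR hT rho hrho hWsub hh wc hwc huncramped hbalanced *.
  have -> : [set rho g w | g in G] = [set w].
    have [h1 _ _] := hrho; have [[[_ G1 _ _] _] _] := hG.
    rewrite eqEsubset; split=> [_ [g _ <-]|_ ->] /=.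
      by rewrite (thinmx0 g) -(thinmx0 1%:M) h1 id_lfunE.
    by exists 1%:M => //; rewrite h1 id_lfunE.
  exact: (@point_closed R (complex_realform R)).
exact: (@closed_orbit R (complex_realform R) n G K TR T hG hGconn hK hTR hT W rho hrho w J Wj
  hWsub hWsum hWdirect h hh wc hwc huncramped hbalanced).
Qed.
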